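(* Let $T$ be a theory of differential fields of characteristic $0$ with $k$ commuting derivations, in the language of differential rings, such that its restriction $T^{field}$ to the language of rings is model complete and all models of $T^{field}$ are large fields. Let $T^*$ be the model companion of $T$ given by Tressl's theorem, $T^*=T^{field}\cup UC$. If $T^{field}$ is rosy, then $T^*$ is rosy.
   Context: A field $K$ is large if every irreducible curve over $K$ with a smooth $K$-rational point has infinitely many $K$-rational points. $UC$ is Tressl's uniform companion, a first-order theory in the language of differential rings with $k$ derivations; by a theorem of Tressl, for $T$ as in the claim, $T^*=T^{field}\cup UC$ is the model companion of the theory of differential fields with $k$ commuting derivations whose underlying field is a model of $T^{field}$ (this characterizes $T^*$ up to equivalence). Rosiness (of a theory, computed in a monster model $\mathcal C^{eq}$): given a formula $\phi$, a finite set $\Delta$ of formulas in variables $x;y$, a finite set $\Pi$ of formulas in variables $y;z$ ($z$ possibly of infinite length), and a number $m$, define the thorn-rank $\operatorname{th}(\phi,\Delta,\Pi,m)$ inductively: (1) it is $\ge 0$ if $\phi$ is consistent; (2) for $\lambda$ limit it is $\ge\lambda$ iff it is $\ge\alpha$ for all $\alpha<\lambda$; (3) it is $\ge\alpha+1$ iff there are $\delta\in\Delta$, $\pi(y;z)\in\Pi$ and parameters $c$ such that (a) $\operatorname{th}(\phi\wedge\delta(x,a),\Delta,\Pi,m)\ge\alpha$ for infinitely many $a\models\pi(y;c)$, and (b) $\{\delta(x,a)\}_{a\models\pi(y;c)}$ is $m$-inconsistent. A theory is rosy if all of its thorn-ranks are defined (i.e. ordinal-valued). *)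

(* Defs.v *)
From Stdlib Require List.
From HB Require Import structures.
From mathcomp Require Import all_boot all_order all_algebra.
From mathcomp Require Import mpoly.

Set Implicit Arguments.
Unset Strict Implicit.
Unset Printing Implicit Defensive.

Import GRing.Theory.
Local Open Scope ring_scope.

Definition infinitely_many (U : Type) (S : U -> Prop) : Prop :=
  forall l : seq U, exists a : U, S a /\ ~ List.In a l.

Record signature := Signature {
  sort : Type;
  fsym : Type;
  farity : fsym -> nat;
  fdom : forall f : fsym, 'I_(farity f) -> sort;
  fcod : fsym -> sort;
  rsym : Type;
  rarity : rsym -> nat;
  rdom : forall r : rsym, 'I_(rarity r) -> sort }.

Record structure (L : signature) := Structure {
  carrier :> sort L -> Type;
  finterp : forall f : fsym L,
    (forall i : 'I_(farity f), carrier (fdom i)) -> carrier (fcod f);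
  rinterp : forall r : rsym L,
    (forall i : 'I_(rarity r), carrier (rdom i)) -> Prop }.

(* A set of free variables is a type [V] together with the map [s : V -> sort L]
   giving the sort of each variable; a binder adds the variable [None]. *)
Definition ext (S V : Type) (s : V -> S) (u : S) : option V -> S :=
  fun o => if o is Some v then s v else u.

Definition juxt (S V W : Type) (s : V -> S) (t : W -> S) : V + W -> S :=
  fun o => match o with inl v => s v | inr w => t w end.

Definition novar (S : Type) : void -> S := fun v => match v with end.

Inductive term (L : signature) (V : Type) (s : V -> sort L) : sort L -> Type :=
| Var (v : V) : term s (s v)
| App (f : fsym L) :
    (forall i : 'I_(farity f), term s (fdom i)) -> term s (fcod f).

Inductive formula (L : signature) (V : Type) (s : V -> sort L) : Type :=
| Bot : formula s
| Equ (u : sort L) : term s u -> term s u -> formula s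
| Rel (r : rsym L) : (forall i : 'I_(rarity r), term s (rdom i)) -> formula s
| Imp : formula s -> formula s -> formula s
| All (u : sort L) : formula (ext s u) -> formula s.

Definition Neg (L : signature) (V : Type) (s : V -> sort L) (p : formula s) :
  formula s := Imp p (Bot s).

Definition Ex (L : signature) (V : Type) (s : V -> sort L) (u : sort L)
  (p : formula (ext s u)) : formula s := Neg (All (Neg p)).

Definition assignment (L : signature) (M : structure L) (V : Type)
  (s : V -> sort L) : Type := forall v : V, M (s v).

Definition aext (L : signature) (M : structure L) (V : Type) (s : V -> sort L)
  (e : assignment M s) (u : sort L) (a : M u) : assignment M (ext s u) :=
  fun o => match o with Some v => e v | None => a end.

Definition ajuxt (L : signature) (M : structure L) (V W : Type)
  (s : V -> sort L) (t : W -> sort L)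
  (e : assignment M s) (g : assignment M t) : assignment M (juxt s t) :=
  fun o => match o with inl v => e v | inr w => g w end.

Definition anovar (L : signature) (M : structure L) :
  assignment M (novar (sort L)) := fun v => match v with end.

Fixpoint teval (L : signature) (M : structure L) (V : Type) (s : V -> sort L)
  (e : assignment M s) (u : sort L) (t : term s u) : M u :=
  match t in term _ u return M u with
  | Var v => e v
  | App f args => finterp (fun i => teval e (args i))
  end.

Fixpoint sat (L : signature) (M : structure L) (V : Type) (s : V -> sort L)
  (p : formula s) : assignment M s -> Prop :=
  match p with
  | Bot => fun _ => False
  | Equ u t1 t2 => fun e => teval e t1 = teval e t2
  | Rel r args => fun e => rinterp (fun i => teval e (args i))
  | Imp p1 p2 => fun e => sat p1 e -> sat p2 e
  | All u p1 => fun e => forall a : M u, sat p1 (aext e a)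
  end.

Definition sentence (L : signature) : Type := formula (novar (sort L)).

Definition theory (L : signature) : Type := sentence L -> Prop.

Definition theoryU (L : signature) (T1 T2 : theory L) : theory L :=
  fun p => T1 p \/ T2 p.

Definition model (L : signature) (T : theory L) (M : structure L) : Prop :=
  forall p : sentence L, T p -> sat p (anovar M).

Definition entails (L : signature) (T : theory L) (p : sentence L) : Prop :=
  forall M : structure L, model T M -> sat p (anovar M).

Record embedding (L : signature) (M N : structure L)
  (h : forall u : sort L, M u -> N u) : Prop := {
  embedding_inj : forall u : sort L, injective (h u);
  embedding_fun : forall (f : fsym L) (a : forall i : 'I_(farity f), M (fdom i)),
    h (fcod f) (finterp a) = finterp (fun i => h (fdom i) (a i));
  embedding_rel : forall (r : rsym L) (a : forall i : 'I_(rarity r), M (rdom i)),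
    rinterp a <-> rinterp (fun i => h (rdom i) (a i)) }.

Definition elementary (L : signature) (M N : structure L)
  (h : forall u : sort L, M u -> N u) : Prop :=
  forall (V : Type) (s : V -> sort L) (p : formula s) (e : assignment M s),
    sat p e <-> sat p ((fun v => h (s v) (e v)) : assignment N s).

Definition embeds_in_model (L : signature) (T : theory L) (M : structure L) :
  Prop := exists (N : structure L) (h : forall u : sort L, M u -> N u),
    model T N /\ embedding h.

Definition model_complete (L : signature) (T : theory L) : Prop :=
  forall (M N : structure L) (h : forall u : sort L, M u -> N u),
    model T M -> model T N -> embedding h -> elementary h.

Definition model_companion (L : signature) (Tstar T : theory L) : Prop :=
  [/\ forall M : structure L, model T M -> embeds_in_model Tstar M,
      forall M : structure L, model Tstar M -> embeds_in_model T M
    & model_complete Tstar].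

(* A formula without parameters defining, in [M], an equivalence relation on
   tuples of sorts [edom]; the condition only depends on the theory of [M]. *)
Record eqdef (L : signature) (M : structure L) := EqDef {
  earity : nat;
  edom : 'I_earity -> sort L;
  efml : formula (juxt edom edom);
  efml_refl : forall a : assignment M edom, sat efml (ajuxt a a);
  efml_sym : forall a b : assignment M edom,
    sat efml (ajuxt a b) -> sat efml (ajuxt b a);
  efml_trans : forall a b c : assignment M edom,
    sat efml (ajuxt a b) -> sat efml (ajuxt b c) -> sat efml (ajuxt a c) }.

(* The signature [L^eq]: the symbols of [L] on the home sorts, and for each
   [E] a sort [inr E] together with the projection [inr E] onto it. *)
Definition sig_eq (L : signature) (M : structure L) : signature :=
  {| sort := (sort L + eqdef M)%type;
     fsym := (fsym L + eqdef M)%type;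
     farity := fun f => match f with inl g => farity g | inr E => earity E end;
     fdom := fun f =>
       match f return 'I_(match f with inl g => farity g | inr E => earity E end)
                      -> (sort L + eqdef M)%type with
       | inl g => fun i => inl (@fdom L g i)
       | inr E => fun i => inl (@edom L M E i)
       end;
     fcod := fun f => match f with inl g => inl (fcod g) | inr E => inr E end;
     rsym := rsym L;
     rarity := @rarity L;
     rdom := fun r i => inl (@rdom L r i) |}.

Definition eclass (L : signature) (M : structure L) (E : eqdef M)
  (a : assignment M (@edom L M E)) : assignment M (@edom L M E) -> Prop :=
  fun b => sat (efml E) (ajuxt a b).

Definition quotient (L : signature) (M : structure L) (E : eqdef M) : Type :=
  {X : assignment M (@edom L M E) -> Prop | exists a, X = eclass a}.

Definition carrier_eq (L : signature) (M : structure L)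
  (u : sort L + eqdef M) : Type :=
  match u with inl v => M v | inr E => quotient E end.

Definition struct_eq (L : signature) (M : structure L) : structure (sig_eq M) :=
  {| carrier := (@carrier_eq L M : sort (sig_eq M) -> Type);
     finterp := fun f : fsym (sig_eq M) =>
       match f return
         (forall i : 'I_(@farity (sig_eq M) f),
            carrier_eq (@fdom (sig_eq M) f i)) ->
         carrier_eq (@fcod (sig_eq M) f) with
       | inl g => fun a => @finterp L M g a
       | inr E => fun a => exist _ (eclass (E := E) a) (ex_intro _ a (erefl _))
       end;
     rinterp := fun (r : rsym (sig_eq M)) a => @rinterp L M r a |}.

(* |K| <= |A| is expressed by an injection; in the presence of choice its
   negation means |A| < |K|. *)
Definition card_lt (A K : Type) : Prop := ~ exists f : K -> A, injective f.

(* Types in one variable over a set of fewer than |K| parameters. *)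
Definition saturated (K : Type) (L : signature) (M : structure L) : Prop :=
  forall (A : Type) (s : A -> sort L) (c : assignment M s) (u : sort L)
         (p : formula (ext s u) -> Prop),
    card_lt A K ->
    (forall l : seq (formula (ext s u)), (forall q, List.In q l -> p q) ->
       exists b : M u, forall q, List.In q l -> sat q (aext c b)) ->
    exists b : M u, forall q, p q -> sat q (aext c b).

(* Sufficiently saturated: |K|-saturated for some |K| > |L| + aleph_0.
   Thorn-ranks do not depend on how large |K| is taken beyond that. *)
Definition monster (L : signature) (M : structure L) : Prop :=
  exists K : Type,
    card_lt (sort L + fsym L + rsym L + nat) K /\ saturated K M.

(* Notations for ordinals: every ordinal is denoted by some element, and
   [OLim f] denotes the supremum of a family indexed by a nonempty type (only
   nonemptiness is recorded; if the supremum is attained, [OLim f] denotes a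
   value of [f], and the clause for [OLim] below is still correct). *)
Inductive ord : Type :=
| OZero : ord
| OSucc : ord -> ord
| OLim (J : Type) (j0 : J) (f : J -> ord) : ord.

(* The instances delta(x,a), for a realizing pi(y;c), are m-inconsistent: the
   conjunction of any m of them, for m distinct tuples a, is inconsistent. *)
Definition m_inconsistent (L : signature) (C : structure L)
  (X Y Z : Type) (x : X -> sort L) (y : Y -> sort L) (z : Z -> sort L)
  (m : nat) (delta : formula (juxt x y)) (pi : formula (juxt y z))
  (c : assignment C z) : Prop :=
  forall a : 'I_m -> assignment C y, injective a ->
    (forall i, sat pi (ajuxt (a i) c)) ->
    ~ exists b : assignment C x, forall i, sat delta (ajuxt b (a i)).

(* [thorn_ge Delta Pi m alpha D] says that th(phi, Delta, Pi, m) >= alpha, where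
   [D] is the set defined by phi(x) (a formula with parameters) in [C]. *)
Fixpoint thorn_ge (L : signature) (C : structure L)
  (X Y Z : Type) (x : X -> sort L) (y : Y -> sort L) (z : Z -> sort L)
  (Delta : seq (formula (juxt x y))) (Pi : seq (formula (juxt y z))) (m : nat)
  (alpha : ord) (D : assignment C x -> Prop) : Prop :=
  match alpha with
  | OZero => exists b, D b
  | OSucc beta =>
      exists (delta : formula (juxt x y)) (pi : formula (juxt y z))
             (c : assignment C z),
        [/\ List.In delta Delta, List.In pi Pi,
            infinitely_many (fun a : assignment C y =>
              sat pi (ajuxt a c) /\
              thorn_ge Delta Pi m beta
                (fun b => D b /\ sat delta (ajuxt b a)))
          & m_inconsistent m delta pi c]
  | OLim J _ f => forall i : J, thorn_ge Delta Pi m (f i) D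
  end.

(* The rank of phi is an ordinal (or phi is inconsistent) as soon as some
   alpha is not a lower bound; [w], [e] are the parameters of phi. *)
Definition thorn_ranks_defined (L : signature) (C : structure L) : Prop :=
  forall (nx ny : nat) (Z : Type)
         (x : 'I_nx -> sort L) (y : 'I_ny -> sort L) (z : Z -> sort L)
         (Delta : seq (formula (juxt x y))) (Pi : seq (formula (juxt y z)))
         (m : nat)
         (W : Type) (w : W -> sort L) (phi : formula (juxt x w))
         (e : assignment C w),
    exists alpha : ord,
      ~ thorn_ge Delta Pi m alpha (fun b : assignment C x => sat phi (ajuxt b e)).

(* A possibly incomplete theory is rosy when all its completions are. *)
Definition rosy (L : signature) (T : theory L) : Prop :=
  forall C : structure L, model T C -> monster C ->
    thorn_ranks_defined (struct_eq C).

Inductive ring_sym := RZero | ROne | ROpp | RAdd | RMul.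

Definition ring_arity (f : ring_sym) : nat :=
  match f with RZero | ROne => 0 | ROpp => 1 | RAdd | RMul => 2 end.

Definition Lring : signature :=
  {| sort := unit; fsym := ring_sym; farity := ring_arity;
     fdom := fun _ _ => tt; fcod := fun _ => tt;
     rsym := void; rarity := fun _ => 0; rdom := fun _ _ => tt |}.

Definition Ldiff (k : nat) : signature :=
  {| sort := unit; fsym := (ring_sym + 'I_k)%type;
     farity := fun f => match f with inl g => ring_arity g | inr _ => 1 end;
     fdom := fun _ _ => tt; fcod := fun _ => tt;
     rsym := void; rarity := fun _ => 0; rdom := fun _ _ => tt |}.

Fixpoint lift_term (k : nat) (V : Type) (s : V -> unit) (u : unit)
  (t : @term Lring V s u) : @term (Ldiff k) V s u :=
  match t in term _ u return @term (Ldiff k) V s u with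
  | Var v => @Var (Ldiff k) V s v
  | App f args => @App (Ldiff k) V s (inl f) (fun i => lift_term k (args i))
  end.

Fixpoint lift_formula (k : nat) (V : Type) (s : V -> unit)
  (p : @formula Lring V s) : @formula (Ldiff k) V s :=
  match p with
  | Bot => @Bot (Ldiff k) V s
  | Equ u t1 t2 => @Equ (Ldiff k) V s u (lift_term k t1) (lift_term k t2)
  | Rel r _ => match r with end
  | Imp p1 p2 => Imp (lift_formula k p1) (lift_formula k p2)
  | All u p1 => @All (Ldiff k) V s u (lift_formula k p1)
  end.

Definition lift_theory (k : nat) (T : theory Lring) : theory (Ldiff k) :=
  fun p => exists q : sentence Lring, T q /\ p = lift_formula k q.

Arguments lift_theory k T : clear implicits.

(* T^field: the consequences of [T] in the language of rings. *)
Definition field_part (k : nat) (T : theory (Ldiff k)) : theory Lring :=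
  fun q => entails T (lift_formula k q).

Section DifferentialFields.

Variable k : nat.

Local Notation trm s := (@term (Ldiff k) _ s tt).

Definition tzero (V : Type) (s : V -> unit) : trm s :=
  @App (Ldiff k) V s (inl RZero) (fun i => match notF (ltn_ord i) with end).
Definition tone (V : Type) (s : V -> unit) : trm s :=
  @App (Ldiff k) V s (inl ROne) (fun i => match notF (ltn_ord i) with end).
Definition topp (V : Type) (s : V -> unit) (t : trm s) : trm s :=
  @App (Ldiff k) V s (inl ROpp) (fun _ => t).
Definition tadd (V : Type) (s : V -> unit) (t1 t2 : trm s) : trm s :=
  @App (Ldiff k) V s (inl RAdd) (fun i => if val i == 0%N then t1 else t2).
Definition tmul (V : Type) (s : V -> unit) (t1 t2 : trm s) : trm s :=
  @App (Ldiff k) V s (inl RMul) (fun i => if val i == 0%N then t1 else t2).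
Definition tder (i : 'I_k) (V : Type) (s : V -> unit) (t : trm s) : trm s :=
  @App (Ldiff k) V s (inr i) (fun _ => t).

Fixpoint tnat (V : Type) (s : V -> unit) (n : nat) : trm s :=
  if n is m.+1 then tadd (tone s) (tnat s m) else tzero s.

(* [vx], [vy], [vz]: the variables bound by the innermost, second innermost and
   third innermost quantifier. *)
Definition vx (V : Type) (s : V -> unit) : trm (ext s tt) :=
  @Var (Ldiff k) _ (ext s tt) None.
Definition vy (V : Type) (s : V -> unit) : trm (ext (ext s tt) tt) :=
  @Var (Ldiff k) _ (ext (ext s tt) tt) (Some None).
Definition vz (V : Type) (s : V -> unit) : trm (ext (ext (ext s tt) tt) tt) :=
  @Var (Ldiff k) _ (ext (ext (ext s tt) tt) tt) (Some (Some None)).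

Local Notation x := (vx _).
Local Notation y := (vy _).
Local Notation z := (vz _).
Local Notation "'FA' p" := (@All (Ldiff k) _ _ tt p) (at level 95).
Local Notation "'EX' p" := (@Ex (Ldiff k) _ _ tt p) (at level 95).
Local Notation "s ≡ t" := (@Equ (Ldiff k) _ _ tt s t) (at level 70).
Local Notation "s ⊕ t" := (tadd s t) (at level 50, left associativity).
Local Notation "s ⊗ t" := (tmul s t) (at level 40, left associativity).
Local Notation "p ⇒ q" := (@Imp (Ldiff k) _ _ p q)
  (at level 90, right associativity).
Local Notation "0" := (tzero _).
Local Notation "1" := (tone _).

Inductive diff_field0 : theory (Ldiff k) :=
| ax_addA : diff_field0 (FA FA FA (x ⊕ (y ⊕ z) ≡ (x ⊕ y) ⊕ z))
| ax_addC : diff_field0 (FA FA (x ⊕ y ≡ y ⊕ x))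
| ax_add0 : diff_field0 (FA (0 ⊕ x ≡ x))
| ax_addN : diff_field0 (FA (topp x ⊕ x ≡ 0))
| ax_mulA : diff_field0 (FA FA FA (x ⊗ (y ⊗ z) ≡ (x ⊗ y) ⊗ z))
| ax_mulC : diff_field0 (FA FA (x ⊗ y ≡ y ⊗ x))
| ax_mul1 : diff_field0 (FA (1 ⊗ x ≡ x))
| ax_mulD : diff_field0 (FA FA FA (x ⊗ (y ⊕ z) ≡ x ⊗ y ⊕ x ⊗ z))
| ax_1neq0 : diff_field0 (Neg (1 ≡ 0))
| ax_inv : diff_field0 (FA (Neg (x ≡ 0) ⇒ EX (y ⊗ x ≡ 1)))
| ax_char0 (n : nat) : diff_field0 (Neg (tnat _ n.+1 ≡ 0))
| ax_derD (i : 'I_k) :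
    diff_field0 (FA FA (tder i (x ⊕ y) ≡ tder i x ⊕ tder i y))
| ax_derM (i : 'I_k) :
    diff_field0 (FA FA (tder i (x ⊗ y) ≡ tder i x ⊗ y ⊕ x ⊗ tder i y))
| ax_der_comm (i j : 'I_k) :
    diff_field0 (FA (tder i (tder j x) ≡ tder j (tder i x))).

End DifferentialFields.

Definition generated_by (K : fieldType) (n m : nat) (I : {pred {mpoly K[n]}})
  (f : 'I_m -> {mpoly K[n]}) : Prop :=
  forall g, g \in I <-> exists h : 'I_m -> {mpoly K[n]}, g = \sum_i h i * f i.

Definition prime_ideal (R : comNzRingType) (I : {pred R}) : Prop :=
  idealr_closed I /\ prime_idealr_closed I.

Definition strictly_below (R : comNzRingType) (I J : {pred R}) : Prop :=
  {subset I <= J} /\ ~ {subset J <= I}.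

(* [R / I] has Krull dimension 1, for a prime ideal [I]. *)
Definition dimension_one (R : comNzRingType) (I : {pred R}) : Prop :=
  (exists J : {pred R}, prime_ideal J /\ strictly_below I J) /\
  ~ (exists J1 J2 : {pred R}, [/\ prime_ideal J1, prime_ideal J2,
                                strictly_below I J1 & strictly_below J1 J2]).

(* The affine curve f_1 = ... = f_m = 0 in n-space over K, irreducible over K.
   Every smooth K-point of a curve has an affine open neighbourhood, and the
   complement of a nonempty open subset of an irreducible curve is finite, so
   that affine curves suffice. *)
Definition irreducible_curve (K : fieldType) (n m : nat)
  (f : 'I_m -> {mpoly K[n]}) : Prop :=
  exists I : {pred {mpoly K[n]}},
    [/\ generated_by I f, prime_ideal I & dimension_one I].

Definition on_curve (K : fieldType) (n m : nat) (f : 'I_m -> {mpoly K[n]})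
  (a : 'I_n -> K) : Prop := forall i, (f i).@[a] = 0.

(* Jacobian criterion: the rank at [a] is the codimension n - 1. *)
Definition smooth_at (K : fieldType) (n m : nat) (f : 'I_m -> {mpoly K[n]})
  (a : 'I_n -> K) : Prop :=
  (\rank (\matrix_(i < m, j < n) ((f i)^`M(j)).@[a])).+1 = n.

Definition large (K : fieldType) : Prop :=
  forall (n m : nat) (f : 'I_m -> {mpoly K[n]}), irreducible_curve f ->
    (exists a, on_curve f a /\ smooth_at f a) ->
    infinitely_many (fun b : 'I_n -> K => on_curve f b).

(* [M] is, up to the bijection [h], the ring structure of a large field. *)
Definition large_field (M : structure Lring) : Prop :=
  exists (K : fieldType) (h : K -> M tt),
    [/\ bijective h,
        [/\ forall a, @finterp Lring M RZero a = h 0,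
            forall a, @finterp Lring M ROne a = h 1
          & forall a, @finterp Lring M ROpp (fun _ => h a) = h (- a)],
        forall a b, @finterp Lring M RAdd
          (fun i => if val i == 0%N then h a else h b) = h (a + b),
        forall a b, @finterp Lring M RMul
          (fun i => if val i == 0%N then h a else h b) = h (a * b)
      & large K].

(* Main.v *)
(* Let K be a saturated model of T*. Two tuples closed under the derivations
   with the same type in the language of rings have the same differential type,
   and a tuple algebraically independent over N from a differential field A
   containing N, with the algebraic type over N of a jet, has the algebraic type
   over A of a jet: correct the derivations of K by derivations over A, and use
   that T^field has, by model completeness and largeness, infinitely many
   realizations of every non-algebraic formula. Consequently, if the E-class of
   alpha is algebraic over N b, for a definable equivalence relation E and an
   elementary substructure N, but contains no tuple of N, then some class of an
   equivalence relation definable in the ring language is algebraic over the jet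
   of b but not over N. If the jet of alpha depends on that of b over N, one of
   its coordinates will do; otherwise E induces an equivalence relation on all
   realizations of the algebraic type of the jet of alpha over N, namely
   [linked], and it is definable.

   An infinite thorn-rank of T* yields, by saturation, increasing chains of
   states (N, b), each of which has a next state, in which an E-class as above
   enters N. By the previous paragraph the step is described by a label: two ring
   formulas and a bound. Since T^field is rosy, no label can be used again and
   again, hence every state has an extension beyond which a given label does not
   occur. There are only countably many labels, so the limit of a suitable chain
   has no label at all, but it still has a next state. *)

From Stdlib Require Eqdep_dec.
From HB Require Import structures.
From mathcomp Require Import all_boot all_order all_algebra.
From mathcomp Require Import separable ring zify.
From mathcomp Require Import boolp.
From mathcomp Require classical_sets.
From mathcomp Require Import mpoly.
Require Import Defs.

Set Implicit Arguments.
Unset Strict Implicit.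
Unset Printing Implicit Defensive.

Import GRing.Theory.

(** * One-sorted logic *)

(** A differential formula controls jets only, whereas thorn-ranks of the field concern all tuples
    of a given algebraic type. Two such tuples need not be conjugate to a pair of jets, and on them
    the ring translation of E need not be an equivalence relation. Tuples each of which is
    independent from the preceding ones are conjugate to jets; so two tuples are compared through a
    third one, independent from both ([link]). Elementary substructures serve twice: a class
    algebraic over one is met by a tuple of it, which turns the negative half of a thorn-forking
    step into non-algebraicity; and Skolem terms make chains of them type-definable, so that
    saturation can pass to limits. A limit replaces [b] by another tuple with the same type over
    every earlier model, hence [extends] lets [b] move. Algebraic closure and independence are
    phrased by derivations because independence is used precisely as the possibility to correct a
    derivation without touching the base. Tressl's theorem enters through [expand]: any commuting
    derivations on the field can be enlarged to a model of the companion without changing the truth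
    of ring formulas. *)

Lemma In_mem (T : eqType) (x : T) (l : seq T) : List.In x l <-> x \in l.
Proof.
elim: l => //= y l IH; rewrite inE; split=> [[->|/IH ->]|/orP[/eqP ->|/IH]];
  by rewrite ?eqxx ?orbT; auto.
Qed.

Lemma In_flatten (I : finType) (T : Type) (l : I -> seq T) (i : I) (v : T) :
  List.In v (l i) -> List.In v (flatten [seq l j | j <- enum I]).
Proof.
have : i \in enum I by rewrite mem_enum.
elim: (enum I) => [|j r IH] //; rewrite inE => /orP[/eqP <-|/IH Hr] Hv;
apply/List.in_app_iff; [by left|by right; apply: Hr].
Qed.

Section Substitution.

Variable L : signature.

Fixpoint tsub (V W : Type) (s : V -> sort L) (t : W -> sort L)
  (f : forall v, term t (s v)) (u : sort L) (a : term s u) : term t u :=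
  match a in term _ u return term t u with
  | Var v => f v
  | App g args => App (fun i => tsub f (args i))
  end.

Definition sub_ext (V W : Type) (s : V -> sort L) (t : W -> sort L) (u : sort L)
  (f : forall v, term t (s v)) (o : option V) : term (ext t u) (ext s u o) :=
  match o return term (ext t u) (ext s u o) with
  | Some v => tsub (fun w => @Var L _ (ext t u) (Some w)) (f v)
  | None => @Var L _ (ext t u) None
  end.

Fixpoint fsub (V W : Type) (s : V -> sort L) (t : W -> sort L)
  (f : forall v, term t (s v)) (p : formula s) : formula t :=
  match p with
  | Bot => Bot t
  | Equ u a b => Equ (tsub f a) (tsub f b)
  | Rel r args => Rel (fun i => tsub f (args i))
  | Imp p q => Imp (fsub f p) (fsub f q)
  | All u p => All (fsub (sub_ext u f) p)
  end.

Lemma teval_tsub (M : structure L) V W (s : V -> sort L) (t : W -> sort L)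
  (f : forall v, term t (s v)) (e : assignment M t) u (a : term s u) :
  teval e (tsub f a) = teval (fun v => teval e (f v)) a.
Proof.
elim: a => //= g args IH; congr finterp.
by apply: functional_extensionality_dep => i; apply: IH.
Qed.

Lemma sat_fsub (M : structure L) V W (s : V -> sort L) (t : W -> sort L)
  (f : forall v, term t (s v)) (p : formula s) (e : assignment M t) :
  sat (fsub f p) e <-> sat p (fun v => teval e (f v)).
Proof.
elim: p W t f e => {V s} [V s|V s u a b|V s r args|V s p IHp q IHq|V s u p IHp] W t f e //=.
- by rewrite !teval_tsub.
- suff -> : (fun i => teval e (tsub f (args i))) =
    (fun i => teval (fun v => teval e (f v)) (args i)) by [].
  by apply: functional_extensionality_dep => i; rewrite teval_tsub.
- by rewrite IHp IHq.
- have E a : (fun o => teval (aext e a) (sub_ext u f o)) = aext (fun v => teval e (f v)) a.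
    by apply: functional_extensionality_dep => -[v|] //=; rewrite teval_tsub.
  by split=> H a; have := H a; rewrite IHp E.
Qed.

Lemma term_support V (s : V -> sort L) u (a : term s u) : exists l : seq V,
  forall (M : structure L) (e e' : assignment M s),
  (forall v, List.In v l -> e v = e' v) -> teval e a = teval e' a.
Proof.
elim: a => [v|g args IH].
  by exists [:: v] => M e e' H /=; apply: H; left.
have [l Hl] := choice IH.
exists (flatten [seq l i | i <- enum 'I_(farity g)]) => M e e' H /=.
congr finterp; apply: functional_extensionality_dep => i; apply: Hl => v Hv.
by apply: H; apply: In_flatten Hv.
Qed.

(** Variable types may be infinite (jets, hulls), so finiteness has to be extracted from each
    formula. The list is the same for all structures, which lets a single formula be used in several
    models. *)
Lemma formula_support V (s : V -> sort L) (p : formula s) : exists l : seq V,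
  forall (M : structure L) (e e' : assignment M s),
  (forall v, List.In v l -> e v = e' v) -> (sat p e <-> sat p e').
Proof.
elim: p => {V s} [V s|V s u a b|V s r args|V s p [l Hl] q [l' Hl']|V s u p [l Hl]].
- by exists [::].
- have [l Hl] := term_support a; have [l' Hl'] := term_support b.
  exists (l ++ l') => M e e' H /=.
  rewrite (Hl _ e e') ?(Hl' _ e e') // => v Hv; apply: H;
    apply/List.in_app_iff; [by right|by left].
- have [l Hl] := choice (fun i => term_support (args i)).
  exists (flatten [seq l i | i <- enum 'I_(rarity r)]) => M e e' H /=.
  suff -> : (fun i => teval e (args i)) = (fun i => teval e' (args i)) by [].
  apply: functional_extensionality_dep => i; apply: Hl => v Hv.
  by apply: H; apply: In_flatten Hv.
- exists (l ++ l') => M e e' H /=.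
  rewrite (Hl _ e e') ?(Hl' _ e e') // => v Hv; apply: H;
    apply/List.in_app_iff; [by right|by left].
(* [pmap id] drops the bound variable [None] from the support of the body. *)
- exists (pmap id l) => M e e' H /=.
  have E a : sat p (aext e a) <-> sat p (aext e' a).
    apply: Hl => -[v|] //= Hv; apply: H.
    elim: l Hv => [|o r IHr] //= [Ho|/IHr Hr]; first by rewrite Ho; left.
    by case: o => [w|] //=; right.
  by split=> K a; apply/E.
Qed.

End Substitution.

(** [Lring] and [Ldiff k] are convertible to instances of [sig1], so everything proved for [sig1]
    applies to them without transport. *)
Definition sig1 (fs : Type) (ar : fs -> nat) : signature :=
  {| sort := unit; fsym := fs; farity := ar;
     fdom := fun _ _ => tt; fcod := fun _ => tt;
     rsym := void; rarity := fun _ => 0; rdom := fun _ _ => tt |}.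

Definition oext (V A : Type) (e : V -> A) (a : A) (o : option V) : A :=
  if o is Some v then e v else a.

Definition sume (V W A : Type) (e : V -> A) (g : W -> A) (o : V + W) : A :=
  match o with inl v => e v | inr w => g w end.

Notation Fm L V := (@formula L V (fun _ => tt)).
Notation Tm L V := (@term L V (fun _ => tt) tt).
Notation univ M := (carrier M tt).

Section OneSorted.

Variables (fs : Type) (ar : fs -> nat).
Let L := sig1 ar.
Implicit Types (M : structure L) (V W : Type).

Definition ev M V (e : V -> univ M) (t : Tm L V) : univ M :=
  @teval L M V (fun _ => tt) e tt t.

Definition holds M V (e : V -> univ M) (p : Fm L V) : Prop :=
  @sat L M V (fun _ => tt) p e.

Definition tren V W (f : V -> W) (t : Tm L V) : Tm L W :=
  @tsub L V W (fun _ => tt) (fun _ => tt) (fun v => @Var L W (fun _ => tt) (f v)) tt t.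

Definition ren V W (f : V -> W) (p : Fm L V) : Fm L W :=
  @fsub L V W (fun _ => tt) (fun _ => tt) (fun v => @Var L W (fun _ => tt) (f v)) p.

Definition inst V W (f : V -> Tm L W) (p : Fm L V) : Fm L W :=
  @fsub L V W (fun _ => tt) (fun _ => tt) f p.

Lemma ev_tren M V W (f : V -> W) (t : Tm L V) (e : W -> univ M) :
  ev e (tren f t) = ev (e \o f) t.
Proof. exact: teval_tsub. Qed.

Lemma holds_ren M V W (f : V -> W) (p : Fm L V) (e : W -> univ M) :
  holds e (ren f p) <-> holds (e \o f) p.
Proof. exact: sat_fsub. Qed.

Lemma holds_inst M V W (f : V -> Tm L W) (p : Fm L V) (e : W -> univ M) :
  holds e (inst f p) <-> holds (fun v => ev e (f v)) p.
Proof. exact: sat_fsub. Qed.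

(** The sort assignment [ext (fun _ => tt) tt] agrees with a constant function only pointwise; the
    substitution retypes the variables before the binder is added. *)
Definition Ex1 V (p : Fm L (option V)) : Fm L V :=
  @Ex L V (fun _ => tt) tt
    (@fsub L (option V) (option V) (fun _ => tt) (ext (fun _ => tt) tt)
      (fun o => match o return @term L _ (ext (fun _ => tt) tt) tt with
         | Some v => @Var L _ (ext (fun _ => tt) tt) (Some v)
         | None => @Var L _ (ext (fun _ => tt) tt) None end) p).

Lemma holds_ext M V (p : Fm L V) (e e' : V -> univ M) :
  e =1 e' -> holds e p <-> holds e' p.
Proof. by move=> /funext ->. Qed.

Lemma holds_eq M V (p : Fm L V) (e e' : V -> univ M) :
  e =1 e' -> holds e p -> holds e' p.
Proof. by move=> /funext ->. Qed.

Lemma holds_Ex1 M V (p : Fm L (option V)) (e : V -> univ M) :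
  holds e (Ex1 p) <-> exists a, holds (oext e a) p.
Proof.
rewrite /holds /=.
set q := fsub _ _; have E (a : univ M) : @sat L M (option V) (ext (fun _ => tt) tt) q (@aext L M _ (fun _ => tt) e tt a) <->
   holds (oext e a) p.
  by apply: iff_trans (sat_fsub _ _ _) _; apply: holds_ext => -[].
split=> [H|[a /E Ha] H]; last exact: H Ha.
by apply: contrapT => N; apply: H => a /E Ha; apply: N; exists a.
Qed.

(* [defb P]: the family [P] of predicates, one for each nonempty structure, is
   defined by a single formula. *)
Definition defb V (P : forall M, (V -> univ M) -> Prop) : Prop :=
  exists p : Fm L V, forall M (x0 : univ M) e, holds e p <-> P M e.

Lemma defb_fm V (p : Fm L V) : defb (fun M e => holds e p).
Proof. by exists p. Qed.

Lemma defb_ren V W (f : V -> W) P : @defb V P -> @defb W (fun M e => P M (e \o f)).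
Proof. by case=> p Hp; exists (ren f p) => M x0 e; rewrite holds_ren Hp. Qed.

Lemma defb_ext V P Q : (forall M (x0 : univ M) e, P M e <-> Q M e) ->
  @defb V P -> @defb V Q.
Proof. by move=> E [p Hp]; exists p => M x0 e; rewrite Hp // E. Qed.

Lemma defb_false V : @defb V (fun _ _ => False).
Proof. by exists (Bot _). Qed.

Lemma defb_imp V P Q : @defb V P -> @defb V Q ->
  @defb V (fun M e => P M e -> Q M e).
Proof.
move=> [p Hp] [q Hq]; exists (Imp p q) => M x0 e.
by rewrite -Hp // -Hq.
Qed.

Lemma defb_not V P : @defb V P -> @defb V (fun M e => ~ P M e).
Proof. by move=> H; apply: defb_imp H (defb_false _). Qed.

Lemma defb_and V P Q : @defb V P -> @defb V Q ->
  @defb V (fun M e => P M e /\ Q M e).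
Proof.
move=> HP HQ; apply: defb_ext (defb_not (defb_imp HP (defb_not HQ))) => M x0 e.
by split=> [H|[p q] H]; [apply: contrapT => N; apply: H => p q; apply: N|apply: H].
Qed.

Lemma defb_or V P Q : @defb V P -> @defb V Q ->
  @defb V (fun M e => P M e \/ Q M e).
Proof.
move=> HP HQ; apply: defb_ext (defb_imp (defb_not HP) HQ) => M x0 e.
split=> [H|[p|q] n] //; case: (pselect (P M e)) => [p|n]; [by left|by right; apply: H].
Qed.

Lemma defb_iff V P Q : @defb V P -> @defb V Q ->
  @defb V (fun M e => P M e <-> Q M e).
Proof. by move=> HP HQ; apply: defb_and; apply: defb_imp. Qed.

Lemma defb_true V : @defb V (fun _ _ => True).
Proof. by apply: defb_ext (defb_not (defb_false _)) => M _ e; split=> // _ []. Qed.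

Lemma defb_eq V (a b : Tm L V) : @defb V (fun M e => ev e a = ev e b).
Proof. by exists (@Equ L V (fun _ => tt) tt a b). Qed.

Lemma defb_eqv V (v w : V) : @defb V (fun M e => e v = e w).
Proof. exact: (@defb_eq V (@Var L _ (fun _ => tt) v) (@Var L _ (fun _ => tt) w)). Qed.

Lemma defb_ex1 V P : @defb (option V) P ->
  @defb V (fun M e => exists a, P M (oext e a)).
Proof.
move=> [p Hp]; exists (Ex1 p) => M x0 e; rewrite holds_Ex1.
by split=> -[a] H; exists a; apply/(Hp M x0).
Qed.

Lemma defb_allseq V (T : Type) (P : T -> forall M, (V -> univ M) -> Prop) (l : seq T) :
  (forall x, List.In x l -> @defb V (P x)) ->
  @defb V (fun M e => forall x, List.In x l -> P x M e).
Proof.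
elim: l => [|x l IH] H; first by apply: defb_ext (defb_true _) => M _ e; split.
have Hx : defb (P x) by apply: H; left.
have {}IH := IH (fun y Hy => H y (or_intror Hy)).
apply: defb_ext (defb_and Hx IH) => M x0 e /=.
by split=> [[Px Pl] y [<-|/Pl]|K] //; split=> [|y Hy]; apply: K; [left|right].
Qed.

Lemma defb_exseq V (T : Type) (P : T -> forall M, (V -> univ M) -> Prop) (l : seq T) :
  (forall x, List.In x l -> @defb V (P x)) ->
  @defb V (fun M e => exists x, List.In x l /\ P x M e).
Proof.
move=> H; have K := @defb_allseq _ _ (fun x M e => ~ P x M e) l (fun x Hx => defb_not (H x Hx)).
apply: defb_ext (defb_not K) => M x0 e; split=> [N|[x [Hx Px]] N].
  by apply: contrapT => N'; apply: N => x Hx Px; apply: N'; exists x.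
exact: N Hx Px.
Qed.

Lemma defb_allfin V (T : finType) (P : T -> forall M, (V -> univ M) -> Prop) :
  (forall x, @defb V (P x)) -> @defb V (fun M e => forall x, P x M e).
Proof.
move=> H; apply: defb_ext (@defb_allseq _ _ P (enum T) (fun x _ => H x)) => M x0 e.
by split=> K x; [apply: K; apply/In_mem; rewrite mem_enum|move=> _; apply: K].
Qed.

Lemma defb_exord V n P : @defb (V + 'I_n) P ->
  @defb V (fun M e => exists w, P M (sume e w)).
Proof.
elim: n P => [|n IH] P H.
  have [p Hp] := H.
  have [l Hl] := formula_support p.
  pose f (o : V + 'I_0) : V := match o with inl v => v | inr i => match notF (ltn_ord i) with end end.
  apply: defb_ext (defb_fm (ren f p)) => M x0 e; rewrite holds_ren.
  split=> [K|[w /(Hp M x0) K]]; first exists (fun _ => x0); first apply/(Hp M x0);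
    by apply: holds_eq K => -[v|i] //=; have := ltn_ord i.
pose f (o : V + 'I_n.+1) : option (V + 'I_n) := match o with inl v => Some (inl v)
  | inr i => if unlift ord_max i is Some j then Some (inr j) else None end.
have /IH := defb_ex1 (defb_ren f H); apply: defb_ext => M x0 e.
split=> [[w [a K]]|[w K]].
  exists (fun i => if unlift ord_max i is Some j then w j else a).
  set g := (X in P M X) in K; set g' := sume _ _; suff -> : g' = g by [].
  apply: funext => -[v|i] //=; rewrite /g /=.
  by case: (unlift ord_max i).
exists (fun j => w (lift ord_max j)), (w ord_max).
set g := (X in P M X) in K; set g' := (X in P M X); suff -> : g' = g by [].
apply: funext => -[v|i] //=; rewrite /g' /g /=.
by case: unliftP => [j ->|->].
Qed.

Lemma formula_bound V (W : countType) (p : Fm L (V + W)) : exists n, forall M (x0 : univ M) e w w',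
  (forall i : W, pickle i < n -> w i = w' i) -> (holds (M:=M) (sume e w) p <-> holds (sume e w') p).
Proof.
have [l Hl] := formula_support p.
have [n Hn] : exists n, forall i, List.In (inr i) l -> pickle i < n.
  elim: l {Hl} => [|[v|i] l [n Hn]]; first by exists 0.
    by exists n => i /= [|/Hn].
  exists (maxn n (pickle i).+1) => j /= [[<-]|/Hn]; rewrite leq_max; first by rewrite leqnn orbT.
  by move=> ->.
by exists n => M x0 e w w' H; apply: Hl => -[v|i] //= /Hn /H.
Qed.

(** A block of countably many quantifiers is harmless because the formula looks at finitely many of
    the variables. *)
Lemma defb_ex V (W : countType) P : @defb (V + W) P ->
  @defb V (fun M e => exists w, P M (sume e w)).
Proof.
move=> [p Hp]; have [n Hn] := formula_bound p.
(* Codes beyond [n] are sent to an arbitrary index, which the formula does not notice; [n.+1] makes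
   [inord] available even for [n = 0]. *)
pose f (o : V + W) : V + 'I_n.+1 := match o with inl v => inl v | inr i => inr (inord (pickle i)) end.
have H := defb_exord (defb_fm (ren f p)).
apply: defb_ext H => M x0 e; split=> -[w].
  move=> /holds_ren K; exists (fun i => w (inord (pickle i))); apply/(Hp M x0).
  by apply: holds_eq K => -[].
move=> /(Hp M x0) K; exists (fun i => if unpickle i is Some j then w j else x0); apply/holds_ren.
have {}K := iffLR (Hn M x0 e w
  (fun i => if unpickle (@nat_of_ord n.+1 (inord (pickle i))) is Some j then w j else x0) _) K.
by apply: holds_eq (K _) => [[]|i Hi] //; rewrite inordK ?pickleK //; apply: ltnW.
Qed.

Lemma defb_all V (W : countType) P : @defb (V + W) P ->
  @defb V (fun M e => forall w, P M (sume e w)).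
Proof.
move=> /defb_not /defb_ex /defb_not; apply: defb_ext => M x0 e.
split=> H; last by case=> w; apply; apply: H.
by move=> w; apply: contrapT => N; apply: H; exists w.
Qed.

End OneSorted.

(** * Saturation *)

Lemma inj_pair2_unit (P : unit -> Type) (u : unit) (x y : P u) :
  existT P u x = existT P u y -> x = y.
Proof. by apply: Eqdep_dec.inj_pair2_eq_dec; do 2!case; left. Qed.

Section Countable.

Variables (fs : Type) (ar : fs -> nat) (fc : fs -> nat).
Hypothesis fc_inj : injective fc.
Let L := sig1 ar.

Fixpoint tcode V (s : V -> unit) (g : V -> nat) u (t : @term L V s u) :
  GenTree.tree nat :=
  match t with
  | Var v => GenTree.Leaf (g v)
  | App f args => GenTree.Node (fc f) [seq tcode g (args i) | i <- enum 'I_(ar f)]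
  end.

Lemma tcode_inj V (s : V -> unit) (g : V -> nat) (g_inj : injective g) u
  (t : @term L V s u) u' (t' : @term L V s u') : tcode g t = tcode g t' ->
  existT (fun u => @term L V s u) u t = existT (fun u => @term L V s u) u' t'.
Proof.
elim: t u' t' => [v|f args IH] u' [v'|f' args'] //= [].
  by move=> /g_inj ->.
move=> /fc_inj E; subst f' => /eq_in_map H.
suff -> : args = args' by [].
apply: functional_extensionality_dep => i.
have /H /IH K : i \in enum 'I_(ar f) by rewrite mem_enum.
exact: inj_pair2_unit K.
Qed.

Lemma tcode_inj1 V (s : V -> unit) (g : V -> nat) (g_inj : injective g) u
  (t t' : @term L V s u) : tcode g t = tcode g t' -> t = t'.
Proof. by move=> H; exact: (inj_pair2_unit (tcode_inj g_inj H)). Qed.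

Fixpoint fcode V (s : V -> unit) (g : V -> nat) (p : @formula L V s) :
  GenTree.tree nat :=
  match p with
  | Bot => GenTree.Node 0 [::]
  | Equ _ a b => GenTree.Node 1 [:: tcode g a; tcode g b]
  | Rel _ _ => GenTree.Node 2 [::]
  | Imp p q => GenTree.Node 3 [:: fcode g p; fcode g q]
  | All u p => GenTree.Node 4 [:: @fcode _ (ext s u) (fun o => if o is Some v then (g v).+1 else 0) p]
  end.

Lemma fcode_inj V (s : V -> unit) (g : V -> nat) : injective g ->
  injective (@fcode V s g).
Proof.
move=> Hg p; elim: p g Hg => {V s} [V s|V s u a b|V s [] //|V s p IHp q IHq|V s u p IHp] g Hg
  [|u' a' b'|[] //|p' q'|u' p'] //= [].
- case: u a b => a b; case: u' a' b' => a' b'.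
  by move=> /(tcode_inj1 Hg) -> /(tcode_inj1 Hg) ->.
- by move=> /(IHp _ Hg) -> /(IHq _ Hg) ->.
- case: u p IHp; case: u' p' => p' p IHp /IHp -> //.
  by move=> [v|] [w|] //= [/Hg ->].
Qed.

Lemma formula_enum (V : countType) : exists en : nat -> Fm L V, forall p, exists n, en n = p.
Proof.
pose c (p : Fm L V) := pickle (fcode pickle p).
have c_inj : injective c.
  by move=> p q /(pcan_inj pickleK) /fcode_inj; apply; apply: pcan_inj pickleK.
exists (fun n => if pselect (exists p, c p = n) is left H then sval (cid H) else Bot _) => p.
exists (c p); case: pselect => [H|[]]; last by exists p.
by apply: c_inj; case: cid.
Qed.

End Countable.

Section Saturation.

Variables (fs : Type) (ar : fs -> nat).
Let L := sig1 ar.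
Implicit Types (M N : structure L) (V W : countType).

Definition eqv M N (V : Type) (e : V -> univ M) (e' : V -> univ N) : Prop :=
  forall p : Fm L V, holds e p <-> holds e' p.

(** The only saturation used below: hulls, patterns and jets are all indexed by countable types. *)
Definition countably_saturated M : Prop :=
  forall (V : countType) (e : V -> univ M) (p : Fm L (option V) -> Prop),
    (forall l, (forall q, List.In q l -> p q) ->
       exists a, forall q, List.In q l -> holds (oext e a) q) ->
    exists a, forall q, p q -> holds (oext e a) q.

Lemma saturated_countably M (K : Type) : card_lt (unit + fs + void + nat) K ->
  saturated K M -> countably_saturated M.
Proof.
move=> cK sat V e p fin.
pose opn (q : Fm L (option V)) := @fsub L (option V) (option V) (fun _ => tt) (ext (fun _ => tt) tt)
      (fun o => match o return @term L _ (ext (fun _ => tt) tt) tt with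
         | Some v => @Var L _ (ext (fun _ => tt) tt) (Some v)
         | None => @Var L _ (ext (fun _ => tt) tt) None end) q.
have E a q : @Defs.sat L M (option V) (ext (fun _ => tt) tt) (opn q) (@aext L M _ (fun _ => tt) e tt a) <->
   holds (oext e a) q.
  by apply: iff_trans (sat_fsub _ _ _) _; apply: holds_ext => -[].
have [||b Hb] := sat V (fun _ => tt) e tt (fun q' => exists q, p q /\ q' = opn q).
(* An injection of [K] into the countable parameter set would compose to one into [nat], against the
   lower bound on [K]. *)
- move=> [f f_inj]; apply: cK; exists (fun x => inr (pickle (f x))).
  by move=> x y [/(pcan_inj pickleK) /f_inj].
- move=> l Hl.
  have [l' [Hl' El]] : exists l', (forall q, List.In q l' -> p q) /\ l = map opn l'.
    elim: l Hl => [|q' l IH] H; first by exists [::].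
    have [q [pq Eq]] := H q' (or_introl erefl).
    have [l' [pl El]] := IH (fun q Hq => H q (or_intror Hq)).
    by exists (q :: l'); rewrite Eq El; split=> // r /= [<-|/pl].
  have [a Ha] := fin l' Hl'; exists a => q; rewrite El => /List.in_map_iff [r [<- /Ha Hr]].
  by apply/E.
- by exists b => q pq; apply/E; apply: Hb; exists q.
Qed.

Lemma eqv_refl M (V : Type) (e : V -> univ M) : eqv e e.
Proof. by []. Qed.

Lemma eqv_sym M N (V : Type) (e : V -> univ M) (e' : V -> univ N) : eqv e e' -> eqv e' e.
Proof. by move=> H p; rewrite H. Qed.

Lemma eqv_trans M N (P : structure L) (V : Type) (e : V -> univ M) (e' : V -> univ N) (e2 : V -> univ P) :
  eqv e e' -> eqv e' e2 -> eqv e e2.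
Proof. by move=> H K p; rewrite H. Qed.

Lemma eqv_ren M N (V W : Type) (f : W -> V) (e : V -> univ M) (e' : V -> univ N) :
  eqv e e' -> eqv (e \o f) (e' \o f).
Proof. by move=> H p; have := H (ren f p); rewrite !holds_ren. Qed.

Lemma eqv_ext M N (V : Type) (e e1 : V -> univ M) (e' e1' : V -> univ N) :
  e =1 e1 -> e' =1 e1' -> eqv e e' -> eqv e1 e1'.
Proof. by move=> /funext -> /funext ->. Qed.

Lemma eqv_defb M N (x0 : univ M) (y0 : univ N) (V : Type) (e : V -> univ M) (e' : V -> univ N) P :
  @defb fs ar V P -> eqv e e' -> P M e -> P N e'.
Proof. by move=> [p Hp] H /(Hp M x0) /H /(Hp N y0). Qed.

Section OneModel.

Variables (M : structure L) (x0 : univ M).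
Hypothesis satM : countably_saturated M.

Definition fin_sat (V W : Type) (e : V -> univ M) (G : Fm L (V + W) -> Prop) : Prop :=
  forall l, (forall q, List.In q l -> G q) ->
    exists w, forall q, List.In q l -> holds (sume e w) q.

(** The values are chosen one at a time. The invariant [good n y] keeps every finite part of [G]
    solvable by a tuple that begins with the [n] values already chosen. *)
Lemma realize_nat V (e : V -> univ M) (G : Fm L (V + nat) -> Prop) :
  fin_sat e G -> exists w, forall q, G q -> holds (sume e w) q.
Proof.
move=> fin.
pose good n (y : nat -> univ M) := forall l, (forall q, List.In q l -> G q) ->
  exists w, (forall i, i < n -> w i = y i) /\ forall q, List.In q l -> holds (sume e w) q.
pose upd (y : nat -> univ M) n a := fun i => if i == n then a else y i.
have step n y : good n y -> exists a, good n.+1 (upd y n a).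
  move=> gn.
  (* A finite part [l] of [G] becomes a condition on the next value alone, the later values being
     quantified away. *)
  pose P (l : seq (Fm L (V + nat))) (N : structure L) (e' : option (V + nat) -> univ N) :=
    exists w : nat -> univ N, (forall i : 'I_n, w i = e' (Some (inr (nat_of_ord i)))) /\
      (w n = e' None /\ forall q, List.In q l -> holds (sume (fun v => e' (Some (inl v))) w) q).
  have dP l : defb (P l).
    apply: (@defb_ex _ _ _ _ (fun N e2 => (forall i : 'I_n, e2 (inr (nat_of_ord i)) = e2 (inl (Some (inr (nat_of_ord i))))) /\
       (e2 (inr n) = e2 (inl None) /\ forall q, List.In q l ->
        holds (sume (fun v => e2 (inl (Some (inl v)))) (fun j => e2 (inr j))) q))).
    apply: defb_and; first by apply: defb_allfin => i; apply: defb_eqv.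
    apply: defb_and; first exact: defb_eqv.
    apply: (@defb_allseq _ _ _ _ (fun q N e2 => holds (sume (fun v => e2 (inl (Some (inl v)))) (fun j => e2 (inr j))) q)) => q _.
    apply: defb_ext (defb_ren (fun o : V + nat => match o with inl v => inl (Some (inl v)) | inr j => inr j end) (defb_fm q)) => N y0 e2.
    by apply: holds_ext => -[].
  have [|a Ha] := satM (e := sume e y) (p := fun q => exists l, (forall q, List.In q l -> G q) /\
      forall a, holds (M:=M) (oext (sume e y) a) q <-> P l M (oext (sume e y) a)).
    move=> l Hl.
    have [l' [Gl' El]] : exists l', (forall q, List.In q l' -> G q) /\
       forall a, P l' M (oext (sume e y) a) -> forall q, List.In q l -> holds (M:=M) (oext (sume e y) a) q.
      elim: l Hl => [|q l IH] H; first by exists [::].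
      have [lq [Glq Eq]] := H q (or_introl erefl).
      have [l' [Gl' El]] := IH (fun q Hq => H q (or_intror Hq)).
      exists (lq ++ l'); split=> [r /List.in_app_iff [/Glq|/Gl']|a [w [w1 [w2 w3]]] r /= [<-|Hr]] //.
        by apply/Eq; exists w; split=> //; split=> // r' Hr'; apply: w3; apply/List.in_app_iff; left.
      by apply: El Hr; exists w; split=> //; split=> // r' Hr'; apply: w3; apply/List.in_app_iff; right.
    have [w [w1 w2]] := gn l' Gl'.
    by exists (w n); apply: El; exists w; split=> [i|] //=; apply: w1.
  exists a => l Gl; have [p Hp] := dP l.
  have /(Hp M x0) [w [w1 [w2 w3]]] : holds (M:=M) (oext (sume e y) a) p.
    by apply: Ha; exists l; split=> // b; apply: Hp.
  exists w; split=> // i; rewrite ltnS leq_eqVlt /upd => /orP[/eqP ->|Hi].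
    by rewrite eqxx.
  by rewrite ltn_eqF //; apply: (w1 (Ordinal Hi)).
have [F HF] : {F : nat * (nat -> univ M) -> univ M & forall z, good z.1 z.2 -> good z.1.+1 (upd z.2 z.1 (F z))}.
  apply: (@choice _ _ (fun z a => good z.1 z.2 -> good z.1.+1 (upd z.2 z.1 a))) => -[n y]; case: (pselect (good n y)) => [/step [a Ha]|N].
    by exists a.
  by exists x0.
pose ys := fix ys n := if n is m.+1 then upd (ys m) m (F (m, ys m)) else fun _ => x0.
pose y i := ys i.+1 i.
have ysE n i : i < n -> ys n i = y i.
  elim: n => // n IH; rewrite ltnS leq_eqVlt => /orP[/eqP ->//|Hi].
  by rewrite /= /upd ltn_eqF // IH.
have g n : good n (ys n).
  elim: n => [|n IH]; last exact: (HF (n, ys n)).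
  by move=> l /fin [w Hw]; exists w.
exists y => q Gq; have [n Hn] := formula_bound q.
have [|w [w1 w2]] := g n [:: q]; first by move=> r /= [<-|].
apply/(Hn M x0 e y w); last by apply: w2; left.
by move=> i Hi; rewrite [LHS]/= -[LHS](ysE n) // w1.
Qed.

Lemma realize V W (e : V -> univ M) (G : Fm L (V + W) -> Prop) :
  fin_sat e G -> exists w, forall q, G q -> holds (sume e w) q.
Proof.
move=> fin; pose f (o : V + W) : V + nat := match o with inl v => inl v | inr w => inr (pickle w) end.
have fE w q : holds (M:=M) (sume e w) (ren f q) <-> holds (sume e (fun v => w (pickle v))) q.
  by rewrite holds_ren; apply: holds_ext => -[].
have [|w Hw] := @realize_nat V e (fun q => exists r, G r /\ q = ren f r).
  move=> l Hl.
  have [l' [Hl' El]] : exists l', (forall q, List.In q l' -> G q) /\ l = map (ren f) l'.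
    elim: l Hl => [|q' l IH] H; first by exists [::].
    have [q [pq Eq]] := H q' (or_introl erefl).
    have [l' [pl El]] := IH (fun q Hq => H q (or_intror Hq)).
    by exists (q :: l'); rewrite Eq El; split=> // r /= [<-|/pl].
  have [w Hw] := fin l' Hl'.
  exists (fun i => if unpickle i is Some v then w v else x0) => q.
  rewrite El => /List.in_map_iff [r [<- /Hw Hr]]; apply/fE.
  by apply: holds_eq Hr => -[v|v] //=; rewrite pickleK.
by exists (fun v => w (pickle v)) => q Gq; apply/fE; apply: Hw; exists q.
Qed.

(** Finitely many formulas that hold eventually hold together at one [A n]. This replaces an
    ultraproduct: the limit of the [A m] is found inside [M]. *)
Lemma realize_limit V W (e : V -> univ M) (A : nat -> W -> univ M) :
  exists w, forall q, (exists n, forall m, n <= m -> holds (sume e (A m)) q) -> holds (sume e w) q.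
Proof.
apply: realize => l Hl.
suff [n Hn] : exists n, forall m, n <= m -> forall q, List.In q l -> holds (sume e (A m)) q.
  by exists (A n); apply: Hn.
elim: l Hl => [|q l IH] H; first by exists 0.
have [n Hn] := H q (or_introl erefl).
have [n' Hn'] := IH (fun q Hq => H q (or_intror Hq)).
exists (maxn n n') => m; rewrite geq_max => /andP[h h'] r /= [<-|]; first exact: Hn.
exact: Hn'.
Qed.

Lemma eqv_extend V W (e e' : V -> univ M) (y : W -> univ M) : eqv e e' ->
  exists y', eqv (sume e y) (sume e' y').
Proof.
move=> E; have [|y' Hy'] := @realize V W e' (fun q => holds (sume e y) q).
  move=> l Hl.
  have dP : defb (fun (N : structure L) (e2 : V + W -> univ N) => forall q, List.In q l -> holds e2 q).
    by apply: (@defb_allseq _ _ _ _ (fun q N e2 => holds e2 q)) => q _; exact: defb_fm.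
  by apply: (eqv_defb x0 x0 (defb_ex dP) E); exists y.
exists y' => q; split; first exact: Hy'.
move=> H; apply: contrapT => N; apply: (Hy' (Imp q (Bot _))) => //.
Qed.

End OneModel.
End Saturation.

(** * Skolem hulls *)

Lemma tree_ind' (A : Type) (P : GenTree.tree A -> Prop) :
  (forall l, P (GenTree.Leaf l)) ->
  (forall n ts, (forall t, List.In t ts -> P t) -> P (GenTree.Node n ts)) ->
  forall t, P t.
Proof.
move=> Hl Hn; fix IH 1 => t; case: t => [l|n ts]; first exact: Hl.
apply: (Hn n ts); elim: ts => [|t ts IHts]; first (move=> u; case).
move=> u [<-|Hu]; first exact: IH.
exact: IHts Hu.
Qed.

Fixpoint graft (A B : Type) (s : A -> GenTree.tree B) (t : GenTree.tree A) : GenTree.tree B :=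
  match t with
  | GenTree.Leaf l => s l
  | GenTree.Node n ts => GenTree.Node n [seq graft s u | u <- ts]
  end.

Definition range (V K : Type) (e : V -> K) (x : K) : Prop := exists v, e v = x.

Section Skolem.

Variables (fs : Type) (ar : fs -> nat).
Let L := sig1 ar.
Implicit Types (M : structure L).
Variable en : nat -> Fm L (option nat).

(** The Tarski-Vaught test for the range of [nu]; [sat_sub] turns it into an elementary
    substructure. *)
Definition elem M (W : Type) (nu : W -> univ M) : Prop :=
  forall (p : Fm L (option W)) a, holds (oext nu a) p ->
    exists w, holds (oext nu (nu w)) p.

Section Trees.

Variables (A : Type) (d : A).
Notation T := (GenTree.tree A).

Definition tenv M (tau : T -> univ M) (ts : seq T) (i : nat) : univ M :=
  tau (nth (GenTree.Leaf d) ts i).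

(** Trees are Skolem terms, [Node n ts] being a witness for the formula [en n] at the arguments
    [ts]. The map [tau] only has to satisfy the Skolem axioms and need not be computed from its
    leaves: the axioms are first-order and survive in limits, a choice of witnesses would not. *)
Definition skolem M (tau : T -> univ M) : Prop := forall n ts a,
  holds (oext (tenv tau ts) a) (en n) ->
  holds (oext (tenv tau ts) (tau (GenTree.Node n ts))) (en n).

Fixpoint tall (P : A -> Prop) (t : T) : Prop :=
  match t with
  | GenTree.Leaf l => P l
  | GenTree.Node n ts => foldr (fun u Q => tall P u /\ Q) True ts
  end.

Lemma tall_Node P n ts : tall P (GenTree.Node n ts) <-> forall t, List.In t ts -> tall P t.
Proof.
rewrite /=; elim: ts => [|t ts [IH1 IH2]] /=; first by split.
by split=> [[H /IH1 K] u [<-|/K]|H] //; split; [apply: H; left|apply: IH2 => u Hu; apply: H; right].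
Qed.

Lemma tall_impl (P Q : A -> Prop) : (forall l, P l -> Q l) -> forall t, tall P t -> tall Q t.
Proof.
move=> PQ t; elim/tree_ind': t => [l|n ts IH]; first exact: PQ.
by move=> /tall_Node H; apply/tall_Node => t Ht; apply: IH => //; apply: H.
Qed.

Section Eval.
Variables (M : structure L) (wit : (nat -> univ M) -> nat -> univ M).

Fixpoint seval (lam : A -> univ M) (t : T) : univ M :=
  match t with
  | GenTree.Leaf l => lam l
  | GenTree.Node n ts => wit (nth (lam d) [seq seval lam u | u <- ts]) n
  end.

Lemma seval_eq lam lam' t : lam d = lam' d -> tall (fun l => lam l = lam' l) t ->
  seval lam t = seval lam' t.
Proof.
move=> Hd; elim/tree_ind': t => [l|n ts IH] //.
move=> /tall_Node H /=; rewrite Hd; congr (wit (nth _ _) _).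
elim: ts IH H => //= t ts IHts IH H; rewrite IH; [|by left|by apply: H; left].
by rewrite IHts // => u Hu; [apply: IH; right|apply: H; right].
Qed.

Lemma seval_skolem lam :
  (forall n e a, holds (oext e a) (en n) -> holds (oext e (wit e n)) (en n)) ->
  skolem (seval lam).
Proof.
move=> Hw n ts a /=.
suff -> : tenv (seval lam) ts = nth (lam d) [seq seval lam u | u <- ts] by apply: Hw.
apply: funext => i; rewrite /tenv; case: (ltnP i (size ts)) => Hi.
  by rewrite (nth_map (GenTree.Leaf d)).
by rewrite !nth_default ?size_map.
Qed.
End Eval.

Lemma witness_exists M (x0 : univ M) : exists wit : (nat -> univ M) -> nat -> univ M,
  forall n e a, holds (oext e a) (en n) -> holds (oext e (wit e n)) (en n).
Proof.
have H (z : (nat -> univ M) * nat) : exists b, forall a, holds (oext z.1 a) (en z.2) -> holds (oext z.1 b) (en z.2).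
  case: (pselect (exists b, holds (oext z.1 b) (en z.2))) => [[b Hb]|N]; first by exists b.
  by exists x0 => a Ha; case: N; exists a.
have [w Hw] := choice H.
by exists (fun e n => w (e, n)) => n e a; apply: (Hw (e, n)).
Qed.

(** The parameters of a formula can be listed as the arguments of a single Skolem term, whose value
    is the witness required. *)
Lemma skolem_elem M (tau : T -> univ M) (D : T -> Prop) (W : countType) (g : W -> T) :
  (forall p, exists n, en n = p) ->
  skolem tau -> (forall n ts, (forall t, List.In t ts -> D t) -> D (GenTree.Node n ts)) ->
  D (GenTree.Leaf d) -> (forall w, D (g w)) -> (forall t, D t -> exists w, tau (g w) = tau t) ->
  elem (tau \o g).
Proof.
move=> en_surj sk Dn Dd Dg sg p a Ha.
have [n Hn] := formula_bound (ren (fun o => if o is Some w then inr w else inl tt) p : Fm L (unit + W)).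
have HnE (e e' : W -> univ M) b : (forall i, pickle i < n -> e i = e' i) -> holds (oext e b) p -> holds (oext e' b) p.
  move=> H K; have /Hn := H; move=> /(_ a (fun _ => b)) [K1 _].
  suff : holds (sume (fun _ : unit => b) e') (ren (fun o => if o is Some w then inr w else inl tt) p).
    by move=> /holds_ren; apply: holds_eq => -[].
  by apply: K1; apply/holds_ren; apply: holds_eq K => -[].
(* Numbers below [n] that code no variable are padded with the leaf [d], which lies in [D]. *)
pose ts := [seq (if unpickle i is Some w then g w else GenTree.Leaf d) | i <- iota 0 n].
have E i : pickle i < n -> tenv tau ts (pickle i) = tau (g i).
  by move=> Hi; rewrite /tenv (nth_map 0) ?size_iota // nth_iota // add0n pickleK.
have [m Hm] := en_surj (ren (omap pickle) p).
have tsD : D (GenTree.Node m ts).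
  apply: Dn => t /List.in_map_iff [i [<- _]].
  by case: (unpickle i).
have [w Hw] := sg _ tsD.
exists w; rewrite [(tau \o g) w]Hw.
have K b : holds (oext (tenv tau ts) b) (en m) <-> holds (oext (tau \o g) b) p.
  rewrite Hm holds_ren.
  have -> : oext (tenv tau ts) b \o omap pickle = oext (tenv tau ts \o (@pickle W)) b.
    by apply: funext => -[].
  by split; apply: HnE => i Hi /=; rewrite E.
by apply/K; apply: sk (iffRL (K a) Ha).
Qed.

End Trees.

(** Replacing generators by terms respects the Skolem axioms provided that the padding leaf is left
    in place. *)
Lemma skolem_graft (A B : Type) (d : A) (d' : B) M (tau : GenTree.tree B -> univ M) (s : A -> GenTree.tree B) :
  s d = GenTree.Leaf d' -> skolem d' tau -> skolem d (tau \o graft s).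
Proof.
move=> sd sk n ts a /=.
suff -> : tenv d (tau \o graft s) ts = tenv d' tau [seq graft s u | u <- ts] by apply: sk.
apply: funext => i; rewrite /tenv /=; case: (ltnP i (size ts)) => Hi.
  by rewrite (nth_map (GenTree.Leaf d)).
by rewrite !nth_default ?size_map //= sd.
Qed.

Lemma tall_graft (A B : Type) (s : A -> GenTree.tree B) (P : A -> Prop) (Q : B -> Prop) :
  (forall l, P l -> tall Q (s l)) -> forall t, tall P t -> tall Q (graft s t).
Proof.
move=> H t; elim/tree_ind': t => [l|n ts IH]; first exact: H.
move=> /tall_Node K; apply/(@tall_Node B Q n) => t /List.in_map_iff [u [<- Hu]].
by apply: IH => //; apply: K.
Qed.

(** Downward Loewenheim-Skolem: there are countably many trees over a countable set of generators,
    so the hull can be enumerated by [nat]. *)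
Lemma elem_hull M (x0 : univ M) (W : countType) (a : W -> univ M) :
  (forall p, exists n, en n = p) ->
  exists nu : nat -> univ M, elem nu /\ forall w, exists n, nu n = a w.
Proof.
move=> en_surj; have [wit Hw] := witness_exists x0.
pose tau := seval None wit (fun o => if o is Some w then a w else x0).
pose g (i : nat) : GenTree.tree (option W) := if unpickle i is Some t then t else GenTree.Leaf None.
exists (tau \o g); split.
  apply: (@skolem_elem _ None _ _ (fun _ => True)) => //; first exact: seval_skolem.
  by move=> t _; exists (pickle t); rewrite /g pickleK.
move=> w; exists (pickle (GenTree.Leaf (Some w) : GenTree.tree (option W))).
by rewrite /= /g pickleK.
Qed.

Section Substructure.

Variables (M : structure L) (nu : nat -> univ M).
Hypothesis elem_nu : elem nu.

Definition in_range (u : unit) : M u -> Prop :=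
  match u return M u -> Prop with tt => fun x => exists i, nu i = x end.

Lemma elem_fun (f : fs) (j : 'I_(ar f) -> nat) :
  exists i, nu i = @finterp L M f (fun k => nu (j k)).
Proof.
pose t : Tm L (option nat) := @App L _ (fun _ => tt) f (fun k => @Var L _ (fun _ => tt) (Some (j k))).
have [w Hw] := elem_nu (p := @Equ L _ (fun _ => tt) tt (@Var L _ (fun _ => tt) None) t)
  (a := @finterp L M f (fun k => nu (j k))) erefl.
by exists w.
Qed.

Lemma range_fun (f : fs) (x : forall i : 'I_(ar f), M tt) :
  (forall i, @in_range tt (x i)) -> @in_range tt (@finterp L M f x).
Proof.
move=> /choice [j Hj]; have [i Hi] := elem_fun j.
exists i; rewrite Hi; congr finterp.
by apply: functional_extensionality_dep.
Qed.

Definition substructure : structure L :=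
  @Structure L (fun u => {x : M u | in_range x})
    (fun f x => exist _ (@finterp L M f (fun i => sval (x i)))
       (range_fun (fun i => svalP (x i))))
    (fun r => match r with end).

Lemma teval_sub V (s : V -> unit) (e : @assignment L substructure V s) u (t : @term L V s u) :
  sval (teval e t) = @teval L M V s (fun v => sval (e v)) u t.
Proof.
elim: t => //= f args IH; congr finterp.
by apply: functional_extensionality_dep => i; rewrite IH.
Qed.

Definition vcast (V : Type) (w : V) (u : unit) : @term L V (fun _ => tt) u :=
  match u with tt => @Var L V (fun _ => tt) w end.

Lemma teval_vcast V (e : V -> univ M) w u :
  @teval L M V (fun _ => tt) e u (vcast w u) = match u with tt => e w end.
Proof. by case: u. Qed.

Lemma sat_sub V (s : V -> unit) (p : @formula L V s) (e : @assignment L substructure V s) :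
  sat p e <-> @sat L M V s p (fun v => sval (e v)).
Proof.
elim: p e => {V s} [V s|V s u a b|V s []|V s p IHp q IHq|V s u p IHp] e //=.
- rewrite -!teval_sub; split=> [->//|].
  by case: (teval e a) (teval e b) => x Hx [y Hy] /= E; subst y; congr exist; apply: Prop_irrelevance.
- by rewrite IHp IHq.
- have E a : (fun o => sval (@aext L substructure V s e u a o)) = @aext L M V s (fun v => sval (e v)) u (sval a).
    by apply: functional_extensionality_dep => -[].
  split=> [H|H a]; last by apply/IHp; rewrite E.
  case: u p IHp H E => p IHp H E a; apply: contrapT => N.
  (* The assignment has its values in the range of [nu], so it factors through indices [j]; a
     failure of [p] in [M] then becomes a formula with parameters from [nu], to which the
     Tarski-Vaught test applies. *)
  have /choice [j Hj] : forall v, exists i, match s v as u return M u -> Prop with tt => fun x => nu i = x end (sval (e v)).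
    move=> v; case: (e v) => x /=; case: (s v) x => x [i Hi]; by exists i.
  pose f o : @term L (option nat) (fun _ => tt) (ext s tt o) :=
    match o return @term L (option nat) (fun _ => tt) (ext s tt o) with
    | Some v => vcast (Some (j v)) (s v) | None => @Var L _ (fun _ => tt) None end.
  have K b : holds (oext nu b) (fsub f p) <-> @sat L M _ (ext s tt) p (@aext L M V s (fun v => sval (e v)) tt b).
    apply: iff_trans (sat_fsub _ _ _) _.
    suff -> : (fun v => teval (oext nu b) (f v)) = @aext L M V s (fun v => sval (e v)) tt b by [].
    apply: functional_extensionality_dep => -[v|] //=; rewrite teval_vcast.
    by move: (Hj v); case: (s v) (sval (e v)).
  have [|w Hw] := elem_nu (p := Imp (fsub f p) (Bot _)) (a := a); first by move=> /K.
  apply: Hw; apply/K.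
  by have /IHp := H (exist _ (nu w) (ex_intro _ w erefl)); rewrite E.
Qed.

Lemma model_sub (T : theory L) : model T M -> model T substructure.
Proof.
move=> H p /H; rewrite sat_sub; congr (sat p _).
by apply: functional_extensionality_dep => -[].
Qed.

(* By model completeness, any map on an elementary substructure that preserves
   and reflects atomic formulas preserves all formulas. *)
Lemma elem_embed (T : theory L) (M' : structure L) (f : nat -> univ M') :
  model_complete T -> model T M -> model T M' ->
  (forall t u : Tm L nat, ev nu t = ev nu u <-> ev f t = ev f u) ->
  eqv nu f.
Proof.
move=> mc MT MT' H.
have [r Hr] : {r : {x : univ M | in_range x} -> nat & forall x, nu (r x) = sval x}.
  by apply: (@choice _ _ (fun x i => nu i = sval x)) => -[x Hx].
pose h u : substructure u -> M' u := match u return substructure u -> M' u with tt => fun x => f (r x) end.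
have HV i j : nu i = nu j <-> f i = f j.
  exact: (H (@Var L _ (fun _ => tt) i) (@Var L _ (fun _ => tt) j)).
have emb : @embedding L substructure M' h.
  split.
  - move=> [] x y /= /HV; rewrite !Hr; case: x y => x Hx [y Hy] /= E.
    by subst y; congr exist; apply: Prop_irrelevance.
  - move=> g a; rewrite /=.
    set y := exist _ _ _; have /= Hy := Hr y.
    have /= := H (@Var L _ (fun _ => tt) (r y)) (@App L _ (fun _ => tt) g (fun k => @Var L _ (fun _ => tt) (r (a k)))).
    rewrite /ev /=; case=> H1 _; apply: H1; rewrite Hy; congr finterp.
    by apply: functional_extensionality_dep => i; rewrite Hr.
  - by case.
have el := mc _ _ h (model_sub MT) MT' emb.
move=> p; pose e (i : nat) : substructure tt := exist _ (nu i) (ex_intro _ i erefl).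
have := el nat (fun _ => tt) p e.
rewrite sat_sub /holds /=.
suff -> : (fun v => f (r (e v))) = f by [].
by apply: funext => i; apply/HV; rewrite Hr.
Qed.

End Substructure.

End Skolem.

(** * Patterns of thorn-forking *)

Section Patterns.

Variables (fs : Type) (ar : fs -> nat).
Let L := sig1 ar.
Variable en : nat -> Fm L (option nat).
Hypothesis en_surj : forall p, exists n, en n = p.
Variables (M : structure L) (x0 : univ M).
Hypothesis satM : countably_saturated M.
Variables X J : countType.
Variables (chi : Fm L (X + J + nat)) (E : Fm L (J + J)).

(* Generators of a chain of elementary substructures: a dummy, the parameters
   of the state, and for the [i]-th step its parameters and its new tuple. *)
Definition leaf : countType := option (nat + nat * (nat + J)).
Definition pleaf (j : nat) : leaf := Some (inl j).
Definition cleaf (i n : nat) : leaf := Some (inr (i, inl n)).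
Definition aleaf (i : nat) (y : J) : leaf := Some (inr (i, inr y)).
Notation tree := (GenTree.tree leaf).

(** The [i]-th model contains the parameters of step [i] but not its tuple: that tuple has to be new
    over the model over which its class is defined. *)
Definition lev (i : nat) (l : leaf) : Prop :=
  match l with
  | Some (inr (i', inl _)) => i' <= i
  | Some (inr (i', inr _)) => i' < i
  | _ => True
  end.

Lemma lev_mono i i' l : i <= i' -> lev i l -> lev i' l.
Proof.
move=> ii'; case: l => [[j|[i2 [n|y]]]|] //= H; exact: leq_trans H ii'.
Qed.

(** Each clause is a conjunction of first-order conditions on [b] and on the values of [tau], so
    patterns can be obtained from approximations by saturation. *)
Definition pattern (nu : nat -> univ M) (b : X -> univ M) (tau : tree -> univ M) : Prop :=
  [/\ skolem en (None : leaf) tau,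
      forall j, tau (GenTree.Leaf (pleaf j)) = nu j,
      forall i, holds (sume (sume b (fun y => tau (GenTree.Leaf (aleaf i y)))) (fun n => tau (GenTree.Leaf (cleaf i n)))) chi
    & forall i (g : J -> tree), (forall y, tall (lev i) (g y)) ->
        ~ holds (sume (tau \o g) (fun y => tau (GenTree.Leaf (aleaf i y)))) E].

(* The new tuple is [E]-equivalent to no tuple of the model [nu], although the
   parameters over which, together with [b], its class is algebraic lie in it. *)
Definition state (nu : nat -> univ M) (b : X -> univ M) : Prop :=
  elem nu /\ exists tau h, pattern nu b tau /\ forall n, tau (GenTree.Leaf (cleaf 0 n)) = nu (h n).

(** The first step is absorbed into the model and the remaining ones are renumbered. *)
Lemma pattern_state nu b tau : pattern nu b tau -> exists nu', [/\ state nu' b,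
  exists r, nu =1 nu' \o r & forall y, range nu' (tau (GenTree.Leaf (aleaf 0 y)))].
Proof.
move=> [sk tp tc ta].
(* Level 1 contains the tuple of step 0 and already the parameters of step 1, which a state must
   contain. *)
pose D (t : tree) := tall (lev 1) t.
pose tr (n : nat) : tree := if @unpickle tree n is Some t then if pselect (D t) is left _ then t else GenTree.Leaf None
  else GenTree.Leaf None.
have Dtr n : D (tr n) by rewrite /tr; case: unpickle => // t; case: pselect.
have trD t : D t -> tr (pickle t) = t by rewrite /tr pickleK; case: pselect.
pose nu' := tau \o tr.
(* Names of the new generators in the old pattern: a parameter of the new state is an arbitrary term
   of level 1, the steps are shifted by one. *)
pose s (l : leaf) : tree := match l with
  | Some (inl j) => tr j
  | Some (inr (i, inl n)) => GenTree.Leaf (cleaf i.+1 n)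
  | Some (inr (i, inr y)) => GenTree.Leaf (aleaf i.+1 y)
  | None => GenTree.Leaf None end.
have Dleaf l : lev 1 l -> nu' (pickle (GenTree.Leaf l : tree)) = tau (GenTree.Leaf l).
  by move=> H; rewrite /nu' /= trD.
exists nu'; split; last 2 first.
- by exists (fun j => pickle (GenTree.Leaf (pleaf j) : tree)) => j; rewrite /= Dleaf ?tp.
- by move=> y; exists (pickle (GenTree.Leaf (aleaf 0 y) : tree)); rewrite Dleaf.
split.
  apply: (skolem_elem (D := D) en_surj sk) => //.
  - by move=> n ts H; apply/tall_Node.
  - by move=> t Dt; exists (pickle t); rewrite trD.
exists (tau \o graft s), (fun n => pickle (GenTree.Leaf (cleaf 1 n) : tree)); split; last first.
  by move=> n; rewrite Dleaf.
split.
- exact: skolem_graft sk.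
- by [].
- by move=> i; exact: (tc i.+1).
- move=> i g Hg; apply: (ta i.+1 (fun y => graft s (g y))) => y.
  apply: tall_graft (Hg y) => -[[j|[i' [n|y']]]|] //= _.
  by apply: tall_impl (Dtr j) => l; apply: lev_mono.
Qed.

(** Approximations of which each clause holds from some index on have a limit that is a pattern. The
    parameters [e] record what else about the approximations must be kept. *)
Lemma pattern_realize (V : countType) (e : V -> univ M) (A : nat -> X + tree -> univ M) :
  (forall m, skolem en (None : leaf) (A m \o inr)) ->
  (forall i, exists n, forall m, n <= m -> holds (sume (sume (A m \o inl) (fun y => A m (inr (GenTree.Leaf (aleaf i y)))))
     (fun n => A m (inr (GenTree.Leaf (cleaf i n))))) chi) ->
  (forall i (g : J -> tree), (forall y, tall (lev i) (g y)) -> exists n, forall m, n <= m ->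
     ~ holds (sume (A m \o inr \o g) (fun y => A m (inr (GenTree.Leaf (aleaf i y))))) E) ->
  exists w : X + tree -> univ M, (forall q, (exists n, forall m, n <= m -> holds (sume e (A m)) q) -> holds (sume e w) q) /\
    pattern (fun j => w (inr (GenTree.Leaf (pleaf j)))) (w \o inl) (w \o inr).
Proof.
move=> Hsk Hc Ha; have [w Hw] := realize_limit x0 satM e A.
exists w; split=> //; split.
- move=> n ts a Hts.
  pose f u (o : option nat) : V + (X + tree) := match o with
    | Some i => inr (inr (nth (GenTree.Leaf None) ts i)) | None => inr (inr u) end.
  pose q0 := ren (fun o => match o with Some i => Some (inr (inr (nth (GenTree.Leaf (None : leaf)) ts i)) : V + (X + tree)) | None => None end) (en n).
  pose q1 := Ex1 q0; pose q2 := ren (f (GenTree.Node n ts)) (en n); pose p := Imp q1 q2.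
  have pE (v : X + tree -> univ M) : holds (sume e v) p <-> ((exists a, holds (oext (tenv (None : leaf) (v \o inr) ts) a) (en n)) ->
      holds (oext (tenv (None : leaf) (v \o inr) ts) (v (inr (GenTree.Node n ts)))) (en n)).
    change ((holds (sume e v) q1 -> holds (sume e v) q2) <-> ((exists a, holds (oext (tenv (None : leaf) (v \o inr) ts) a) (en n)) ->
      holds (oext (tenv (None : leaf) (v \o inr) ts) (v (inr (GenTree.Node n ts)))) (en n))).
    rewrite /q1 /q2 holds_Ex1 holds_ren.
    have E1 c : holds (oext (sume e v) c) q0 <-> holds (oext (tenv (None : leaf) (v \o inr) ts) c) (en n).
      by rewrite holds_ren; apply: holds_ext => -[].
    have -> : (exists c, holds (oext (sume e v) c) q0) <-> exists c, holds (oext (tenv (None : leaf) (v \o inr) ts) c) (en n).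
      by split=> -[c /E1 Hc']; exists c.
    suff -> : sume e v \o f (GenTree.Node n ts) = oext (tenv (None : leaf) (v \o inr) ts) (v (inr (GenTree.Node n ts))) by [].
    by apply: funext => -[].
  have /pE : holds (sume e w) p.
    by apply: Hw; exists 0 => m _; apply/pE => -[c Hc']; exact: Hsk Hc'.
  by apply; exists a.
- by [].
- move=> i.
  pose f (o : X + J + nat) : V + (X + tree) := match o with inl (inl x) => inr (inl x)
    | inl (inr y) => inr (inr (GenTree.Leaf (aleaf i y))) | inr n => inr (inr (GenTree.Leaf (cleaf i n))) end.
  have /holds_ren : holds (sume e w) (ren f chi).
    apply: Hw; have [n Hn] := Hc i; exists n => m /Hn H; apply/holds_ren.
    by apply: holds_eq H; do 2?case.
  by apply: holds_eq; do 2?case.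
- move=> i g Hg.
  pose f (o : J + J) : V + (X + tree) := match o with inl y => inr (inr (g y))
    | inr y => inr (inr (GenTree.Leaf (aleaf i y))) end.
  have : holds (sume e w) (Imp (ren f E) (Bot _)).
    apply: Hw; have [n Hn] := Ha i g Hg; exists n => m /Hn N /holds_ren H; apply: N.
    by apply: holds_eq H; case.
  move=> H K; apply: H; apply/holds_ren; by apply: holds_eq K; case.
Qed.

(** The states of the chain have unrelated patterns, so nothing is left of these in the union of the
    models. Instead, a limit of the patterns is taken in which the leaf [pleaf (pickle (n, j))]
    names the element [j] of the [n]-th model. *)
Lemma pattern_limit (nus : nat -> nat -> univ M) (bs : nat -> X -> univ M) (rs : nat -> nat -> nat) :
  (forall n, state (nus n) (bs n)) -> (forall n, nus n =1 nus n.+1 \o rs n) ->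
  (forall n, eqv (sume (nus n) (bs n)) (sume (nus n) (bs n.+1))) ->
  exists (nu : nat -> univ M) (b : X -> univ M) (tau : tree -> univ M), pattern nu b tau /\ forall n,
    (exists r, nus n =1 nu \o r) /\ eqv (sume (nus n) (bs n)) (sume (nus n) b).
Proof.
move=> St Hr Hb.
have ren_le n m : n <= m -> exists r, nus n =1 nus m \o r.
  move=> /subnK <-; elim: (m - n) => [|i [r IH]]; first by exists id.
  by exists (rs (i + n) \o r) => j; rewrite IH /= Hr.
have /choice [R HR] : forall nm : nat * nat, exists r, nm.1 <= nm.2 -> nus nm.1 =1 nus nm.2 \o r.
  move=> [n m]; case: (leqP n m) => [/ren_le [r H]|_]; by [exists r|exists id].
have eqv_le n m : n <= m -> eqv (sume (nus n) (bs n)) (sume (nus n) (bs m)).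
  move=> /subnK <-; elim: (m - n) => [|i IH]; first exact: eqv_refl.
  apply: eqv_trans IH _; have [r H] := ren_le n (i + n) (leq_addl _ _).
  pose f (o : nat + X) : nat + X := match o with inl v => inl (r v) | inr x => inr x end.
  by apply: eqv_ext (eqv_ren f (Hb (i + n))) => -[v|x] //=; rewrite H.
have /choice [tau Htau] : forall m, exists tau, pattern (nus m) (bs m) tau.
  by move=> m; have [_ [tau [h [H _]]]] := St m; exists tau.
pose dec (j : nat) : nat * nat := odflt (0, 0) (unpickle j).
(* The [m]-th pattern only knows the models up to the [m]-th; the names of later elements get a
   default value, which the limit forgets. *)
pose s m (l : leaf) : tree := match l with
  | Some (inl j) => let: (n, j') := dec j in if n <= m then GenTree.Leaf (pleaf (R (n, m) j')) else GenTree.Leaf None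
  | _ => GenTree.Leaf l end.
pose ta m := tau m \o graft (s m).
have tp m n j : n <= m -> ta m (GenTree.Leaf (pleaf (pickle (n, j)))) = nus n j.
  move=> nm; rewrite /ta /= /dec pickleK /= nm; have [_ -> _ _] := Htau m.
  by rewrite [RHS](HR (n, m) nm).
pose e (o : nat * nat) := nus o.1 o.2.
pose A m : X + tree -> univ M := sume (bs m) (ta m).
have [|||w [Hw Pw]] := @pattern_realize _ e A.
- move=> m; have [sk _ _ _] := Htau m; exact: (@skolem_graft _ _ en _ _ (None : leaf) (None : leaf) M (tau m) (s m) erefl sk).
- by move=> i; exists 0 => m _; have [_ _ tc _] := Htau m; apply: tc.
- move=> i g Hg; exists 0 => m _; have [_ _ _ ta'] := Htau m.
  apply: (ta' i (fun y => graft (s m) (g y))) => y; apply: tall_graft (Hg y) => -[[j|[i' [n|y']]]|] //= _.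
  by case: (dec j) => n j'; case: ifP.
pose b := w \o inl; pose t := w \o inr.
exists (fun j => t (GenTree.Leaf (pleaf j))), b, t; split=> //.
  move=> n; split.
    exists (fun j => pickle (n, j)) => j /=.
    apply: (Hw (@Equ L _ (fun _ => tt) tt (@Var L _ (fun _ => tt) (inl (n, j)))
      (@Var L _ (fun _ => tt) (inr (inr (GenTree.Leaf (pleaf (pickle (n, j))))))))).
    by exists n => m nm; rewrite /holds /= tp.
  have H p : holds (sume (nus n) (bs n)) p -> holds (sume (nus n) b) p.
    move=> Hp; pose f (o : nat + X) : nat * nat + (X + tree) := match o with inl v => inl (n, v) | inr x => inr (inl x) end.
    have /holds_ren : holds (sume e w) (ren f p).
      apply: Hw; exists n => m nm; apply/holds_ren.
      have fE : sume e (A m) \o f =1 sume (nus n) (bs m) by case.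
      by apply: holds_eq (fun o => esym (fE o)) _; apply/eqv_le.
    by apply: holds_eq => -[].
  move=> p; split; first exact: H.
  by move=> Hp; apply: contrapT => N; exact: (H (Imp p (Bot _)) N Hp).
Qed.

End Patterns.

(** * Imaginaries *)

Section Imaginaries.

Variables (fs : Type) (ar : fs -> nat).
Let L := sig1 ar.
Variables (M : structure L) (x0 : univ M).
Notation C := (struct_eq M).

(* An element of a sort of [M^eq] is represented by a tuple of elements of [M]. *)
Definition fibn (u : unit + eqdef M) : nat := match u with inl _ => 1 | inr E => earity E end.

Definition ucst (v : unit) (x : M tt) : M v := match v with tt => x end.

Definition mk (u : sort (sig_eq M)) : ('I_(fibn u) -> M tt) -> C u :=
  match u return ('I_(fibn u) -> M tt) -> C u with
  | inl v => fun f => ucst v (f ord0)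
  | inr E => fun f => exist _ (eclass (E := E) (fun i => ucst (edom i) (f i))) (ex_intro _ _ (erefl _))
  end.

Lemma quotient_eq (E : eqdef M) (X Y : quotient E) : sval X = sval Y -> X = Y.
Proof. by case: X Y => X HX [Y HY] /= XY; subst Y; congr exist; apply: Prop_irrelevance. Qed.

Lemma mk_surj u (a : C u) : exists f, mk f = a.
Proof.
case: u a => [[] a|E [X [a Xa]]]; first by exists (fun _ => a).
exists (fun i => match edom i as v return M v -> M tt with tt => id end (a i)).
apply: quotient_eq => /=; rewrite Xa; congr (eclass _).
by apply: functional_extensionality_dep => i; case: (edom i) (a i).
Qed.

Definition rep (V : Type) (s : V -> sort (sig_eq M)) : Type := {v : V & 'I_(fibn (s v))}.

Definition rass (V : Type) (s : V -> sort (sig_eq M)) (e : rep s -> univ M) : assignment C s :=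
  fun v => mk (fun i => e (existT _ v i)).

Lemma rass_surj (V : Type) (s : V -> sort (sig_eq M)) (a : assignment C s) : exists e, rass e = a.
Proof.
have H : forall v, {f | mk f = a v} by move=> v; apply: cid; apply: mk_surj.
exists (fun o => sval (H (projT1 o)) (projT2 o)).
by apply: functional_extensionality_dep => v; exact: (svalP (H v)).
Qed.

(** Definability in the fixed [M], in contrast to [defb]: an [eqdef] is an equivalence relation in
    [M], so the sorts of [struct_eq M] depend on [M]. *)
Definition mdef (W : Type) (P : (W -> univ M) -> Prop) : Prop := exists p : Fm L W, forall e, holds e p <-> P e.

Lemma mdef_ext W (P Q : (W -> univ M) -> Prop) : (forall e, P e <-> Q e) -> mdef P -> mdef Q.
Proof. by move=> E [p Hp]; exists p => e; rewrite Hp. Qed.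

Lemma mdef_defb W P : @defb _ ar W P -> mdef (P M).
Proof. by move=> [p Hp]; exists p => e; apply: Hp. Qed.

Lemma mdef_imp W (P Q : (W -> univ M) -> Prop) : mdef P -> mdef Q -> mdef (fun e => P e -> Q e).
Proof. by move=> [p Hp] [q Hq]; exists (Imp p q) => e; rewrite -Hp -Hq. Qed.

Lemma mdef_not W (P : (W -> univ M) -> Prop) : mdef P -> mdef (fun e => ~ P e).
Proof. by move=> [p Hp]; exists (Imp p (Bot _)) => e; rewrite -Hp. Qed.

Lemma mdef_and W (P Q : (W -> univ M) -> Prop) : mdef P -> mdef Q -> mdef (fun e => P e /\ Q e).
Proof.
move=> [p Hp] [q Hq]; apply: mdef_ext (mdef_defb (defb_and (defb_fm p) (defb_fm q))) => e.
by rewrite Hp Hq.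
Qed.

Lemma mdef_ren V W (f : V -> W) (P : (V -> univ M) -> Prop) : mdef P -> mdef (fun e => P (e \o f)).
Proof. by move=> [p Hp]; exists (ren f p) => e; rewrite holds_ren Hp. Qed.

Lemma mdef_all V (W : countType) (P : (V + W -> univ M) -> Prop) : mdef P -> mdef (fun e => forall w, P (sume e w)).
Proof.
move=> [p Hp]; apply: mdef_ext (mdef_defb (defb_all (defb_fm p))) => e.
by split=> H w; apply/Hp.
Qed.

Lemma mdef_allfin V (T : finType) (P : T -> (V -> univ M) -> Prop) : (forall x, mdef (P x)) -> mdef (fun e => forall x, P x e).
Proof.
move=> H; have [f Hf] := choice H.
apply: mdef_ext (mdef_defb (@defb_allfin _ _ _ _ (fun x N e => holds e (f x)) (fun x => defb_fm (f x)))) => e.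
by split=> K x; apply/Hf.
Qed.

Lemma mdef_exseq V (T : Type) (P : T -> (V -> univ M) -> Prop) (l : seq T) : (forall x, mdef (P x)) ->
  mdef (fun e => exists x, List.In x l /\ P x e).
Proof.
move=> H; have [f Hf] := choice H.
apply: mdef_ext (mdef_defb (@defb_exseq _ _ _ _ (fun x N e => holds e (f x)) l (fun x _ => defb_fm (f x)))) => e.
by split=> -[x [xl K]]; exists x; split=> //; apply/Hf.
Qed.

Lemma mdef_sat V (s : V -> unit) (p : @formula L V s) :
  mdef (fun e : V -> univ M => sat p (fun v => ucst (s v) (e v))).
Proof.
exists (fsub (fun v => @vcast _ ar V v (s v)) p) => e.
apply: iff_trans (sat_fsub _ _ _) _; rewrite (_ : (fun v => _) = (fun v => ucst (s v) (e v))) //.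
by apply: functional_extensionality_dep => v; rewrite teval_vcast; case: (s v).
Qed.

Lemma mdef_sameE (E : eqdef M) : mdef (fun e : 'I_(earity E) + 'I_(earity E) -> univ M =>
  @mk (inr E) (e \o inl) = @mk (inr E) (e \o inr)).
Proof.
apply: mdef_ext (mdef_sat (efml E)) => e.
set a : assignment M (@edom L M E) := fun i => ucst (edom i) (e (inl i)).
set b : assignment M (@edom L M E) := fun i => ucst (edom i) (e (inr i)).
have -> : (fun v => ucst (juxt (@edom L M E) (@edom L M E) v) (e v)) = ajuxt a b.
  by apply: functional_extensionality_dep => -[].
split=> [H|/(congr1 (@sval _ _)) /= H].
  apply: quotient_eq => /=; apply: funext => c; apply/propext.
  split; [exact: efml_trans (efml_sym H)|exact: efml_trans H].
have : eclass a b by rewrite [eclass a]H; apply: efml_refl.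
by [].
Qed.

Lemma translate_term V (s : V -> sort (sig_eq M)) u (t : @term (sig_eq M) V s u) :
  exists t' : 'I_(fibn u) -> Tm L (rep s), forall e : rep s -> univ M, teval (M := C) (rass e) t = mk (fun i => ev e (t' i)).
Proof.
elim: t => [v|f args IH]; first by exists (fun i => @Var L _ (fun _ => tt) (existT _ v i)).
have H : forall i : 'I_(@farity (sig_eq M) f), {t' : 'I_(fibn (@fdom (sig_eq M) f i)) -> Tm L (rep s) |
    forall e : rep s -> univ M, teval (M := C) (rass e) (args i) = mk (fun i => ev e (t' i))}.
  by move=> i; apply: cid; apply: IH.
case: f args IH H => [g|E] args IH H.
  exists (fun _ => @App L _ (fun _ => tt) g (fun i => sval (H i) ord0)) => e.
  rewrite /= /ev /=; congr (@finterp L M g); apply: functional_extensionality_dep => i.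
  exact: (svalP (H i) e).
exists (fun i => sval (H i) ord0) => e; apply: quotient_eq; rewrite /=; congr (eclass _).
apply: functional_extensionality_dep => i; exact: (svalP (H i) e).
Qed.

Lemma mdef_same V u (t t' : 'I_(fibn u) -> Tm L V) :
  mdef (fun e : V -> univ M => mk (fun i => ev e (t i)) = mk (fun i => ev e (t' i))).
Proof.
case: u t t' => [[]|E] t t'.
  by exists (@Equ L V (fun _ => tt) tt (t ord0) (t' ord0)).
have [p Hp] := mdef_sameE E.
exists (inst (fun o => match o with inl i => t i | inr i => t' i end) p) => e.
by rewrite holds_inst Hp.
Qed.

(** Quantifying over an imaginary sort amounts to quantifying over representing tuples, because [mk]
    is onto. *)
Lemma translate V (s : V -> sort (sig_eq M)) (p : @formula (sig_eq M) V s) :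
  mdef (fun e : rep s -> univ M => sat (M := C) p (rass e)).
Proof.
elim: p => {V s} [V s|V s u a b|V s []|V s p IHp q IHq|V s u p [p' Hp]].
- by exists (Bot _).
- have [a' Ha] := translate_term a; have [b' Hb] := translate_term b.
  by apply: mdef_ext (mdef_same a' b') => e; rewrite /= Ha Hb.
- exact: mdef_imp IHp IHq.
- pose f (o : rep (ext s u)) : rep s + 'I_(fibn u) :=
    match o with existT v i => match v return 'I_(fibn (ext s u v)) -> rep s + 'I_(fibn u) with
      | Some v => fun i => inl (existT _ v i) | None => fun i => inr i end i end.
  apply: mdef_ext (mdef_all (mdef_ren f (ex_intro _ p' (fun e => iff_refl (holds e p'))))) => e.
  have E w : holds (sume e w \o f) p' <-> sat (M := C) p (aext (M := C) (rass e) (mk w)).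
    rewrite Hp (_ : rass _ = aext (M := C) (rass e) (mk w)) //.
    by apply: functional_extensionality_dep => -[].
  split=> [H a|H w]; last exact/E.
  by have [w <-] := mk_surj a; apply/E.
Qed.

End Imaginaries.

(** Every instance of bounded rank has a bound. The rank of [D] exceeds the supremum of these bounds
    over all instances, so a step taken at that ordinal only meets instances of unbounded rank. *)
Lemma thorn_step (L : signature) (C : structure L) (X Y Z : Type) (x : X -> sort L) (y : Y -> sort L)
  (z : Z -> sort L) (Delta : seq (formula (juxt x y))) (Pi : seq (formula (juxt y z))) m (D : assignment C x -> Prop) :
  (forall alpha, thorn_ge Delta Pi m alpha D) ->
  exists delta pi (c : assignment C z), [/\ List.In delta Delta, List.In pi Pi,
    infinitely_many (fun a : assignment C y => sat pi (ajuxt a c) /\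
      forall alpha, thorn_ge Delta Pi m alpha (fun b => D b /\ sat delta (ajuxt b a)))
    & m_inconsistent m delta pi c].
Proof.
move=> big.
have /choice [r Hr] : forall q : formula (juxt x y) * assignment C y, exists alpha,
    thorn_ge Delta Pi m alpha (fun b => D b /\ sat q.1 (ajuxt b q.2)) ->
    forall alpha', thorn_ge Delta Pi m alpha' (fun b => D b /\ sat q.1 (ajuxt b q.2)).
  move=> q; case: (pselect (exists alpha, ~ thorn_ge Delta Pi m alpha (fun b => D b /\ sat q.1 (ajuxt b q.2)))) => [[alpha N]|N].
    by exists alpha.
  by exists OZero => _ alpha'; apply: contrapT => N'; apply: N; exists alpha'.
(* [None] merely makes the index type of the supremum nonempty. *)
pose f (o : option (formula (juxt x y) * assignment C y)) := if o is Some q then r q else OZero.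
have [delta [pi [c [H1 H2 H3 H4]]]] := big (OSucc (OLim None f)).
exists delta, pi, c; split=> // l; have [a [[Ha Ta] al]] := H3 l; exists a; split=> //; split=> //.
exact: (Hr (delta, a) (Ta (Some (delta, a)))).
Qed.

(** * From an unbounded thorn-rank to a pattern *)

Section ThornPattern.

Variables (fs : Type) (ar : fs -> nat).
Let L := sig1 ar.
Variable en : nat -> Fm L (option nat).
Hypothesis en_surj : forall p, exists n, en n = p.
Variables (M : structure L) (x0 : univ M).
Hypothesis satM : countably_saturated M.
Notation C := (struct_eq M).
Variables (nx ny : nat) (Z : Type) (x : 'I_nx -> sort (sig_eq M)) (y : 'I_ny -> sort (sig_eq M)) (z : Z -> sort (sig_eq M)).
Variables (Delta : seq (formula (juxt x y))) (Pi : seq (formula (juxt y z))) (m : nat).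

Notation X := {v : 'I_nx & 'I_(fibn (x v))}.
Notation J := {v : 'I_ny & 'I_(fibn (y v))}.
Notation tree := (GenTree.tree (leaf J)).

(** The type [Z] of parameter variables is arbitrary, but finitely many formulas mention finitely
    many of them, so that parameters can be taken to be sequences. *)
Lemma index_support (I : Type) (T : Type) (F : T -> Fm L (J + I)) (l : seq T) :
  exists f : I -> nat, forall c : I -> univ M, exists c' : nat -> univ M, forall t, List.In t l ->
    forall a, holds (sume a c) (F t) <-> holds (sume a (c' \o f)) (F t).
Proof.
have [s Hs] : exists s : seq I, forall t, List.In t l -> forall a c c', (forall i, List.In i s -> c i = c' i) ->
    holds (M := M) (sume a c) (F t) <-> holds (sume a c') (F t).
  elim: l => [|t l [s Hs]]; first by exists [::].
  have [s' Hs'] := formula_support (F t).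
  pose pick (o : J + I) := if o is inr i then Some i else None.
  exists (pmap pick s' ++ s) => t' /= [<-|/Hs H] a c c' E.
    apply: Hs' => -[j|i] //= Hi; apply: E; apply/List.in_app_iff; left.
    elim: s' Hi => [|[j|i'] s' IH] //= [] //; [by case=> ->; left|by right; apply: IH].
  by apply: H => i Hi; apply: E; apply/List.in_app_iff; right.
exists (fun i => @index {classic I} i s) => c; exists (fun n => nth x0 (map c s) n) => t Ht a.
apply: Hs Ht _ _ _ _ => i /(@In_mem {classic I}) Hi /=.
by rewrite (nth_map (i : {classic I})) ?index_mem // nth_index.
Qed.

Definition sat_delta delta (b : X -> univ M) (a : J -> univ M) : Prop :=
  sat (M := C) delta (ajuxt (rass (s := x) b) (rass (s := y) a)).

Lemma mdef_delta delta : mdef (fun e : X + J -> univ M => sat_delta delta (e \o inl) (e \o inr)).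
Proof.
pose f (o : rep (juxt x y)) : X + J :=
  match o with existT v i => match v return 'I_(fibn (juxt x y v)) -> X + J with
    | inl v => fun i => inl (existT _ v i) | inr v => fun i => inr (existT _ v i) end i end.
apply: mdef_ext (mdef_ren f (translate x0 delta)) => e.
rewrite /sat_delta; set g := rass _; set g' := ajuxt _ _; suff -> : g = g' by [].
by apply: functional_extensionality_dep => -[].
Qed.

Lemma mdef_pi pi : exists p : Fm L (J + rep z), forall (a : J -> univ M) c,
  holds (sume a c) p <-> sat (M := C) pi (ajuxt (rass (s := y) a) (rass (s := z) c)).
Proof.
pose f (o : rep (juxt y z)) : J + rep z :=
  match o with existT v i => match v return 'I_(fibn (juxt y z v)) -> J + rep z with
    | inl v => fun i => inl (existT _ v i) | inr v => fun i => inr (existT _ v i) end i end.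
have [p Hp] := mdef_ren f (translate x0 pi); exists p => a c; rewrite Hp.
set g := rass _; set g' := ajuxt _ _; suff -> : g = g' by [].
by apply: functional_extensionality_dep => -[].
Qed.

Definition same_tuple (a a' : J -> univ M) : Prop := rass (s := y) a = rass (s := y) a'.

Lemma mdef_same_tuple : mdef (fun e : J + J -> univ M => same_tuple (e \o inl) (e \o inr)).
Proof.
have H v : mdef (fun e : J + J -> univ M => rass (s := y) (e \o inl) v = rass (s := y) (e \o inr) v).
  pose t i := @Var L (J + J) (fun _ => tt) (inl (existT _ v i)).
  pose t' i := @Var L (J + J) (fun _ => tt) (inr (existT _ v i)).
  exact: (@mdef_same _ _ M _ (y v) t t').
apply: mdef_ext (mdef_allfin x0 H) => e; split=> [K|-> //].
exact: functional_extensionality_dep.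
Qed.

Variables (Pf : formula (juxt y z) -> Fm L (J + rep z)) (fz : rep z -> nat).
Hypothesis PfE : forall pi (a : J -> univ M) c,
  holds (sume a c) (Pf pi) <-> sat (M := C) pi (ajuxt (rass (s := y) a) (rass (s := z) c)).
Hypothesis fzP : forall c : rep z -> univ M, exists c' : nat -> univ M, forall t, List.In t Pi ->
    forall a, holds (sume a c) (Pf t) <-> holds (sume a (c' \o fz)) (Pf t).

(** The inconsistency of the instances, restated for representing tuples: distinct elements become
    tuples that are not [same_tuple]. It is first-order in [c] because [m] is fixed. *)
Definition incons delta pi (c : nat -> univ M) : Prop :=
  forall (b : X -> univ M) (a : 'I_m * J -> univ M),
    (forall ij : 'I_m * 'I_m, ij.1 < ij.2 -> ~ same_tuple (fun v => a (ij.1, v)) (fun v => a (ij.2, v))) ->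
    (forall i, holds (sume (fun v => a (i, v)) (c \o fz)) (Pf pi)) ->
    ~ (forall i, sat_delta delta b (fun v => a (i, v))).

(** The inconsistency is made part of the relation, so that the bound on the number of classes holds
    for all [b] and [c] and not only along a pattern. *)
Definition chi_rel (b : X -> univ M) (a : J -> univ M) (c : nat -> univ M) : Prop :=
  exists delta, List.In delta Delta /\ exists pi, List.In pi Pi /\
    [/\ sat_delta delta b a, holds (sume a (c \o fz)) (Pf pi) & incons delta pi c].

Lemma mdef_incons delta pi : mdef (fun c : nat -> univ M => incons delta pi c).
Proof.
apply: (@mdef_all _ _ _ x0 nat X (fun e => forall a : 'I_m * J -> univ M,
    (forall ij : 'I_m * 'I_m, ij.1 < ij.2 -> ~ same_tuple (fun v => a (ij.1, v)) (fun v => a (ij.2, v))) ->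
    (forall i, holds (sume (fun v => a (i, v)) (e \o inl \o fz)) (Pf pi)) ->
    ~ (forall i, sat_delta delta (e \o inr) (fun v => a (i, v))))).
apply: (@mdef_all _ _ _ x0 (nat + X) ('I_m * J)%type (fun e => 
    (forall ij : 'I_m * 'I_m, ij.1 < ij.2 -> ~ same_tuple (fun v => e (inr (ij.1, v))) (fun v => e (inr (ij.2, v)))) ->
    (forall i, holds (sume (fun v => e (inr (i, v))) (fun o => e (inl (inl (fz o))))) (Pf pi)) ->
    ~ (forall i, sat_delta delta (fun o => e (inl (inr o))) (fun v => e (inr (i, v)))))).
apply: mdef_imp; last apply: mdef_imp; last apply: mdef_not.
- apply: (mdef_allfin x0 (P := fun (ij : 'I_m * 'I_m) e => ij.1 < ij.2 -> ~ same_tuple (fun v => e (inr (ij.1, v))) (fun v => e (inr (ij.2, v))))) => ij.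
  case: (ltnP ij.1 ij.2) => _; last by exists (Imp (Bot _) (Bot _)) => e; split=> [_ //|_]; exact: id.
  apply: mdef_ext (mdef_not (mdef_ren (fun o : J + J => match o with inl v => inr (ij.1, v) | inr v => inr (ij.2, v) end : nat + X + 'I_m * J) mdef_same_tuple)) => e.
  by split=> [H _|/(_ isT)].
- apply: (mdef_allfin x0 (P := fun i e => holds (sume (fun v => e (inr (i, v))) (fun o => e (inl (inl (fz o))))) (Pf pi))) => i.
  exists (ren (fun o => match o with inl v => inr (i, v) | inr o => inl (inl (fz o)) end) (Pf pi)) => e.
  by rewrite holds_ren; apply: holds_ext => -[].
- apply: (mdef_allfin x0 (P := fun i e => sat_delta delta (fun o => e (inl (inr o))) (fun v => e (inr (i, v))))) => i.
  exact: (mdef_ren (fun o : X + J => match o with inl v => inl (inr v) | inr v => inr (i, v) end : nat + X + 'I_m * J) (mdef_delta delta)).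
Qed.

Lemma mdef_chi : mdef (fun e : X + J + nat -> univ M => chi_rel (e \o inl \o inl) (e \o inl \o inr) (e \o inr)).
Proof.
apply: (mdef_exseq x0 (P := fun delta e => exists pi, List.In pi Pi /\
    [/\ sat_delta delta (e \o inl \o inl) (e \o inl \o inr), holds (sume (e \o inl \o inr) (e \o inr \o fz)) (Pf pi) & incons delta pi (e \o inr)])) => delta.
apply: (mdef_exseq x0 (P := fun pi e => 
    [/\ sat_delta delta (e \o inl \o inl) (e \o inl \o inr), holds (sume (e \o inl \o inr) (e \o inr \o fz)) (Pf pi) & incons delta pi (e \o inr)])) => pi.
have H1 := mdef_ren (@inl (X + J) nat) (mdef_delta delta).
have H2 : mdef (fun e : X + J + nat -> univ M => holds (sume (e \o inl \o inr) (e \o inr \o fz)) (Pf pi)).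
  exists (ren (fun o => match o with inl v => inl (inr v) | inr o => inr (fz o) end) (Pf pi)) => e.
  by rewrite holds_ren; apply: holds_ext => -[].
have H3 := mdef_ren (@inr (X + J) nat) (mdef_incons delta pi).
by apply: mdef_ext (mdef_and x0 H1 (mdef_and x0 H2 H3)) => e; split=> [[? [? ?]]|[? ? ?]].
Qed.

Definition max_classes : nat := m * (size Delta * size Pi).

(** Pigeonhole: more than [m] of the tuples share the same pair of formulas, and [m] pairwise
    inequivalent ones among them would contradict [incons]. *)
Lemma chi_few b c (f : nat -> J -> univ M) : (forall i, i <= max_classes -> chi_rel b (f i) c) ->
  exists i j, [/\ i < j, j <= max_classes & same_tuple (f i) (f j)].
Proof.
move=> H; apply: contrapT => N.
have nthIn (T : Type) (t0 : T) (l : seq T) t : List.In t l -> exists i : 'I_(size l), nth t0 l i = t.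
  elim: l => //= u l IH [->|/IH [i Hi]]; first by exists ord0.
  by exists (lift ord0 i).
have /choice [F HF] : forall i : 'I_max_classes.+1, exists dp : 'I_(size Delta) * 'I_(size Pi),
    [/\ sat_delta (nth (Bot _) Delta dp.1) b (f i), holds (sume (f i) (c \o fz)) (Pf (nth (Bot _) Pi dp.2)) &
      incons (nth (Bot _) Delta dp.1) (nth (Bot _) Pi dp.2) c].
  move=> i; have [|delta [/(nthIn _ (Bot _)) [j <-] [pi [/(nthIn _ (Bot _)) [j' <-] K]]]] := H i.
    by rewrite -ltnS.
  by exists (j, j').
have [dp Hdp] : exists dp, m < #|[pred i | F i == dp]|.
  apply: contrapT => N'.
  have : \sum_(dp : 'I_(size Delta) * 'I_(size Pi)) #|[pred i | F i == dp]| <= \sum_(dp : 'I_(size Delta) * 'I_(size Pi)) m.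
    apply: leq_sum => dp _; case: (leqP #|[pred i | F i == dp]| m) => // Hm.
    by case: N'; exists dp.
  rewrite sum_nat_const card_prod !card_ord mulnC -/max_classes.
  have -> : \sum_(dp : 'I_(size Delta) * 'I_(size Pi)) #|[pred i | F i == dp]| = max_classes.+1.
    rewrite -[RHS]card_ord -sum1_card (partition_big F predT) //=.
    by apply: eq_bigr => dp _; rewrite sum1_card; apply: eq_card.
  by rewrite ltnn.
pose g (i : 'I_m) : 'I_max_classes.+1 := nth ord0 (enum [pred i | F i == dp]) i.
have gsize (i : 'I_m) : i < size (enum [pred i | F i == dp]) by rewrite -cardE; apply: leq_trans (ltnW Hdp).
have gF i : F (g i) = dp.
  by apply/eqP; have := mem_nth ord0 (gsize i); rewrite mem_enum inE.
have g_inj (i j : 'I_m) : i < j -> g i != g j.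
  by move=> ij; rewrite nth_uniq ?enum_uniq // neq_ltn ij.
(* The member of index [m] exists even when [m = 0]; it is what gives access to [incons] for the
   pair [dp]. *)
have Fi0 : F (nth ord0 (enum [pred i | F i == dp]) m) = dp.
  have Hs : m < size (enum [pred i | F i == dp]) by rewrite -cardE.
  by apply/eqP; have := mem_nth ord0 Hs; rewrite mem_enum inE.
have [_ _] := HF (nth ord0 (enum [pred i | F i == dp]) m); rewrite Fi0.
move=> /(_ b (fun o => f (g o.1) o.2)); apply=> [[i j] /= ij S|i|i].
- apply: N; case: (ltngtP (g i) (g j)) => [h|h|/val_inj E].
  + by exists (g i), (g j); split=> //; rewrite -ltnS.
  + by exists (g j), (g i); split=> //; rewrite -ltnS.
  + by have := g_inj i j ij; rewrite E eqxx.
- by have [_ + _] := HF (g i); rewrite gF.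
- by have [+ _ _] := HF (g i); rewrite gF.
Qed.

Definition chi_fm : Fm L (X + J + nat) := sval (cid mdef_chi).
Definition same_fm : Fm L (J + J) := sval (cid mdef_same_tuple).

Lemma chi_fmE b a c : holds (M := M) (sume (sume b a) c) chi_fm <-> chi_rel b a c.
Proof. by rewrite /chi_fm; case: cid => p Hp /=; rewrite Hp. Qed.

Lemma same_fmE a a' : holds (M := M) (sume a a') same_fm <-> same_tuple a a'.
Proof. by rewrite /same_fm; case: cid => p Hp /=; rewrite Hp. Qed.

Variable D0 : assignment C x -> Prop.
Hypothesis big0 : forall alpha, thorn_ge Delta Pi m alpha D0.

Lemma walk (wit : (nat -> univ M) -> nat -> univ M) n i : exists (lam : leaf J -> univ M) (D : assignment C x -> Prop),
  [/\ forall alpha, thorn_ge Delta Pi m alpha D,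
      forall i', i' < i -> forall b, D (rass (s := x) b) -> chi_rel b (fun v => lam (aleaf i' v)) (fun j => lam (cleaf J i' j))
    & forall i', i' < i -> forall j, j < n -> forall g : {ffun J -> tree}, unpickle j = Some g ->
        (forall v, tall (@lev J i') (g v)) -> ~ same_tuple (fun v => seval (None : leaf J) wit lam (g v)) (fun v => lam (aleaf i' v))].
Proof.
elim: i => [|i [lam [D [bigD chiD avD]]]]; first by exists (fun _ => x0), D0.
have [delta [pi [c [Hd Hp inf inc]]]] := thorn_step bigD.
have [c0 Hc0] := @rass_surj _ _ M _ z c.
have [c' Hc'] := fzP c0.
have PfE' a : holds (sume a (c' \o fz)) (Pf pi) <-> sat (M := C) pi (ajuxt (rass (s := y) a) c).
  by rewrite -Hc' // PfE Hc0.
have inc' : incons delta pi c'.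
  move=> b a Ha Hpi Hda; apply: (inc (fun j => rass (s := y) (fun v => a (j, v)))).
  - move=> j j' E; apply: val_inj; case: (ltngtP j j') => // jj'; [case: (Ha (j, j') jj')|case: (Ha (j', j) jj')];
      rewrite /same_tuple //=; exact: esym.
  - by move=> j; apply/PfE'; apply: Hpi.
  - by exists (rass (s := x) b) => j; apply: Hda.
pose lam' (l : leaf J) := if l is Some (inr (i', inl j)) then if i' == i then c' j else lam l else lam l.
(* The tuple to avoid with code [j]. It is evaluated with the parameters of step [i] in place, since
   terms of level [i] may use them. *)
pose F j : assignment C y := if unpickle j is Some g then rass (s := y) (fun v => seval (None : leaf J) wit lam' ((g : {ffun J -> tree}) v))
  else rass (s := y) (fun _ => x0).
have [a [[Ha bigD'] al]] := inf [seq F j | j <- iota 0 n].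
have [a0 Ha0] := @rass_surj _ _ M _ y a.
pose lam2 (l : leaf J) := if l is Some (inr (i', inr v)) then if i' == i then a0 v else lam' l else lam' l.
have lam2E i' l : i' < i -> lev i' l -> lam2 l = lam l.
  case: l => [[j|[i2 [j|v]]]|] //= ii' li.
    by rewrite ltn_eqF // (leq_ltn_trans li).
  by rewrite ltn_eqF // (ltn_trans li).
have lam2a i' v : i' < i -> lam2 (aleaf i' v) = lam (aleaf i' v) by move=> ii'; rewrite /= ltn_eqF.
have lam2c i' j : i' < i -> lam2 (cleaf J i' j) = lam (cleaf J i' j) by move=> ii'; rewrite /= ltn_eqF.
have lam2ai : (fun v => lam2 (aleaf i v)) = a0 by apply: funext => v; rewrite /= eqxx.
have lam2ci : (fun j => lam2 (cleaf J i j)) = c' by apply: funext => j; rewrite /= eqxx.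
exists lam2, (fun b => D b /\ sat delta (ajuxt b a)); split=> //.
- move=> i'; rewrite ltnS leq_eqVlt => /orP[/eqP -> b [_ Hb]|ii' b [Db _]].
    rewrite lam2ai lam2ci; exists delta; split=> //; exists pi; split=> //; split=> //.
      by rewrite /sat_delta Ha0.
    by apply/PfE'; rewrite Ha0.
  rewrite (_ : (fun v => _) = (fun v => lam (aleaf i' v))); last by apply: funext => v; apply: lam2a.
  rewrite (_ : (fun j => _) = (fun j => lam (cleaf J i' j))); last by apply: funext => v; apply: lam2c.
  exact: chiD.
- move=> i'; rewrite ltnS leq_eqVlt => /orP[/eqP -> j jn g gj Hg|ii' j jn g gj Hg].
    rewrite lam2ai /same_tuple Ha0 => E; apply: al; apply/List.in_map_iff; exists j; split; last first.
      by apply/In_mem; rewrite mem_iota.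
    rewrite /F gj -E; congr rass; apply: funext => v; apply: seval_eq => //.
    apply: tall_impl (Hg v) => -[[j'|[i2 [j'|v']]]|] //= li.
    by rewrite ltn_eqF.
  have := avD i' ii' j jn g gj Hg.
  rewrite (_ : (fun v => lam2 (aleaf i' v)) = (fun v => lam (aleaf i' v))); last by apply: funext => v; apply: lam2a.
  rewrite (_ : (fun v => seval _ wit lam2 (g v)) = (fun v => seval (None : leaf J) wit lam (g v))) //.
  apply: funext => v; apply: seval_eq => //.
  by apply: tall_impl (Hg v) => l; apply: lam2E.
Qed.

(** The walks of length [n] that avoid [n] tuples serve as approximations for [pattern_realize]. *)
Lemma pattern_exists : exists (nu : nat -> univ M) (b : X -> univ M) tau, pattern en chi_fm same_fm nu b tau.
Proof.
have [wit Hwit] := witness_exists en x0.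
have /choice [F HF] : forall n, exists bl : (X -> univ M) * (leaf J -> univ M),
    (forall i', i' < n -> chi_rel bl.1 (fun v => bl.2 (aleaf i' v)) (fun j => bl.2 (cleaf J i' j))) /\
    (forall i', i' < n -> forall j, j < n -> forall g : {ffun J -> tree}, unpickle j = Some g ->
        (forall v, tall (@lev J i') (g v)) -> ~ same_tuple (fun v => seval (None : leaf J) wit bl.2 (g v)) (fun v => bl.2 (aleaf i' v))).
  move=> n; have [lam [D [bigD chiD avD]]] := walk wit n n.
  have [b Db] := bigD OZero; have [b0 Hb0] := @rass_surj _ _ M _ x b.
  by exists (b0, lam); split=> [i' /chiD|] //; apply; rewrite Hb0.
pose e (v : void) : univ M := match v with end.
pose A n : X + tree -> univ M := sume (F n).1 (seval (None : leaf J) wit (F n).2).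
have [|||w [_ Pw]] := @pattern_realize _ _ en M x0 satM X J chi_fm same_fm void e A; last by do 3!eexists; exact: Pw.
- by move=> n; apply: seval_skolem.
- move=> i; exists i.+1 => n /(proj1 (HF n) i) H; apply/chi_fmE; exact: H.
- move=> i g Hg; pose fg : {ffun J -> tree} := [ffun v => g v].
  exists (maxn i.+1 (pickle fg).+1) => n; rewrite geq_max => /andP[ni nj] /same_fmE S.
  apply: (proj2 (HF n) i ni _ nj fg (pickleK _)) => [v|]; first by rewrite ffunE.
  by rewrite (_ : (fun v => _) = (fun v => seval (None : leaf J) wit (F n).2 (g v))) //; apply: funext => v; rewrite ffunE.
Qed.

End ThornPattern.

Lemma thorn_pattern (fs : Type) (ar : fs -> nat) (en : nat -> Fm (sig1 ar) (option nat)) (M : structure (sig1 ar)) (x0 : univ M) :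
  countably_saturated M -> ~ thorn_ranks_defined (struct_eq M) ->
  exists (X J : countType) (chi : Fm (sig1 ar) (X + J + nat)) (E : Fm (sig1 ar) (J + J)) (m : nat),
    [/\ exists nu b tau, @pattern _ _ en M X J chi E nu b tau,
        forall a a' : J -> univ M, holds (sume a a') E -> holds (sume a' a) E,
        forall a a' a2 : J -> univ M, holds (sume a a') E -> holds (sume a' a2) E -> holds (sume a a2) E
      & forall b c (f : nat -> J -> univ M), (forall i, i <= m -> holds (sume (sume b (f i)) c) chi) ->
          exists i j, [/\ i < j, j <= m & holds (sume (f i) (f j)) E]].
Proof.
move=> satM ND; apply: contrapT => N; apply: ND => nx ny Z x y z Delta Pi m W w phi e.
apply: contrapT => N'; apply: N.
have /choice [Pf PfE] := mdef_pi x0 (y := y) (z := z).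
have [fz fzP] := index_support x0 (I := rep z) Pf Pi.
exists {v : 'I_nx & 'I_(fibn (x v))}, {v : 'I_ny & 'I_(fibn (y v))}, (chi_fm x0 Delta Pi m Pf fz), (same_fm x0 y), (max_classes Delta Pi m); split.
- apply: (pattern_exists en x0 satM PfE fzP (D0 := fun b => sat phi (ajuxt b e))) => alpha.
  by apply: contrapT => Na; apply: N'; exists alpha.
- by move=> a a' /same_fmE H; apply/same_fmE; exact: esym.
- by move=> a a' a2 /same_fmE H /same_fmE H'; apply/same_fmE; exact: etrans H H'.
- move=> b c f H; have [|i [j [ij jm S]]] := @chi_few _ _ _ _ _ _ x y z Delta Pi m Pf fz b c f.
    by move=> i /H /chi_fmE.
  by exists i, j; split=> //; apply/same_fmE.
Qed.

Lemma thorn_ge_mono (L : signature) (C : structure L) (X Y Z : Type) (x : X -> sort L) (y : Y -> sort L)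
  (z : Z -> sort L) (Delta : seq (formula (juxt x y))) (Pi : seq (formula (juxt y z))) m alpha
  (D D' : assignment C x -> Prop) : (forall b, D b -> D' b) ->
  thorn_ge Delta Pi m alpha D -> thorn_ge Delta Pi m alpha D'.
Proof.
elim: alpha D D' => [|alpha IH|J j0 f IH] D D' DD' /=.
- by move=> [b /DD' Hb]; exists b.
- move=> [delta [pi [c [H1 H2 H3 H4]]]]; exists delta, pi, c; split=> // l.
  have [a [[Ha Ta] al]] := H3 l; exists a; split=> //; split=> //.
  by apply: IH Ta => b [/DD' Db Hb].
- by move=> H i; apply: IH DD' (H i).
Qed.

(** * Formulas of the language inside the imaginary structure *)

Section LiftToImaginaries.

Variables (L : signature) (M : structure L).
Notation C := (struct_eq M).

Fixpoint iterm V (s0 : V -> sort L) W (s : W -> sort (sig_eq M)) (f : forall v, @term (sig_eq M) W s (inl (s0 v)))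
  u (t : term s0 u) : @term (sig_eq M) W s (inl u) :=
  match t in term _ u return @term (sig_eq M) W s (inl u) with
  | Var v => f v
  | App g args => @App (sig_eq M) W s (inl g) (fun i => iterm f (args i))
  end.

Definition iext V (s0 : V -> sort L) W (s : W -> sort (sig_eq M)) (f : forall v, @term (sig_eq M) W s (inl (s0 v)))
  (u : sort L) (o : option V) : @term (sig_eq M) (option W) (ext s (inl u)) (inl (ext s0 u o)) :=
  match o return @term (sig_eq M) (option W) (ext s (inl u)) (inl (ext s0 u o)) with
  | Some v => tsub (fun w => @Var (sig_eq M) _ (ext s (inl u)) (Some w)) (f v)
  | None => @Var (sig_eq M) _ (ext s (inl u)) None
  end.

Fixpoint iform V (s0 : V -> sort L) (p : formula s0) W (s : W -> sort (sig_eq M))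
  (f : forall v, @term (sig_eq M) W s (inl (s0 v))) : @formula (sig_eq M) W s :=
  match p with
  | Bot => Bot s
  | Equ u a b => @Equ (sig_eq M) W s (inl u) (iterm f a) (iterm f b)
  | Rel r args => @Rel (sig_eq M) W s r (fun i => iterm f (args i))
  | Imp p q => Imp (iform p f) (iform q f)
  | All u p => @All (sig_eq M) W s (inl u) (iform p (iext f u))
  end.

Lemma teval_iterm V (s0 : V -> sort L) W (s : W -> sort (sig_eq M)) (f : forall v, @term (sig_eq M) W s (inl (s0 v)))
  u (t : term s0 u) (e : assignment C s) :
  teval (M := C) e (iterm f t) = @teval L M V s0 (fun v => teval (M := C) e (f v)) u t.
Proof.
elim: t => //= g args IH; congr (@finterp L M g).
by apply: functional_extensionality_dep => i; apply: IH.
Qed.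

Lemma sat_iform V (s0 : V -> sort L) (p : formula s0) W (s : W -> sort (sig_eq M))
  (f : forall v, @term (sig_eq M) W s (inl (s0 v))) (e : assignment C s) :
  sat (M := C) (iform p f) e <-> sat (M := M) p (fun v => teval (M := C) e (f v)).
Proof.
elim: p W s f e => {V s0} [V s0|V s0 u a b|V s0 r args|V s0 p IHp q IHq|V s0 u p IHp] W s f e //=.
- by rewrite !teval_iterm.
- suff -> : (fun i => teval (M := C) e (iterm f (args i))) = (fun i => @teval L M V s0 (fun v => teval (M := C) e (f v)) _ (args i)) by [].
  by apply: functional_extensionality_dep => i; rewrite teval_iterm.
- by rewrite IHp IHq.
- have E (a : M u) : (fun o => teval (M := C) (@aext _ C _ _ e (inl u) a) (iext f u o)) = @aext L M V s0 (fun v => teval (M := C) e (f v)) u a.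
    by apply: functional_extensionality_dep => -[v|] //=; rewrite teval_tsub.
  by split=> H a; have := H a; rewrite IHp E.
Qed.

End LiftToImaginaries.

Section ImaginaryBlocks.

Variables (fs : Type) (ar : fs -> nat).
Variable M : structure (sig1 ar).
Notation C := (struct_eq M).
Notation home := (fun _ => inl tt : sort (sig_eq M)).

Lemma exists_block V (s : V -> sort (sig_eq M)) n (p : @formula (sig_eq M) (V + 'I_n) (juxt s home)) :
  exists q : @formula (sig_eq M) V s, forall e : assignment C s, sat (M := C) q e <->
    exists w : 'I_n -> M tt, sat (M := C) p (ajuxt (M := C) (t := home) e w).
Proof.
elim: n p => [|n IH] p.
  pose F (o : V + 'I_0) : @term (sig_eq M) V s (juxt s home o) :=
    match o return @term (sig_eq M) V s (juxt s home o) with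
    | inl v => @Var (sig_eq M) V s v | inr i => match notF (ltn_ord i) with end end.
  have FE (e : assignment C s) w : (fun o => teval (M := C) e (F o)) = ajuxt (M := C) (t := home) e w.
    by apply: functional_extensionality_dep => -[v|i] //; case: (notF (ltn_ord i)).
  exists (fsub F p) => e; split=> [/sat_fsub H|[w H]]; last by apply/sat_fsub; rewrite (FE e w).
  have w : 'I_0 -> M tt by move=> i; have := ltn_ord i.
  by exists w; rewrite -FE.
pose F (o : V + 'I_n.+1) : @term (sig_eq M) (option (V + 'I_n)) (ext (juxt s home) (inl tt)) (juxt s home o) :=
  match o return @term (sig_eq M) _ (ext (juxt s home) (inl tt)) (juxt s home o) with
  | inl v => @Var (sig_eq M) _ (ext (juxt s home) (inl tt)) (Some (inl v))
  | inr i => match unlift ord_max i with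
    | Some j => @Var (sig_eq M) _ (ext (juxt s home) (inl tt)) (Some (inr j))
    | None => @Var (sig_eq M) _ (ext (juxt s home) (inl tt)) None end end.
have [q Hq] := IH (@Ex (sig_eq M) _ _ (inl tt) (fsub F p)).
have FE (e : assignment C s) w a : (fun o => teval (M := C) (@aext _ C _ _ (ajuxt (M := C) (t := home) e w) (inl tt) a) (F o)) =
    ajuxt (M := C) (t := home) e (fun i => if unlift ord_max i is Some j then w j else a).
  by apply: functional_extensionality_dep => -[v|i] //=; case: (unlift ord_max i).
exists q => e; rewrite Hq; split=> [[w H]|[w H]].
  apply: contrapT => N; apply: H => a /sat_fsub Ha; apply: N; move: Ha; rewrite FE => Ha.
  by eexists; exact: Ha.
exists (fun j => w (lift ord_max j)) => /(_ (w ord_max)); apply; apply/sat_fsub; rewrite FE.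
suff -> : (fun i => if unlift ord_max i is Some j then w (lift ord_max j) else w ord_max) = w by [].
by apply: funext => i; case: unliftP => [j ->|->].
Qed.

End ImaginaryBlocks.

Local Open Scope ring_scope.

(** * Derivations and relative algebraic closure *)

Section Derivations.

Variable K : fieldType.
Implicit Types (R B : K -> Prop) (d D : K -> K) (p q g : {poly K}).

Definition subring R : Prop :=
  [/\ R 1, forall x y, R x -> R y -> R (x - y) & forall x y, R x -> R y -> R (x * y)].

Definition der_on R d : Prop :=
  (forall x y, R x -> R y -> d (x + y) = d x + d y) /\
  (forall x y, R x -> R y -> d (x * y) = d x * y + x * d y).

Definition der D : Prop := der_on (fun _ => True) D.

(** In characteristic 0 this is the relative algebraic closure in [K] of the field generated by [B]
    ([cl_alg]). In this form, closure properties become computations with derivations. *)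
Definition cl B (x : K) : Prop :=
  forall D, der D -> (forall b, B b -> D b = 0) -> D x = 0.

Lemma subringD R x y : subring R -> R x -> R y -> R (x + y).
Proof.
case=> R1 RB _ Rx Ry; rewrite -[y]opprK; apply: (RB _ _ Rx).
rewrite -[- y]add0r; apply: (RB _ _ _ Ry); rewrite -(subrr 1); exact: RB.
Qed.

Section OneStep.

Variables (R : K -> Prop) (d : K -> K).
Hypotheses (subR : subring R) (derR : der_on R d).

Let R1 : R 1. Proof. by case: subR. Qed.
Let RB x y : R x -> R y -> R (x - y). Proof. by case: subR => _ H _; apply: H. Qed.
Let RM x y : R x -> R y -> R (x * y). Proof. by case: subR => _ _ H; apply: H. Qed.
Let R0 : R 0. Proof. by rewrite -(subrr 1); apply: RB. Qed.
Let RN x : R x -> R (- x). Proof. by move=> H; rewrite -[- x]add0r; apply: RB. Qed.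
Let RD x y : R x -> R y -> R (x + y).
Proof. by move=> H H'; rewrite -[y]opprK; apply: RB => //; apply: RN. Qed.
Let Rn n : R n%:R. Proof. by elim: n => [|n IH] //; rewrite mulrS; apply: RD. Qed.

Let d0 : d 0 = 0.
Proof. by apply: (addrI (d 0)); rewrite -derR.1 // addr0 addr0. Qed.
Let d1 : d 1 = 0.
Proof.
have := derR.2 1 1 R1 R1; rewrite !mulr1 mul1r => H.
by apply: (addrI (d 1)); rewrite addr0 -H.
Qed.

Definition poly_in p : Prop := forall i, R p`_i.

Lemma sum_in (I : Type) (r : seq I) (F : I -> K) : (forall i, R (F i)) ->
  R (\sum_(i <- r) F i) /\ d (\sum_(i <- r) F i) = \sum_(i <- r) d (F i).
Proof.
move=> H; elim: r => [|i r [IH1 IH2]]; first by rewrite !big_nil.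
by rewrite !big_cons derR.1 // IH2; split=> //; apply: RD.
Qed.

Lemma poly_inD p q : poly_in p -> poly_in q -> poly_in (p + q).
Proof. by move=> H H' i; rewrite coefD; apply: RD. Qed.
Lemma poly_inN p : poly_in p -> poly_in (- p).
Proof. by move=> H i; rewrite coefN; apply: RN. Qed.
Lemma poly_inM p q : poly_in p -> poly_in q -> poly_in (p * q).
Proof. by move=> H H' i; rewrite coefM; apply: (sum_in _ _).1 => j; apply: RM. Qed.
Lemma poly_inC c : R c -> poly_in c%:P.
Proof. by move=> H i; rewrite coefC; case: eqP. Qed.
Lemma poly_inX : poly_in 'X.
Proof. by move=> i; rewrite coefX; case: eqP. Qed.
Lemma poly_inXn n : poly_in 'X^n.
Proof. by move=> i; rewrite coefXn; case: eqP. Qed.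
Lemma poly_in_deriv p : poly_in p -> poly_in p^`().
Proof. by move=> H i; rewrite coef_deriv -mulr_natr; apply: RM. Qed.

Definition pd p : {poly K} := \poly_(i < size p) d p`_i.

Lemma coef_pd p i : (pd p)`_i = d p`_i.
Proof. by rewrite coef_poly; case: ltnP => // /(nth_default 0) ->; rewrite d0. Qed.

Lemma pdD p q : poly_in p -> poly_in q -> pd (p + q) = pd p + pd q.
Proof. by move=> H H'; apply/polyP => i; rewrite coefD !coef_pd coefD derR.1. Qed.

Lemma pdM p q : poly_in p -> poly_in q -> pd (p * q) = pd p * q + p * pd q.
Proof.
move=> H H'; apply/polyP => i; rewrite coefD !coefM coef_pd coefM.
rewrite (sum_in _ _).2; last by move=> j; apply: RM.
rewrite -big_split; apply: eq_bigr => j _ /=.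
by rewrite !coef_pd derR.2.
Qed.

Lemma pdC c : pd c%:P = (d c)%:P.
Proof. by apply/polyP => i; rewrite coef_pd !coefC; case: eqP. Qed.

Lemma pdX n : pd 'X^n = 0.
Proof. by apply/polyP => i; rewrite coef_pd coefXn coef0; case: eqP. Qed.

Section At.
Variables (x v : K).

(** The value that an extension of [d] with value [v] at [x] must take at [p.[x]]. *)
Definition Th p : K := (pd p).[x] + p^`().[x] * v.

Lemma ThD p q : poly_in p -> poly_in q -> Th (p + q) = Th p + Th q.
Proof. by move=> H H'; rewrite /Th pdD // derivD !hornerD mulrDl addrACA. Qed.

Lemma ThM p q : poly_in p -> poly_in q -> Th (p * q) = Th p * q.[x] + p.[x] * Th q.
Proof.
move=> H H'; rewrite /Th pdM // derivM !hornerD !hornerM; ring.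
Qed.

(** The hypothesis says exactly that [Th p] depends on [p.[x]] only. *)
Lemma adjoin : (forall g, poly_in g -> g.[x] = 0 -> Th g = 0) ->
  exists R' d', [/\ subring R', der_on R' d', forall y, R y -> R' y /\ d' y = d y & R' x /\ d' x = v].
Proof.
move=> H; pose R' y := exists p, poly_in p /\ y = p.[x].
pose d' y := if pselect (R' y) is left h then Th (sval (cid h)) else 0.
have d'E p : poly_in p -> d' p.[x] = Th p.
  move=> Hp; rewrite /d'; case: pselect => [h|[]]; last by exists p.
  case: cid => q [Hq E] /=.
  have /H : poly_in (q - p) by apply: poly_inD => //; apply: poly_inN.
  rewrite hornerD hornerN E subrr => /(_ erefl) K0.
  have : Th (q - p + p) = Th (q - p) + Th p by apply: ThD => //; apply: poly_inD => //; apply: poly_inN.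
  by rewrite subrK K0 add0r.
exists R', d'; split.
- split; first by exists 1%:P; split; [apply: poly_inC|rewrite hornerC].
  + move=> _ _ [p [Hp ->]] [q [Hq ->]]; exists (p - q); split; last by rewrite hornerD hornerN.
    by apply: poly_inD => //; apply: poly_inN.
  + move=> _ _ [p [Hp ->]] [q [Hq ->]]; exists (p * q); split; last by rewrite hornerM.
    exact: poly_inM.
- split=> _ _ [p [Hp ->]] [q [Hq ->]].
  + by rewrite -hornerD !d'E ?ThD //; apply: poly_inD.
  + by rewrite -hornerM !d'E ?ThM //; apply: poly_inM.
- move=> y Ry; split; first by exists y%:P; split; [apply: poly_inC|rewrite hornerC].
  rewrite -{1}(hornerC y x) d'E; last exact: poly_inC.
  by rewrite /Th pdC derivC !hornerC mul0r addr0.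
- split; first by exists 'X; split; [apply: poly_inX|rewrite hornerX].
  rewrite -{1}(hornerX x) d'E; last exact: poly_inX.
  have -> : Th 'X = v; last by [].
  by rewrite /Th -['X]expr1 pdX expr1 derivX horner0 add0r -polyC1 hornerC mul1r.
Qed.
End At.

Hypothesis char0 : forall n, n.+1%:R != 0 :> K.

(** Take a nonzero polynomial of least size vanishing at [x]: its derivative is shorter and, in
    characteristic 0, nonzero, so it does not vanish at [x]. *)
Lemma min_root x : (exists p, [/\ p != 0, poly_in p & p.[x] = 0]) ->
  exists p, [/\ p != 0, poly_in p, p.[x] = 0, p^`().[x] != 0 &
    forall g, poly_in g -> g.[x] = 0 -> (size g < size p)%N -> g = 0].
Proof.
move=> [p0 Hp0].
pose P n := `[< exists p, [/\ p != 0, poly_in p, p.[x] = 0 & size p = n] >].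
have exP : exists n, P n by exists (size p0); apply/asboolP; exists p0; case: Hp0.
have [n /asboolP [p [pn0 pin px sp]] minn] := ex_minnP exP.
have small g : poly_in g -> g.[x] = 0 -> (size g < size p)%N -> g = 0.
  move=> Hg gx sg; apply/eqP; apply: contraTT sg => gn0; rewrite -leqNgt sp.
  by apply: minn; apply/asboolP; exists g.
exists p; split=> //; apply/eqP => dpx.
have : p^`() = 0 by apply: small => //; [apply: poly_in_deriv|apply: lt_size_deriv].
have s2 : (1 < size p)%N.
  by apply: (@root_size_gt1 _ x _ pn0); apply/rootP.
move/polyP => /(_ (size p).-2); rewrite coef0 coef_deriv.
have -> : (size p).-2.+1 = (size p).-1 by case: (size p) s2 => [|[]].
rewrite -lead_coefE -mulr_natr => /eqP; rewrite mulf_eq0 lead_coef_eq0 (negPf pn0) /=.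
by case: (size p) s2 => [|[|m]] //= _; apply/negP; apply: char0.
Qed.

(** For a transcendental [x] any value would do and 0 is taken; for an algebraic [x] the value is
    forced by a polynomial of least size, whose derivative does not vanish. *)
Lemma adjoin_any x : exists R' d', [/\ subring R', der_on R' d',
  forall y, R y -> R' y /\ d' y = d y & R' x].
Proof.
case: (pselect (exists p, [/\ p != 0, poly_in p & p.[x] = 0])) => [/min_root|N]; last first.
  have [|R' [d' [H1 H2 H3 [H4 _]]]] := @adjoin x 0; last by exists R', d'.
  move=> g Hg gx; have -> : g = 0 by apply/eqP/negPn/negP => gn0; apply: N; exists g.
  by rewrite /Th -(polyC0 K) pdC d0 polyC0 derivC horner0 add0r mul0r.
move=> [p [pn0 pin px dpx small]].
pose v := - (pd p).[x] / p^`().[x].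
have Thp : Th x v p = 0 by rewrite /Th /v mulrC divfK // subrr.
have [|R' [d' [H1 H2 H3 [H4 _]]]] := @adjoin x v; last by exists R', d'.
move=> g; have [n] := ubnP (size g); elim: n g => // n IH g sg Hg gx.
case: (ltnP (size g) (size p)) => [/small -> //|spg].
  by rewrite /Th -(polyC0 K) pdC d0 polyC0 derivC horner0 add0r mul0r.
(* Pseudo-division by [p]: [R] is only a ring, so [g] is first multiplied by the leading coefficient
   of [p]. *)
pose c := lead_coef p; pose h := (lead_coef g)%:P * 'X^(size g - size p).
pose g1 := c%:P * g - h * p.
have hin : poly_in h by apply: poly_inM; [apply: poly_inC; apply: Hg|apply: poly_inXn].
have cin : poly_in c%:P by apply: poly_inC; apply: pin.
have g1in : poly_in g1 by apply: poly_inD; [apply: poly_inM|apply: poly_inN; apply: poly_inM].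
have g1x : g1.[x] = 0 by rewrite !hornerE gx px !mulr0 subrr.
have cn0 : c != 0 by rewrite lead_coef_eq0.
case: (eqVneq g 0) => [->|gn0]; first by rewrite /Th -(polyC0 K) pdC d0 polyC0 derivC horner0 add0r mul0r.
have sp0 : (0 < size p)%N by rewrite size_poly_gt0.
have sg1 : (size g1 < size g)%N.
  have gS : (size g).-1.+1 = size g by rewrite prednK // size_poly_gt0.
  rewrite -gS ltnS; apply/leq_sizeP => j; rewrite leq_eqVlt => /orP[/eqP <-|Hj].
    rewrite coefB !coefCM -mulrA coefCM coefXnM.
    have -> : ((size g).-1 < size g - size p)%N = false.
      by move: sp0 spg gS; lia.
    have -> : ((size g).-1 - (size g - size p) = (size p).-1)%N by move: sp0 spg; lia.
    by rewrite -!lead_coefE mulrC subrr.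
  rewrite coefB !coefCM -mulrA coefCM coefXnM.
  have sj : (size g <= j)%N by rewrite -gS.
  rewrite nth_default // mulr0 sub0r.
  rewrite ltnNge (leq_trans (leq_subr _ _) sj) /=.
  by rewrite nth_default ?mulr0 ?oppr0 // leq_subRL ?subnK // (leq_trans (leq_subr _ _) sj).
have : Th x v g1 = 0 by apply: IH => //; apply: leq_trans sg1 _.
have E : c%:P * g = g1 + h * p by rewrite subrK.
move=> Z; have := congr1 (Th x v) E.
rewrite ThM // ThD ?ThM //; last exact: poly_inM.
rewrite gx px Thp Z !mulr0 !addr0 add0r hornerC => /eqP.
by rewrite mulf_eq0 (negPf cn0) => /eqP.
- by apply: poly_inC; apply: Hg.
- exact: poly_inXn.
Qed.

End OneStep.

Section Char0.

Hypothesis char0 : forall n, n.+1%:R != 0 :> K.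

(** Zorn's lemma on partial derivations; a maximal one is total by [adjoin_any]. *)
Lemma der_extend R d : subring R -> der_on R d ->
  exists D, der D /\ forall x, R x -> D x = d x.
Proof.
move=> subR derR.
pose ok (Rd : (K -> Prop) * (K -> K)) := [/\ subring Rd.1, der_on Rd.1 Rd.2 &
  forall x, R x -> Rd.1 x /\ Rd.2 x = d x].
pose T := {Rd | ok Rd}.
pose leR (s t : T) := `[< forall x, (sval s).1 x -> (sval t).1 x /\ (sval t).2 x = (sval s).2 x >].
have ok0 : ok (R, d) by split.
have [|r s t /asboolP rs /asboolP st|A tot|[[R' d'] ok'] mx] := @classical_sets.ZL_preorder T (exist _ _ ok0) leR.
- by move=> t; apply/asboolP.
- by apply/asboolP => x /rs [sx <-]; apply: st.
- case: (pselect (exists s, A s)) => [[s0 As0]|N]; last first.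
    by exists (exist _ _ ok0) => s As; case: N; exists s.
  pose R' x := exists s : T, A s /\ (sval s).1 x.
  pose d' x := if pselect (R' x) is left h then (sval (sval (cid h))).2 x else 0.
  have two s t : A s -> A t -> exists u, [/\ A u, forall x, (sval s).1 x -> (sval u).1 x /\ (sval u).2 x = (sval s).2 x
    & forall x, (sval t).1 x -> (sval u).1 x /\ (sval u).2 x = (sval t).2 x].
    by move=> As At; case: (tot s t As At) => /asboolP H; [exists t|exists s]; split.
  have d'E s x : A s -> (sval s).1 x -> d' x = (sval s).2 x.
    move=> As sx; rewrite /d'; case: pselect => [h|[]]; last by exists s.
    case: cid => t [At tx] /=.
    by have [u [_ /(_ x sx) [_ <-] /(_ x tx) [_ <-]]] := two s t As At.
  have ok' : ok (R', d').
    split=> /=.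
    + split; first by exists s0; split=> //; case: (svalP s0) => -[].
      * move=> x y [s [As sx]] [t [At ty]]; have [u [Au su tu]] := two s t As At.
        exists u; split=> //; case: (svalP u) => -[_ HB _] _ _; apply: HB; [by case: (su x sx)|by case: (tu y ty)].
      * move=> x y [s [As sx]] [t [At ty]]; have [u [Au su tu]] := two s t As At.
        exists u; split=> //; case: (svalP u) => -[_ _ HM] _ _; apply: HM; [by case: (su x sx)|by case: (tu y ty)].
    + split=> x y [s [As sx]] [t [At ty]]; have [u [Au su tu]] := two s t As At;
      have [[ux _] [uy _]] := (su x sx, tu y ty); have [[u1 uB uM] [uD1 uD2] _] := svalP u.
      * by rewrite !(d'E u) ?uD1 //; apply: subringD.
      * by rewrite !(d'E u) ?uD2 //; apply: uM.
    + move=> x Rx; have [_ _ /(_ x Rx) [sx <-]] := svalP s0.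
      by split; [exists s0|apply: d'E].
  exists (exist _ _ ok') => s As; apply/asboolP => x sx /=.
  by split; [exists s|apply: d'E].
have [/= sub' der' ext'] := ok'.
have all_in x : R' x.
  have [R2 [d2 [sub2 der2 ext2 R2x]]] := adjoin_any sub' der' char0 x.
  have ok2 : ok (R2, d2).
    split=> // y /ext' [/ext2 [/= ? ->] ->]; by split.
  have /asboolP /= : leR (exist _ _ ok') (exist _ _ ok2) by apply/asboolP.
  move=> H; have /asboolP /= := mx (exist _ _ ok2) (introT (asboolP _) H).
  by move=> /(_ x R2x) [].
exists d'; split; last by move=> x /ext' [].
by case: der' => H1 H2; split=> x y _ _; [apply: H1|apply: H2].
Qed.

Lemma derB D x y : der D -> D (x - y) = D x - D y.
Proof.
move=> dD; apply: (addIr (D y)); rewrite subrK -dD.1 // subrK //.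
Qed.
Lemma der0 D : der D -> D 0 = 0.
Proof. by move=> dD; have := derB 0 0 dD; rewrite !subrr. Qed.
Lemma der1 D : der D -> D 1 = 0.
Proof.
move=> dD; apply: (addrI (D 1)); rewrite addr0.
by have := dD.2 1 1 I I; rewrite !mulr1 mul1r => /esym.
Qed.
Lemma derN D x : der D -> D (- x) = - D x.
Proof. by move=> dD; rewrite -[- x]add0r derB // der0 // sub0r. Qed.

Inductive genr B : K -> Prop :=
| gen_in x : B x -> genr B x
| gen_1 : genr B 1
| gen_B x y : genr B x -> genr B y -> genr B (x - y)
| gen_M x y : genr B x -> genr B y -> genr B (x * y).

Lemma genr_subring B : subring (genr B).
Proof. by split; [apply: gen_1|apply: gen_B|apply: gen_M]. Qed.

Lemma der_genr B D : der D -> (forall b, B b -> D b = 0) -> forall x, genr B x -> D x = 0.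
Proof.
move=> dD H x; elim=> [y /H//||y z _ Hy _ Hz|y z _ Hy _ Hz]; first exact: der1.
  by rewrite derB // Hy Hz subrr.
by rewrite dD.2 // Hy Hz mul0r mulr0 addr0.
Qed.

(** If [x] is transcendental, some derivation kills [B] and has value 1 at [x]; if [x] is a simple
    root of [p], then [p'(x) D(x) = 0] for every derivation [D] killing [B]. *)
Lemma cl_alg B x : cl B x <-> exists p, [/\ p != 0, poly_in (genr B) p & p.[x] = 0].
Proof.
have derz : der_on (genr B) (fun _ => 0) by split=> *; rewrite ?addr0 ?mul0r ?mulr0 ?addr0.
split=> [H|/(min_root (genr_subring B) char0) [p [pn0 pin px dpx _]]].
  apply: contrapT => N.
  have [|R' [d' [sub' der' ext' [R'x d'x]]]] := @adjoin _ _ (genr_subring B) derz x 1.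
    move=> g Hg gx; have -> : g = 0 by apply/eqP/negPn/negP => gn0; apply: N; exists g.
    rewrite /Th derivC horner0 mul0r addr0; have -> : pd (fun _ => 0) (0 : {poly K}) = 0; last by rewrite horner0.
    by apply/polyP => i; rewrite coef_poly size_poly0 coef0.
  have [D [dD DE]] := der_extend sub' der'.
  have : D x = 0 by apply: H => // b Bb; have [Rb E] := ext' b (gen_in Bb); rewrite DE.
  by rewrite DE // d'x => /eqP; rewrite oner_eq0.
move=> D dD DB.
have E q : poly_in (genr B) q -> D q.[x] = q^`().[x] * D x.
  have [n] := ubnP (size q); elim: n q => // n IH q; elim/poly_ind: q => [|q c _] sq Hq.
    by rewrite derivC !horner0 der0 // mul0r.
  have Hq' : poly_in (genr B) q.
    by move=> i; have := Hq i.+1; rewrite coefD coefMX coefC /= addr0.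
  have Hc : genr B c by have := Hq 0%N; rewrite coefD coefMX coefC /= add0r.
  rewrite derivD derivC derivM derivX addr0 mulr1 !hornerE dD.1 // dD.2 //.
  rewrite (der_genr dD DB Hc) addr0; case: (eqVneq q 0) => [->|qn0].
    by rewrite deriv0 !horner0 der0 // !mul0r !addr0 mul0r.
  rewrite IH //; first ring.
  by move: sq; rewrite size_MXaddC (negPf qn0).
by have := E p pin; rewrite px der0 // => /esym/eqP; rewrite mulf_eq0 (negPf dpx) => /eqP.
Qed.

Lemma cl_in B x : B x -> cl B x.
Proof. by move=> Bx D dD; apply. Qed.

Lemma cl_mono B B' x : (forall y, B y -> B' y) -> cl B x -> cl B' x.
Proof. by move=> H C D dD DB; apply: C => // b /H /DB. Qed.

Lemma cl_trans B B' x : (forall y, B y -> cl B' y) -> cl B x -> cl B' x.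
Proof. by move=> H C D dD DB; apply: C => // b /H; apply. Qed.

Lemma cl_subring B : subring (cl B).
Proof.
split=> [D dD _|x y Hx Hy D dD DB|x y Hx Hy D dD DB]; first exact: der1.
  by rewrite derB // (Hx D dD DB) (Hy D dD DB) subrr.
by rewrite dD.2 // (Hx D dD DB) (Hy D dD DB) mul0r mulr0 addr0.
Qed.

Lemma der_lin D G c : der D -> der G -> der (fun x => D x + c * G x).
Proof.
move=> dD dG; split=> x y _ _; first by rewrite dD.1 // dG.1 //; ring.
by rewrite dD.2 // dG.2 //; ring.
Qed.

Lemma der_comm D G : der D -> der G -> der (fun x => D (G x) - G (D x)).
Proof.
move=> dD dG; split=> x y _ _; first by rewrite dD.1 // dG.1 // dD.1 // dG.1 //; ring.
by rewrite dD.2 // dG.2 // dD.1 // dG.1 // !dD.2 // !dG.2 //; ring.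
Qed.

Lemma not_clP B x : ~ cl B x -> exists G, [/\ der G, forall b, B b -> G b = 0 & G x = 1].
Proof.
move=> N; have [D [dD DB Dx]] : exists D, [/\ der D, forall b, B b -> D b = 0 & D x <> 0].
  by apply: contrapT => N'; apply: N => D dD DB; apply: contrapT => Dx; apply: N'; exists D.
exists (fun y => 0 + (D x)^-1 * D y); split; last 2 first.
- by move=> b /DB ->; rewrite mulr0 addr0.
- by rewrite add0r mulVf //; apply/eqP.
- by apply: (@der_lin (fun _ => 0)) => //; split=> *; rewrite ?addr0 ?mul0r ?mulr0 ?addr0.
Qed.

(** If [H] kills [B] with [H y = 1], and [G] kills [B] and [y] with [G x = 1], then [H - H(x) G]
    kills [B] and [x] but has value 1 at [y]. *)
Lemma cl_exchange B x y : cl (fun z => B z \/ z = x) y -> ~ cl B y -> cl (fun z => B z \/ z = y) x.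
Proof.
move=> Cy /not_clP [H [dH HB Hy]]; apply: contrapT => /not_clP [G [dG GB Gx]].
have dF := der_lin (- H x) dH dG.
have : H y + - H x * G y = 0.
  apply: (Cy _ dF) => b [Bb|->]; first by rewrite HB // GB ?mulr0 ?addr0 //; left.
  by rewrite Gx mulr1 subrr.
rewrite (GB y) ?mulr0 ?addr0 ?Hy; last by right.
by move/eqP; rewrite oner_eq0.
Qed.

(* A derivation that maps [B] into [cl B] maps [cl B] into itself: for [G]
   killing [B], the commutator of [G] and [D] kills [B] too. *)
Lemma cl_der_stable B D : der D -> (forall b, B b -> cl B (D b)) ->
  forall x, cl B x -> cl B (D x).
Proof.
move=> dD H x Cx G dG GB.
have : G (D x) - D (G x) = 0.
  by apply: (Cx _ (der_comm dG dD)) => b Bb; rewrite H // GB // der0 // subrr.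
by rewrite (Cx _ dG GB) der0 // subr0.
Qed.

(** Zorn's lemma on closed, stable sets on which the derivations commute. A missing [x] is
    transcendental over such a set [R], so some [G] killing [R] has [G x = 1]; subtracting multiples
    of [G] makes all derivations vanish at [x], and then their commutators vanish on generators. *)
Lemma commuting_extend (I : Type) (B : K -> Prop) (d : I -> K -> K) :
  (forall i, der (d i)) -> (forall i b, B b -> B (d i b)) ->
  (forall i j b, B b -> d i (d j b) = d j (d i b)) ->
  exists D : I -> K -> K, [/\ forall i, der (D i),
    forall i j x, D i (D j x) = D j (D i x) & forall i b, B b -> D i b = d i b].
Proof.
move=> derd dB dcomm.
pose ok (Rd : (K -> Prop) * (I -> K -> K)) := [/\ forall x, cl Rd.1 x -> Rd.1 x,
  forall i, der (Rd.2 i), forall i x, Rd.1 x -> Rd.1 (Rd.2 i x),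
  forall i j x, Rd.1 x -> Rd.2 i (Rd.2 j x) = Rd.2 j (Rd.2 i x) &
  forall x, B x -> Rd.1 x /\ forall i, Rd.2 i x = d i x].
pose T := {Rd | ok Rd}.
pose leR (s t : T) := `[< forall x, (sval s).1 x -> (sval t).1 x /\ forall i, (sval t).2 i x = (sval s).2 i x >].
have ok0 : ok (cl B, d).
  split=> //=.
  - by move=> x; apply: cl_trans.
  - by move=> i; apply: cl_der_stable => // b Bb; apply/cl_in/dB.
  - move=> i j x Cx; apply/eqP; rewrite -subr_eq0; apply/eqP.
    by apply: (Cx _ (der_comm (derd i) (derd j))) => b Bb; rewrite dcomm // subrr.
  - by move=> x Bx; split=> //; apply: cl_in.
have [|r s t /asboolP rs /asboolP st|A tot|[[R d'] ok'] mx] := @classical_sets.ZL_preorder T (exist _ _ ok0) leR.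
- by move=> t; apply/asboolP.
- by apply/asboolP => x /rs [sx E]; have [tx E'] := st x sx; split=> // i; rewrite E' E.
- case: (pselect (exists s, A s)) => [[s0 As0]|N]; last first.
    by exists (exist _ _ ok0) => s As; case: N; exists s.
  pose R' x := exists s : T, A s /\ (sval s).1 x.
  pose d' i x := if pselect (R' x) is left h then (sval (sval (cid h))).2 i x else 0.
  have two s t : A s -> A t -> exists u, [/\ A u, forall x, (sval s).1 x -> (sval u).1 x /\ forall i, (sval u).2 i x = (sval s).2 i x
    & forall x, (sval t).1 x -> (sval u).1 x /\ forall i, (sval u).2 i x = (sval t).2 i x].
    by move=> As At; case: (tot s t As At) => /asboolP H; [exists t|exists s]; split.
  have d'E s i x : A s -> (sval s).1 x -> d' i x = (sval s).2 i x.
    move=> As sx; rewrite /d'; case: pselect => [h|[]]; last by exists s.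
    case: cid => t [At tx] /=.
    by have [u [_ /(_ x sx) [_ <-] /(_ x tx) [_ <-]]] := two s t As At.
  have subs (s : T) : subring (sval s).1.
    have [c _ _ _ _] : ok (sval s) := svalP s; have [H1 HB HM] := cl_subring (sval s).1.
    by split=> [|x y Hx Hy|x y Hx Hy]; apply: c => //; [apply: HB|apply: HM]; apply: cl_in.
  have sub' : subring R'.
    split; first by exists s0; split=> //; case: (subs s0).
    + move=> x y [s [As sx]] [t [At ty]]; have [u [Au su tu]] := two s t As At.
      exists u; split=> //; case: (subs u) => _ HB _; apply: HB; [by case: (su x sx)|by case: (tu y ty)].
    + move=> x y [s [As sx]] [t [At ty]]; have [u [Au su tu]] := two s t As At.
      exists u; split=> //; case: (subs u) => _ _ HM; apply: HM; [by case: (su x sx)|by case: (tu y ty)].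
  have der' i : der_on R' (d' i).
    split=> x y [s [As sx]] [t [At ty]]; have [u [Au su tu]] := two s t As At;
    have [ux _] := su x sx; have [uy _] := tu y ty; have [u1 uB uM] := subs u; have [_ uD _ _ _] : ok (sval u) := svalP u.
    + by rewrite !(d'E u) ?(uD i).1 //; apply: subringD.
    + by rewrite !(d'E u) ?(uD i).2 //; apply: uM.
  (* Outside the union of the chain the extensions are arbitrary and need not commute; only their
     values on the union are used. *)
  have [D HD] := choice (fun i => der_extend sub' (der' i)).
  have DE s i x : A s -> (sval s).1 x -> D i x = (sval s).2 i x.
    by move=> As sx; rewrite (HD i).2 ?(d'E s) //; exists s.
  have Rin s i x : A s -> (sval s).1 x -> (sval s).1 (D i x).
    by move=> As sx; rewrite (DE s) //; have [_ _ st _ _] : ok (sval s) := svalP s; apply: st.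
  have ok' : ok (R', D).
    split=> /=.
    + move=> x /cl_alg [p [pn0 pin px]].
      have genR y : genr R' y -> R' y.
        by elim=> {y} [y//||y z _ Hy _ Hz|y z _ Hy _ Hz]; have [r1 rB rM] := sub'; [|apply: rB|apply: rM].
      have [s [As sp]] : exists s, A s /\ forall i, (i < size p)%N -> (sval s).1 p`_i.
        elim: (size p) => [|n [s [As IH]]]; first by exists s0.
        have [t [At tn]] := genR _ (pin n); have [u [Au su tu]] := two s t As At.
        exists u; split=> // i; rewrite ltnS leq_eqVlt => /orP[/eqP ->|/IH /su []] //.
        by case: (tu _ tn).
      exists s; split=> //; have [c _ _ _ _] : ok (sval s) := svalP s; apply: c.
      apply/cl_alg; exists p; split=> // i; case: (ltnP i (size p)) => [/sp Hi|Hi]; first exact: gen_in.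
      by rewrite nth_default // -(subrr 1); apply: gen_B; apply: gen_1.
    + by move=> i; case: (HD i).
    + by move=> i x [s [As sx]]; exists s; split=> //; apply: Rin.
    + move=> i j x [s [As sx]]; have [_ _ st sc _] : ok (sval s) := svalP s.
      rewrite (DE s i) //; last by apply: Rin.
      rewrite (DE s j x) // sc // (DE s j) ?(DE s i x) //; exact: st.
    + move=> x Bx; have [_ _ _ _ /(_ x Bx) [sx E]] := svalP s0.
      by split=> [|i]; [exists s0|rewrite (DE s0)].
  exists (exist _ _ ok') => s As; apply/asboolP => x sx /=.
  by split=> [|i]; [exists s|apply: DE].
have [/= clR derR stR cR extR] := ok'.
suff all_in x : R x.
  by exists d'; split=> // [i j x|i b /extR [_ ->]] //; apply: cR.
apply: contrapT => Nx.
have /not_clP [G [dG GR Gx]] : ~ cl R x by move=> /clR.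
pose R2 := cl (fun y => R y \/ y = x).
pose d2 i := fun y => d' i y + - d' i x * G y.
have der2 i : der (d2 i) by apply: der_lin.
have d2R i y : R y -> d2 i y = d' i y by move=> Ry; rewrite /d2 GR // mulr0 addr0.
have d2x i : d2 i x = 0 by rewrite /d2 Gx mulr1 subrr.
have ok2 : ok (R2, d2).
  split=> //=.
  - by move=> y; apply: cl_trans.
  - move=> i; apply: cl_der_stable => // b [Rb|->]; first by apply: cl_in; left; rewrite d2R //; apply: stR.
    by rewrite d2x; apply: cl_in; left; rewrite -(der0 (derR i)); apply: stR; have [_ _ HM] := cl_subring R;
      apply: clR => D dD _; apply: der0.
  - move=> i j y Cy; apply/eqP; rewrite -subr_eq0; apply/eqP.
    apply: (Cy _ (der_comm (der2 i) (der2 j))) => b [Rb|->]; last by rewrite !d2x !(der0 (der2 _)) subrr.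
    rewrite (d2R j b Rb) (d2R i b Rb) (d2R i _ (stR j b Rb)) (d2R j _ (stR i b Rb)).
    by rewrite cR // subrr.
  - by move=> y /extR [Ry E]; split=> [|i]; [apply: cl_in; left|rewrite d2R].
have H : leR (exist _ _ ok') (exist _ _ ok2).
  by apply/asboolP => y /= Ry; split=> [|i]; [apply: cl_in; left|apply: d2R].
have /asboolP /= := mx _ H => /(_ x) [] //.
by apply: cl_in; right.
Qed.

End Char0.
End Derivations.

(** * Curves over large fields *)

(* [lia] does not see that the same size may be displayed through different
   paths of the algebraic hierarchy. *)
Ltac size_lia := repeat (match goal with
  |- context [size (polyseq ?p)] => move: (size p) => ? end); lia.

Section PlaneCurves.

Variable K : fieldType.
Implicit Types (c p : {poly K}) (f g h u w : {poly {poly K}}).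

Lemma const_poly (R : nzRingType) (p : {poly R}) : (size p <= 1)%N -> exists a, p = a%:P.
Proof. by move=> /size1_polyC H; exists p`_0. Qed.

Lemma irreducible_factor c : (1 < size c)%N -> exists p, irreducible_poly p /\ p %| c.
Proof.
have [n] := ubnP (size c); elim: n c => // n IH c sc c1.
case: (pselect (irreducible_poly c)) => [|N]; first by exists c.
have [q [q1 qc qn]] : exists q : {poly K}, [/\ size q != 1%N, q %| c & ~~ (q %= c)].
  apply: contrapT => N'; apply: N; split=> // q q1 qc.
  by apply: contrapT => /negP qn; apply: N'; exists q.
have cn0 : c != 0 by rewrite -size_poly_gt0; apply: ltn_trans c1.
have qn0 : q != 0 by apply: contraNneq cn0 => q0; move: qc; rewrite q0 dvd0p.
have sq : (size q < size c)%N.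
  by rewrite ltn_neqAle dvdp_leq // andbT Pdiv.Idomain.dvdp_size_eqp.
have [||p [ip pq]] := IH q; first exact: leq_trans sq sc.
  by move: q1 qn0; rewrite -size_poly_gt0; case: (size q) => [|[]].
by exists p; split=> //; apply: dvdp_trans pq qc.
Qed.

(** The first coefficients of [u] and of [w] that [p] does not divide, at [i] and [j], produce a
    coefficient of the product at [i + j] that it does not divide. *)
Lemma coef_dvd_prime p u w : irreducible_poly p ->
  (forall i, p %| (u * w)`_i) -> (forall i, p %| u`_i) \/ (forall i, p %| w`_i).
Proof.
move=> ip H; apply: contrapT => /not_orP [Nu Nw].
have ex (v : {poly {poly K}}) : ~ (forall i, p %| v`_i) ->
    exists i, ~~ (p %| v`_i) /\ forall j, (j < i)%N -> p %| v`_j.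
  move=> N; have exi : exists i, ~~ (p %| v`_i).
    by apply: contrapT => N'; apply: N => i; apply: contrapT => /negP Hi; apply: N'; exists i.
  have [i Hi mi] := ex_minnP exi; exists i; split=> // j ji.
  by apply: contraTT ji => Hj; rewrite -leqNgt; apply: mi.
have [i [Hi mi]] := ex u Nu; have [j [Hj mj]] := ex w Nw.
have := H (i + j)%N; rewrite coefM.
have lei : (i < (i + j).+1)%N by rewrite ltnS leq_addr.
rewrite (bigD1 (Ordinal lei)) //= addKn dvdp_addl.
  rewrite Gauss_dvdpr; last by rewrite irreducible_poly_coprime.
  by apply/negP.
apply: (big_ind (fun x : {poly K} => p %| x)) => [||k kn]; first exact: dvdp0.
  by move=> x y px py; apply: dvdp_add.
case: (ltngtP k i) => ki; first by apply: dvdp_mulr; apply: mi.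
- apply: dvdp_mull; apply: mj; have := ltn_ord k; move: ki; lia.
- by case/negP: kn; apply/eqP/val_inj.
Qed.

Lemma coef_dvd_divides p u : (forall i, p %| u`_i) -> exists u', u = p *: u'.
Proof.
move=> H; exists (\poly_(i < size u) (u`_i %/ p)); apply/polyP => i.
rewrite coefZ coef_poly; case: ltnP => [_|/(nth_default 0) ->]; last by rewrite mulr0.
by rewrite mulrC divpK.
Qed.

(* Gauss' lemma for monic polynomials. *)
Lemma monic_factor f u w c : f \is monic -> c != 0 -> c *: f = u * w ->
  exists g h, [/\ g \is monic, h \is monic, f = g * h & size g = size u].
Proof.
move=> fm; have [n] := ubnP (size c); elim: n c u w => // n IH c u w sc cn0 E.
case: (leqP (size c) 1) => c1.
  have [a ca] := const_poly c1.
  have lE : lead_coef u * lead_coef w = c.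
    by rewrite -lead_coefM -E lead_coefZ (eqP fm) mulr1.
  have an0 : a != 0 by apply: contraNneq cn0 => a0; rewrite ca a0.
  have unit_of x y : x * y = c -> exists b, b != 0 /\ x = b%:P.
    move=> xy; have xn0 : x != 0 by apply: contraNneq cn0 => x0; rewrite -xy x0 mul0r.
    have yn0 : y != 0 by apply: contraNneq cn0 => y0; rewrite -xy y0 mulr0.
    have : size (x * y) = 1%N by rewrite xy ca size_polyC an0.
    rewrite size_mul // => s; have /const_poly [b xb] : (size x <= 1)%N.
      by move: s yn0; rewrite -size_poly_gt0; size_lia.
    by exists b; split=> //; apply: contraNneq xn0 => b0; rewrite xb b0.
  have [b [bn0 lu]] := unit_of _ _ lE.
  have [b' [bn0' lw]] : exists b, b != 0 /\ lead_coef w = b%:P.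
    by apply: (unit_of _ (lead_coef u)); rewrite mulrC.
  have inv (x : K) : x != 0 -> x^-1%:P * x%:P = 1 :> {poly K}.
    by move=> xn0; rewrite -polyCM mulVf.
  exists (b^-1%:P *: u), (b'^-1%:P *: w); split.
  - by apply/monicP; rewrite lead_coefZ lu inv.
  - by apply/monicP; rewrite lead_coefZ lw inv.
  - rewrite -scalerAl -scalerAr -E !scalerA.
    suff -> : b^-1%:P * b'^-1%:P * c = 1 by rewrite scale1r.
    by rewrite -lE lu lw mulrACA !inv // mulr1.
  - by rewrite size_scale // polyC_eq0 invr_eq0.
have [p [ip pc]] := irreducible_factor c1.
have pn0 : p != 0 by apply: contraNneq cn0 => p0; move: pc; rewrite p0 dvd0p.
have [c' cE] : exists c', c = c' * p by exists (c %/ p); rewrite divpK.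
have c'n0 : c' != 0 by apply: contraNneq cn0 => c0; rewrite cE c0 mul0r.
have sc' : (size c' < n)%N.
  have [p1 _] := ip; move: sc; rewrite cE size_mul //; move: p1 c'n0; rewrite -size_poly_gt0; size_lia.
have : forall i, p %| (u * w)`_i by move=> i; rewrite -E coefZ; apply: dvdp_mulr.
case/(coef_dvd_prime ip) => /coef_dvd_divides [v vE].
  have E' : c' *: f = v * w.
    apply: (@mulfI _ p%:P); first by rewrite polyC_eq0.
    by rewrite !mul_polyC scalerA [p * _]mulrC -cE E vE -scalerAl.
  have [g [h [gm hm fE sg]]] := IH c' v w sc' c'n0 E'.
  by exists g, h; rewrite vE size_scale.
have E' : c' *: f = u * v.
 apply: (@mulfI _ p%:P); first by rewrite polyC_eq0.
  by rewrite !mul_polyC scalerA [p * _]mulrC -cE E vE -scalerAr.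
exact: IH c' u v sc' c'n0 E'.
Qed.

Lemma monic_dvd f g : f \is monic -> f %| g -> exists w, g = w * f.
Proof.
move=> fm /Pdiv.Idomain.dvdpP [[c w] /= cn0 E].
exists (Pdiv.CommonRing.rdivp g f).
have gE := Pdiv.RingMonic.rdivp_eq fm g.
set q := Pdiv.CommonRing.rdivp g f in gE *; set r := Pdiv.CommonRing.rmodp g f in gE.
suff r0 : r = 0 by rewrite {1}gE r0 addr0.
have fn0 : f != 0 by apply: monic_neq0.
have sr : (size r < size f)%N by rewrite Pdiv.CommonRing.ltn_rmodp.
have Er : c *: r = (w - c *: q) * f.
  by rewrite mulrBl -E -scalerAl {1}gE scalerDr addrC addKr.
apply/eqP; apply: contraTT sr => rn0; rewrite -leqNgt -(size_scale r cn0) Er.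
have : (w - c *: q) != 0.
  by apply: contraNneq rn0 => W0; move: Er; rewrite W0 mul0r -mul_polyC => /eqP; rewrite mulf_eq0 polyC_eq0 (negPf cn0).
move=> Wn0; rewrite size_mul //; move: Wn0; rewrite -size_poly_gt0; size_lia.
Qed.

Variable f : {poly {poly K}}.
Hypotheses (fm : f \is monic) (f1 : (1 < size f)%N)
  (firr : forall g h, g \is monic -> h \is monic -> f = g * h -> size g = 1%N \/ size g = size f).

Let fn0 : f != 0. Proof. exact: monic_neq0. Qed.

(** The greatest common divisor divides a constant multiple of [f]; by Gauss' lemma its size is that
    of a monic factor of [f], and irreducibility leaves two sizes. *)
Lemma coprime_or_dvd g : coprimep f g \/ f %| g.
Proof.
have /Pdiv.Idomain.dvdpP [[c w] /= cn0 E] := Pdiv.Idomain.dvdp_gcdl f g.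
have [g1 [h1 [gm hm fE sg]]] := monic_factor fm cn0 (etrans E (mulrC _ _)).
case: (firr gm hm fE) => s; first by left; rewrite Pdiv.Idomain.coprimep_def -sg s.
right; have : gcdp f g %= f.
  by rewrite -Pdiv.Idomain.dvdp_size_eqp ?Pdiv.Idomain.dvdp_gcdl // -sg s.
by rewrite Pdiv.Idomain.eqp_sym => /Pdiv.Idomain.eqp_dvdl ->; apply: Pdiv.Idomain.dvdp_gcdr.
Qed.

Definition in_ideal g : Prop := exists w, g = w * f.

Lemma in_idealP g : in_ideal g <-> f %| g.
Proof.
split; last exact: monic_dvd.
by case=> w ->; apply: Pdiv.Idomain.dvdp_mull.
Qed.

Lemma in_ideal_prime g h : in_ideal (g * h) -> in_ideal g \/ in_ideal h.
Proof.
move=> /in_idealP H; case: (coprime_or_dvd g) => [cop|]; last by left; apply/in_idealP.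
by right; apply/in_idealP; rewrite -(Pdiv.Idomain.Gauss_dvdpr _ cop).
Qed.

Lemma in_idealN1 : ~ in_ideal 1.
Proof.
case=> w E; have wn0 : w != 0 by apply: contraTneq (oner_neq0 {poly {poly K}}) => w0; rewrite E w0 mul0r eqxx.
have := congr1 (fun p : {poly {poly K}} => size p) E; rewrite size_poly1 size_mul //.
by move: wn0 f1; rewrite -size_poly_gt0; size_lia.
Qed.

Lemma in_ideal_const c : in_ideal c%:P -> c = 0.
Proof.
case=> w E; apply/eqP; apply: contrapT => /negP cn0.
have wn0 : w != 0.
  by apply: contraNneq cn0 => w0; move: E; rewrite w0 mul0r => /eqP; rewrite polyC_eq0.
have := congr1 (fun p : {poly {poly K}} => size p) E; rewrite size_polyC cn0 size_mul //.
by move: wn0 f1; rewrite -size_poly_gt0; size_lia.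
Qed.

Definition prime_set (J : {poly {poly K}} -> Prop) : Prop :=
  [/\ J 0, ~ J 1, forall a u v, J u -> J v -> J (a * u + v) &
      forall u v, J (u * v) -> J u \/ J v].

(** The ring modulo [f] has dimension one. [J1] contains a nonconstant [p] in the first variable,
    and modulo [p] leading coefficients outside [J1] are invertible. So a smallest element of [J2]
    outside [J1] may be taken monic, and dividing a smallest monic element of [J1] by it is
    contradictory. This is division with remainder over a residue field that is never formed. *)
Lemma no_chain (J1 J2 : {poly {poly K}} -> Prop) : prime_set J1 -> prime_set J2 ->
  (forall u, in_ideal u -> J1 u) -> ~ (forall u, J1 u -> in_ideal u) ->
  (forall u, J1 u -> J2 u) -> forall u, J2 u -> J1 u.
Proof.
move=> [J10 J1n J1l J1p] [J20 J2n J2l J2p] IJ NJ J12 z0 z0J2; apply: contrapT => z0J1.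
have J1M a u : J1 u -> J1 (a * u) by move=> Hu; rewrite -[a * u]addr0; apply: J1l.
have J1D u v : J1 u -> J1 v -> J1 (u + v) by move=> Hu Hv; rewrite -[u]mul1r; apply: J1l.
have J2M a u : J2 u -> J2 (a * u) by move=> Hu; rewrite -[a * u]addr0; apply: J2l.
have J2D u v : J2 u -> J2 v -> J2 (u + v) by move=> Hu Hv; rewrite -[u]mul1r; apply: J2l.
have [g [gJ ng]] : exists g, J1 g /\ ~ in_ideal g.
  by apply: contrapT => N; apply: NJ => u Hu; apply: contrapT => Nu; apply: N; exists u.
have [c [cn0 cJ]] : exists c, c != 0 /\ J1 c%:P.
  case: (coprime_or_dvd g) => [/Pdiv.Idomain.Bezout_coprimepP [[u v] /= E]|/in_idealP] //.
  have : size (u * f + v * g) == 1%N by rewrite -Pdiv.Idomain.size_poly_eq1 // in E *.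
  move=> /size_poly1P [c cn0 cE]; exists c; split=> //; rewrite -cE.
  by apply: J1D; apply: J1M => //; apply: IJ; exists 1; rewrite mul1r.
pose P n := `[< exists c, [/\ c != 0, J1 c%:P & size c = n] >].
have exP : exists n, P n by exists (size c); apply/asboolP; exists c.
have [n /asboolP [p [pn0 pJ sp]] minp] := ex_minnP exP => {c cn0 cJ exP}.
have small c : c != 0 -> J1 c%:P -> (size p <= size c)%N.
  by move=> cn0 cJ; rewrite sp; apply: minp; apply/asboolP; exists c.
have p1 : (1 < size p)%N.
  rewrite ltnNge; apply/negP => /const_poly [a pa].
  have an0 : a != 0 by apply: contraNneq pn0 => a0; rewrite pa a0.
  apply: J1n; suff -> : 1 = (a^-1%:P)%:P * p%:P :> {poly {poly K}} by apply: J1M.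
  by rewrite pa -!polyCM mulVf.
have inv c : ~ J1 c%:P -> exists a b, a * c + b * p = 1.
  move=> nc; suff /Bezout_eq1_coprimepP [[a b] E] : coprimep c p by exists a, b.
  rewrite coprimep_def; apply: contrapT => ne1.
  have en0 : gcdp c p != 0 by rewrite gcdp_eq0 (negPf pn0) andbF.
  have e1 : (1 < size (gcdp c p))%N by move: en0 ne1; rewrite -size_poly_gt0; case: (size _) => [|[]].
  have pE : p = (p %/ gcdp c p) * gcdp c p by rewrite divpK // dvdp_gcdr.
  have qn0 : p %/ gcdp c p != 0 by apply: contraNneq pn0 => q0; rewrite pE q0 mul0r.
  have := pJ; rewrite pE polyCM => /J1p [] H.
    have := small _ qn0 H; rewrite {1}pE size_mul //; move: e1 qn0; rewrite -size_poly_gt0; size_lia.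
  by apply: nc; rewrite -(divpK (dvdp_gcdl c p)) polyCM; apply: J1M.
pose Q n := `[< exists z, [/\ J2 z, ~ J1 z & size z = n] >].
have exQ : exists n, Q n by exists (size z0); apply/asboolP; exists z0.
have [s /asboolP [z [zJ2 zJ1 sz]] minz] := ex_minnP exQ => {exQ}.
have smallz v : J2 v -> (size v < size z)%N -> J1 v.
  move=> vJ2 sv; apply: contrapT => vJ1; move: sv; rewrite ltnNge => /negP; apply.
  by rewrite sz; apply: minz; apply/asboolP; exists v.
have zn0 : z != 0 by apply: contraPneq zJ1 => ->; case.
have szS : size z = (size z).-1.+1 by rewrite prednK // size_poly_gt0.
have lzJ1 : ~ J1 (lead_coef z)%:P.
  move=> lJ; apply: zJ1; pose v := z - (lead_coef z)%:P * 'X^((size z).-1).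
  have E : z = v + (lead_coef z)%:P * 'X^((size z).-1) by rewrite subrK.
  have lJ' : J1 ((lead_coef z)%:P * 'X^((size z).-1)) by rewrite mulrC; apply: J1M.
  rewrite E; apply: J1D => //; apply: smallz.
    by rewrite /v -mulN1r; apply: J2D => //; apply: J2M; apply: J12.
  rewrite [X in (_ < X)%N]szS ltnS; apply/leq_sizeP => j; rewrite leq_eqVlt => /orP[/eqP <-|Hj].
    by rewrite coefB coefCM coefXn eqxx mulr1 subrr.
  rewrite coefB coefCM coefXn gtn_eqF // mulr0 subr0 nth_default //; by rewrite szS.
have {lzJ1} [a [b ab]] := inv _ lzJ1.
(* Adding an element of [J1] makes the leading coefficient equal to [a * lead_coef z + b * p = 1]
   without changing the size. *)
pose y := a%:P * z + (b * p)%:P * 'X^((size z).-1).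
have pJ' : J1 ((b * p)%:P * 'X^((size z).-1)) by rewrite mulrC polyCM; apply: (J1M); apply: J1M.
have yJ2 : J2 y by apply: J2D; [apply: J2M|apply: J12].
have yJ1 : ~ J1 y.
  move=> H; have : J1 (a%:P * z).
    have -> : a%:P * z = y + (-1) * ((b * p)%:P * 'X^((size z).-1)) by rewrite mulN1r addrK.
    by apply: J1D => //; apply: J1M.
  case/J1p => // aJ; apply: J1n; have -> : 1 = (a * lead_coef z + b * p)%:P :> {poly {poly K}} by rewrite ab.
  rewrite polyCD; apply: J1D.
    by rewrite mulrC polyCM; apply: J1M.
  by rewrite polyCM; apply: J1M.
have sy : (size y <= size z)%N.
  apply/leq_sizeP => j Hj; rewrite coefD !coefCM coefXn nth_default // mulr0 add0r.
  by rewrite gtn_eqF ?mulr0 // -szS.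
have ytop : y`_(size z).-1 = 1.
  by rewrite coefD !coefCM coefXn eqxx mulr1 -lead_coefE ab.
have sy' : size y = size z.
  apply/eqP; rewrite eqn_leq sy szS; apply: contraT; rewrite -leqNgt => /leq_sizeP /(_ _ (leqnn _)).
  by rewrite ytop => /eqP; rewrite oner_eq0.
have ym : y \is monic by apply/monicP; rewrite lead_coefE sy'.
pose G n := `[< exists g, [/\ J1 g, g \is monic & size g = n] >].
have exG : exists n, G n.
  by exists (size f); apply/asboolP; exists f; split=> //; apply: IJ; exists 1; rewrite mul1r.
have [t /asboolP [h [hJ hm sh]] minh] := ex_minnP exG => {exG}.
have hE := Pdiv.RingMonic.rdivp_eq ym h.
set q := Pdiv.CommonRing.rdivp h y in hE; set r := Pdiv.CommonRing.rmodp h y in hE.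
have sr : (size r < size y)%N by rewrite Pdiv.CommonRing.ltn_rmodp; apply: monic_neq0.
have rJ : J1 r.
  apply: smallz; last by rewrite -sy'.
  have -> : r = h + (- q) * y by rewrite hE mulNr addrC addKr.
  by apply: J2D; [apply: J12|apply: J2M].
have qy : J1 (q * y).
  have -> : q * y = h + (-1) * r by rewrite hE mulN1r addrK.
  by apply: J1D => //; apply: J1M.
case/J1p: qy => // qJ.
have y1 : (1 < size y)%N.
  rewrite ltnNge; apply/negP => /const_poly [e ye]; apply: J2n.
  suff <- : y = 1 by [].
  by move: ym; rewrite ye monicE lead_coefC => /eqP ->.
have hn0 : h != 0 by apply: monic_neq0.
case: (ltnP (size h) (size y)) => shy.
  have q0 : q = 0 by rewrite /q Pdiv.CommonRing.rdivp_small.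
  (* [h] would be a monic element of [J1] smaller than [y] *)
  pose v := y - 'X^(size y - size h) * h.
  have sv : (size v < size z)%N.
    rewrite -sy' -[X in (_ < X)%N](@prednK (size y)) ?size_poly_gt0 ?monic_neq0 // ltnS.
    apply/leq_sizeP => j; rewrite leq_eqVlt => /orP[/eqP <-|Hj]; rewrite coefB coefXnM.
      have -> : ((size y).-1 < size y - size h)%N = false.
        by move: shy y1; have := hn0; rewrite -size_poly_gt0; size_lia.
      have -> : ((size y).-1 - (size y - size h) = (size h).-1)%N.
        by move: shy y1; have := hn0; rewrite -size_poly_gt0; size_lia.
      by rewrite -!lead_coefE (eqP ym) (eqP hm) subrr.
    rewrite nth_default; last by move: Hj; size_lia.
    case: ifP => [_|/negbT]; first by rewrite subrr.
    rewrite -leqNgt => Hj'; rewrite nth_default ?subrr //.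
    by move: Hj Hj' shy; size_lia.
  apply: yJ1; have -> : y = v + 'X^(size y - size h) * h by rewrite subrK.
  apply: J1D; last exact: J1M.
  apply: smallz sv; rewrite /v -mulN1r; apply: J2D => //.
  by apply: (J2M); apply: (J2M); apply: J12.
have qn0 : q != 0.
  by apply: contraTneq shy => q0; rewrite -ltnNge hE q0 mul0r add0r.
have sqy : (size r < size (q * y)%R)%N.
  apply: (leq_trans sr); rewrite size_mul // ?monic_neq0 //.
  by move: qn0; rewrite -size_poly_gt0; size_lia.
have qm : q \is monic.
  have hl : lead_coef h = lead_coef q by rewrite hE lead_coefDl // lead_coef_Mmonic.
  by rewrite monicE -hl -monicE.
have : (t <= size q)%N by apply: minh; apply/asboolP; exists q.
rewrite -sh; apply/negP; rewrite -ltnNge hE size_polyDl // size_mul // ?monic_neq0 //.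
by move: y1 qn0; rewrite -size_poly_gt0; size_lia.
Qed.

End PlaneCurves.

(** * Points of irreducible plane curves over a large field *)

Section Bivariate.

Variable K : fieldType.

Definition ev2 (P : {poly {poly K}}) (x y : K) : K := P.[y%:P].[x].

Lemma ev2D P Q x y : ev2 (P + Q) x y = ev2 P x y + ev2 Q x y.
Proof. by rewrite /ev2 !hornerD. Qed.
Lemma ev2N P x y : ev2 (- P) x y = - ev2 P x y.
Proof. by rewrite /ev2 !hornerN. Qed.
Lemma ev2M P Q x y : ev2 (P * Q) x y = ev2 P x y * ev2 Q x y.
Proof. by rewrite /ev2 !hornerM. Qed.
Lemma ev2C c x y : ev2 c%:P x y = c.[x].
Proof. by rewrite /ev2 hornerC. Qed.
Lemma ev2X x y : ev2 'X x y = y.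
Proof. by rewrite /ev2 hornerX hornerC. Qed.

Lemma rmorph_ext2 (S : comNzRingType) (f g : {rmorphism {poly {poly K}} -> S}) :
  (forall a, f a%:P%:P = g a%:P%:P) -> f 'X%:P = g 'X%:P -> f 'X = g 'X -> f =1 g.
Proof.
move=> Hc Hx Hy; elim/poly_ind => [|P c IH]; first by rewrite !rmorph0.
rewrite !rmorphD !rmorphM /= IH Hy; congr (_ + _).
elim/poly_ind: c => [|d e IHd]; first by rewrite !rmorph0.
by rewrite polyCD polyCM !rmorphD !rmorphM /= IHd Hx Hc.
Qed.

Lemma rmorph_extm (n : nat) (S : comNzRingType) (f g : {rmorphism {mpoly K[n]} -> S}) :
  (forall a, f a%:MP = g a%:MP) -> (forall i, f 'X_i = g 'X_i) -> f =1 g.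
Proof.
move=> Hc Hx p; rewrite (mpolyE p) !rmorph_sum; apply: eq_bigr => m _ /=.
rewrite -mul_mpolyC !rmorphM /= Hc; congr (_ * _).
rewrite (mpolyXE K (perm.perm_one 'I_n) m) !rmorph_prod; apply: eq_bigr => i _.
by rewrite !rmorphXn /= Hx.
Qed.

Definition psi0 : {rmorphism {poly K} -> {mpoly K[2]}} := horner_eval ('X_(0 : 'I_2)) \o map_poly (@mpolyC 2 K).
Definition psi : {rmorphism {poly {poly K}} -> {mpoly K[2]}} := horner_eval ('X_(1 : 'I_2)) \o map_poly psi0.
Definition phi : {rmorphism {mpoly K[2]} -> {poly {poly K}}} := mmap (polyC \o polyC : K -> {poly {poly K}})
  (fun i : 'I_2 => if i == 0 then 'X%:P else 'X).

Arguments psi0 : simpl never.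
Arguments psi : simpl never.
Arguments phi : simpl never.

Lemma psi0C a : psi0 a%:P = a%:MP.
Proof. by rewrite /psi0 /= map_polyC /= /horner_eval hornerC. Qed.
Lemma psi0X : psi0 'X = 'X_0.
Proof. by rewrite /psi0 /= map_polyX /= /horner_eval hornerX. Qed.
Lemma psiC c : psi c%:P = psi0 c.
Proof. by rewrite /psi /= map_polyC /= /horner_eval hornerC. Qed.
Lemma psiX : psi 'X = 'X_1.
Proof. by rewrite /psi /= map_polyX /= /horner_eval hornerX. Qed.
Lemma phiC a : phi a%:MP = a%:P%:P.
Proof. exact: mmapC. Qed.
Lemma phiX i : phi 'X_i = if i == 0 then 'X%:P else 'X.
Proof. by apply: etrans (mmapX _ _ _) _; rewrite mmap1U. Qed.

Lemma psiK : cancel psi phi.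
Proof.
apply: (@rmorph_ext2 _ (phi \o psi) idfun) => [a||].
- by change (phi (psi a%:P%:P) = a%:P%:P); rewrite psiC psi0C phiC.
- by change (phi (psi 'X%:P) = 'X%:P); rewrite psiC psi0X phiX.
- by change (phi (psi 'X) = 'X); rewrite psiX phiX.
Qed.

Lemma phiK : cancel phi psi.
Proof.
apply: (@rmorph_extm _ _ (psi \o phi) idfun) => [a|i].
  by change (psi (phi a%:MP) = a%:MP); rewrite phiC psiC psi0C.
change (psi (phi 'X_i) = 'X_i); rewrite phiX; case: eqP => [->|ne]; first by rewrite psiC psi0X.
rewrite psiX; congr 'X_[U_(_)]; apply: val_inj => /=; case: i ne => -[|[|//]] Hi ne //.
by case: ne; apply: val_inj.
Qed.

Definition point (x y : K) (i : 'I_2) : K := if i == 0 then x else y.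

Lemma meval_psi P x y : (psi P).@[point x y] = ev2 P x y.
Proof.
apply: (@rmorph_ext2 _ (meval (point x y) \o psi) (horner_eval x \o horner_eval y%:P)) => [a||].
- by change ((psi a%:P%:P).@[point x y] = ev2 a%:P%:P x y); rewrite psiC psi0C mevalC ev2C hornerC.
- by change ((psi 'X%:P).@[point x y] = ev2 'X%:P x y); rewrite psiC psi0X mevalXU ev2C hornerX.
- by change ((psi 'X).@[point x y] = ev2 'X x y); rewrite psiX mevalXU ev2X.
Qed.

Lemma mderivU (i j : 'I_2) : ('X_i : {mpoly K[2]})^`M(j) = (i == j)%:R.
Proof.
rewrite mderivX mnm1E; case: eqP => [->|_]; last by rewrite scale0r.
by rewrite scale1r -{1}[U_(j)%MM]addm0 addmC addmK mpolyX0.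
Qed.

Lemma mderiv_psi P : (psi P)^`M(1 : 'I_2) = psi P^`().
Proof.
elim/poly_ind: P => [|P c IH]; first by rewrite rmorph0 deriv0 rmorph0 mderiv0.
rewrite derivD derivC derivM derivX addr0 mulr1 !rmorphD !rmorphM.
rewrite mderivD mderivM IH psiX mderivU eqxx mulr1 psiC.
suff -> : (psi0 c)^`M(1) = 0 by rewrite addr0.
elim/poly_ind: c => [|d e IHd]; first by rewrite rmorph0 mderiv0.
rewrite rmorphD rmorphM mderivD mderivM IHd mul0r add0r psi0X mderivU mulr0 add0r.
by rewrite psi0C mderivC.
Qed.

Lemma roots_listable (p : {poly K}) : p != 0 -> exists l : seq K, forall x, p.[x] = 0 -> x \in l.
Proof.
have [n] := ubnP (size p); elim: n p => // n IH p sp pn0.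
case: (pselect (exists x, root p x)) => [[x /factor_theorem [q qE]]|N]; last first.
  by exists [::] => x px; case: N; exists x; apply/rootP.
have qn0 : q != 0 by apply: contraNneq pn0 => q0; rewrite qE q0 mul0r.
have [|l Hl] := IH q _ qn0; first by move: sp; rewrite qE size_mul ?polyXsubC_eq0 // size_XsubC addn2.
exists (x :: l) => y; rewrite qE hornerM hornerXsubC inE => /eqP.
by rewrite mulf_eq0 subr_eq0 => /orP[/eqP /Hl ->|->] //; rewrite orbT.
Qed.

(** Largeness provides infinitely many points. Only finitely many of them lie over roots of [c],
    since [f] is monic in the second variable and so has finite fibres. *)
Lemma large_plane (f : {poly {poly K}}) (a s : K) (c : {poly K}) : large K ->
  f \is monic -> (1 < size f)%N ->
  (forall g h, g \is monic -> h \is monic -> f = g * h -> size g = 1%N \/ size g = size f) ->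
  ev2 f a s = 0 -> ev2 f^`() a s != 0 -> c != 0 ->
  exists x y, ev2 f x y = 0 /\ c.[x] != 0.
Proof.
move=> lK fm f1 firr fas dfas cn0.
pose I : {pred {mpoly K[2]}} := fun u => `[< in_ideal f (phi u) >].
have II u : u \in I <-> in_ideal f (phi u) by split=> /asboolP.
have curve : irreducible_curve (fun _ : 'I_1 => psi f).
  exists I; split.
  - move=> u; split=> [/II [w E]|[h ->]].
      exists (fun _ => psi w); rewrite big_ord1 -rmorphM -E; exact/esym/phiK.
    by apply/II; exists (phi (h ord0)); rewrite big_ord1 rmorphM psiK.
  - split; last first.
      move=> u v /II; rewrite rmorphM => /(in_ideal_prime fm firr) [] H; apply/orP; [left|right]; exact/II.
    split; first by apply/II; exists 0; rewrite rmorph0 mul0r.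
    + by apply/negP => /II; rewrite rmorph1; apply: in_idealN1.
    + move=> w u v /II [w1 E1] /II [w2 E2]; apply/II.
      by exists (phi w * w1 + w2); rewrite rmorphD rmorphM E1 E2 mulrDl mulrA.
  - split.
      (* The ideal of the point [(a, s)] is a prime strictly above that of the curve: it contains
         [X - a], whereas a nonzero polynomial in the first variable is no multiple of [f]. *)
      pose J : {pred {mpoly K[2]}} := fun u => ev2 (phi u) a s == 0.
      exists J; split; first split.
      * split; first by rewrite /in_mem /= /J rmorph0 /ev2 !horner0.
          by rewrite /in_mem /= /J rmorph1 /ev2 !hornerE oner_eq0.
        move=> w u v; rewrite /in_mem /= /J rmorphD rmorphM ev2D ev2M => /eqP -> /eqP ->.
        by rewrite mulr0 addr0.
      * by move=> u v; rewrite /in_mem /= /J rmorphM ev2M mulf_eq0.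
      * split; first by move=> u /II [w E]; rewrite /in_mem /= /J E ev2M fas mulr0.
        move=> /(_ (psi ('X - a%:P)%:P)); rewrite /in_mem /= {1}/J psiK ev2C !hornerE subrr eqxx => /(_ isT).
        move=> /II; rewrite psiK => /(in_ideal_const fm f1) /eqP; by rewrite polyXsubC_eq0.
    case=> J1 [J2 [[[J10 J1n J1l] J1p] [[J20 J2n J2l] J2p] [IJ NJ] [J12 N21]]].
    apply: N21 => u uJ2.
    rewrite -[u]phiK.
    apply: (@no_chain K f fm f1 firr (fun u => psi u \in J1) (fun u => psi u \in J2)).
    + split; [by rewrite rmorph0|by rewrite rmorph1; apply/negP| |].
        by move=> w v z Hv Hz; rewrite rmorphD rmorphM; apply: J1l.
      by move=> v z; rewrite rmorphM => /J1p /orP.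
    + split; [by rewrite rmorph0|by rewrite rmorph1; apply/negP| |].
        by move=> w v z Hv Hz; rewrite rmorphD rmorphM; apply: J2l.
      by move=> v z; rewrite rmorphM => /J2p /orP.
    + by move=> v Hv; apply: IJ; apply/II; rewrite psiK.
    + move=> H; apply: NJ => v vJ; apply/II; apply: H; by rewrite phiK.
    + by move=> v; apply: J12.
    + by rewrite phiK.
have sm : on_curve (fun _ : 'I_1 => psi f) (point a s) /\ smooth_at (fun _ : 'I_1 => psi f) (point a s).
  split; first by move=> _; rewrite meval_psi.
  rewrite /smooth_at; congr S; rewrite rank_rV.
  suff -> : (\matrix_(i < 1, j < 2) ((psi f)^`M(j)).@[point a s]) != 0 by [].
  apply: contraNneq dfas => /matrixP /(_ 0 1); rewrite !mxE mderiv_psi meval_psi => ->.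
  by [].
have inf := lK 2 1%N _ curve (ex_intro _ _ sm).
have [l Hl] := roots_listable cn0.
pose fib x := (map_poly (horner_eval x) f : {poly K}).
have fib0 x : fib x != 0.
  by apply: monic_neq0; apply: monic_map.
have fibE x y : (fib x).[y] = ev2 f x y.
  by rewrite /fib /ev2 -[y in LHS](hornerC y x) -/(horner_eval x y%:P) horner_map.
have [r Hr] := choice (fun x => roots_listable (fib0 x)).
have [b [bc nb]] := inf (flatten [seq [seq point x y | y <- r x] | x <- l]).
have bE : b = point (b 0) (b 1).
  apply: funext => -[[|[|//]] Hi]; rewrite /point /=; congr b; exact: val_inj.
have fb : ev2 f (b 0) (b 1) = 0 by have := bc ord0; rewrite bE meval_psi.
exists (b 0), (b 1); split=> //; apply/eqP => cb; apply: nb.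
have {}cb := Hl _ cb; have yr : b 1 \in r (b 0) by apply: Hr; rewrite fibE.
rewrite {1}bE; elim: l cb {Hl} => //= x l IH; rewrite inE => /orP[/eqP <-|/IH H];
  apply/List.in_app_iff; [left|by right].
elim: (r (b 0)) yr => //= y r' IHr; rewrite inE => /orP[/eqP <-|/IHr]; by [left|right].
Qed.

End Bivariate.

Section SubfieldType.

Variables (K : fieldType) (P : K -> Prop).

Definition subfield_set : Prop := subring P /\ forall x, P x -> P x^-1.

Variable subfP : subfield_set.

(** A subfield given by a proposition is packaged as a [fieldType], so that polynomials over it can
    be used. The closure proof is an argument in order that the instances can be attached to the
    predicate. *)
Definition subf_pred (H : subfield_set) : {pred K} := fun x => `[< P x >].

Fact subf_pred_closed : divring_closed (subf_pred subfP).
Proof.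
case: subfP => -[P1 PB PM] PV; split.
- exact/asboolP.
- by move=> x y /asboolP Hx /asboolP Hy; apply/asboolP; apply: PB.
- by move=> x y /asboolP Hx /asboolP Hy; apply/asboolP; apply: PM => //; apply: PV.
Qed.
HB.instance Definition _ := GRing.isDivringClosed.Build K (subf_pred subfP) subf_pred_closed.

Record subf := Subf { subf_val : K; _ : subf_val \in subf_pred subfP }.
HB.instance Definition _ := [isSub for subf_val].
HB.instance Definition _ := [Choice of subf by <:].
HB.instance Definition _ := [SubChoice_isSubIntegralDomain of subf by <:].
HB.instance Definition _ := [SubIntegralDomain_isSubField of subf by <:].

Lemma subf_valP (x : subf) : P (val x).
Proof. by case: x => x /= /asboolP. Qed.

Lemma subf_lift x : P x -> exists y : subf, val y = x.
Proof. by move=> /asboolP Px; exists (Subf Px). Qed.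

Lemma subf_poly_lift (p : {poly K}) : (forall i, P p`_i) ->
  exists q : {poly subf}, map_poly val q = p.
Proof.
move=> /(fun H i => subf_lift (H i)) /choice [c Hc].
exists (\poly_(i < size p) c i); apply/polyP => i.
rewrite coef_map coef_poly /= -[RHS]Hc.
by case: ltnP => // /(nth_default 0) E; rewrite Hc E.
Qed.

End SubfieldType.

Section PrimitiveElement.

Variables (F L : fieldType) (iota : {rmorphism F -> L}).
Hypothesis char0 : [pchar F] =i pred0.

Lemma primitive_element (xs : seq L) : (forall x, x \in xs -> algebraicOver iota x) ->
  exists s, algebraicOver iota s /\ forall x, x \in xs -> exists q, (map_poly iota q).[s] = x.
Proof.
elim: xs => [|x xs IH] H.
  by exists (iota 0); split=> //; apply: algebraic_id.
have [s [sa sx]] := IH (fun y Hy => H y (mem_behead (s := x :: xs) Hy)).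
have [p pn0 px] := H x (mem_head _ _); have [q qn0 qs] := sa.
have [n [[r rx] [r' rs]]] := pchar0_PET pn0 px qn0 qs char0.
exists (s *+ n - x); split.
  apply: algebraic_sub; last exact: H (mem_head _ _).
  rewrite -mulr_natl -(rmorph_nat iota); apply: algebraic_mul => //; exact: algebraic_id.
move=> y; rewrite inE => /orP[/eqP ->|/sx [t ty]]; first by exists r.
by exists (t \Po r'); rewrite map_comp_poly horner_comp rs.
Qed.

End PrimitiveElement.

Lemma size_monicM (R : idomainType) (g h : {poly R}) : g \is monic -> h \is monic ->
  size (g * h) = ((size g).-1 + size h)%N.
Proof.
move=> gm hm; rewrite size_Mmonic ?monic_neq0 //.
by have := monic_neq0 gm; rewrite -size_poly_gt0; size_lia.
Qed.

Lemma minimal_monic_irreducible (R : idomainType) (E : {poly R} -> Prop) (p : {poly R}) :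
  (forall g h, E (g * h) -> E g \/ E h) -> E p ->
  (forall h w, h \is monic -> w \is monic -> p = h * w -> E h -> (size p <= size h)%N) ->
  forall g h, g \is monic -> h \is monic -> p = g * h -> size g = 1%N \/ size g = size p.
Proof.
move=> EM Ep minp g h gm hm pE; have := Ep; rewrite pE => /EM [] H.
  right; rewrite -pE; apply/eqP; rewrite eqn_leq (minp g h) // andbT pE size_monicM //.
  have := monic_neq0 gm; have := monic_neq0 hm; rewrite -!size_poly_gt0; size_lia.
left; have := minp h g hm gm (etrans pE (mulrC _ _)) H; rewrite pE size_monicM //.
have := monic_neq0 gm; have := monic_neq0 hm; rewrite -!size_poly_gt0; size_lia.
Qed.

(** * The curve through a tuple of transcendence degree one *)

Section CurveThrough.

Variables (F0 K : fieldType) (iota : {rmorphism F0 -> K}) (a : K).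
Hypotheses (char0 : forall n, n.+1%:R != 0 :> K) (lK : large K).
Hypothesis transc : forall p : {poly F0}, (map_poly iota p).[a] = 0 -> p = 0.

Notation at_a p := ((map_poly iota p).[a]).

Lemma at_aM (p q : {poly F0}) : at_a (p * q) = at_a p * at_a q.
Proof. by rewrite rmorphM hornerM. Qed.
Lemma at_aB (p q : {poly F0}) : at_a (p - q) = at_a p - at_a q.
Proof. by rewrite rmorphB hornerD hornerN. Qed.

(** The subfield of [K] generated by [a] over [F0]. *)
Definition rat_in (u : K) : Prop :=
  exists p q : {poly F0}, at_a q != 0 /\ u * at_a q = at_a p.

Lemma rat_in_poly (p : {poly F0}) : rat_in (at_a p).
Proof. by exists p, 1; rewrite rmorph1 hornerC oner_eq0 mulr1. Qed.

Lemma rat_in_subfield : subfield_set rat_in.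
Proof.
split; first split.
- by have := rat_in_poly 1; rewrite rmorph1 hornerC.
- move=> x y [p [q [qn0 E]]] [p' [q' [qn0' E']]]; exists (p * q' - p' * q), (q * q').
  by rewrite at_aB !at_aM mulf_neq0 // -E -E'; split=> //; ring.
- move=> x y [p [q [qn0 E]]] [p' [q' [qn0' E']]]; exists (p * p'), (q * q').
  by rewrite !at_aM mulf_neq0 // -E -E'; split=> //; ring.
- move=> x [p [q [qn0 E]]]; case: (eqVneq x 0) => [->|xn0].
    by rewrite invr0; have := rat_in_poly 0; rewrite rmorph0 horner0.
  by exists q, p; rewrite -E mulf_neq0 //; split=> //; rewrite mulKf.
Qed.

Definition ev0 (P : {poly {poly F0}}) (x y : K) : K := ev2 (map_poly (map_poly iota) P) x y.

Lemma ev0D P Q x y : ev0 (P + Q) x y = ev0 P x y + ev0 Q x y.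
Proof. by rewrite /ev0 rmorphD ev2D. Qed.
Lemma ev0N P x y : ev0 (- P) x y = - ev0 P x y.
Proof. by rewrite /ev0 rmorphN ev2N. Qed.
Lemma ev0M P Q x y : ev0 (P * Q) x y = ev0 P x y * ev0 Q x y.
Proof. by rewrite /ev0 rmorphM ev2M. Qed.
Lemma ev0C c x y : ev0 c%:P x y = (map_poly iota c).[x].
Proof. by rewrite /ev0 map_polyC ev2C. Qed.
Lemma ev0X x y : ev0 'X x y = y.
Proof. by rewrite /ev0 map_polyX ev2X. Qed.

Lemma clear_denominators (q : {poly K}) : (forall i, rat_in q`_i) ->
  exists (Q : {poly {poly F0}}) (d : {poly F0}), at_a d != 0 /\
    (forall t, ev0 Q a t = at_a d * q.[t]) /\ (Q = 0 -> q = 0).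
Proof.
elim/poly_ind: q => [|q c IH] H.
  exists 0, 1; rewrite rmorph1 hornerC oner_eq0; split=> //; split=> // t.
  by rewrite /ev0 rmorph0 /ev2 !horner0 mulr0.
have [|Q [d [dn0 [Qq Q0]]]] := IH.
  by move=> i; have := H i.+1; rewrite coefD coefMX coefC /= addr0.
have [p [e [en0 E]]] : rat_in c by have := H 0%N; rewrite coefD coefMX coefC /= add0r.
exists (e%:P * Q * 'X + (d * p)%:P), (d * e).
rewrite at_aM mulf_neq0 //; split=> //; split=> [t|].
  rewrite ev0D !ev0M !ev0C ev0X Qq !at_aM hornerD hornerM hornerX hornerC -E; ring.
move=> S0; have {}S0 i : (e%:P * Q * 'X + (d * p)%:P)`_i = 0 by rewrite S0 coef0.
have en0' : e != 0 by apply: contraNneq en0 => ->; rewrite rmorph0 horner0.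
have dn0' : d != 0 by apply: contraNneq dn0 => ->; rewrite rmorph0 horner0.
have -> : q = 0.
  apply: Q0; apply/polyP => i; have := S0 i.+1.
  rewrite coefD coefMX coefC /= addr0 coefCM coef0 => /eqP.
  by rewrite mulf_eq0 (negPf en0') => /eqP.
have := S0 0%N; rewrite coefD coefMX coefC /= add0r => /eqP.
rewrite mulf_eq0 (negPf dn0') => /eqP p0; move: E; rewrite p0 rmorph0 horner0 => /eqP.
by rewrite mulf_eq0 (negPf en0) orbF => /eqP ->; rewrite mul0r add0r.
Qed.

(** With [c] the leading coefficient and [n] the degree of [g], the product [c^(n-1) g(t)] is a
    monic polynomial in [c t]. *)
Lemma monic_scaling (R : idomainType) (g : {poly R}) : (1 < size g)%N -> exists f : {poly R},
  f \is monic /\ forall (S : comNzRingType) (h : {rmorphism R -> S}) t,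
  (map_poly h f).[h (lead_coef g) * t] = h (lead_coef g) ^+ (size g).-2 * (map_poly h g).[t].
Proof.
move=> g1; set n := (size g).-1; set c := lead_coef g.
have sg : size g = n.+1 by rewrite /n prednK //; apply: ltn_trans g1.
have n0 : (0 < n)%N by rewrite -ltnS -sg.
pose f := \poly_(i < n.+1) (if i == n then 1 else g`_i * c ^+ (n.-1 - i)).
have sf : size f = n.+1 by rewrite size_poly_eq // eqxx oner_eq0.
exists f; split; first by apply/monicP; rewrite lead_coefE sf coef_poly ltnSn eqxx.
move=> S h t; rewrite (@horner_coef_wide _ n.+1) ?size_map_poly_le //; last first.
  by apply: leq_trans (size_poly _ _) _; rewrite sf.
rewrite (@horner_coef_wide _ n.+1); last first.
  by apply: leq_trans (size_poly _ _) _; rewrite sg.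
rewrite mulr_sumr; apply: eq_bigr => -[i Hi] _ /=.
rewrite !coef_map coef_poly Hi; case: eqP => [->|ne].
  rewrite [X in X * _](_ : _ = 1); last exact: (rmorph1 h).
  rewrite mul1r exprMn mulrA; congr (_ * _).
  by rewrite -[n in LHS](prednK n0) exprSr /c lead_coefE -/n.
have Hi' : (i <= n.-1)%N by move: Hi ne n0; lia.
rewrite [X in X * _](_ : _ = h g`_i * h c ^+ (n.-1 - i)); last first.
  by apply: (etrans (rmorphM h _ _)); congr (_ * _); apply: rmorphXn.
by rewrite exprMn -[in RHS](subnK Hi') exprD; ring.
Qed.

Definition at_a_mor : {rmorphism {poly F0} -> K} := horner_eval a \o map_poly iota.

Lemma ev0_at P y : ev0 P a y = (map_poly at_a_mor P).[y].
Proof.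
elim/poly_ind: P => [|P c IH]; first by rewrite /ev0 !rmorph0 /ev2 !horner0.
rewrite ev0D ev0M ev0C ev0X IH.
have -> : map_poly at_a_mor (P * 'X + c%:P) = map_poly at_a_mor P * 'X + (at_a_mor c)%:P.
  apply: (etrans (rmorphD (map_poly at_a_mor) _ _)); congr (_ + _); last exact: map_polyC.
  apply: (etrans (rmorphM (map_poly at_a_mor) _ _)); congr (_ * _); exact: map_polyX.
by rewrite !hornerE.
Qed.

(** The tuple is a rational function of a point [(a, s)] of a plane curve, where [s] is a primitive
    element made integral. Every relation over [F0] that holds at [(a, s)] is a multiple of the
    minimal monic polynomial [f], hence holds on the whole curve. *)
Lemma curve_param m (v : 'I_m -> K) :
  (forall j, exists p : {poly K}, [/\ p != 0, forall i, rat_in p`_i & p.[v j] = 0]) ->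
  exists s (Q : 'I_m -> {poly {poly F0}}) (e : {poly F0}),
    [/\ at_a e != 0, forall j, ev0 (Q j) a s = at_a e * v j &
      forall c : {poly K}, c != 0 -> exists x y, c.[x] != 0 /\
        forall G, ev0 G a s = 0 -> ev0 G x y = 0].
Proof.
move=> alg; pose F := subf rat_in_subfield.
have pcharF : [pchar F] =i pred0.
  move=> p; apply/negP => /andP[pp /eqP p0].
  have : val (p%:R : F) = 0 by rewrite p0 rmorph0.
  by rewrite rmorph_nat => /eqP; case: p pp {p0} => // p _; apply/negP; apply: char0.
have [s0 [[g gn0 gs] sv]] : exists s, algebraicOver (\val : F -> K) s /\
    forall x, x \in codom v -> exists q : {poly F}, (map_poly val q).[s] = x.
  apply: primitive_element => // x /codomP [j ->].
  have [p [pn0 pin pv]] := alg j; have [q qE] := subf_poly_lift rat_in_subfield pin.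
  exists q; last by apply/rootP; rewrite -[X in X.[_]]/(map_poly val q) qE.
  by apply: contraNneq pn0 => q0; rewrite -qE q0 rmorph0.
have [|G0 [d0 [d0n0 [G0E G00]]]] := @clear_denominators (map_poly val g).
  by move=> i; rewrite coef_map; apply: subf_valP.
have G0n0 : G0 != 0.
  by apply: contraNneq gn0 => /G00 /eqP; rewrite map_poly_eq0.
have G0s : ev0 G0 a s0 = 0 by rewrite G0E (rootP gs) mulr0.
have G01 : (1 < size G0)%N.
  rewrite ltnNge; apply/negP => /const_poly [b bE]; move: G0s; rewrite bE ev0C => /transc b0.
  by move: G0n0; rewrite bE b0 eqxx.
have [f0 [f0m f0E]] := monic_scaling G01.
set c0 := lead_coef G0 in f0E.
have c0n0 : at_a c0 != 0 by apply: contraNneq G0n0 => /transc c00; rewrite -lead_coef_eq0 -/c0 c00.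
pose s := at_a c0 * s0.
have f0s : ev0 f0 a s = 0.
  by rewrite ev0_at; apply: (etrans (f0E _ at_a_mor s0)); rewrite -ev0_at G0s mulr0.
pose P n := `[< exists f, [/\ f \is monic, ev0 f a s = 0 & size f = n] >].
have exP : exists n, P n by exists (size f0); apply/asboolP; exists f0.
have [n /asboolP [f [fm fs sf]] minf] := ex_minnP exP => {exP}.
have small h : h \is monic -> ev0 h a s = 0 -> (size f <= size h)%N.
  by move=> hm hs; rewrite sf; apply: minf; apply/asboolP; exists h.
have f1 : (1 < size f)%N.
  rewrite ltnNge; apply/negP => /const_poly [b bE]; move: fs; rewrite bE ev0C => /transc b0.
  by move: (monic_neq0 fm); rewrite bE b0 eqxx.
have firr : forall g h, g \is monic -> h \is monic -> f = g * h -> size g = 1%N \/ size g = size f.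
  apply: (@minimal_monic_irreducible _ (fun g => ev0 g a s = 0)) => // [u w|h w hm _ _]; last exact: small.
  by rewrite ev0M => /eqP; rewrite mulf_eq0 => /orP[/eqP|/eqP]; [left|right].
have relG G : ev0 G a s = 0 -> exists w, G = w * f.
  move=> Gs; case: (coprime_or_dvd fm firr G) => [|/(monic_dvd fm)//].
  move=> /Pdiv.Idomain.Bezout_coprimepP [[u w] /= E].
  have : size (u * f + w * G) == 1%N by rewrite -Pdiv.Idomain.size_poly_eq1 // in E *.
  move=> /size_poly1P [c cn0 cE].
  have := congr1 (fun p => ev0 p a s) cE; rewrite ev0D !ev0M fs Gs !mulr0 addr0 ev0C => /esym /transc c00.
  by rewrite c00 eqxx in cn0.
(* Otherwise the derivative, divided by the degree, would be a smaller monic polynomial vanishing at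
   the point. *)
have dfs : ev0 f^`() a s != 0.
  apply/eqP => dfs0.
  have n2 : (size f).-1.-1.+1 = (size f).-1 by case: (size f) f1 => [|[]].
  have n2' : ((size f).-1)%:R != 0 :> F0.
    rewrite -(fmorph_eq0 iota) rmorph_nat; by case: ((size f).-1) n2 => // k _; apply: char0.
  have dn0 : lead_coef f^`() = ((size f).-1)%:R.
    have sd : size f^`() = (size f).-1.
      have lts := lt_size_deriv (monic_neq0 fm).
      apply/eqP; rewrite eqn_leq; apply/andP; split; first by move: lts; size_lia.
      rewrite -n2 ltnNge; apply/negP => /leq_sizeP /(_ _ (leqnn _)).
      rewrite coef_deriv n2 -lead_coefE (eqP fm) => /eqP.
      by rewrite -polyCMn polyC_eq0 (negPf n2').
    by rewrite lead_coefE sd coef_deriv n2 -lead_coefE (eqP fm).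
  pose k : {poly F0} := (((size f).-1)%:R^-1)%:P.
  have km : k%:P * f^`() \is monic.
    apply/monicP; rewrite lead_coefM lead_coefC dn0 /k -polyCMn -polyCM mulVf //.
  have := small _ km; rewrite ev0M dfs0 mulr0 => /(_ erefl).
  rewrite leqNgt => /negP; apply; rewrite mul_polyC size_scale ?polyC_eq0 ?invr_eq0 //.
  exact: lt_size_deriv (monic_neq0 fm).
(* Over [K] the polynomial may split. A smallest monic factor through [(a, s)] is irreducible, and
   still smooth there because the derivative of [f] does not vanish. *)
pose fK := map_poly (map_poly iota) f.
have fKm : fK \is monic by apply: monic_map.
have fKs : ev2 fK a s = 0 by [].
pose P1 n := `[< exists g h, [/\ g \is monic, h \is monic, fK = g * h, ev2 g a s = 0 & size g = n] >].
have exP1 : exists n, P1 n.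
  by exists (size fK); apply/asboolP; exists fK, 1; rewrite mulr1 monic1.
have [n1 /asboolP [g1 [h1 [gm hm gE gs1 sg]]] ming] := ex_minnP exP1 => {exP1}.
have girr : forall g h, g \is monic -> h \is monic -> g1 = g * h -> size g = 1%N \/ size g = size g1.
  apply: (@minimal_monic_irreducible _ (fun g => ev2 g a s = 0)) => // [u w|u w gm' wm E gs'].
    by rewrite ev2M => /eqP; rewrite mulf_eq0 => /orP[/eqP|/eqP]; [left|right].
  rewrite sg; apply: ming; apply/asboolP; exists u, (w * h1); split=> //; first by rewrite monicMr.
  by rewrite gE E mulrA.
have g11 : (1 < size g1)%N.
  rewrite ltnNge; apply/negP => /const_poly [b bE]; have := gs1.
  move: (gm); rewrite bE monicE lead_coefC => /eqP b1.
  by rewrite b1 ev2C hornerC => /eqP; rewrite oner_eq0.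
have dgs : ev2 g1^`() a s != 0.
  have : ev2 fK^`() a s != 0 by rewrite /fK deriv_map.
  by rewrite gE derivM ev2D !ev2M gs1 mul0r addr0 mulf_eq0 => /norP [].
have c0V : rat_in (at_a c0)^-1 by apply: rat_in_subfield.2; apply: rat_in_poly.
have [kap kapE] := subf_lift rat_in_subfield c0V.
have HQ j : exists (Q : {poly {poly F0}}) (d : {poly F0}), at_a d != 0 /\ ev0 Q a s = at_a d * v j.
  have [q qv] := sv (v j) (codom_f v j).
  have [|Q [d [dn0 [QE _]]]] := @clear_denominators (map_poly val (q \Po (kap *: 'X))).
    by move=> i; rewrite coef_map; apply: subf_valP.
  exists Q, d; split=> //; rewrite QE map_comp_poly horner_comp.
  rewrite (_ : (map_poly _ (kap *: 'X)).[s] = s0) ?qv //.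
  rewrite map_polyZ hornerZ (_ : (map_poly _ 'X).[s] = s).
    by apply: (etrans _ (mulKf c0n0 s0)); congr (_ * _); exact: kapE.
  by rewrite map_polyX hornerX.
have [Q {}HQ] := choice HQ; have [d Hd] := choice HQ.
exists s, (fun j => (\prod_(i | i != j) d i)%:P * Q j), (\prod_i d i); split.
- rewrite rmorph_prod /= -[_.[a]]/(horner_eval a _) rmorph_prod; apply/prodf_neq0 => i _; by case: (Hd i).
- move=> j; rewrite ev0M ev0C (Hd j).2.
  have -> : \prod_i d i = d j * \prod_(i | i != j) d i by rewrite (bigD1 j).
  by rewrite at_aM; ring.
- move=> c cn0; have [x [y [gxy cx]]] := large_plane lK gm g11 girr gs1 dgs cn0.
  exists x, y; split=> // G /relG [w ->]; rewrite ev0M /ev0 -/fK gE !ev2M gxy; ring.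
Qed.

End CurveThrough.

(** * Non-algebraic types in large fields *)

Notation Lr := (sig1 ring_arity).

Definition ring_op (K : fieldType) (f : ring_sym) : ('I_(ring_arity f) -> K) -> K :=
  match f return ('I_(ring_arity f) -> K) -> K with
  | RZero => fun _ => 0
  | ROne => fun _ => 1
  | ROpp => fun a => - a ord0
  | RAdd => fun a => a ord0 + a ord_max
  | RMul => fun a => a ord0 * a ord_max
  end.

Definition Kr (K : fieldType) : structure Lr :=
  @Structure Lr (fun _ => K) (@ring_op K) (fun r => match r with end).

Section RingTerms.

Variable V : Type.

Definition rvar (v : V) : Tm Lr V := @Var Lr V (fun _ => tt) v.
Definition rzero : Tm Lr V := @App Lr V (fun _ => tt) RZero (fun i => match notF (ltn_ord i) with end).
Definition rone : Tm Lr V := @App Lr V (fun _ => tt) ROne (fun i => match notF (ltn_ord i) with end).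
Definition ropp (t : Tm Lr V) : Tm Lr V := @App Lr V (fun _ => tt) ROpp (fun _ => t).
Definition radd (t u : Tm Lr V) : Tm Lr V :=
  @App Lr V (fun _ => tt) RAdd (fun i => if val i == 0%N then t else u).
Definition rmul (t u : Tm Lr V) : Tm Lr V :=
  @App Lr V (fun _ => tt) RMul (fun i => if val i == 0%N then t else u).

Variables (K : fieldType) (e : V -> univ (Kr K)).

Lemma ev_var v : ev e (rvar v) = e v. Proof. by []. Qed.
Lemma ev_zero : ev e rzero = 0 :> K. Proof. by []. Qed.
Lemma ev_one : ev e rone = 1 :> K. Proof. by []. Qed.
Lemma ev_opp t : ev e (ropp t) = - (ev e t : K). Proof. by []. Qed.
Lemma ev_add t u : ev e (radd t u) = (ev e t : K) + ev e u. Proof. by []. Qed.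
Lemma ev_mul t u : ev e (rmul t u) = (ev e t : K) * ev e u. Proof. by []. Qed.
Definition evE := (ev_var, ev_zero, ev_one, ev_opp, ev_add, ev_mul).

End RingTerms.

Lemma ring_term_ind V (P : Tm Lr V -> Prop) :
  (forall v, P (rvar v)) -> P (rzero V) -> P (rone V) -> (forall t, P t -> P (ropp t)) ->
  (forall t u, P t -> P u -> P (radd t u)) -> (forall t u, P t -> P u -> P (rmul t u)) ->
  forall t, P t.
Proof.
move=> Hv H0 H1 Ho Ha Hm t.
pose Q (u : unit) : @term Lr V (fun _ => tt) u -> Prop :=
  match u return @term Lr V (fun _ => tt) u -> Prop with tt => P end.
suff H : forall u (t : @term Lr V (fun _ => tt) u), Q u t by exact: (H tt t).
move=> u {}t; elim: t => [v|f args IH] /=; first exact: Hv.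
case: f args IH => args IH.
- suff -> : @App Lr V (fun _ => tt) RZero args = rzero V by [].
  by congr App; apply: functional_extensionality_dep => -[].
- suff -> : @App Lr V (fun _ => tt) ROne args = rone V by [].
  by congr App; apply: functional_extensionality_dep => -[].
- suff -> : @App Lr V (fun _ => tt) ROpp args = ropp (args ord0) by apply: Ho; apply: IH.
  by congr App; apply: functional_extensionality_dep => i; congr args; apply: val_inj; case: i => -[].
- suff -> : @App Lr V (fun _ => tt) RAdd args = radd (args ord0) (args ord_max) by apply: Ha; apply: IH.
  congr App; apply: functional_extensionality_dep => -[[|[|//]] Hi]; congr args; exact: val_inj.
- suff -> : @App Lr V (fun _ => tt) RMul args = rmul (args ord0) (args ord_max) by apply: Hm; apply: IH.
  congr App; apply: functional_extensionality_dep => -[[|[|//]] Hi]; congr args; exact: val_inj.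
Qed.

Section LargeMove.

Variable K : fieldType.
Hypotheses (char0 : forall n, n.+1%:R != 0 :> K) (lK : large K).

Lemma cl_subfield (B : K -> Prop) : subfield_set (cl B).
Proof.
split; first exact: cl_subring.
move=> x Cx D dD DB; case: (eqVneq x 0) => [->|xn0]; first by rewrite invr0 der0.
have : D (x * x^-1) = 0 by rewrite mulfV // der1.
by rewrite dD.2 // (Cx D dD DB) mul0r add0r => /eqP; rewrite mulf_eq0 (negPf xn0) => /eqP.
Qed.

Lemma map_hornerM (F0 : fieldType) (iota : {rmorphism F0 -> K}) (p q : {poly F0}) x :
  (map_poly iota (p * q)).[x] = (map_poly iota p).[x] * (map_poly iota q).[x].
Proof. by rewrite rmorphM hornerM. Qed.

(** A maximal set [I] of coordinates over which [v ord0] remains transcendental makes, by exchange,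
    all coordinates algebraic over [F0(v ord0)], with [F0] the closure of [E] and [I]. The tuple
    then moves along a curve over [F0], and the equations between its coordinates move along. *)
Lemma large_move n (v : 'I_n.+1 -> K) (E : K -> Prop) (l : seq K) : ~ cl E (v ord0) ->
  exists v' : 'I_n.+1 -> K, [/\ forall j, E (v j) -> v' j = v j, v' ord0 \notin l &
    forall t u : Tm Lr 'I_n.+1, ev (M := Kr K) v t = ev (M := Kr K) v u ->
      ev (M := Kr K) v' t = ev (M := Kr K) v' u].
Proof.
move=> NE.
pose B (I : {set 'I_n.+1}) x := E x \/ exists i, i \in I /\ x = v i.
pose P (I : {set 'I_n.+1}) := `[< ~ cl (B I) (v ord0) >].
have P0 : P set0.
  by apply/asboolP => C; apply: NE; apply: cl_mono C => x [//|[i []]]; rewrite inE.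
have [I /asboolP NI maxI] : exists2 I, P I & forall J, P J -> (#|J| <= #|I|)%N.
  by case: (@arg_maxnP _ set0 P (fun J => #|J|) P0) => I PI HI; exists I.
have clj j : cl (fun z => B I z \/ z = v ord0) (v j).
  case: (boolP (j \in I)) => jI; first by apply: cl_in; left; right; exists j.
  apply: (@cl_exchange K (B I) (v j) (v ord0)) NI.
  apply: contrapT => N; have /maxI : P (j |: I).
    apply/asboolP => C; apply: N; apply: cl_mono C => x [Ex|[i [+ ->]]]; first by left; left.
    by rewrite !inE => /orP[/eqP ->|iI]; [right|left; right; exists i].
  by rewrite cardsU1 jI ltnn.
pose F0 := subf (cl_subfield (B I)); pose iota := (\val : {rmorphism F0 -> K}).
pose a := v ord0.
have transc (p : {poly F0}) : (map_poly iota p).[a] = 0 -> p = 0.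
  move=> pa; apply/eqP; apply: contrapT => /negP pn0; apply: NI.
  apply: (@cl_trans K (cl (B I)) (B I)); first by [].
  apply/(cl_alg char0); exists (map_poly iota p); split=> //; first by rewrite map_poly_eq0.
  by move=> i; rewrite coef_map; apply: gen_in; apply: subf_valP.
have lift x : cl (B I) x -> exists y : F0, iota y = x by apply: subf_lift.
have ratB x : cl (B I) x -> rat_in iota a x.
  move=> /lift [y <-]; have := rat_in_poly iota a y%:P.
  by rewrite map_polyC hornerC.
have [|s [Q [e [en0 Qv move_pt]]]] := @curve_param F0 K iota a char0 lK transc _ v.
  move=> j; have /(cl_alg char0) [p [pn0 pin pv]] := clj j; exists p; split=> // i.
  have [[r1 rB rM] _] := rat_in_subfield iota a.
  elim: (pin i) => [x [Bx| ->]||x y _ Hx _ Hy|x y _ Hx _ Hy] ; [exact: ratB (cl_in Bx)| | |exact: rB|exact: rM].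
  - by have := rat_in_poly iota a 'X; rewrite map_polyX hornerX.
  - exact: r1.
pose eK := map_poly iota e.
pose w x y j := ev0 iota (Q j) x y / eK.[x].
have term_curve (t : Tm Lr 'I_n.+1) : exists N (G : {poly {poly F0}}), forall x y, eK.[x] != 0 ->
    (ev (M := Kr K) (w x y) t : K) * eK.[x] ^+ N = ev0 iota G x y.
  elim/ring_term_ind: t => [j|||t [N [G HG]]|t u [N [G HG]] [N' [G' HG']]|t u [N [G HG]] [N' [G' HG']]].
  - by exists 1%N, (Q j) => x y ex; rewrite evE /w expr1 divfK.
  - by exists 0%N, 0%:P => x y _; rewrite evE mul0r ev0C rmorph0 horner0.
  - by exists 0%N, 1%:P => x y _; rewrite evE mul1r expr0 ev0C rmorph1 hornerC.
  - by exists N, (- G) => x y ex; rewrite evE ev0N -HG // mulNr.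
  - exists (N + N')%N, (G * (e ^+ N')%:P + G' * (e ^+ N)%:P) => x y ex.
    rewrite evE ev0D !ev0M -HG // -HG' // !ev0C !rmorphXn !horner_exp -/eK exprD; ring.
  - exists (N + N')%N, (G * G') => x y ex.
    by rewrite evE ev0M -HG // -HG' // exprD; ring.
have wv : w a s = v by apply: funext => j; rewrite /w Qv mulrC mulKf.
(* Excludes the zeros of the common denominator and the listed values. *)
pose c := eK * \prod_(z <- l) ('X - z%:P).
have cn0 : c != 0.
  rewrite mulf_neq0 //; first by apply: contraNneq en0; rewrite -/eK => ->; rewrite horner0.
  by rewrite prodf_seq_neq0; apply/allP => z _ /=; rewrite polyXsubC_eq0.
have [x [y [cx rel]]] := move_pt c cn0.
have ex : eK.[x] != 0 by move: cx; rewrite hornerM mulf_eq0 => /norP [].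
exists (w x y); split.
- move=> j Ej; have [k kv] := lift (v j) (cl_in (or_introl Ej)).
  have kE z : (map_poly iota k%:P).[z] = v j by rewrite map_polyC hornerC; exact: kv.
  have /rel : ev0 iota (Q j - (k%:P * e)%:P) a s = 0.
    by rewrite ev0D ev0N ev0C Qv map_hornerM kE; ring.
  rewrite ev0D ev0N ev0C map_hornerM kE -/eK => /eqP; rewrite subr_eq0 => /eqP E1.
  by rewrite /w E1 mulfK.
- have XE z : (map_poly iota 'X).[z] = z by rewrite map_polyX hornerX.
  have /rel : ev0 iota (Q ord0 - ('X * e)%:P) a s = 0.
    by rewrite ev0D ev0N ev0C Qv map_hornerM XE -/a; ring.
  rewrite ev0D ev0N ev0C map_hornerM XE -/eK => /eqP; rewrite subr_eq0 => /eqP E1.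
  rewrite /w E1 mulfK //; apply: contraNN cx => xl.
  rewrite hornerM mulf_eq0 (_ : (\prod_(z <- l) ('X - z%:P)).[x] == 0) ?orbT //.
  by rewrite -rootE root_prod_XsubC.
- move=> t u tu; have [N [G HG]] := term_curve t; have [N' [G' HG']] := term_curve u.
  have /rel : ev0 iota (G * (e ^+ N')%:P - G' * (e ^+ N)%:P) a s = 0.
    rewrite ev0D ev0N !ev0M -HG // -HG' // !ev0C !rmorphXn !horner_exp -/eK wv tu; ring.
  rewrite ev0D ev0N !ev0M -HG // -HG' // !ev0C !rmorphXn !horner_exp -/eK => /eqP.
  rewrite subr_eq0 -!mulrA -!exprD addnC => /eqP H.
  by apply: mulIf H; rewrite expf_neq0.
Qed.

End LargeMove.

Definition ring_code (f : ring_sym) : nat :=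
  match f with RZero => 0 | ROne => 1 | ROpp => 2 | RAdd => 3 | RMul => 4 end.

Lemma ring_code_inj : injective ring_code. Proof. by do 2!case. Qed.

Section InfinitelyManySolutions.

Variable K : fieldType.
Hypotheses (char0 : forall n, n.+1%:R != 0 :> K) (lK : large K).
Variable T : theory Lr.
Hypotheses (mcT : model_complete T) (KT : model T (Kr K)).
Hypothesis satK : countably_saturated (Kr K).

Notation M := (Kr K).

(** Moving [a] alone would preserve equations only. A whole elementary hull of [e] and [a] is moved
    instead, and model completeness then carries over the formula [p]. *)
Lemma infinitely_many_solutions (V : countType) (e : V -> univ M) (a : K) (p : Fm Lr (option V)) :
  ~ cl (range e) a -> holds (M := M) (oext e a) p ->
  forall l : seq K, exists a' : K, a' \notin l /\ holds (M := M) (oext e a') p.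
Proof.
move=> Ca pa l.
have [en en_surj] : exists en : nat -> Fm Lr (option nat), forall p, exists n, en n = p.
  exact: (@formula_enum _ ring_arity _ ring_code_inj (option nat : countType)).
have [nu [el hit]] := @elem_hull _ _ en M (0 : K) (option V : countType) (oext e a) en_surj.
have [i Hi] := choice hit.
pose ia := i None.
pose lp (j : 'I_(size l)) : univ M := l`_j.
pose emb (o : V + nat) : (V + 'I_(size l)) + nat :=
  match o with inl v => inl (inl v) | inr n => inr n end.
pose G (q : Fm Lr ((V + 'I_(size l)) + nat)) :=
  (exists t u : Tm Lr (V + nat), ev (M := M) (sume e nu) t = ev (M := M) (sume e nu) u /\
     q = ren emb (@Equ Lr _ (fun _ => tt) tt t u)) \/
  (exists j : 'I_(size l), q = Imp (@Equ Lr _ (fun _ => tt) tt (rvar (inr ia)) (rvar (inl (inr j)))) (Bot _)).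
have [|w Hw] := @realize _ _ M (0 : K) satK ((V + 'I_(size l))%type : countType) (nat : countType) (sume e lp) G.
  move=> qs Hqs.
  have [s Hs] : exists s : seq (V + nat), forall q, List.In q qs ->
      forall t u : Tm Lr (V + nat), q = ren emb (@Equ Lr _ (fun _ => tt) tt t u) ->
      forall e1 e2 : V + nat -> univ M, (forall o, o \in s -> e1 o = e2 o) ->
      ev e1 t = ev e1 u -> ev e2 t = ev e2 u.
    elim: qs {Hqs} => [|q qs [s IH]]; first by exists [::].
    case: (pselect (exists t u : Tm Lr (V + nat), q = ren emb (@Equ Lr _ (fun _ => tt) tt t u))) => [[t [u E]]|N]; last first.
      exists s => r /= [<- t u E|/IH //]; by case: N; exists t, u.
    have [s' Hs'] := formula_support (ren emb (@Equ Lr _ (fun _ => tt) tt t u)).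
    exists (s ++ pmap (fun o => match o with inl (inl v) => Some (inl v) | inl (inr _) => None | inr n => Some (inr n) end) s').
    move=> r /= [<-|Hr] t' u' E' e1 e2 He; last first.
      by apply: IH Hr _ _ E' _ _ _ => o Ho; apply: He; rewrite mem_cat Ho.
    pose ex (e' : V + nat -> univ M) (o : (V + 'I_(size l)) + nat) : univ M :=
      match o with inl (inl v) => e' (inl v) | inl (inr j) => lp j | inr n => e' (inr n) end.
    have exE e' : ex e' \o emb = e' by apply: funext => -[].
    have := Hs' M (ex e1) (ex e2); rewrite -E E'.
    have HH e' : @sat Lr M _ (fun _ => tt) (ren emb (@Equ Lr _ (fun _ => tt) tt t' u')) (ex e') <-> ev e' t' = ev e' u'.
      by have := holds_ren emb (@Equ Lr _ (fun _ => tt) tt t' u') (ex e'); rewrite exE.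
    rewrite !HH; case; last by [].
    move=> [[v|j]|n] Hv //=; apply: He; rewrite mem_cat mem_pmap; apply/orP; right; apply/mapP;
      [exists (inl (inl v))|exists (inr n)] => //; exact/In_mem.
  (* Finitely many equations involve finitely many variables; [a] is put at index 0, so the others
     are shifted by one. *)
  pose v (j : 'I_(size s).+1) : K := if val j is j'.+1 then sume e nu (nth (inr ia) s j') else a.
  pose E x := range e x.
  have [|v' [v'E v'l v'rel]] := large_move char0 lK (v := v) (E := E) l; first by [].
  pose r (o : V + nat) : 'I_(size s).+1 := if o == inr ia then ord0 else inord (index o s).+1.
  have vr o : o \in s -> v (r o) = sume e nu o.
    move=> os; rewrite /r /v; case: eqP => [->|_] /=; first by rewrite Hi.
    by rewrite inordK ?ltnS ?index_mem // nth_index.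
  have vria : r (inr ia) = ord0 by rewrite /r eqxx.
  exists (fun n => v' (r (inr n))) => q Hq.
  case: (Hqs q Hq) => [[t [u [tu qE]]]|[j ->]]; last first.
    rewrite /holds /= -/ia vria => E1; move: v'l; rewrite E1.
    by rewrite mem_nth.
  pose e2 (o : V + nat) := if o \in s then v' (r o) else sume e (fun n => v' (r (inr n))) o.
  have e2E : e2 = sume e (fun n => v' (r (inr n))).
    apply: funext => -[x|n]; rewrite /e2 /=; case: ifP => // xs.
    by rewrite v'E vr //; exists x.
  have H1 : ev (M := M) (v \o r) t = ev (M := M) (v \o r) u.
    by apply: (Hs q Hq t u qE (sume e nu)) => // o os; rewrite /= vr.
  have H2 : ev (M := M) (v' \o r) t = ev (M := M) (v' \o r) u.
    have := v'rel (tren r t) (tren r u); rewrite !ev_tren; exact.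
  have H3 := Hs q Hq t u qE (v' \o r) e2 _ H2.
  rewrite qE; apply/holds_ren; apply: (@holds_eq _ _ M _ _ (sume e (fun n => v' (r (inr n))))); first by case.
  by rewrite /holds /= -/(ev _ t) -/(ev _ u) -e2E; apply: H3 => o os; rewrite /e2 os.
have rel (t u : Tm Lr (V + nat)) : ev (M := M) (sume e nu) t = ev (M := M) (sume e nu) u ->
    ev (M := M) (sume e w) t = ev (M := M) (sume e w) u.
  move=> tu; have /Hw /holds_ren : G (ren emb (@Equ Lr _ (fun _ => tt) tt t u)) by left; exists t, u.
  suff -> : sume (sume e lp) w \o emb = sume e w by [].
  by apply: funext => -[].
(* Inequations are preserved as well: a nonzero element of the hull has an inverse in it, and being
   invertible is an equation. *)
have reln (t u : Tm Lr nat) : ev (M := M) nu t = ev (M := M) nu u <-> ev (M := M) w t = ev (M := M) w u.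
  have H t' u' : ev (M := M) nu t' = ev (M := M) nu u' -> ev (M := M) w t' = ev (M := M) w u'.
    by have := rel (tren inr t') (tren inr u'); rewrite !ev_tren.
  split; first exact: H.
  move=> wtu; apply/eqP; apply: contrapT => /negP ne.
  pose z := radd t (ropp u).
  have zn0 : (ev (M := M) nu z : K) != 0 by rewrite !evE subr_eq0.
  pose f : Fm Lr (option nat) := @Equ Lr _ (fun _ => tt) tt (rmul (rvar None) (tren Some z)) (rone _).
  have fE b c : holds (M := M) (oext b c) f <-> (c : K) * ev (M := M) b z = 1.
    change (ev (M := M) (oext b c) (rmul (rvar None) (tren Some z)) = ev (M := M) (oext b c) (rone _) <->
      (c : K) * ev (M := M) b z = 1).
    by rewrite ev_mul ev_var ev_one ev_tren.
  have [|k /fE Hk] := el f ((ev (M := M) nu z : K)^-1); first by apply/fE; rewrite mulVf.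
  have /eqP := H (rmul (rvar k) z) (rone _) Hk.
  rewrite !evE wtu subrr mulr0 eq_sym; exact/negP/oner_neq0.
have EQ := elem_embed el mcT KT KT reln.
exists (w ia); split.
  apply/negP => /(nthP 0) [j Hj E].
  have := Hw _ (or_intror (ex_intro _ (Ordinal Hj) erefl)).
  by apply; rewrite /holds /=; exact: esym E.
have : holds (M := M) nu (ren i p) by apply/holds_ren; apply: holds_eq pa => o; rewrite /= Hi.
move=> /EQ /holds_ren; apply: holds_eq => -[v|] //=.
by have := rel (rvar (inr (i (Some v)))) (rvar (inl v)); rewrite /ev /= => -> //; rewrite Hi.
Qed.

End InfinitelyManySolutions.

(** * Algebraic independence *)

Section AlgebraicFormulas.

Variable V : Type.

Definition poly_term (W : Type) (x : Tm Lr W) (ts : seq (Tm Lr W)) : Tm Lr W :=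
  foldr (fun t u => radd t (rmul x u)) (rzero W) ts.

(** With the coefficient terms fixed, being a root is a single formula; algebraicity is the
    disjunction of these ([cl_alg_rel]). *)
Definition alg_rel (ts : seq (Tm Lr V)) (M : structure Lr) (e : option V -> univ M) : Prop :=
  ev e (poly_term (rvar None) (map (tren Some) ts)) = ev e (rzero _) /\
  exists t, List.In t ts /\ ev e (tren Some t) <> ev e (rzero _).

Lemma alg_rel_defb ts : defb (alg_rel ts).
Proof.
apply: defb_and; first exact: defb_eq.
apply: (@defb_exseq _ _ _ _ (fun t M e => ev e (tren Some t) <> ev e (rzero _))) => t _.
by apply: defb_not; apply: defb_eq.
Qed.

Variable K : fieldType.
Hypothesis char0 : forall n, n.+1%:R != 0 :> K.
Notation M := (Kr K).

Lemma ev_poly_term W (e : W -> univ M) x ts :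
  (ev e (poly_term x ts) : K) = (Poly [seq (ev e t : K) | t <- ts]).[ev e x].
Proof.
elim: ts => [|t ts IH]; first by rewrite horner_Poly.
rewrite [poly_term _ _]/(radd t (rmul x (poly_term x ts))) ev_add ev_mul IH /= horner_cons.
by rewrite addrC mulrC.
Qed.

Lemma genr_term (e : V -> univ M) x : genr (range e) x -> exists t, ev e t = x.
Proof.
elim=> {x} [x [v <-]||x y _ [t <-] _ [u <-]|x y _ [t <-] _ [u <-]].
- by exists (rvar v).
- by exists (rone V).
- by exists (radd t (ropp u)); rewrite ev_add ev_opp.
- by exists (rmul t u); rewrite ev_mul.
Qed.

Lemma term_genr (e : V -> univ M) t : genr (range e) (ev e t : K).
Proof.
have g0 : genr (range e) 0 by rewrite -(subrr 1); apply: gen_B; apply: gen_1.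
elim/ring_term_ind: t => [v|||t Ht|t u Ht Hu|t u Ht Hu].
- by apply: gen_in; exists v.
- exact: g0.
- exact: gen_1.
- by rewrite ev_opp -sub0r; apply: gen_B.
- by rewrite ev_add -[ev e u : K]opprK; apply: gen_B => //; rewrite -sub0r; apply: gen_B.
- by rewrite ev_mul; apply: gen_M.
Qed.

Lemma cl_alg_rel (e : V -> univ M) (x : K) : cl (range e) x <-> exists ts, @alg_rel ts M (oext e x).
Proof.
have some t : ev (M := M) (oext e x) (tren Some t) = ev (M := M) e t by rewrite ev_tren.
have pol ts : (ev (M := M) (oext e x) (poly_term (rvar None) (map (tren Some) ts)) : K) = (Poly [seq (ev (M := M) e t : K) | t <- ts]).[x].
  rewrite ev_poly_term ev_var /= -map_comp; congr (Poly _).[_].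
  by apply: eq_map => t /=; rewrite some.
rewrite (cl_alg char0); split=> [[p [pn0 pin px]]|[ts [E [t [tts tn0]]]]].
  have [f Hf] := choice (fun i => genr_term (pin i)).
  have pE : Poly [seq (ev (M := M) e t : K) | t <- [seq f i | i <- iota 0 (size p)]] = p.
    apply/polyP => i; rewrite coef_Poly -map_comp.
    case: (ltnP i (size p)) => Hi; last by rewrite !nth_default // size_map size_iota.
    by rewrite (nth_map 0%N) ?size_iota // nth_iota //= Hf.
  exists [seq f i | i <- iota 0 (size p)]; split; first by rewrite pol pE px.
  exists (f (size p).-1); split; last by rewrite some Hf -lead_coefE => /eqP; rewrite lead_coef_eq0; apply/negP.
  apply/List.in_map_iff; exists (size p).-1; split=> //; apply/In_mem.
  by rewrite mem_iota add0n /= prednK // size_poly_gt0.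
exists (Poly [seq (ev (M := M) e t : K) | t <- ts]); split; last by rewrite -pol E.
- apply/eqP => P0; apply: tn0; rewrite some.
  have : forall i, (Poly [seq (ev (M := M) e t : K) | t <- ts])`_i = 0 by move=> i; rewrite P0 coef0.
  move=> H; elim: ts tts H {pol E P0} => //= u ts IH [<-|Ht] H.
    by have := H 0%N; rewrite coef_cons.
  by apply: IH => // i; have := H i.+1; rewrite coef_cons.
- move=> i; rewrite coef_Poly.
  case: (ltnP i (size ts)) => Hi; last by rewrite nth_default ?size_map // -(subrr 1); apply: gen_B; apply: gen_1.
  by rewrite (nth_map (rzero V)) //; apply: term_genr.
Qed.

(** The bound does not depend on the parameters; it becomes the number of classes of a label in
    [label_dependent]. *)
Lemma alg_rel_finite ts (e : V -> univ M) : exists l : seq K, (size l <= size ts)%N /\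
  forall x : K, @alg_rel ts M (oext e x) -> x \in l.
Proof.
case: (pselect (exists x : K, @alg_rel ts M (oext e x))) => [[x0 H0]|N]; last first.
  by exists [::]; split=> // x Hx; case: N; exists x.
pose p := Poly [seq (ev (M := M) e t : K) | t <- ts].
have pol x : @alg_rel ts M (oext e x) -> p != 0 /\ p.[x] = 0.
  move=> [E [t [tts tn0]]]; split.
    apply/eqP => P0; apply: tn0; rewrite ev_tren; change (ev (M := M) e t = 0 :> K).
    have : forall i, p`_i = 0 by move=> i; rewrite P0 coef0.
    rewrite /p => H; elim: ts tts H {p E P0 H0} => //= u ts IH [<-|Ht] H.
      by have := H 0%N; rewrite coef_cons.
    by apply: IH => // i; have := H i.+1; rewrite coef_cons.
  rewrite -[RHS]E ev_poly_term ev_var /= -map_comp; congr (Poly _).[_].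
  by apply: eq_map => u /=; rewrite ev_tren.
have [pn0 _] := pol x0 H0.
have sp : (size p <= size ts)%N by apply: leq_trans (size_Poly _) _; rewrite size_map.
suff [l [sl Hl]] : exists l : seq K, (size l < size p)%N /\ forall x, p.[x] = 0 -> x \in l.
  by exists l; split=> [|x /pol [_ /Hl]] //; apply: leq_trans sp; apply: ltnW.
have [n] := ubnP (size p); move: p pn0 {pol sp} => p; elim: n p => // n IH p pn0 sp.
case: (pselect (exists x, root p x)) => [[x /factor_theorem [q qE]]|N]; last first.
  exists [::]; split; first by rewrite size_poly_gt0.
  by move=> x px; case: N; exists x; apply/rootP.
have qn0 : q != 0 by apply: contraNneq pn0 => q0; rewrite qE q0 mul0r.
have sq : size p = (size q).+1 by rewrite qE size_mul ?polyXsubC_eq0 // size_XsubC addn2.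
have [|l [sl Hl]] := IH q qn0; first by rewrite -ltnS -sq.
exists (x :: l); split=> [|y]; first by rewrite sq /= ltnS.
rewrite qE hornerM hornerXsubC inE => /eqP.
by rewrite mulf_eq0 subr_eq0 => /orP[/eqP /Hl ->|->] //; rewrite orbT.
Qed.

Lemma cl_eqv (e e' : V -> univ M) (x x' : K) : eqv (M := M) (N := M) (oext e x) (oext e' x') ->
  cl (range e) x -> cl (range e') x'.
Proof.
move=> E /cl_alg_rel [ts H]; apply/cl_alg_rel; exists ts.
exact: (@eqv_defb _ _ M M (0 : K) (0 : K) _ _ _ _ (alg_rel_defb ts) E H).
Qed.

End AlgebraicFormulas.

Section Independence.

Variable K : fieldType.
Hypothesis char0 : forall n, n.+1%:R != 0 :> K.
Notation M := (Kr K).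

(* Algebraic independence of [y] from [A] over [B], in terms of derivations. *)
Definition indep (B A : K -> Prop) (J : Type) (y : J -> K) : Prop :=
  forall D, der D -> (forall b, B b -> D b = 0) ->
  exists D', [/\ der D', forall b, A b -> D' b = 0 & forall j, D' (y j) = D (y j)].

Lemma indep_trans (B A C : K -> Prop) (J : Type) (y : J -> K) :
  indep B A y -> indep A C y -> indep B C y.
Proof.
move=> H H' D dD DB; have [D1 [d1 D1A E1]] := H D dD DB.
have [D2 [d2 D2A E2]] := H' D1 d1 D1A; exists D2; split=> // j; by rewrite E2 E1.
Qed.

Lemma indep_mono (B A A' : K -> Prop) (J : Type) (y : J -> K) :
  (forall x, A' x -> A x) -> indep B A y -> indep B A' y.
Proof. by move=> s H D dD DB; have [D' [d D'A E]] := H D dD DB; exists D'; split=> // b /s /D'A. Qed.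

Lemma indep_base (B B' A : K -> Prop) (J : Type) (y : J -> K) :
  (forall x, B x -> B' x) -> indep B A y -> indep B' A y.
Proof. by move=> s H D dD DB; apply: H => // b /s /DB. Qed.

Lemma indep_sub (B A : K -> Prop) (J J' : Type) (y : J -> K) (f : J' -> J) :
  indep B A y -> indep B A (y \o f).
Proof. by move=> H D dD DB; have [D' [d D'A E]] := H D dD DB; exists D'; split=> // j; apply: E. Qed.

Definition tr (n : nat) (y : nat -> K) (i : nat) : K := if (i < n)%N then y i else 0.

Definition seq_indep (B A : K -> Prop) (y : nat -> K) : Prop := forall n,
  cl (fun z => A z \/ exists i, (i < n)%N /\ y i = z) (y n) ->
  cl (fun z => B z \/ exists i, (i < n)%N /\ y i = z) (y n).

(** The corrected derivation is built coordinate by coordinate. If [y n] is algebraic over [A] and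
    the earlier coordinates, its derivative is forced, and the criterion makes the forced value the
    right one; otherwise it can be prescribed. The stages agree on an increasing union of closed
    sets, from which the derivation is extended. *)
Lemma seq_indepP (B A : K -> Prop) (y : nat -> K) : (forall x, B x -> A x) ->
  indep B A y <-> seq_indep B A y.
Proof.
move=> BA; split=> [H n C|H D dD DB].
  apply: contrapT => /not_clP [D [dD DB Dy]].
  have [|D' [dD' D'A E]] := H D dD; first by move=> b Bb; apply: DB; left.
  have : D' (y n) = 0.
    apply: C dD' _ => b [Ab|[i [Hi <-]]]; first exact: D'A.
    by rewrite E DB //; right; exists i.
  by rewrite E Dy => /eqP; rewrite oner_eq0.
pose ok n (D' : K -> K) := [/\ der D', forall b, A b -> D' b = 0 & forall i, (i < n)%N -> D' (y i) = D (y i)].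
have step n D1 : ok n D1 -> exists D2, ok n.+1 D2 /\
    forall x, cl (fun z => A z \/ exists i, (i < n)%N /\ y i = z) x -> D2 x = D1 x.
  move=> [d1 D1A D1y]; case: (pselect (cl (fun z => A z \/ exists i, (i < n)%N /\ y i = z) (y n))) => [C|].
    exists D1; split=> //; split=> // i; rewrite ltnS leq_eqVlt => /orP[/eqP ->|/D1y //].
    have dF := der_lin (-1) d1 dD.
    have : D1 (y n) + -1 * D (y n) = 0.
      apply: (H n C _ dF) => b [Bb|[j [Hj <-]]]; first by rewrite (D1A _ (BA _ Bb)) DB // mulr0 addr0.
      by rewrite D1y // mulN1r subrr.
    by rewrite mulN1r => /eqP; rewrite subr_eq0 => /eqP.
  move=> /not_clP [G [dG GA Gy]].
  exists (fun x => D1 x + (D (y n) - D1 (y n)) * G x); split; first split.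
  - exact: der_lin.
  - by move=> b Ab; rewrite D1A // GA ?mulr0 ?addr0 //; left.
  - move=> i; rewrite ltnS leq_eqVlt => /orP[/eqP ->|Hi]; first by rewrite Gy mulr1 addrC subrK.
    by rewrite GA ?mulr0 ?addr0 ?D1y //; right; exists i.
  - by move=> x Cx; rewrite (Cx _ dG GA) mulr0 addr0.
have dz : der (fun _ : K => 0 : K) by split=> *; rewrite ?mul0r ?mulr0 ?addr0.
have ok0 : ok 0%N (fun _ => 0) by split.
have [F HF] : {F : nat * (K -> K) -> K -> K & forall z, ok z.1 z.2 -> ok z.1.+1 (F z) /\
    forall x, cl (fun u => A u \/ exists i, (i < z.1)%N /\ y i = u) x -> F z x = z.2 x}.
  apply: (@choice _ _ (fun z D2 => ok z.1 z.2 -> ok z.1.+1 D2 /\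
    forall x, cl (fun u => A u \/ exists i, (i < z.1)%N /\ y i = u) x -> D2 x = z.2 x)) => -[n D1].
  case: (pselect (ok n D1)) => [/step [D2 H2]|N]; first by exists D2.
  by exists D1.
pose Ds := fix Ds n := if n is m.+1 then F (m, Ds m) else fun _ => 0.
have okD n : ok n (Ds n) by elim: n => [|n IH] //=; case: (HF (n, Ds n) IH).
pose C n := cl (fun z => A z \/ exists i, (i < n)%N /\ y i = z).
have Cmono m n x : (m <= n)%N -> C m x -> C n x.
  move=> mn; apply: cl_mono => z [Az|[i [Hi yi]]]; [by left|right; exists i; split=> //].
  exact: leq_trans mn.
have DsE m n x : (m <= n)%N -> C m x -> Ds n x = Ds m x.
  move=> + Cx; elim: n => [|n IH]; first by rewrite leqn0 => /eqP ->.
  rewrite leq_eqVlt => /orP[/eqP -> //|]; rewrite ltnS => mn.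
  by rewrite -IH //=; case: (HF (n, Ds n) (okD n)) => _; apply; apply: Cmono Cx.
pose R x := exists n, C n x.
pose d x := if pselect (R x) is left h then Ds (sval (cid h)) x else 0.
have dE n x : C n x -> d x = Ds n x.
  move=> Cx; rewrite /d; case: pselect => [h|[]]; last by exists n.
  case: cid => m Cm /=; case: (leqP m n) => [mn|/ltnW nm]; first exact/esym/DsE.
  exact: DsE.
have subR : subring R.
  split; first by exists 0%N; case: (cl_subring (fun z => A z \/ exists i, (i < 0)%N /\ y i = z)).
  - move=> x x' [m Cx] [n Cx']; exists (maxn m n).
    have [_ HB _] := cl_subring (fun z => A z \/ exists i, (i < maxn m n)%N /\ y i = z).
    by apply: HB; [apply: Cmono Cx; apply: leq_maxl|apply: Cmono Cx'; apply: leq_maxr].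
  - move=> x x' [m Cx] [n Cx']; exists (maxn m n).
    have [_ _ HM] := cl_subring (fun z => A z \/ exists i, (i < maxn m n)%N /\ y i = z).
    by apply: HM; [apply: Cmono Cx; apply: leq_maxl|apply: Cmono Cx'; apply: leq_maxr].
have derR : der_on R d.
  split=> x x' [m Cx] [n Cx']; have C1 := Cmono _ _ _ (leq_maxl m n) Cx; have C2 := Cmono _ _ _ (leq_maxr m n) Cx'.
  - rewrite (dE _ _ C1) (dE _ _ C2) (dE (maxn m n)); last exact: (subringD (cl_subring _) C1 C2).
    by have [[DD _] _ _] := okD (maxn m n); rewrite DD.
  - have [_ _ HM] := cl_subring (fun z => A z \/ exists i, (i < maxn m n)%N /\ y i = z).
    by rewrite (dE _ _ C1) (dE _ _ C2) (dE (maxn m n)); [have [[_ DM] _ _] := okD (maxn m n); rewrite DM|apply: HM].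
have [D' [dD' D'E]] := der_extend char0 subR derR.
exists D'; split=> //.
- move=> b Ab; have Cb : C 0%N b by apply: cl_in; left.
  by rewrite D'E ?(dE 0%N) //; exists 0%N.
- move=> j; have Cj : C j.+1 (y j) by apply: cl_in; right; exists j.
  by rewrite D'E ?(dE j.+1) //; [case: (okD j.+1) => _ _ ->|exists j.+1].
Qed.

End Independence.

Section IndependenceTypes.

Variable K : fieldType.
Hypothesis char0 : forall n, n.+1%:R != 0 :> K.
Notation M := (Kr K).

Definition before (J : countType) (y : J -> K) (j : J) (z : K) : Prop :=
  exists i, (pickle i < pickle j)%N /\ y i = z.

(** Numbers that code no index are filled with 0, which every derivation kills. *)
Lemma indepP (J : countType) (B A : K -> Prop) (y : J -> K) : (forall x, B x -> A x) ->
  indep B A y <-> forall j, cl (fun z => A z \/ before y j z) (y j) ->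
                            cl (fun z => B z \/ before y j z) (y j).
Proof.
move=> BA; pose y2 (n : nat) := if @pickle_inv J n is Some j then y j else 0.
have y2j j : y2 (pickle j) = y j by rewrite /y2 pickleK_inv.
have -> : indep B A y <-> indep B A y2.
  split=> H.
    move=> D dD DB; have [D' [dD' D'A E]] := H D dD DB; exists D'; split=> // n.
    by rewrite /y2; case: pickle_inv => [j|]; rewrite ?der0.
  move=> D dD DB; have [D' [dD' D'A E]] := H D dD DB; exists D'; split=> // j.
  by rewrite -y2j E.
rewrite (seq_indepP char0) //.
have s1 (A' : K -> Prop) j z : cl (fun z => A' z \/ exists i, (i < pickle j)%N /\ y2 i = z) z <->
    cl (fun z => A' z \/ before y j z) z.
  split; apply: cl_trans => x [Ax|[i [Hi <-]]]; try by apply: cl_in; left.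
    rewrite /y2; case E: (@pickle_inv J i) => [j'|]; last by move=> D dD _; apply: der0.
    apply: cl_in; right; exists j'; split=> //.
    by have := @pickle_invK J i; rewrite E /= => ->.
  by apply: cl_in; right; exists (pickle i); rewrite y2j.
split=> H; first by move=> j /s1 C; apply/s1; have := H (pickle j); rewrite y2j; apply.
move=> n; case E: (@pickle_inv J n) => [j|]; last first.
  by move=> _ D dD _; rewrite /y2 E der0.
have En : (pickle j : nat) = n.
  move: (@pickle_invK J n).
  by rewrite E.
by rewrite -En y2j => /s1 /H /s1.
Qed.

(** The criterion of [indepP] speaks of algebraicity only, which the type decides. *)
Lemma indep_eqv (V A J : countType) (e e1 : V -> univ M) (a a1 : A -> univ M) (y y1 : J -> univ M) :
  eqv (M := M) (N := M) (sume (sume e a) y) (sume (sume e1 a1) y1) ->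
  indep (range e) (fun z => range e z \/ range a z) (y : J -> K) ->
  indep (range e1) (fun z => range e1 z \/ range a1 z) (y1 : J -> K).
Proof.
have sub (e0 : V -> K) (a0 : A -> K) x : range e0 x -> range e0 x \/ range a0 x by left.
move=> E H0; have {H0} H := iffLR (indepP y (sub e a)) H0; apply/(indepP y1 (sub e1 a1)) => j C.
pose f (o : option (V + A + {i : J | (pickle i < pickle j)%N})) : V + A + J :=
  match o with Some (inl v) => inl v | Some (inr i) => inr (val i) | None => inr j end.
pose g (o : option (V + {i : J | (pickle i < pickle j)%N})) : V + A + J :=
  match o with Some (inl v) => inl (inl v) | Some (inr i) => inr (val i) | None => inr j end.
have rf (e0 : V -> K) (a0 : A -> K) (y0 : J -> K) z :
    range (sume (sume e0 a0) (fun i : {i : J | (pickle i < pickle j)%N} => y0 (val i))) z <->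
    (range e0 z \/ range a0 z) \/ before y0 j z.
  split=> [[[[v|v]|i] <-]|[[[v <-]|[v <-]]|[i [Hi <-]]]] /=.
  - by left; left; exists v.
  - by left; right; exists v.
  - by right; exists (val i); split=> //; apply: (valP i).
  - by exists (inl (inl v)).
  - by exists (inl (inr v)).
  - by exists (inr (exist _ i Hi)).
have rg (e0 : V -> K) (y0 : J -> K) z :
    range (sume e0 (fun i : {i : J | (pickle i < pickle j)%N} => y0 (val i))) z <->
    range e0 z \/ before y0 j z.
  split=> [[[v|i] <-]|[[v <-]|[i [Hi <-]]]] /=.
  - by left; exists v.
  - by right; exists (val i); split=> //; apply: (valP i).
  - by exists (inl v).
  - by exists (inr (exist _ i Hi)).
have H1 : cl (range (sume (sume e a) (fun i : {i : J | (pickle i < pickle j)%N} => y (val i)))) (y j).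
  apply: (@cl_eqv _ K char0 (sume (sume e1 a1) (fun i => y1 (val i))) _ (y1 j)).
    by apply: eqv_ext (eqv_sym (eqv_ren f E)); do ![case=> //].
  by apply: cl_mono C => z /rf.
have H2 : cl (range (sume e (fun i : {i : J | (pickle i < pickle j)%N} => y (val i)))) (y j).
  apply: (@cl_mono _ (fun z => range e z \/ before y j z)); first by move=> z /rg.
  by apply: H; apply: cl_mono H1 => z /rf.
apply: (@cl_mono _ (range (sume e1 (fun i : {i : J | (pickle i < pickle j)%N} => y1 (val i))))); first by move=> z /rg.
apply: (@cl_eqv _ K char0 (sume e (fun i => y (val i))) _ (y j)) H2.
by apply: eqv_ext (eqv_ren g E); do ![case=> //].
Qed.

Hypothesis lK : large K.
Variable T : theory Lr.
Hypotheses (mcT : model_complete T) (KT : model T (Kr K)).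
Hypothesis satK : countably_saturated (Kr K).

(** Every formula of the type has infinitely many solutions, while each algebraic relation over the
    new parameters excludes finitely many. *)
Lemma nonalg_extend (V A : countType) (e e' : V -> univ M) (a : A -> univ M) (y : K) :
  eqv (M := M) (N := M) e e' -> ~ cl (range e) y ->
  exists y' : K, eqv (M := M) (N := M) (oext e y) (oext e' y') /\ ~ cl (range (sume e' a)) y'.
Proof.
move=> E Ny.
have [c0 Hc0] := @eqv_extend _ _ M (0 : K) satK V unit e e' (fun _ => y) E.
have {}Hc0 : eqv (M := M) (N := M) (oext e y) (oext e' (c0 tt)).
  by apply: eqv_ext (eqv_ren (fun o : option V => if o is Some v then inl v else inr tt) Hc0); case.
have Nc0 : ~ cl (range e') (c0 tt) by move=> C; apply: Ny; apply: cl_eqv (eqv_sym Hc0) C.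
pose P (q : Fm Lr (option (V + A))) :=
  (exists p, holds (M := M) (oext e y) p /\ q = ren (omap inl) p) \/
  (exists ts, forall b, holds (M := M) (oext (sume e' a) b) q <-> ~ @alg_rel _ ts M (oext (sume e' a) b)).
have [|b Hb] := satK (V := (V + A : countType)%type) (e := sume e' a) (p := P).
  move=> l Hl.
  suff [p [s [Hp Hs]]] : exists (p : Fm Lr (option V)) (s : seq K), holds (M := M) (oext e y) p /\
      forall b : K, holds (M := M) (oext e' b) p -> b \notin s ->
      forall q, List.In q l -> holds (M := M) (oext (sume e' a) b) q.
    have [b [bs bp]] := infinitely_many_solutions char0 lK mcT KT satK Nc0 (iffLR (Hc0 p) Hp) s.
    by exists b; apply: Hs.
  elim: l Hl => [|q l IH] Hl.
    by exists (@Equ Lr _ (fun _ => tt) tt (rzero _) (rzero _)), [::].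
  have [|p [s [Hp Hs]]] := IH; first by move=> r Hr; apply: Hl; right.
  case: (Hl q (or_introl erefl)) => [[r [Hr ->]]|[ts Hts]].
    have [pr Epr] : defb (fun (M : structure Lr) (e : option V -> univ M) => holds e p /\ holds e r).
      by apply: defb_and; apply: defb_fm.
    exists pr, s; split; first by apply/(Epr M (0 : K)).
    move=> b /(Epr M (0 : K)) [bp br] bs q' /= [<-|]; last exact: Hs.
    by apply/holds_ren; apply: holds_eq br; case.
  have [s' [_ Hs']] := alg_rel_finite ts (sume e' a).
  exists p, (s ++ s'); split=> // b bp; rewrite mem_cat negb_or => /andP[bs bs'] q' /= [<-|]; last exact: Hs.
  by apply/Hts => /Hs' H; rewrite H in bs'.
exists b; split.
  suff H p : holds (M := M) (oext e y) p -> holds (M := M) (oext e' b) p.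
    move=> p; split; first exact: H.
    move=> Hp; apply: contrapT => N.
    exact: (H (Imp p (Bot _)) N Hp).
  move=> Hp; have /holds_ren := Hb (ren (omap inl) p) (or_introl (ex_intro _ p (conj Hp erefl))).
  by apply: holds_eq; case.
move=> /(cl_alg_rel char0) [ts Hts].
have [q Hq] := defb_not (alg_rel_defb ts).
have /(Hq M (0 : K)) := Hb q (or_intror (ex_intro _ ts (fun c => Hq M (0 : K) _))).
by apply.
Qed.

(** Free extension of types: the values are chosen one after the other, non-algebraic over [a]
    whenever the type permits. Padding the tuples with 0 lets all stages use the same variables. *)
Lemma ext_indep_nat (V A : countType) (e e' : V -> univ M) (a : A -> univ M) (y : nat -> univ M) :
  eqv (M := M) (N := M) e e' ->
  exists y' : nat -> univ M, eqv (M := M) (N := M) (sume e y) (sume e' y') /\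
    indep (range e') (fun z => range e' z \/ range a z) (y' : nat -> K).
Proof.
move=> E.
pose T' n (z : nat -> K) : nat -> univ M := tr n z.
pose upd (z : nat -> K) n b := fun i => if i == n then b else z i : K.
pose ok n (z : nat -> K) b :=
  cl (fun x => (range e' x \/ range a x) \/ exists i, (i < n)%N /\ z i = x) b ->
  cl (fun x => range e' x \/ exists i, (i < n)%N /\ z i = x) b.
have rtr n z (B : Type) (f : B -> K) b : cl (range (sume f (T' n z : nat -> K))) b <->
   cl (fun x => range f x \/ exists i, (i < n)%N /\ z i = x) b.
  split; apply: cl_trans => x [].
  - move=> [v|i] /= <-; first by apply: cl_in; left; exists v.
    rewrite /T' /tr; case: ifP => Hi; last by move=> D dD _; apply: der0.
    by apply: cl_in; right; exists i.
  - by move=> [v <-]; apply: cl_in; exists (inl v).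
  - move=> [i [Hi <-]]; apply: cl_in; exists (inr i); by rewrite /= /T' /tr Hi.
have step n z : eqv (M := M) (N := M) (sume e (T' n y)) (sume e' (T' n z)) ->
    exists b, eqv (M := M) (N := M) (sume e (T' n.+1 y)) (sume e' (T' n.+1 (upd z n b))) /\ ok n z b.
  move=> Ez.
  suff [b [Eb okb]] : exists b, eqv (M := M) (N := M) (oext (sume e (T' n y)) (y n)) (oext (sume e' (T' n z)) b) /\ ok n z b.
    exists b; split=> //.
    pose f (o : V + nat) : option (V + nat) := match o with inl v => Some (inl v)
      | inr i => if i == n then None else Some (inr i) end.
    apply: eqv_ext (eqv_ren f Eb) => -[v|i] //=; rewrite /T' /tr /upd ltnS leq_eqVlt; case: eqP => [->|] //=.
  case: (pselect (cl (range (sume e (T' n y))) (y n))) => [C|NC].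
    have [b Hb] := @eqv_extend _ _ M (0 : K) satK _ unit _ _ (fun _ => y n) Ez.
    have {}Hb : eqv (M := M) (N := M) (oext (sume e (T' n y)) (y n)) (oext (sume e' (T' n z)) (b tt)).
      by apply: eqv_ext (eqv_ren (fun o : option (V + nat) => if o is Some v then inl v else inr tt) Hb); case.
    exists (b tt); split=> // _; apply/rtr; exact: cl_eqv Hb C.
  have [b [Hb NCb]] := nonalg_extend a Ez NC.
  exists b; split=> // C; case: NCb; apply: cl_trans C => x [[[v <-]|[v <-]]|[i [Hi <-]]]; apply: cl_in.
  - by exists (inl (inl v)).
  - by exists (inr v).
  - by exists (inl (inr i)); rewrite /= /T' /tr Hi.
have [F HF] : {F : nat * (nat -> K) -> K & forall z, eqv (M := M) (N := M) (sume e (T' z.1 y)) (sume e' (T' z.1 z.2)) ->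
   eqv (M := M) (N := M) (sume e (T' z.1.+1 y)) (sume e' (T' z.1.+1 (upd z.2 z.1 (F z)))) /\ ok z.1 z.2 (F z)}.
  apply: (@choice _ _ (fun z b => eqv (M := M) (N := M) (sume e (T' z.1 y)) (sume e' (T' z.1 z.2)) ->
   eqv (M := M) (N := M) (sume e (T' z.1.+1 y)) (sume e' (T' z.1.+1 (upd z.2 z.1 b))) /\ ok z.1 z.2 b)) => -[n z].
  case: (pselect (eqv (M := M) (N := M) (sume e (T' n y)) (sume e' (T' n z)))) => [/step [b Hb]|N]; first by exists b.
  by exists 0.
pose ys := fix ys n := if n is m.+1 then upd (ys m) m (F (m, ys m)) else fun _ => 0.
pose y' i := ys i.+1 i.
have ysE n i : (i < n)%N -> ys n i = y' i.
  elim: n => // n IH; rewrite ltnS leq_eqVlt => /orP[/eqP ->//|Hi].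
  by rewrite /= /upd ltn_eqF // IH.
have g n : eqv (M := M) (N := M) (sume e (T' n y)) (sume e' (T' n (ys n))).
  elim: n => [|n IH]; last by case: (HF (n, ys n) IH).
  have [c Hc] := @eqv_extend _ _ M (0 : K) satK _ unit _ _ (fun _ => (0 : K)) E.
  have c0 : c tt = (0 : K).
    have := Hc (@Equ Lr _ (fun _ => tt) tt (rvar (inr tt)) (rzero _)); rewrite /holds /= => -[H _].
    by apply: H.
  have Hc' := eqv_ren (fun o : V + nat => match o with inl v => inl v | inr _ => inr tt end) Hc.
  by apply: eqv_ext Hc' => -[].
exists y'; split.
  move=> q; have [n Hn] := formula_bound q.
  rewrite (Hn M (0 : K) e y (T' n y)); last by move=> i Hi; rewrite /T' /tr Hi.
  rewrite (Hn M (0 : K) e' y' (T' n (ys n))); last by move=> i Hi; rewrite /T' /tr Hi ysE.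
  exact: g.
apply/(seq_indepP char0); first by left.
move=> n C; have [_ okn] := HF (n, ys n) (g n).
have Ey : F (n, ys n) = y' n by rewrite /y' /= /upd eqxx.
rewrite /= Ey in okn; have {okn} := okn.
rewrite /ok => okn; apply: cl_mono (okn _).
  by move=> x [|[i [Hi <-]]]; [left|right; exists i; rewrite ysE].
by apply: cl_mono C => x [|[i [Hi <-]]]; [left|right; exists i; rewrite ysE].
Qed.

Lemma ext_indep (V A J : countType) (e e' : V -> univ M) (a : A -> univ M) (y : J -> univ M) :
  eqv (M := M) (N := M) e e' ->
  exists y' : J -> univ M, eqv (M := M) (N := M) (sume e y) (sume e' y') /\
    indep (range e') (fun z => range e' z \/ range a z) (y' : J -> K).
Proof.
move=> E; have [y' [Ey Iy]] := ext_indep_nat a (fun n => if unpickle n is Some j then y j else (0 : K)) E.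
exists (y' \o pickle); split; last exact: indep_sub Iy.
apply: eqv_ext (eqv_ren (fun o : V + J => match o with inl v => inl v | inr j => inr (pickle j) end) Ey).
  by case=> //= j; rewrite pickleK.
by case.
Qed.

End IndependenceTypes.

(** * Differential fields *)

Section TermDerivative.

Variables (V : Type) (s : V -> V).

(** The Leibniz rule on terms, [s v] being the variable that names the derivative of [v]. *)
Fixpoint tderiv u (t : @term Lr V (fun _ => tt) u) : Tm Lr V :=
  match t with
  | Var v => rvar (s v)
  | App f args =>
    match f return ('I_(ring_arity f) -> Tm Lr V) -> ('I_(ring_arity f) -> Tm Lr V) -> Tm Lr V with
    | RZero | ROne => fun _ _ => rzero V
    | ROpp => fun _ d => ropp (d ord0)
    | RAdd => fun _ d => radd (d ord0) (d ord_max)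
    | RMul => fun a d => radd (rmul (d ord0) (a ord_max)) (rmul (a ord0) (d ord_max))
    end args (fun i => tderiv (args i))
  end.

Variables (K : fieldType) (D : K -> K).
Hypothesis char0 : forall n, n.+1%:R != 0 :> K.
Hypothesis derD : der D.
Variable e : V -> univ (Kr K).
Hypothesis eD : forall v, D (e v) = e (s v).

Lemma ev_tderiv t : ev e (tderiv t) = D (ev e t).
Proof.
elim/ring_term_ind: t => [v|||t Ht|t u Ht Hu|t u Ht Hu].
- exact/esym/eD.
- exact/esym/(der0 derD).
- exact/esym/(der1 derD).
- rewrite ev_opp (derN _ derD) -Ht; reflexivity.
- have [DD _] := derD; rewrite ev_add DD // -Ht -Hu; reflexivity.
- have [_ DM] := derD; rewrite ev_mul DM // -Ht -Hu; reflexivity.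
Qed.

(* A derivation acting on the entries of a tuple is determined by the
   quantifier-free type of the tuple. *)
Lemma transport_der (e' : V -> univ (Kr K)) :
  eqv (M := Kr K) (N := Kr K) e e' ->
  exists D' : K -> K, der D' /\ forall v, D' (e' v) = e' (s v).
Proof.
move=> E.
have Et t u : ev (M := Kr K) e t = ev (M := Kr K) e u -> ev (M := Kr K) e' t = ev (M := Kr K) e' u.
  by case: (E (@Equ Lr _ (fun _ => tt) tt t u)).
have Et' t u : ev (M := Kr K) e' t = ev (M := Kr K) e' u -> ev (M := Kr K) e t = ev (M := Kr K) e u.
  by case: (E (@Equ Lr _ (fun _ => tt) tt t u)).
pose R := genr (range e').
pose d x : K := if pselect (R x) is left h then ev (M := Kr K) e' (tderiv (sval (cid (genr_term h)))) else 0.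
have dE t : d (ev (M := Kr K) e' t) = ev (M := Kr K) e' (tderiv t).
  rewrite /d; case: pselect => [h|[]]; last exact: term_genr.
  by case: cid => u /= /Et' Eu; apply: Et; rewrite !ev_tderiv Eu.
have derR : der_on R d.
  split=> x y /genr_term [t <-] /genr_term [u <-].
    by have := dE (radd t u); rewrite ev_add => ->; rewrite !dE.
  by have := dE (rmul t u); rewrite ev_mul => ->; rewrite !dE.
have [D' [dD' D'E]] := der_extend char0 (@genr_subring K _) derR.
exists D'; split=> // v; rewrite D'E; last by apply: gen_in; exists v.
exact: (dE (rvar v)).
Qed.

End TermDerivative.

Definition diff_arity (k : nat) (f : ring_sym + 'I_k) : nat :=
  match f with inl g => ring_arity g | inr _ => 1%N end.

Notation Ld k := (sig1 (@diff_arity k)).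

Definition diff_op (K : fieldType) (k : nat) (d : 'I_k -> K -> K) (f : ring_sym + 'I_k) :
  ('I_(diff_arity f) -> K) -> K :=
  match f return ('I_(diff_arity f) -> K) -> K with
  | inl g => @ring_op K g
  | inr i => fun a => d i (a ord0)
  end.

Definition Kd (K : fieldType) (k : nat) (d : 'I_k -> K -> K) : structure (Ld k) :=
  @Structure (Ld k) (fun _ => K) (diff_op d) (fun r => match r with end).

Definition reduct (k : nat) (M : structure (Ld k)) : structure Lr :=
  @Structure Lr M (fun f a => @finterp (Ld k) M (inl f) a)
    (fun r => match r with end).

Definition lift_fm (k : nat) (V : Type) (p : Fm Lr V) : Fm (Ld k) V :=
  @lift_formula k V (fun _ => tt) p.

Section Lift.

Variables (k : nat) (M : structure (Ld k)).

Lemma teval_lift (V : Type) (s : V -> unit) u (t : @term Lr V s u) (e : @assignment (Ld k) M V s) :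
  @teval (Ld k) M V s e u (@lift_term k V s u t) = @teval Lr (reduct M) V s e u t.
Proof.
elim: t => //= f args IH; congr finterp.
by apply: functional_extensionality_dep => i; apply: IH.
Qed.

Lemma sat_lift (V : Type) (s : V -> unit) (p : @formula Lr V s) (e : @assignment (Ld k) M V s) :
  @sat (Ld k) M V s (@lift_formula k V s p) e <-> @sat Lr (reduct M) V s p e.
Proof.
elim: p e => {V s} [V s|V s u a b|V s []|V s p IHp q IHq|V s u p IHp] e //=.
- by rewrite -!teval_lift.
- by rewrite IHp IHq.
- by split=> H a; have [H1 H2] := IHp (@aext (Ld k) M V s e u a); [apply: H1; apply: H|apply: H2; apply: H].
Qed.

Lemma holds_lift (V : Type) (e : V -> univ M) (p : Fm Lr V) :
  holds (M := M) e (lift_fm k p) <-> holds (M := reduct M) e p.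
Proof. exact: sat_lift. Qed.

Lemma saturated_reduct : countably_saturated M -> countably_saturated (reduct M).
Proof.
move=> satM V e p fin.
have [|a Ha] := satM V e (fun q => exists r, p r /\ q = lift_fm k r).
  move=> l Hl.
  have [l' [Hl' El]] : exists l', (forall q, List.In q l' -> p q) /\ l = map (@lift_fm k _) l'.
    elim: l Hl => [|q' l IH] H; first by exists [::].
    have [q [pq Eq]] := H q' (or_introl erefl).
    have [l' [pl El]] := IH (fun q Hq => H q (or_intror Hq)).
    by exists (q :: l'); rewrite Eq El; split=> // r /= [<-|/pl].
  have [a Ha] := fin l' Hl'; exists a => q; rewrite El => /List.in_map_iff [r [<- /Ha Hr]].
  exact/holds_lift.
by exists a => q pq; apply/(holds_lift (oext e a)); apply: Ha; exists q.
Qed.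

End Lift.

Definition diff_code (k : nat) (f : ring_sym + 'I_k) : nat :=
  match f with inl g => ring_code g | inr i => (5 + i)%N end.

Lemma diff_code_inj k : injective (@diff_code k).
Proof.
move=> [f|i] [g|j] //=; first by move=> /ring_code_inj ->.
- by case: f.
- by case: g.
- by case=> E; congr inr; apply: val_inj.
Qed.

Section JetClosed.

Variables (K : fieldType) (k : nat).
Hypothesis char0 : forall n, n.+1%:R != 0 :> K.
Implicit Types d : 'I_k -> K -> K.
Notation M := (Kr K).

(** The naming [s] of the derivatives is separate from the tuple, so that two closed tuples can be
    compared variable by variable. *)
Definition jclosed d (V : Type) (s : 'I_k -> V -> V) (e : V -> K) : Prop :=
  forall i v, d i (e v) = e (s i v).

Fixpoint reduce (V : Type) (s : 'I_k -> V -> V) u (t : @term (Ld k) V (fun _ => tt) u) : Tm Lr V :=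
  match t with
  | Var v => rvar v
  | App f args =>
    match f return ('I_(diff_arity f) -> Tm Lr V) -> Tm Lr V with
    | inl g => fun a => @App Lr V (fun _ => tt) g a
    | inr i => fun a => tderiv (s i) (a ord0)
    end (fun i => reduce s (args i))
  end.

Lemma ev_reduce d V (s : 'I_k -> V -> V) (e : V -> univ (Kd d)) (t : Tm (Ld k) V) :
  (forall i, der (d i)) -> jclosed d s e -> ev (M := Kd d) e t = ev (M := Kr K) e (reduce s t) :> K.
Proof.
move=> dd je.
suff H : forall u (t : @term (Ld k) V (fun _ => tt) u),
    @teval (Ld k) (Kd d) V (fun _ => tt) e u t = ev (M := Kr K) e (reduce s t) :> K by exact: (H tt t).
move=> u {}t; elim: t => [v|f args IH] //=.
have E : (fun i => teval (M := Kd d) e (args i)) = (fun i => ev (M := Kr K) e (reduce s (args i)) : K).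
  by apply: funext => i; apply: IH.
case: f args IH E => [g|i] args IH E.
  have -> : (fun i : 'I_(diff_arity (inl g)) => teval (M := Kd d) e (args i)) = (fun i => ev (M := Kr K) e (reduce s (args i)) : K) by exact: E.
  by [].
rewrite /= (ev_tderiv (dd i) (je i)); congr (d i).
exact: IH.
Qed.

(* A tuple independent from [A] may be given the derivatives of a conjugate:
   the derivations only have to be corrected by derivations over [A]. *)
Lemma new_derivations d (V J : Type) (s : 'I_k -> V -> V) (sJ : 'I_k -> J -> J)
  (e e' : V -> univ M) (eta Y : J -> univ M) (A : K -> Prop) :
  (forall i, der (d i)) -> (forall i j x, d i (d j x) = d j (d i x)) ->
  jclosed d s e -> jclosed d s e' -> jclosed d sJ eta -> (forall i x, A x -> A (d i x)) ->
  eqv (M := M) (N := M) (sume e eta) (sume e' Y) ->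
  indep (range e') (fun z => range e' z \/ A z) (Y : J -> K) ->
  exists D : 'I_k -> K -> K, [/\ forall i, der (D i), forall i j x, D i (D j x) = D j (D i x),
    forall i x, (range e' x \/ A x) -> D i x = d i x & jclosed D sJ Y].
Proof.
move=> dd dc je je' jeta Ad E I.
pose sV i (o : V + J) := match o with inl v => inl (s i v) | inr j => inr (sJ i j) end.
have /choice [T HT] : forall i, exists T : K -> K, der T /\ forall o, T (sume e' Y o) = sume e' Y (sV i o).
  by move=> i; apply: (transport_der char0 (dd i) _ E); case=> [v|j]; [apply: je|apply: jeta].
(* [T i] acts on [Y] as wanted but ignores [A]. Its difference with [d i] kills [e'], so by
   independence some derivation killing [A] has the same values on [Y], and adding that one to [d i]
   keeps [d i] on [A]. *)
have /choice [G HG] : forall i, exists G : K -> K, [/\ der G, forall b, (range e' b \/ A b) -> G b = 0 &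
    forall j, G (Y j) = T i (Y j) + -1 * d i (Y j)].
  move=> i; have [dT TE] := HT i; apply: (I (fun x => T i x + -1 * d i x)); first exact: der_lin.
  by move=> _ [v <-]; have := TE (inl v); rewrite /= => ->; rewrite je' mulN1r subrr.
pose f i x := d i x + 1 * G i x.
have fA i x : (range e' x \/ A x) -> f i x = d i x.
  by move=> Ax; have [_ GA _] := HG i; rewrite /f GA // mulr0 addr0.
have fY i j : f i (Y j) = Y (sJ i j).
  have [_ _ GY] := HG i; rewrite /f GY mul1r mulN1r addrC subrK.
  by have [_ TE] := HT i; apply: (TE (inr j)).
have cA i x : (range e' x \/ A x) -> (range e' (d i x) \/ A (d i x)).
  by move=> [[v <-]|Ax]; [left; exists (s i v); rewrite je'|right; apply: Ad].
(* The [f i] commute on [e'], [A] and [Y] but not necessarily elsewhere. *)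
have [|||D [dD Dc DB]] := @commuting_extend K char0 _ (fun x => (range e' x \/ A x) \/ range Y x) f.
- by move=> i; have [dG _ _] := HG i; apply: der_lin.
- move=> i b [Ax|[j <-]]; first by left; rewrite fA //; apply: cA.
  by right; exists (sJ i j); rewrite fY.
- move=> i j b [Ax|[l <-]]; first by rewrite (fA i b Ax) (fA j b Ax) (fA i _ (cA j b Ax)) (fA j _ (cA i b Ax)); exact: dc.
  rewrite !fY.
  have El : eta (sJ i (sJ j l)) = eta (sJ j (sJ i l)) by rewrite -!jeta dc.
  have := E (@Equ Lr _ (fun _ => tt) tt (rvar (inr (sJ i (sJ j l)))) (rvar (inr (sJ j (sJ i l))))).
  by rewrite /holds /= => -[H _]; apply: H.
exists D; split=> // [i x Ax|i j]; first by rewrite DB ?fA //; left.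
by rewrite DB ?fY //; right; exists j.
Qed.

Variable d : 'I_k -> K -> K.
Hypotheses (dd : forall i, der (d i)) (dc : forall i j x, d i (d j x) = d j (d i x)).
Hypothesis lK : large K.
Variable T : theory Lr.
Hypotheses (mcT : model_complete T) (KT : model T (Kr K)).
Hypothesis satK : countably_saturated (Kd d).
Variable Ts : theory (Ld k).
Hypotheses (mcTs : model_complete Ts) (KTs : model Ts (Kd d)).

(* Any commuting derivations on [K] extend to a model of the model companion. *)
Hypothesis expand : forall D : 'I_k -> K -> K, (forall i, der (D i)) ->
  (forall i j x, D i (D j x) = D j (D i x)) ->
  exists (N : structure (Ld k)) (h : forall u, Kd D u -> N u), [/\ model Ts N, embedding h &
    forall (V : Type) (e : V -> K) (p : Fm Lr V),
      holds (M := Kr K) e p <-> holds (M := N) (fun v => h tt (e v)) (lift_fm k p)].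

Let satr : countably_saturated (Kr K) := saturated_reduct satK.

Lemma ev_embedding (D : 'I_k -> K -> K) (N : structure (Ld k)) (h : forall u, Kd D u -> N u) V (e : V -> K) (t : Tm (Ld k) V) :
  embedding h -> ev (M := N) (fun v => h tt (e v)) t = h tt (ev (M := Kd D) e t).
Proof.
move=> emb.
suff H : forall u (t : @term (Ld k) V (fun _ => tt) u),
  @teval (Ld k) N V (fun _ => tt) (fun v => h tt (e v)) u t = h u (@teval (Ld k) (Kd D) V (fun _ => tt) e u t) by exact: (H tt t).
move=> u {}t; elim: t => [v|f args IH] //=.
rewrite (embedding_fun emb (f := f)); congr finterp.
by apply: functional_extensionality_dep => i; apply: IH.
Qed.

Lemma elem_jclosed (nu : nat -> univ (Kd d)) : elem (ar := @diff_arity k) nu ->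
  exists s, jclosed d s nu.
Proof.
move=> el; have /choice [s Hs] : forall iv : 'I_k * nat, exists w, nu w = d iv.1 (nu iv.2).
  by move=> [i v]; apply: (@elem_fun _ _ _ nu el (inr i) (fun _ => v)).
by exists (fun i v => s (i, v)) => i v; rewrite (Hs (i, v)).
Qed.

Let diff_en : {en : nat -> Fm (Ld k) (option nat) | forall p, exists n, en n = p}.
Proof. exact: cid (@formula_enum _ (@diff_arity k) _ (@diff_code_inj k) (option nat : countType)). Qed.

(** On closed tuples differential terms reduce to ring terms, so equality of ring types preserves
    atomic differential formulas, and model completeness of [Ts] does the rest. *)
Lemma eqv_expand (D : 'I_k -> K -> K) (N : structure (Ld k)) (h : forall u, Kd D u -> N u)
    (nu Y : nat -> univ M) s : model Ts N -> embedding h -> (forall i, der (D i)) ->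
    elem (ar := @diff_arity k) (nu : nat -> univ (Kd d)) ->
    eqv (M := M) (N := M) nu Y -> jclosed d s nu -> jclosed D s Y ->
    eqv (M := Kd d) (N := N) nu (fun n => h tt (Y n)).
Proof.
move=> NT emb dD el E jn jY; apply: (elem_embed el mcTs KTs NT) => t u.
rewrite !(ev_embedding _ _ emb).
rewrite -[X in X <-> _]/(ev (M := Kd d) nu t = ev (M := Kd d) nu u :> K) !(ev_reduce _ dd jn).
have Eq := E (@Equ Lr _ (fun _ => tt) tt (reduce s t) (reduce s u)).
split=> [H|/(embedding_inj emb)]; first by congr (h tt); rewrite !(ev_reduce _ dD jY); apply/Eq.
rewrite -[X in X -> _]/(ev (M := Kd D) Y t = ev (M := Kd D) Y u :> K) !(ev_reduce _ dD jY) => H.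
exact/Eq.
Qed.

(** Amalgamation: a copy of the hull of [e] over [e'], independent from the hull of [e'], is made
    differential by new derivations on [K]. In a model containing [K] with these, both hulls keep
    their differential types, and [e] and [e'] have the same image. *)
Lemma ring_type_determines (V : countType) (s : 'I_k -> V -> V) (e e' : V -> univ M) :
  jclosed d s e -> jclosed d s e' -> eqv (M := M) (N := M) e e' ->
  eqv (M := Kd d) (N := Kd d) e e'.
Proof.
move=> je je' E.
have [nu [el hit]] := elem_hull (M := Kd d) (0 : K) e (svalP diff_en).
have [nu' [el' hit']] := elem_hull (M := Kd d) (0 : K) e' (svalP diff_en).
have [sn jn] := elem_jclosed el; have [sn' jn'] := elem_jclosed el'.
have [Y [EY IY]] := ext_indep char0 lK mcT KT satr nu' nu E.
have [||D [dD Dc DA DY]] := new_derivations dd dc je je' jn _ EY (A := range nu') _.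
- by move=> i _ [n <-]; exists (sn' i n); rewrite jn'.
- exact: IY.
have [N [h [NT emb _]]] := expand dD Dc.
have E1 : eqv (M := Kd d) (N := N) nu (fun n => h tt (Y n)).
  apply: eqv_expand jn DY => //; exact: (eqv_ren (@inr V nat) EY).
have E2 : eqv (M := Kd d) (N := N) nu' (fun n => h tt (nu' n)).
  apply: (eqv_expand NT emb dD el' (@eqv_refl _ _ _ _ _) jn') => i n.
  by rewrite DA; [apply: jn'|right; exists n].
have [f Hf] := choice hit; have [f' Hf'] := choice hit'.
have EYe v : Y (f v) = e' v.
  have := EY (@Equ Lr _ (fun _ => tt) tt (rvar (inr (f v))) (rvar (inl v))).
  by rewrite /holds /= => -[H _]; apply: H; apply: Hf.
apply: (eqv_trans (e' := fun v => h tt (e' v))); last apply: eqv_sym.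
  by apply: eqv_ext (eqv_ren f E1) => v //=; rewrite EYe.
by apply: eqv_ext (eqv_ren f' E2) => v //=; rewrite Hf'.
Qed.

(** With new derivations a conjugate of [Y] becomes closed, in a model [N] in which the hull of [e]
    and [a] keeps its type. Finite parts of the requirement thus transfer from [N] to [K], where
    saturation applies. *)
Lemma realize_jets (V A J : countType) (s : 'I_k -> V -> V) (sA : 'I_k -> A -> A) (sJ : 'I_k -> J -> J)
  (e : V -> univ M) (a : A -> univ M) (eta Y : J -> univ M) :
  jclosed d s e -> jclosed d sA a -> jclosed d sJ eta ->
  eqv (M := M) (N := M) (sume e eta) (sume e Y) ->
  indep (range e) (fun z => range e z \/ range a z) (Y : J -> K) ->
  exists eta', jclosed d sJ eta' /\ eqv (M := M) (N := M) (sume (sume e a) Y) (sume (sume e a) eta').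
Proof.
move=> je ja jeta E I.
have [nu [el hit]] := elem_hull (M := Kd d) (0 : K) (sume e a) (svalP diff_en).
(* Independence is arranged from the whole hull and not just from [a], so that the new derivations
   may agree with [d] on the hull. *)
have [Y' [EY IY]] := ext_indep char0 lK mcT KT satr nu Y (@eqv_refl _ _ M _ (sume e a)).
have IY' : indep (range e) (fun z => range e z \/ range nu z) (Y' : J -> K).
  have I1 := indep_eqv char0 EY I.
  apply: (indep_trans I1); apply: (indep_base (B := range (sume e a))).
    by move=> _ [[v|v] <-]; [left|right]; exists v.
  by apply: indep_mono IY => _ [[v <-]|[n <-]]; [left; exists (inl v)|right; exists n].
have E' : eqv (M := M) (N := M) (sume e eta) (sume e Y').
  apply: eqv_trans E _.
  pose f (o : V + J) : V + A + J := match o with inl v => inl (inl v) | inr j => inr j end.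
  by apply: eqv_ext (eqv_ren f EY); case.
have [sn jn] := elem_jclosed el.
have [|D [dD Dc DA DY]] := new_derivations dd dc je je jeta _ E' IY'.
  by move=> i _ [n <-]; exists (sn i n); rewrite jn.
have [N [h [NT emb hr]]] := expand dD Dc.
have E2 : eqv (M := Kd d) (N := N) nu (fun n => h tt (nu n)).
  apply: (eqv_expand NT emb dD el (@eqv_refl _ _ _ _ _) jn) => i n.
  by rewrite DA; [apply: jn|right; exists n].
have [f Hf] := choice hit.
have {}E2 : eqv (M := Kd d) (N := N) (sume e a) (fun v => h tt (sume e a v)).
  by apply: eqv_ext (eqv_ren f E2) => v //=; rewrite Hf.
pose jeq i j : Fm (Ld k) (V + A + J) := @Equ (Ld k) _ (fun _ => tt) tt
  (@App (Ld k) _ (fun _ => tt) (inr i) (fun _ => @Var (Ld k) _ (fun _ => tt) (inr j)))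
  (@Var (Ld k) _ (fun _ => tt) (inr (sJ i j))).
pose G (q : Fm (Ld k) (V + A + J)) :=
  (exists r, holds (M := M) (sume (sume e a) Y) r /\ q = lift_fm k r) \/ (exists i j, q = jeq i j).
have [|eta' Heta] := @realize _ _ (Kd d) (0 : K) satK _ J (sume e a) G.
  move=> l Hl.
  have dP : defb (fun (N : structure (Ld k)) (e2 : V + A + J -> univ N) => forall q, List.In q l -> holds e2 q).
    by apply: (@defb_allseq _ _ _ _ (fun q N e2 => holds e2 q)) => q _; exact: defb_fm.
  apply: (@eqv_defb _ _ N (Kd d) (h tt (0 : K)) (0 : K) _ _ _
    (fun N e2 => exists w, forall q, List.In q l -> holds (M := N) (sume e2 w) q) (defb_ex dP) (eqv_sym E2)).
  exists (fun j => h tt (Y' j)) => q /Hl [[r [Hr ->]]|[i [j ->]]].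
    apply: (@holds_eq _ _ N _ _ (fun o => h tt (sume (sume e a) Y' o))); first by case.
    by apply/(hr _ (sume (sume e a) Y')); apply/EY.
  rewrite /holds /= -DY.
  exact: esym (embedding_fun emb (f := inr i) (fun _ => Y' j)).
exists eta'; split.
  move=> i j; exact: (Heta (jeq i j) (or_intror (ex_intro _ i (ex_intro _ j erefl)))).
have H q : holds (M := M) (sume (sume e a) Y) q -> holds (M := M) (sume (sume e a) eta') q.
  by move=> Hq; apply/(@holds_lift k (Kd d)); apply: Heta; left; exists q.
move=> q; split; first exact: H.
move=> Hq; apply: contrapT => Nq; exact: (H (Imp q (Bot _)) Nq Hq).
Qed.

End JetClosed.

(** * Type-definable sets and separation *)

Section Compactness.

Variables (fs : Type) (ar : fs -> nat).
Variables (M : structure (sig1 ar)) (x0 : univ M).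
Hypothesis satM : countably_saturated M.
Variables (V : countType) (e : V -> univ M).

(* [R] is type-definable over the parameters [e]. *)
Definition tdef (W : Type) (R : (W -> univ M) -> Prop) : Prop := forall x,
  (forall r, (forall x', R x' -> holds (sume e x') r) -> holds (sume e x) r) -> R x.

Lemma tdef_fm W r : tdef (fun x : W -> univ M => holds (sume e x) r).
Proof. by move=> x; apply. Qed.

Lemma tdef_and W R S : @tdef W R -> @tdef W S -> tdef (fun x => R x /\ S x).
Proof.
by move=> HR HS x H; split; [apply: HR|apply: HS] => r Hr; apply: H => x' []; auto.
Qed.

Lemma tdef_ren W W' (f : W -> W') R : @tdef W R -> @tdef W' (fun x => R (x \o f)).
Proof.
move=> HR x H; apply: HR => r Hr.
pose g (o : V + W) : V + W' := match o with inl v => inl v | inr w => inr (f w) end.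
have gE z : sume e z \o g =1 sume e (z \o f) by case.
have := H (ren g r); rewrite holds_ren (holds_ext _ (gE x)); apply=> x' Rx'.
by rewrite holds_ren (holds_ext _ (gE x')); apply: Hr.
Qed.

Lemma tdef_ext W R S : (forall x, R x <-> S x) -> @tdef W R -> @tdef W S.
Proof.
by move=> E HR x H; apply/E; apply: HR => r Hr; apply: H => x' /E /Hr.
Qed.

Lemma tdef_type W (a : W -> univ M) : tdef (fun x : W -> univ M => eqv (sume e a) (sume e x)).
Proof.
move=> x H; have H1 r : holds (sume e a) r -> holds (sume e x) r.
  by move=> Hr; apply: H => x' E; apply/E.
move=> r; split; first exact: H1.
by move=> Hr; apply: contrapT => N; exact: (H1 (Imp r (Bot _)) N Hr).
Qed.

(** An interpolation argument: if the projections are disjoint, finite parts [l1] and [l2] of the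
    two types are already incompatible, and the projection of [l1] is a formula separating them. *)
Lemma separate (A B1 B2 : countType) (R1 : (A + B1 -> univ M) -> Prop) (R2 : (A + B2 -> univ M) -> Prop) :
  tdef R1 -> tdef R2 -> (forall x y1 y2, R1 (sume x y1) -> R2 (sume x y2) -> False) ->
  exists t : Fm (sig1 ar) (V + A), (forall x y, R1 (sume x y) -> holds (sume e x) t) /\
    (forall x y, R2 (sume x y) -> ~ holds (sume e x) t).
Proof.
move=> d1 d2 N.
pose T1 r := forall z, R1 z -> holds (sume e z) r.
pose T2 r := forall z, R2 z -> holds (sume e z) r.
pose f1 (o : V + (A + B1)) : V + ((A + B1) + B2) := match o with inl v => inl v | inr w => inr (inl w) end.
pose f2 (o : V + (A + B2)) : V + ((A + B1) + B2) := match o with inl v => inl v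
  | inr (inl w) => inr (inl (inl w)) | inr (inr w) => inr (inr w) end.
have f1E (x : A -> univ M) y1 y2 r : holds (sume e (sume (sume x y1) y2)) (ren f1 r) <-> holds (sume e (sume x y1)) r.
  by rewrite holds_ren; apply: holds_ext; case.
have f2E (x : A -> univ M) y1 y2 r : holds (sume e (sume (sume x y1) y2)) (ren f2 r) <-> holds (sume e (sume x y2)) r.
  by rewrite holds_ren; apply: holds_ext; do 2?case.
have splitE (P Q : Type) (w : P + Q -> univ M) : w = sume (w \o inl) (w \o inr) by apply: funext; case.
pose G q := (exists r, T1 r /\ q = ren f1 r) \/ (exists r, T2 r /\ q = ren f2 r).
have /existsNP [l /not_implyP [Gl Nl]] : ~ fin_sat e G.
  move=> /(realize x0 satM) [w Hw].
  rewrite (splitE _ _ w) (splitE _ _ (w \o inl)) in Hw.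
  apply: (N (w \o inl \o inl) (w \o inl \o inr) (w \o inr)).
    by apply: d1 => r Tr; apply/f1E; apply: Hw; left; exists r.
  by apply: d2 => r Tr; apply/f2E; apply: Hw; right; exists r.
have [l1 [l2 [Hl1 [Hl2 Hl]]]] : exists l1 l2, (forall r, List.In r l1 -> T1 r) /\ ((forall r, List.In r l2 -> T2 r) /\
    forall x y1 y2, (forall r, List.In r l1 -> holds (sume e (sume x y1)) r) ->
      (forall r, List.In r l2 -> holds (sume e (sume x y2)) r) ->
      forall q, List.In q l -> holds (sume e (sume (sume x y1) y2)) q).
  elim: l Gl {Nl} => [|q l IH] Gl; first by exists [::], [::].
  have [|l1 [l2 [Hl1 [Hl2 Hl]]]] := IH; first by move=> r Hr; apply: Gl; right.
  case: (Gl q (or_introl erefl)) => [] [r [Tr ->]].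
    exists (r :: l1), l2; split; first by move=> r' /= [<-|/Hl1].
    split=> // x y1 y2 K1 K2 q' /= [<-|]; first by apply/f1E; apply: K1; left.
    by apply: Hl => // r' Hr'; apply: K1; right.
  exists l1, (r :: l2); split=> //; split; first by move=> r' /= [<-|/Hl2].
  move=> x y1 y2 K1 K2 q' /= [<-|]; first by apply/f2E; apply: K2; left.
  by apply: Hl => // r' Hr'; apply: K2; right.
pose g (o : V + (A + B1)) : V + A + B1 := match o with inl v => inl (inl v)
  | inr (inl a) => inl (inr a) | inr (inr b) => inr b end.
have gE x (y : B1 -> univ M) : sume (sume e x) y \o g =1 sume e (sume x y) by do 2?case.
have [t Ht] : defb (fun (N : structure (sig1 ar)) (e2 : V + A -> univ N) =>
    exists y, forall r, List.In r l1 -> holds (sume e2 y) (ren g r)).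
  apply: (@defb_ex _ _ _ _ (fun N e2 => forall r, List.In r l1 -> holds e2 (ren g r))).
  by apply: (@defb_allseq _ _ _ _ (fun r N e2 => holds e2 (ren g r))) => r _; exact: defb_fm.
exists t; split=> x y.
  move=> R1x; apply/(Ht M x0); exists y => r Hr.
  by rewrite holds_ren (holds_ext _ (gE x y)); apply: Hl1.
move=> R2x /(Ht M x0) [y1 Hy1]; apply: Nl; exists (sume (sume x y1) y).
apply: Hl; last by move=> r /Hl2; apply.
by move=> r /Hy1; rewrite holds_ren (holds_ext _ (gE x y1)).
Qed.

End Compactness.

(** * Jets and the translation into ring formulas *)

Section Jets.

Variables (K : fieldType) (k : nat) (d : 'I_k -> K -> K).

Definition jet (X : Type) (e : X -> K) (o : X * seq 'I_k) : K := foldr d (e o.1) o.2.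

Definition jshift (X : Type) (i : 'I_k) (o : X * seq 'I_k) : X * seq 'I_k := (o.1, i :: o.2).

Lemma jclosed_jet (X : Type) (e : X -> K) : jclosed d (@jshift X) (jet e).
Proof. by []. Qed.

Definition sshift (V W : Type) (s : 'I_k -> V -> V) (t : 'I_k -> W -> W) (i : 'I_k) (o : V + W) : V + W :=
  match o with inl v => inl (s i v) | inr w => inr (t i w) end.

Lemma jclosed_sume (V W : Type) (s : 'I_k -> V -> V) (t : 'I_k -> W -> W) e g :
  jclosed d s e -> jclosed d t g -> jclosed d (sshift s t) (sume e g).
Proof. by move=> je jg i [v|w]; [apply: je|apply: jg]. Qed.

Definition jterm (X : Type) (o : X * seq 'I_k) : Tm (Ld k) X :=
  foldr (fun i (t : Tm (Ld k) X) => @App (Ld k) X (fun _ => tt) (inr i) (fun _ => t)) (@Var (Ld k) X (fun _ => tt) o.1) o.2.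

Lemma ev_jterm (X : Type) (e : X -> univ (Kd d)) o : ev (M := Kd d) e (jterm o) = jet e o.
Proof. by case: o => x; elim=> //= i w; rewrite /ev /= => ->. Qed.

Definition jinst (V X : Type) (p : Fm Lr (V + X * seq 'I_k)) : Fm (Ld k) (V + X) :=
  inst (fun o => match o with
    | inl v => @Var (Ld k) (V + X) (fun _ => tt) (inl v)
    | inr (x, w) => jterm (inr x, w) end) (lift_fm k p).

Lemma holds_jinst (V X : Type) (e : V -> univ (Kd d)) (x : X -> univ (Kd d)) p :
  holds (M := Kd d) (sume e x) (jinst p) <-> holds (M := Kr K) (sume e (jet x)) p.
Proof.
rewrite holds_inst holds_lift; apply: holds_ext => -[v|[y w]] //.
exact: ev_jterm.
Qed.

Hypothesis satK : countably_saturated (Kd d).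
Hypothesis determines : forall (X : countType) (e e' : X -> K),
  eqv (M := Kr K) (N := Kr K) (jet e) (jet e') -> eqv (M := Kd d) (N := Kd d) e e'.

(** Compactness twice: at each [e] satisfying [p], a single ring formula true of its jet implies
    [p], since the ring type of the jet decides the type of [e]; and finitely many of these ring
    formulas cover [p]. *)
Lemma ring_formula (X : countType) (p : Fm (Ld k) X) : exists q : Fm Lr (X * seq 'I_k),
  forall e : X -> K, holds (M := Kd d) e p <-> holds (M := Kr K) (jet e) q.
Proof.
pose nu (v : void) : univ (Kd d) := match v with end.
pose jq (q : Fm Lr (X * seq 'I_k)) := jinst (ren (@inr void _) q).
have jqE q (e : X -> K) : holds (M := Kd d) (sume nu e) (jq q) <-> holds (M := Kr K) (jet e) q.
  by rewrite holds_jinst holds_ren.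
have prE p' (e : X -> K) : holds (M := Kd d) (sume nu e) (ren (@inr void _) p') <-> holds (M := Kd d) e p'.
  by rewrite holds_ren.
have step (e : X -> K) : holds (M := Kd d) e p -> exists q, holds (M := Kr K) (jet e) q /\
    forall e' : X -> K, holds (M := Kr K) (jet e') q -> holds (M := Kd d) e' p.
  move=> He.
  pose G q := (exists r, holds (M := Kr K) (jet e) r /\ q = jq r) \/ q = ren (@inr void _) (Imp p (Bot _)).
  have /existsNP [l /not_implyP [Gl Nl]] : ~ fin_sat (M := Kd d) nu G.
    move=> /(realize (M := Kd d) (0 : K) satK) [e' He'].
    have E : eqv (M := Kr K) (N := Kr K) (jet e) (jet e').
      have H r : holds (M := Kr K) (jet e) r -> holds (M := Kr K) (jet e') r.
        by move=> Hr; apply/jqE; apply: He'; left; exists r.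
      move=> r; split; first exact: H.
      by move=> Hr; apply: contrapT => N; exact: (H (Imp r (Bot _)) N Hr).
    have := He' _ (or_intror erefl); rewrite prE; apply.
    exact: (iffLR (determines E p)).
  suff [q [Hq Hl]] : exists q, holds (M := Kr K) (jet e) q /\ forall e' : X -> K, holds (M := Kr K) (jet e') q ->
      ~ holds (M := Kd d) e' p -> forall r, List.In r l -> holds (M := Kd d) (sume nu e') r.
    exists q; split=> // e' He'; apply: contrapT => N; apply: Nl; exists e'; exact: Hl.
  elim: l Gl {Nl} => [|r l IH] Gl.
    by exists (@Equ Lr _ (fun _ => tt) tt (rzero _) (rzero _)).
  have [|q [Hq Hl]] := IH; first by move=> r' Hr'; apply: Gl; right.
  case: (Gl r (or_introl erefl)) => [[r' [Hr' ->]]|->].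
    have [pr Epr] : defb (fun (M : structure Lr) (e : X * seq 'I_k -> univ M) => holds e q /\ holds e r').
      by apply: defb_and; apply: defb_fm.
    exists pr; split; first by apply/(Epr (Kr K) (0 : K)).
    move=> e' /(Epr (Kr K) (0 : K)) [He1 He2] N r2 /= [<-|]; last exact: Hl.
    exact/jqE.
  exists q; split=> // e' He1 N r2 /= [<-|]; last exact: Hl.
  exact/prE.
have /choice [F HF] : forall e : X -> K, exists q, holds (M := Kd d) e p -> holds (M := Kr K) (jet e) q /\
    forall e' : X -> K, holds (M := Kr K) (jet e') q -> holds (M := Kd d) e' p.
  move=> e; case: (pselect (holds (M := Kd d) e p)) => [/step [q Hq]|N]; first by exists q.
  by exists (Bot _).
pose G q := (exists e, holds (M := Kd d) e p /\ q = jq (Imp (F e) (Bot _))) \/ q = ren (@inr void _) p.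
have /existsNP [l /not_implyP [Gl Nl]] : ~ fin_sat (M := Kd d) nu G.
  move=> /(realize (M := Kd d) (0 : K) satK) [e He].
  have He1 : holds (M := Kd d) e p by apply/prE; apply: He; right.
  have [K1 _] := HF e He1.
  have /jqE := He _ (or_introl (ex_intro _ e (conj He1 erefl))); exact.
suff [q [Hq Hl]] : exists q, (forall e : X -> K, holds (M := Kr K) (jet e) q -> holds (M := Kd d) e p) /\
    forall e : X -> K, holds (M := Kd d) e p -> ~ holds (M := Kr K) (jet e) q ->
    forall r, List.In r l -> holds (M := Kd d) (sume nu e) r.
  exists q => e; split; last exact: Hq.
  move=> He; apply: contrapT => N; apply: Nl; exists e; exact: Hl.
elim: l Gl {Nl} => [|r l IH] Gl; first by exists (Bot _).
have [|q [Hq Hl]] := IH; first by move=> r' Hr'; apply: Gl; right.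
case: (Gl r (or_introl erefl)) => [[e [He ->]]|->].
  have [pr Epr] : defb (fun (M : structure Lr) (e' : X * seq 'I_k -> univ M) => holds e' q \/ holds e' (F e)).
    by apply: defb_or; apply: defb_fm.
  exists pr; split.
    by move=> e' /(Epr (Kr K) (0 : K)) [/Hq //|]; case: (HF e He) => _; apply.
  move=> e' He' N r2 /= [<-|].
    by apply/jqE => H; apply: N; apply/(Epr (Kr K) (0 : K)); right.
  by apply: Hl => // H; apply: N; apply/(Epr (Kr K) (0 : K)); left.
exists q; split=> // e' He1 N r2 /= [<-|]; last exact: Hl.
exact/prE.
Qed.

End Jets.

Notation eqr K := (@eqv _ ring_arity (Kr K) (Kr K) _).

Section ElementaryTuples.

Variables (fs : Type) (ar : fs -> nat).
Variables (M : structure (sig1 ar)) (nu : nat -> univ M).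
Hypothesis el : elem nu.

(** The Tarski-Vaught test yields one element at a time; the coordinates are moved into the model in
    the order of their codes, up to the last one the formula mentions. *)
Lemma elem_tuple (W : countType) (p : Fm (sig1 ar) (nat + W)) w : holds (sume nu w) p ->
  exists g : W -> nat, holds (sume nu (nu \o g)) p.
Proof.
move=> Hw; have [n Hn] := formula_bound p.
suff [w' [Hw' Rw']] : exists w', holds (sume nu w') p /\ forall i : W, (pickle i < n)%N -> exists g, nu g = w' i.
  have /choice [g Hg] : forall i : W, exists g, (pickle i < n)%N -> nu g = w' i.
    by move=> i; case: (ltnP (pickle i) n) => [/Rw' [g Hg]|_]; [exists g|exists 0%N].
  exists g; apply: (iffLR (Hn M (nu 0%N) nu w' (nu \o g) _) Hw') => i Hi; exact: esym (Hg i Hi).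
elim: n {Hn} => [|n [w' [Hw' Rw']]]; first by exists w.
case: (pselect (exists i : W, pickle i = n)) => [[i0 Hi0]|N]; last first.
  exists w'; split=> // i; rewrite ltnS leq_eqVlt => /orP[/eqP E|/Rw' //].
  by case: N; exists i.
have /choice [g Hg] : forall i : W, exists g, (pickle i < n)%N -> nu g = w' i.
  by move=> i; case: (ltnP (pickle i) n) => [/Rw' [g Hg]|_]; [exists g|exists 0%N].
have [t Ht] : defb (fun (N : structure (sig1 ar)) (e : option nat -> univ N) => exists u : W -> univ N,
    (forall j : 'I_n, forall i, @pickle_inv W j = Some i -> u i = e (Some (g i))) /\
    (u i0 = e None /\ holds (sume (e \o Some) u) p)).
  apply: (@defb_ex _ _ _ _ (fun N e => (forall j : 'I_n, forall i, @pickle_inv W j = Some i -> e (inr i) = e (inl (Some (g i)))) /\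
    (e (inr i0) = e (inl None) /\ holds (sume (fun v => e (inl (Some v))) (fun i => e (inr i))) p))).
  apply: defb_and.
    apply: (@defb_allfin _ _ _ _ (fun (j : 'I_n) N e => forall i, @pickle_inv W j = Some i -> e (inr i) = e (inl (Some (g i))))) => j.
    case: (@pickle_inv W j) => [i|]; last by apply: defb_ext (defb_true _ _) => N _ e; split.
    apply: defb_ext (defb_eqv _ (inr i) (inl (Some (g i)))) => N _ e.
    by split=> [H i' [<-]|]; [|apply].
  apply: defb_and; first exact: defb_eqv.
  apply: defb_ext (defb_ren (fun o : nat + W => match o with inl v => inl (Some v) | inr j => inr j end) (defb_fm p)) => N y0 e2.
  by apply: holds_ext => -[].
have tE a : holds (oext nu a) t <-> exists u : W -> univ M, (forall i, (pickle i < n)%N -> u i = nu (g i)) /\ u i0 = a /\ holds (sume nu u) p.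
  rewrite (Ht M (nu 0%N)); split=> [[u [H1 [H2 H3]]]|[u [H1 [H2 H3]]]]; exists u; split=> //.
    by move=> i Hi; apply: (H1 (Ordinal Hi)); rewrite /= pickleK_inv.
  move=> j i Hi; apply: H1; have := @pickle_invK W j; rewrite Hi /= => ->; exact: (ltn_ord j).
have [|m Hm] := el (p := t) (a := w' i0).
  by apply/tE; exists w'; split=> // i Hi; rewrite Hg.
have [u [u1 [u2 u3]]] := iffLR (tE _) Hm.
exists u; split=> // i; rewrite ltnS leq_eqVlt => /orP[/eqP E|Hi].
  exists m; have -> // : i = i0 by apply: (pcan_inj pickleK); rewrite E Hi0.
by exists (g i); rewrite u1.
Qed.

End ElementaryTuples.

Lemma elem_reduct (k : nat) (M : structure (Ld k)) (nu : nat -> univ M) :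
  elem (ar := @diff_arity k) nu -> elem (M := reduct M) nu.
Proof.
move=> el p a Hp; have [|w Hw] := el (lift_fm k p) a; first exact/(holds_lift (oext nu a)).
by exists w; apply/(holds_lift (oext nu (nu w))).
Qed.

Section TypeDefinability.

Variable K : fieldType.
Hypothesis char0 : forall n, n.+1%:R != 0 :> K.
Notation M := (Kr K).

(** Fixing the type of the tuple decides beforehand which coordinates are algebraic over the base
    and the earlier ones. For the others, independence says that every algebraic relation fails, a
    closed condition. *)
Lemma tdef_indep (V A J : countType) (e : V -> univ M) (h : J -> univ M) :
  tdef (M := M) e (fun z : A + J -> univ M => eqv (M := M) (N := M) (sume e h) (sume e (z \o inr)) /\
    indep (range e) (fun x => range e x \/ range (z \o inl) x) (z \o inr : J -> K)).
Proof.
move=> z H.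
have q : eqv (M := M) (N := M) (sume e h) (sume e (z \o inr)).
  have D := @tdef_ren _ _ M V e J (A + J)%type inr _ (tdef_type (M := M) (e := e) (a := h)) z.
  by apply: D => r Hr; apply: H => z' [/Hr].
split=> //.
have sub (z0 : A + J -> K) x : range e x -> range e x \/ range (z0 \o inl) x by left.
apply/(indepP char0 _ (sub z)) => j C.
case: (pselect (cl (fun x => range e x \/ before (h : J -> K) j x) (h j))) => [Ch|NC].
  pose f (o : option (V + {i : J | (pickle i < pickle j)%N})) : V + J :=
    match o with Some (inl v) => inl v | Some (inr i) => inr (val i) | None => inr j end.
  have rg (y0 : J -> K) x : range (sume e (fun i : {i : J | (pickle i < pickle j)%N} => y0 (val i))) x <->
      range e x \/ before y0 j x.
    split=> [[[v|i] <-]|[[v <-]|[i [Hi <-]]]] /=.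
    - by left; exists v.
    - by right; exists (val i); split=> //; apply: (valP i).
    - by exists (inl v).
    - by exists (inr (exist _ i Hi)).
  apply: (@cl_mono _ (range (sume e (fun i : {i : J | (pickle i < pickle j)%N} => (z \o inr) (val i))))); first by move=> x /rg.
  apply: (@cl_eqv _ K char0 (sume e (fun i => h (val i))) _ (h j)).
    by apply: eqv_ext (eqv_ren f q); do ![case=> //].
  by apply: cl_mono Ch => x /rg.
pose f (o : option (V + A + {i : J | (pickle i < pickle j)%N})) : V + (A + J) :=
  match o with Some (inl (inl v)) => inl v | Some (inl (inr a)) => inr (inl a)
    | Some (inr i) => inr (inr (val i)) | None => inr (inr j) end.
pose E (z0 : A + J -> univ M) := sume (sume e (z0 \o inl)) (fun i : {i : J | (pickle i < pickle j)%N} => z0 (inr (val i))).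
have rf (z0 : A + J -> K) x : range (E z0) x <->
    (range e x \/ range (z0 \o inl) x) \/ before (z0 \o inr) j x.
  split=> [[[[v|v]|i] <-]|[[[v <-]|[v <-]]|[i [Hi <-]]]] /=.
  - by left; left; exists v.
  - by left; right; exists v.
  - by right; exists (val i); split=> //; apply: (valP i).
  - by exists (inl (inl v)).
  - by exists (inl (inr v)).
  - by exists (inr (exist _ i Hi)).
have fE (z0 : A + J -> univ M) : sume e z0 \o f =1 oext (E z0) (z0 (inr j)) by do ![case=> //].
have /(cl_alg_rel char0) [ts Hts] : cl (range (E z)) (z (inr j)).
  by apply: cl_mono C => x /rf.
have [p Hp] := defb_not (alg_rel_defb ts).
have : holds (M := M) (sume e z) (ren f p).
  apply: H => z' [q' I']; apply/holds_ren; rewrite (holds_ext _ (fE z')); apply/(Hp M (0 : K)) => R.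
  apply: NC.
  have := iffLR (indepP char0 _ (sub z')) I' j.
  have C' : cl (range (E z')) (z' (inr j)) by apply/(cl_alg_rel char0); exists ts.
  have C2 : cl (fun x => (range e x \/ range (z' \o inl) x) \/ before (z' \o inr : J -> K) j x) ((z' \o inr) j).
    by apply: cl_mono C' => x /rf.
  move=> /(_ C2) C3 {C' C2}.
  pose f' (o : option (V + {i : J | (pickle i < pickle j)%N})) : V + J :=
    match o with Some (inl v) => inl v | Some (inr i) => inr (val i) | None => inr j end.
  have rg (y0 : J -> K) x : range (sume e (fun i : {i : J | (pickle i < pickle j)%N} => y0 (val i))) x <->
      range e x \/ before y0 j x.
    split=> [[[v|i] <-]|[[v <-]|[i [Hi <-]]]] /=.
    - by left; exists v.
    - by right; exists (val i); split=> //; apply: (valP i).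
    - by exists (inl v).
    - by exists (inr (exist _ i Hi)).
  apply: (@cl_mono _ (range (sume e (fun i : {i : J | (pickle i < pickle j)%N} => h (val i))))); first by move=> x /rg.
  apply: (@cl_eqv _ K char0 (sume e (fun i => (z' \o inr) (val i))) _ ((z' \o inr) j)).
    by apply: eqv_ext (eqv_sym (eqv_ren f' q')); do ![case=> //].
  by apply: cl_mono C3 => x /rg.
by rewrite holds_ren (holds_ext _ (fE z)) => /(Hp M (0 : K)) N; case: (N Hts).
Qed.

Lemma tdef_jet (k : nat) (d : 'I_k -> K -> K) (V W : countType) (e : V -> univ M) (R : (W * seq 'I_k -> univ M) -> Prop) :
  tdef (M := M) e R -> tdef (M := Kd d) e (fun x : W -> univ (Kd d) => R (jet d x)).
Proof.
move=> HR x H; apply: HR => r Hr; apply/(@holds_jinst K k d V W e x); apply: H => x' Rx'.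
by apply/holds_jinst; apply: Hr.
Qed.

End TypeDefinability.

(** * From differential to algebraic thorn-forking *)

Lemma range_sume (V W K : Type) (e : V -> K) (g : W -> K) x :
  range (sume e g) x <-> range e x \/ range g x.
Proof.
split=> [[[v|w] <-]|[[v <-]|[w <-]]]; [by left; exists v|by right; exists w| |].
  by exists (inl v).
by exists (inr w).
Qed.

Lemma build_sequence (S : Type) (s0 : S) (P : S -> Prop) (rel : S -> S -> Prop) :
  (forall n (f : nat -> S), (forall i, (i < n)%N -> P (f i)) -> exists a, P a /\ forall i, (i < n)%N -> rel (f i) a) ->
  forall n, exists f : nat -> S, (forall i, (i < n)%N -> P (f i)) /\
    forall i j, (i < j)%N -> (j < n)%N -> rel (f i) (f j).
Proof.
move=> step; elim=> [|n [f [Pf rf]]]; first by exists (fun _ => s0).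
have [a [Pa ra]] := step n f Pf.
exists (fun i => if i == n then a else f i); split=> [i|i j].
  by rewrite ltnS leq_eqVlt; case: eqP => //= _ /Pf.
move=> ij; rewrite ltnS leq_eqVlt => /orP[/eqP E|jn].
  by rewrite E eqxx ltn_eqF -?E //; apply: ra; rewrite -E.
by rewrite !ltn_eqF ?(ltn_trans ij) //; apply: rf.
Qed.

Section Labels.

Variable K : fieldType.
Notation M := (Kr K).

(* Two tuples are equivalent when [eta(_, W, p)] does not distinguish them. *)
Definition same_class (JY JP : Type) (eta : Fm Lr (JY + JY + JP)) (p : JP -> univ M) (Y Y' : JY -> univ M) : Prop :=
  forall W, holds (M := M) (sume (sume Y W) p) eta <-> holds (M := M) (sume (sume Y' W) p) eta.

(** Quantified over all [x] and [p], this is a property of the label alone, so it holds at every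
    conjugate of a state. *)
Definition few_classes (B JY JP : Type) (chi : Fm Lr (B + (JY + JP))) (eta : Fm Lr (JY + JY + JP)) (m : nat) : Prop :=
  forall x p (Ys : nat -> JY -> univ M), (forall i, (i <= m)%N -> holds (M := M) (sume x (sume (Ys i) p)) chi) ->
  exists i j, [/\ (i < j)%N, (j <= m)%N & same_class eta p (Ys i) (Ys j)].

(** The class of [Y] is not algebraic over [e] and [p]: no formula true of [Y] is covered by
    finitely many classes. *)
Definition nonalgebraic (V JY JP : Type) (e : V -> univ M) (eta : Fm Lr (JY + JY + JP)) (Y : JY -> univ M) (p : JP -> univ M) : Prop :=
  forall z : Fm Lr (V + JP + JY), holds (M := M) (sume (sume e p) Y) z -> forall n, exists Ys : nat -> JY -> univ M,
    (forall i, (i < n)%N -> holds (M := M) (sume (sume e p) (Ys i)) z) /\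
    forall i j, (i < j)%N -> (j < n)%N -> ~ same_class eta p (Ys i) (Ys j).

Lemma same_class_sym JY JP (eta : Fm Lr (JY + JY + JP)) p Y Y' :
  same_class eta p Y Y' -> same_class eta p Y' Y.
Proof. by move=> H W; rewrite H. Qed.

Lemma same_class_trans JY JP (eta : Fm Lr (JY + JY + JP)) p Y Y' Y2 :
  same_class eta p Y Y' -> same_class eta p Y' Y2 -> same_class eta p Y Y2.
Proof. by move=> H H' W; rewrite H. Qed.

Lemma same_class_fm (JY JP : countType) (eta : Fm Lr (JY + JY + JP)) : exists s : Fm Lr (JY + JY + JP),
  forall p Y Y', holds (M := M) (sume (sume Y Y') p) s <-> same_class eta p Y Y'.
Proof.
pose f (o : JY + JY + JP) : JY + JY + JP + JY := match o with inl (inl v) => inl (inl (inl v))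
  | inl (inr w) => inr w | inr p => inl (inr p) end.
pose g (o : JY + JY + JP) : JY + JY + JP + JY := match o with inl (inl v) => inl (inl (inr v))
  | inl (inr w) => inr w | inr p => inl (inr p) end.
have [s Hs] : defb (fun (N : structure Lr) (e : JY + JY + JP -> univ N) => forall W, holds (sume e W) (ren f eta) <-> holds (sume e W) (ren g eta)).
  apply: (@defb_all _ _ _ _ (fun N e => holds e (ren f eta) <-> holds e (ren g eta))).
  by apply: defb_iff; apply: defb_fm.
have fE Y Y' p W : sume (sume (sume Y Y') p) W \o f =1 (sume (sume Y W) p : _ -> univ M) by do 2?case.
have gE Y Y' p W : sume (sume (sume Y Y') p) W \o g =1 (sume (sume Y' W) p : _ -> univ M) by do 2?case.
exists s => p Y Y'; rewrite (Hs M (0 : K)).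
by split=> H W; have := H W; rewrite !holds_ren (holds_ext _ (fE Y Y' p W)) (holds_ext _ (gE Y Y' p W)).
Qed.

Definition labelled (B V JY JP : Type) (e : V -> univ M) (b : B -> univ M)
  (chi : Fm Lr (B + (JY + JP))) (eta : Fm Lr (JY + JY + JP)) (m : nat) (Y : JY -> univ M) (p : JP -> univ M) : Prop :=
  [/\ holds (M := M) (sume b (sume Y p)) chi, few_classes chi eta m & nonalgebraic e eta Y p].

Lemma labelled_nat (B V : Type) (JY JP : countType) (v0 : V) (e : V -> univ M) (b : B -> univ M) chi eta m
  (Y : JY -> univ M) (p : JP -> univ M) (R : K -> Prop) :
  (forall v, R (e v)) -> (forall j, R (Y j)) -> (forall j, R (p j)) ->
  labelled e b chi eta m Y p ->
  exists (chi' : Fm Lr (B + (nat + nat))) (eta' : Fm Lr (nat + nat + nat)) (Y' p' : nat -> univ M),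
    [/\ forall j, R (Y' j), forall j, R (p' j) & labelled e b chi' eta' m Y' p'].
Proof.
move=> Re RY Rp [Hchi Hfew Hna].
pose ex (J : countType) (y : J -> univ M) (n : nat) : univ M := if @unpickle J n is Some j then y j else e v0.
have exK (J : countType) (y : J -> univ M) : ex J y \o pickle = y.
  by apply: funext => j /=; rewrite /ex pickleK.
have Rex (J : countType) (y : J -> univ M) : (forall j, R (y j)) -> forall n, R (ex J y n).
  by move=> Ry n; rewrite /ex; case: unpickle.
pose f (o : B + (JY + JP)) : B + (nat + nat) := match o with inl v => inl v
  | inr (inl j) => inr (inl (pickle j)) | inr (inr j) => inr (inr (pickle j)) end.
pose g (o : JY + JY + JP) : nat + nat + nat := match o with inl (inl v) => inl (inl (pickle v))
  | inl (inr j) => inl (inr (pickle j)) | inr j => inr (pickle j) end.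
have fE x y q : holds (M := M) (sume x (sume y q)) (ren f chi) <-> holds (M := M) (sume x (sume (y \o pickle) (q \o pickle))) chi.
  by rewrite holds_ren; apply: holds_ext; do 2?case.
have gE x y q : holds (M := M) (sume (sume x y) q) (ren g eta) <-> holds (M := M) (sume (sume (x \o pickle) (y \o pickle)) (q \o pickle)) eta.
  by rewrite holds_ren; apply: holds_ext; do 2?case.
have cE q y y' : same_class (ren g eta) q y y' <-> same_class eta (q \o pickle) (y \o pickle) (y' \o pickle).
  split=> H W; last by rewrite !gE.
  by have := H (ex JY W); rewrite !gE !exK.
exists (ren f chi), (ren g eta), (ex JY Y), (ex JP p); split; [exact: Rex|exact: Rex|split].
- by rewrite fE !exK.
- move=> x q Ys H; have [|i [j [ij jm S]]] := Hfew x (q \o pickle) (fun i => Ys i \o pickle).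
    by move=> i /H /fE.
  by exists i, j; split=> //; apply/cE.
- move=> z Hz n.
  pose h (o : V + nat + nat) : V + JP + JY := match o with
    | inl (inl v) => inl (inl v)
    | inl (inr i) => if @unpickle JP i is Some j then inl (inr j) else inl (inl v0)
    | inr i => if @unpickle JY i is Some j then inr j else inl (inl v0) end.
  have hE y : holds (M := M) (sume (sume e p) y) (ren h z) <-> holds (M := M) (sume (sume e (ex JP p)) (ex JY y)) z.
    rewrite holds_ren; apply: holds_ext => -[[v|i]|i] //=; rewrite /ex; by case: unpickle.
  have [|Ys [Y1 Y2]] := Hna (ren h z) _ n; first exact/hE.
  exists (fun i => ex JY (Ys i)); split=> [i /Y1 /hE //|i j ij jn /cE]; rewrite !exK.
  exact: Y2.
Qed.

End Labels.

(** * Conjugates of jets and the equivalence relation induced on them *)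

Section Conjugates.

Variables (K : fieldType) (k : nat).
Hypothesis char0 : forall n, n.+1%:R != 0 :> K.
Notation M := (Kr K).
Variable d : 'I_k -> K -> K.
Hypotheses (dd : forall i, der (d i)) (dc : forall i j x, d i (d j x) = d j (d i x)).
Hypothesis lK : large K.
Variable T : theory Lr.
Hypotheses (mcT : model_complete T) (KT : model T (Kr K)).
Hypothesis satK : countably_saturated (Kd d).
Variable Ts : theory (Ld k).
Hypotheses (mcTs : model_complete Ts) (KTs : model Ts (Kd d)).
Hypothesis expand : forall D : 'I_k -> K -> K, (forall i, der (D i)) ->
  (forall i j x, D i (D j x) = D j (D i x)) ->
  exists (N : structure (Ld k)) (h : forall u, Kd D u -> N u), [/\ model Ts N, embedding h &
    forall (V : Type) (e : V -> K) (p : Fm Lr V),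
      holds (M := Kr K) e p <-> holds (M := N) (fun v => h tt (e v)) (lift_fm k p)].

Let satr : countably_saturated (Kr K) := saturated_reduct satK.
Notation jet := (jet d).

Lemma jet_determines (X : countType) (e e' : X -> K) :
  eqr K (jet e) (jet e') -> eqv (M := Kd d) (N := Kd d) e e'.
Proof.
move=> E.
have E1 := ring_type_determines char0 dd dc lK mcT KT satK mcTs KTs expand
  (jclosed_jet d e) (jclosed_jet d e') E.
exact: (eqv_ren (fun x => (x, [::])) E1).
Qed.

Lemma jets_determine (V J : countType) s (e : V -> univ M) (a a' : J -> univ M) : jclosed d s e ->
  eqr K (sume e (jet a)) (sume e (jet a')) -> eqv (M := Kd d) (N := Kd d) (sume e a) (sume e a').
Proof.
move=> je E.
have E1 := ring_type_determines char0 dd dc lK mcT KT satK mcTs KTs expand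
  (jclosed_sume je (jclosed_jet d a)) (jclosed_sume je (jclosed_jet d a')) E.
pose f (o : V + J) : V + J * seq 'I_k := match o with inl v => inl v | inr j => inr (j, [::]) end.
by apply: eqv_ext (eqv_ren f E1); case.
Qed.

Lemma conjugate_jets (V A J : countType) s sA (e : V -> univ M) (A0 : A -> univ M) (a0 : J -> univ M) Y :
  jclosed d s e -> jclosed d sA A0 -> eqr K (sume e (jet a0)) (sume e Y) ->
  indep (range e) (fun z => range e z \/ range A0 z) (Y : J * seq 'I_k -> K) ->
  exists a : J -> K, eqr K (sume (sume e A0) Y) (sume (sume e A0) (jet a)).
Proof.
move=> je jA E I.
have [eta [jeta Eeta]] := realize_jets char0 dd dc lK mcT KT satK mcTs KTs expand je jA (jclosed_jet d a0) E I.
exists (fun j => eta (j, [::])).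
apply: eqv_ext Eeta => // -[//|[j w]] /=.
elim: w => //= i w IH; apply: etrans (esym (jeta i (j, w))) _; congr (d i); exact: IH.
Qed.

Section OverModel.

Variables (nu : nat -> univ M) (sn : 'I_k -> nat -> nat).
Hypothesis jn : jclosed d sn nu.
Variables (J : countType) (al : J -> univ M).
Notation Jt := (J * seq 'I_k)%type.
Notation q Y := (eqr K (sume nu (jet al)) (sume nu Y)).

(** Once the earlier tuples [B] have been moved onto [B'], a tuple independent from [B] follows as a
    jet; iterating this requires each tuple to be independent from all earlier ones. *)
Lemma conjugate_step (A : countType) sA (B B' : A -> univ M) (Y : Jt -> univ M) :
  jclosed d sA B' -> eqr K (sume nu B) (sume nu B') -> q Y ->
  indep (range nu) (fun z => range nu z \/ range B z) (Y : Jt -> K) ->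
  exists a : J -> K, eqr K (sume (sume nu B) Y) (sume (sume nu B') (jet a)).
Proof.
move=> jB E qY I.
have [Y' EY] := @eqv_extend _ _ M (0 : K) satr _ _ _ _ Y E.
have qY' : q Y'.
  apply: eqv_trans qY _.
  pose f (o : nat + Jt) : nat + A + Jt := match o with inl v => inl (inl v) | inr j => inr j end.
  by apply: eqv_ext (eqv_ren f EY); case.
have [a Ea] := conjugate_jets jn jB qY' (indep_eqv char0 EY I).
by exists a; apply: eqv_trans EY Ea.
Qed.

Variable E : Fm (Ld k) (J + J).
Definition E_rel (a a' : J -> univ (Kd d)) : Prop := holds (M := Kd d) (sume a a') E.
Hypothesis E_sym : forall a a', E_rel a a' -> E_rel a' a.
Hypothesis E_trans : forall a a' a2, E_rel a a' -> E_rel a' a2 -> E_rel a a2.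

Definition jets2 (Y Y' : Jt -> univ M) (o : (J + J) * seq 'I_k) : univ M :=
  match o with (inl j, w) => Y (j, w) | (inr j, w) => Y' (j, w) end.

Lemma jets2_jet (a a' : J -> K) : jets2 (jet a) (jet a') = jet (sume a a').
Proof. by apply: funext => -[[j|j] w]. Qed.

Definition E_ring : Fm Lr ((J + J) * seq 'I_k) :=
  sval (cid (ring_formula satK jet_determines E)).

(** Meaningful for arbitrary tuples, but symmetry and transitivity are inherited from [E] only on
    jets. *)
Definition E_alg (Y Y' : Jt -> univ M) : Prop := holds (M := M) (jets2 Y Y') E_ring.

Lemma E_algE (a a' : J -> K) : E_alg (jet a) (jet a') <-> E_rel a a'.
Proof. by rewrite /E_alg jets2_jet /E_ring; case: cid => p Hp /=; rewrite -Hp. Qed.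

Lemma E_alg_eqv (W : Type) (e e' : W -> univ M) (f g : Jt -> W) :
  eqr K e e' -> E_alg (e \o f) (e \o g) -> E_alg (e' \o f) (e' \o g).
Proof.
move=> H; pose h (o : (J + J) * seq 'I_k) := match o with (inl j, w) => f (j, w) | (inr j, w) => g (j, w) end.
have hE x : jets2 (x \o f) (x \o g) = x \o h by apply: funext => -[[j|j] w].
by rewrite /E_alg !hE; case: (eqv_ren h H E_ring).
Qed.

(** Among [m + 1] successively independent realizations of the type of [al] over [nu] and [b], two
    must lie in the same class. *)
Lemma independent_pair (X : countType) (b : X -> K) (chi : Fm (Ld k) (nat + X + J)) m :
  holds (M := Kd d) (sume (sume nu b) al) chi ->
  (forall f : nat -> J -> K, (forall i, (i <= m)%N -> holds (M := Kd d) (sume (sume nu b) (f i)) chi) ->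
     exists i j, [/\ (i < j)%N, (j <= m)%N & E_rel (f i) (f j)]) ->
  indep (range nu) (fun z => range nu z \/ range (jet b) z) (jet al) ->
  exists a a' : J -> K, [/\ q (jet a), q (jet a'), E_rel a a' &
    indep (range nu) (fun z => range nu z \/ range (jet a) z) (jet a')].
Proof.
move=> Hchi bound I; pose e0 : _ -> univ M := sume nu (jet b).
have je0 := jclosed_sume jn (jclosed_jet d b); rewrite -/e0 in je0.
pose P (a : J -> univ M) := eqr K (sume e0 (jet al)) (sume e0 (jet a)).
have Pq a : P a -> q (jet a).
  pose f (o : nat + Jt) : nat + X * seq 'I_k + Jt := match o with inl v => inl (inl v) | inr j => inr j end.
  by move=> H; apply: eqv_ext (eqv_ren f H); case.
have [|f [Pf rf]] := build_sequence al (P := P)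
    (rel := fun a a' => indep (range nu) (fun z => range nu z \/ range (jet a) z) (jet a')) _ m.+1.
  move=> n f Pf; pose A0 (o : nat * Jt) : univ M := jet (f o.1) o.2.
  have jA : jclosed d (fun i o => (o.1, jshift i o.2)) A0 by [].
  have [Y [EY IY]] := ext_indep char0 lK mcT KT satr A0 (jet al) (@eqv_refl _ _ M _ e0).
  have [a Ea] := conjugate_jets je0 jA EY IY.
  have Pa : P a.
    apply: eqv_trans EY _.
    pose g (o : nat + X * seq 'I_k + Jt) : nat + X * seq 'I_k + nat * Jt + Jt :=
      match o with inl v => inl (inl v) | inr j => inr j end.
    by apply: eqv_ext (eqv_ren g Ea); case.
  exists a; split=> // i Hi.
  (* Transitivity: the new jet is independent from [b] over [nu] like [al], and over [nu] and [b]
     from the earlier jets. *)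
  have I1 := indep_eqv char0 Ea IY.
  have I2 := indep_eqv char0 Pa I.
  apply: (@indep_mono _ _ (fun z => range e0 z \/ range A0 z)).
    by move=> z [[v <-]|[j <-]]; [left; exists (inl v)|right; exists (i, j)].
  apply: (indep_trans I2); apply: indep_base I1 => z /range_sume; exact.
have [|i [j [ij jm Eij]]] := bound f.
  move=> i Hi; have H := jets_determine je0 (Pf i Hi).
  pose g (o : nat + X + J) : nat + X * seq 'I_k + J := match o with inl (inl v) => inl (inl v)
    | inl (inr x) => inl (inr (x, [::])) | inr j => inr j end.
  have /(_ chi) [H1 _] := eqv_ren g H.
  have gE (a : J -> K) : sume e0 a \o g =1 sume (sume nu b) a by do 2?case.
  apply: (@holds_eq _ _ (Kd d) _ _ _ _ (gE (f i))); apply: H1.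
  exact: (@holds_eq _ _ (Kd d) _ _ _ _ (fun o => esym (gE al o)) Hchi).
have ii : (i < m.+1)%N by apply: leq_trans ij (leq_trans jm _).
exists (f i), (f j); split=> //; [exact: Pq (Pf i ii)|exact: Pq (Pf j jm)|exact: rf].
Qed.

Hypothesis pair : exists a a' : J -> K, [/\ q (jet a), q (jet a'), E_rel a a' &
    indep (range nu) (fun z => range nu z \/ range (jet a) z) (jet a')].

Lemma sumeA (V A B : Type) (e : V -> univ M) (x : A -> univ M) (y : B -> univ M)
  (e' : V -> univ M) (x' : A -> univ M) (y' : B -> univ M) :
  eqr K (sume (sume e x) y) (sume (sume e' x') y') <-> eqr K (sume e (sume x y)) (sume e' (sume x' y')).
Proof.
pose f (o : V + (A + B)) : V + A + B := match o with inl v => inl (inl v)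
  | inr (inl a) => inl (inr a) | inr (inr b) => inr b end.
pose g (o : V + A + B) : V + (A + B) := match o with inl (inl v) => inl v
  | inl (inr a) => inr (inl a) | inr b => inr (inr b) end.
by split=> H; [apply: eqv_ext (eqv_ren f H)|apply: eqv_ext (eqv_ren g H)]; do 2?case.
Qed.

Lemma three_jets (Y1 Y2 Y3 : Jt -> univ M) : q Y1 -> q Y2 -> q Y3 ->
  indep (range nu) (fun z => range nu z \/ range Y1 z) (Y2 : Jt -> K) ->
  indep (range nu) (fun z => range nu z \/ range (sume Y1 Y2) z) (Y3 : Jt -> K) ->
  exists a1 a2 a3 : J -> K, eqr K (sume nu (sume (sume Y1 Y2) Y3)) (sume nu (sume (sume (jet a1) (jet a2)) (jet a3))).
Proof.
move=> q1 q2 q3 I2 I3.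
pose B0 (v : void) : univ M := match v with end.
have [||a1 E1] := @conjugate_step void (fun _ v => v) B0 B0 Y1 _ (@eqv_refl _ _ M _ _) q1; first by move=> i [].
  by move=> D dD DB; exists D; split=> // z [/DB|[[]]].
have {}E1 : eqr K (sume nu Y1) (sume nu (jet a1)).
  pose g (o : nat + Jt) : nat + void + Jt := match o with inl v => inl (inl v) | inr j => inr j end.
  by apply: eqv_ext (eqv_ren g E1); case.
have [a2 /sumeA E2] := conjugate_step (jclosed_jet d a1) E1 q2 I2.
have [a3 /sumeA E3] := conjugate_step (jclosed_sume (jclosed_jet d a1) (jclosed_jet d a2)) E2 q3 I3.
by exists a1, a2, a3.
Qed.

(** [Y2] is a test tuple. Being independent from [Y] and [Y'] together, it can be moved onto a jet
    along with either of them, even when [Y] and [Y'] cannot be moved jointly. *)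
Definition link (Y Y' Y2 : Jt -> univ M) : Prop :=
  [/\ q Y, q Y', q Y2, indep (range nu) (fun z => range nu z \/ range (sume Y Y') z) (Y2 : Jt -> K) & E_alg Y2 Y].

(** The answer does not depend on the test tuple. [Y3] is first made independent from [Y2] as well,
    within its type over [Y] and [Y']. The triples formed by [Y2], the new [Y3'] and either [Y] or
    [Y'] are then conjugate to jets: the first one relates [Y3'] to [Y2], and the second one [Y3']
    to [Y']. *)
Lemma link_exclusive Y Y' Y2 Y3 : link Y Y' Y2 -> E_alg Y2 Y' -> link Y Y' Y3 -> E_alg Y3 Y'.
Proof.
move=> [q1 q1' q2 I2 E2] E2' [_ _ q3 I3 E3].
have [Y3' [H3 I3']] := ext_indep char0 lK mcT KT satr Y2 Y3 (@eqv_refl _ _ M _ (sume nu (sume Y Y'))).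
have q3' : q Y3'.
  apply: eqv_trans q3 _.
  pose g (o : nat + Jt) : nat + (Jt + Jt) + Jt := match o with inl v => inl (inl v) | inr j => inr j end.
  by apply: eqv_ext (eqv_ren g H3); case.
have I : indep (range nu) (fun z => range (sume nu (sume Y Y')) z \/ range Y2 z) (Y3' : Jt -> K).
  apply: (indep_trans (indep_eqv char0 H3 I3)); apply: indep_base I3' => z /range_sume; exact.
have E31 : E_alg Y3' Y.
  exact: (E_alg_eqv (f := @inr _ Jt) (g := fun o => inl (inr (inl o))) H3 E3).
have tri (Y1 : Jt -> univ M) : q Y1 -> (forall z, range Y1 z -> range (sume Y Y') z) ->
    exists a1 a2 a3 : J -> K, eqr K (sume nu (sume (sume Y1 Y2) Y3')) (sume nu (sume (sume (jet a1) (jet a2)) (jet a3))).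
  move=> qY1 sub; apply: three_jets => //.
    by apply: indep_mono I2 => z [|/sub]; [left|right].
  apply: indep_mono I => z [Nz|/range_sume [/sub Yz|Yz]]; [left|left|by right]; apply/range_sume; by [left|right].
have E32 : E_alg Y3' Y2.
  have [|a1 [a2 [a3 H]]] := tri Y q1; first by move=> z Hz; apply/range_sume; left.
  have H' := eqv_sym H.
  apply: (E_alg_eqv (f := fun o => inr (inr o)) (g := fun o => inr (inl (inr o))) H').
  apply/E_algE; apply: (@E_trans _ a1); apply/E_algE.
    exact: (E_alg_eqv (f := fun o => inr (inr o)) (g := fun o => inr (inl (inl o))) H E31).
  apply/E_algE/E_sym/E_algE.
  exact: (E_alg_eqv (f := fun o => inr (inl (inr o))) (g := fun o => inr (inl (inl o))) H E2).
have [|a1 [a2 [a3 H]]] := tri Y' q1'; first by move=> z Hz; apply/range_sume; right.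
have H' := eqv_sym H.
have E31' : E_alg Y3' Y'.
  apply: (E_alg_eqv (f := fun o => inr (inr o)) (g := fun o => inr (inl (inl o))) H').
  apply/E_algE; apply: (@E_trans _ a2); apply/E_algE.
    exact: (E_alg_eqv (f := fun o => inr (inr o)) (g := fun o => inr (inl (inr o))) H E32).
  exact: (E_alg_eqv (f := fun o => inr (inl (inr o))) (g := fun o => inr (inl (inl o))) H E2').
exact: (E_alg_eqv (f := @inr _ Jt) (g := fun o => inl (inr (inr o))) (eqv_sym H3) E31').
Qed.

(** The independent pair is copied onto [Y], with its second member taken independent from [Y']
    too. *)
Lemma link_exists Y Y' : q Y -> q Y' -> exists Y2, link Y Y' Y2.
Proof.
move=> q1 q1'; have [a [a' [qa qa' Eaa I]]] := pair.
have [Y2 [H2 I2]] := ext_indep char0 lK mcT KT satr Y' (jet a') (eqv_trans (eqv_sym qa) q1).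
exists Y2; split=> //.
- apply: eqv_trans qa' _.
  pose g (o : nat + Jt) : nat + Jt + Jt := match o with inl v => inl (inl v) | inr j => inr j end.
  by apply: eqv_ext (eqv_ren g H2); case.
- apply: (@indep_mono _ _ (fun z => range (sume nu Y) z \/ range Y' z)).
    by move=> z [Nz|/range_sume [Yz|Yz]]; [left; apply/range_sume; left|left; apply/range_sume; right|right].
  apply: (indep_trans (indep_eqv char0 H2 I)); apply: indep_base I2 => z /range_sume; exact.
- apply: (E_alg_eqv (f := @inr _ Jt) (g := fun o => inl (inr o)) H2).
  by apply/E_algE/E_sym.
Qed.

(* The equivalence relation that [E] induces on realizations of the algebraic
   type of the jet of [al], whether or not they are jets. *)
Definition linked Y Y' : Prop := exists Y2, link Y Y' Y2 /\ E_alg Y2 Y'.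

Lemma linked_refl Y : q Y -> linked Y Y.
Proof. by move=> qY; have [Y2 H] := link_exists qY qY; exists Y2; split=> //; case: H. Qed.

Lemma linked_sym Y Y' : linked Y Y' -> linked Y' Y.
Proof.
move=> [Y2 [[q1 q1' q2 I E1] E1']]; exists Y2; split=> //; split=> //.
apply: indep_mono I => z [|/range_sume [Yz|Yz]]; [by left| |]; by right; apply/range_sume; auto.
Qed.

(** A conjugate of the first test tuple, independent also from [Y3], tests both pairs at once. *)
Lemma linked_trans Y Y' Y3 : linked Y Y' -> linked Y' Y3 -> linked Y Y3.
Proof.
move=> [Y2 [[q1 q1' q2 I2 E2] E2']] [Y4 [L4 E4]]; have [_ q3 _ _ _] := L4.
have [Z [HZ IZ]] := ext_indep char0 lK mcT KT satr Y3 Y2 (@eqv_refl _ _ M _ (sume nu (sume Y Y'))).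
have qZ : q Z.
  apply: eqv_trans q2 _.
  pose g (o : nat + Jt) : nat + (Jt + Jt) + Jt := match o with inl v => inl (inl v) | inr j => inr j end.
  by apply: eqv_ext (eqv_ren g HZ); case.
have I : indep (range nu) (fun z => range (sume nu (sume Y Y')) z \/ range Y3 z) (Z : Jt -> K).
  apply: (indep_trans (indep_eqv char0 HZ I2)); apply: indep_base IZ => z /range_sume; exact.
have EZ : E_alg Z Y by exact: (E_alg_eqv (f := @inr _ Jt) (g := fun o => inl (inr (inl o))) HZ E2).
have EZ' : E_alg Z Y' by exact: (E_alg_eqv (f := @inr _ Jt) (g := fun o => inl (inr (inr o))) HZ E2').
have LZ : link Y' Y3 Z.
  split=> //; apply: indep_mono I => z [Nz|/range_sume [Yz|Yz]]; [left|left|by right]; apply/range_sume.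
    by left.
  by right; apply/range_sume; right.
exists Z; split; last exact: link_exclusive L4 E4 LZ.
split=> //; apply: indep_mono I => z [Nz|/range_sume [Yz|Yz]]; [left|left|by right]; apply/range_sume.
  by left.
by right; apply/range_sume; left.
Qed.

(** For actual jets only the test tuple remains to be moved onto a jet, after which [E] can be used
    directly. *)
Lemma linked_jets (a a' : J -> K) : q (jet a) -> q (jet a') -> linked (jet a) (jet a') <-> E_rel a a'.
Proof.
move=> qa qa'.
have real Y2 : link (jet a) (jet a') Y2 -> exists a2, [/\ E_rel a2 a & E_alg Y2 (jet a') <-> E_rel a2 a'].
  move=> [_ _ q2 I E1].
  have [a2 /sumeA H] := conjugate_step (jclosed_sume (jclosed_jet d a) (jclosed_jet d a')) (@eqv_refl _ _ M _ _) q2 I.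
  exists a2; split.
    apply/E_algE.
    exact: (E_alg_eqv (f := fun o => inr (inr o)) (g := fun o => inr (inl (inl o))) H E1).
  split=> [E2|/E_algE E2].
    apply/E_algE.
    exact: (E_alg_eqv (f := fun o => inr (inr o)) (g := fun o => inr (inl (inr o))) H E2).
  exact: (E_alg_eqv (f := fun o => inr (inr o)) (g := fun o => inr (inl (inr o))) (eqv_sym H) E2).
split=> [[Y2 [/real [a2 [E1 E2]] /E2 E3]]|Eaa]; first exact: E_trans (E_sym E1) E3.
have [Y2 L] := link_exists qa qa'; exists Y2; split=> //.
have [a2 [E1 E2]] := real Y2 L; apply/E2; exact: E_trans E1 Eaa.
Qed.

(** As all test tuples agree, [linked] and its complement are both projections of type-definable
    sets. *)
Lemma linked_definable : exists t : Fm Lr (nat + (Jt + Jt)), forall Y Y', q Y -> q Y' ->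
  (linked Y Y' <-> holds (M := M) (sume nu (sume Y Y')) t).
Proof.
pose y (z : Jt + Jt + Jt -> univ M) := z \o inl \o inl.
pose y' (z : Jt + Jt + Jt -> univ M) := z \o inl \o inr.
pose y2 (z : Jt + Jt + Jt -> univ M) := z \o inr.
have splitE (P Q : Type) (w : P + Q -> univ M) : w = sume (w \o inl) (w \o inr) by apply: funext; case.
have dq (f : Jt -> Jt + Jt + Jt) : tdef (M := M) nu (fun z => q (z \o f)).
  exact: (@tdef_ren _ _ M _ nu Jt (Jt + Jt + Jt)%type f _ (tdef_type (M := M) (e := nu) (a := jet al))).
have dE (f g : Jt -> Jt + Jt + Jt) : exists r, forall z, holds (M := M) (sume nu z) r <-> E_alg (z \o f) (z \o g).
  pose h (o : (J + J) * seq 'I_k) : nat + (Jt + Jt + Jt) := match o with (inl j, w) => inr (f (j, w)) | (inr j, w) => inr (g (j, w)) end.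
  exists (ren h E_ring) => z; rewrite holds_ren; apply: holds_ext; by do 2?case.
have dL : tdef (M := M) nu (fun z => link (y z) (y' z) (y2 z)).
  have [r Hr] := dE inr (fun o => inl (inl o)).
  have dI := @tdef_indep K char0 nat (Jt + Jt)%type Jt nu (jet al).
  apply: tdef_ext (tdef_and (dq (fun o => inl (inl o))) (tdef_and (dq (fun o => inl (inr o)))
    (tdef_and dI (tdef_fm (M := M) (e := nu) (r := r))))) => z.
  rewrite Hr /link -(splitE _ _ (z \o inl)).
  by split=> [[? [? [[? ?] ?]]]|[? ? ? ? ?]].
have [r Hr] := dE inr (fun o => inl (inr o)).
have d1 : tdef (M := M) nu (fun z => link (y z) (y' z) (y2 z) /\ E_alg (y2 z) (y' z)).
  by apply: tdef_ext (tdef_and dL (tdef_fm (M := M) (e := nu) (r := r))) => z; rewrite Hr.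
have d2 : tdef (M := M) nu (fun z => link (y z) (y' z) (y2 z) /\ ~ E_alg (y2 z) (y' z)).
  by apply: tdef_ext (tdef_and dL (tdef_fm (M := M) (e := nu) (r := Imp r (Bot _)))) => z; rewrite -Hr.
have [|t [t1 t2]] := separate (M := M) (0 : K) satr d1 d2.
  move=> x Y2 Y3 [L2 E2] [L3]; apply; exact: link_exclusive L2 E2 L3.
exists t => Y Y' qY qY'; split=> [[Y2 H]|Ht]; first exact: t1 H.
have [Y2 L] := link_exists qY qY'; exists Y2; split=> //.
by apply: contrapT => N; exact: (t2 (sume Y Y') Y2 (conj L N) Ht).
Qed.

(** [linked] is an equivalence relation only on realizations of the type, while [same_class]
    quantifies over all [W]. The formula [psi] is a neighbourhood of the type on which [t(Y, W)], as
    a function of [Y], is constant on linked realizations; [eta] is [t] restricted to it. *)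
Lemma linked_class : exists eta : Fm Lr (Jt + Jt + nat), forall Y Y', q Y -> q Y' ->
  (same_class eta nu Y Y' <-> linked Y Y').
Proof.
have [t Ht] := linked_definable.
pose th (Y Y' : Jt -> univ M) := holds (M := M) (sume nu (sume Y Y')) t.
pose z3 := (Jt + (Jt + Jt))%type.
have dq (f : Jt -> z3) : tdef (M := M) nu (fun z => q (z \o f)).
  exact: (@tdef_ren _ _ M _ nu Jt z3 f _ (tdef_type (M := M) (e := nu) (a := jet al))).
have dt (f g : Jt -> z3) : exists r, forall z, holds (M := M) (sume nu z) r <-> th (z \o f) (z \o g).
  pose h (o : nat + (Jt + Jt)) : nat + z3 := match o with inl v => inl v | inr (inl j) => inr (f j) | inr (inr j) => inr (g j) end.
  by exists (ren h t) => z; rewrite holds_ren; apply: holds_ext; do 2?case.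
pose y := @inl Jt Jt; pose y' := @inr Jt Jt.
have [r1 Hr1] := dt (inr \o y) (inr \o y').
have [r2 Hr2] := dt (inr \o y) inl.
have [r3 Hr3] := dt (inr \o y') inl.
have [r Hr] : defb (fun (N : structure Lr) (e : nat + z3 -> univ N) => holds e r1 /\ ~ (holds e r2 <-> holds e r3)).
  by apply: defb_and; [apply: defb_fm|apply/defb_not/defb_iff; apply: defb_fm].
pose z1 := (Jt + void)%type.
have d1 : tdef (M := M) nu (fun z : z1 -> univ M => q (z \o inl)).
  exact: (@tdef_ren _ _ M _ nu Jt z1 inl _ (tdef_type (M := M) (e := nu) (a := jet al))).
have d2 := tdef_and (dq (inr \o y)) (tdef_and (dq (inr \o y')) (tdef_fm (M := M) (e := nu) (r := r))).
have [|psi [p1 p2]] := separate (M := M) (0 : K) satr d1 d2.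
  move=> W v Y qW [qY [qY' /(Hr M (0 : K)) [Hr1' N]]].
  change (q (Y \o y)) in qY; change (q (Y \o y')) in qY'; change (q W) in qW.
  have /(iffRL (Ht _ _ qY qY')) L : th (Y \o y) (Y \o y') by exact: (iffLR (Hr1 (sume W Y)) Hr1').
  apply: N; rewrite Hr2 Hr3.
  change (th (Y \o y) W <-> th (Y \o y') W); split=> /(iffRL (Ht _ _ _ qW)) => [/(_ qY)|/(_ qY')] L'.
    exact/(Ht _ _ qY' qW)/(linked_trans (linked_sym L) L').
  exact/(Ht _ _ qY qW)/(linked_trans L L').
pose f1 (o : nat + Jt) : Jt + Jt + nat := match o with inl v => inr v | inr j => inl (inr j) end.
pose f2 (o : nat + (Jt + Jt)) : Jt + Jt + nat := match o with inl v => inr v | inr (inl j) => inl (inl j) | inr (inr j) => inl (inr j) end.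
have [eta Heta] : defb (fun (N : structure Lr) (e : Jt + Jt + nat -> univ N) => holds e (ren f1 psi) /\ holds e (ren f2 t)).
  by apply: defb_and; apply: defb_fm.
have etaE Y W : holds (M := M) (sume (sume Y W) nu) eta <-> holds (M := M) (sume nu W) psi /\ th Y W.
  have f1E : sume (sume Y W) nu \o f1 =1 sume nu W by case.
  have f2E : sume (sume Y W) nu \o f2 =1 sume nu (sume Y W) by do 2?case.
  by rewrite (Heta M (0 : K)) !holds_ren (holds_ext _ f1E) (holds_ext _ f2E).
have psiq W : q W -> holds (M := M) (sume nu W) psi.
  by move=> qW; apply: (p1 W (fun v : void => match v with end)).
exists eta => Y Y' qY qY'; split=> [H|L W].
  have /etaE [_ /(Ht _ _ qY qY') //] : holds (M := M) (sume (sume Y Y') nu) eta.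
  by apply/H/etaE; split; [exact: psiq|apply/(Ht _ _ qY' qY'); exact: linked_refl].
rewrite !etaE; suff H : holds (M := M) (sume nu W) psi -> (th Y W <-> th Y' W).
  by split=> -[h1 h2]; split=> //; apply/(H h1).
move=> HW; apply: contrapT => N; apply: (p2 W (sume Y Y')) HW; split=> //; split=> //.
apply/(Hr M (0 : K)); split; first by apply/Hr1/(Ht _ _ qY qY').
by rewrite Hr2 Hr3.
Qed.

Variable eta : Fm Lr (Jt + Jt + nat).
Hypothesis eta_linked : forall Y Y', q Y -> q Y' -> (same_class eta nu Y Y' <-> linked Y Y').

Lemma eta_jets (a a' : J -> K) : q (jet a) -> q (jet a') -> same_class eta nu (jet a) (jet a') <-> E_rel a a'.
Proof. by move=> qa qa'; rewrite eta_linked // linked_jets. Qed.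

(** If the class were algebraic, elementarity in the ring language would put a tuple of [nu] into
    it. That tuple need not be a jet; a second reflection, in the differential language, replaces it
    by the jet of a tuple of [nu], which would be [E]-equivalent to [al]. *)
Lemma nonalgebraic_over_model : elem (M := Kd d) nu -> (forall g : J -> nat, ~ E_rel (nu \o g) al) ->
  nonalgebraic nu eta (jet al) nu.
Proof.
move=> el notN z Hz n; apply: contrapT => Nn.
have [s Hs] := same_class_fm K eta.
pose good m := exists Ys : nat -> Jt -> univ M,
    (forall i, (i < m)%N -> holds (M := M) (sume (sume nu nu) (Ys i)) z) /\
    forall i j, (i < j)%N -> (j < m)%N -> ~ same_class eta nu (Ys i) (Ys j).
(* A maximal number [m] of pairwise inequivalent solutions of [z]: their classes cover [z]. *)
have [m [[Ys [Y1 Y2]] Nm]] : exists m, good m /\ ~ good m.+1.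
  apply: contrapT => N; apply: Nn; elim: n => [|n IH]; first by exists (fun _ => jet al).
  by apply: contrapT => N'; apply: N; exists n.
have cover Y : holds (M := M) (sume (sume nu nu) Y) z -> exists i : 'I_m, same_class eta nu (Ys i) Y.
  move=> HY; apply: contrapT => N; apply: Nm; exists (fun i => if i == m then Y else Ys i); split=> [i|i j].
    by rewrite ltnS leq_eqVlt; case: eqP => //= _ /Y1.
  move=> ij; rewrite ltnS leq_eqVlt => /orP[/eqP E1|jm].
    rewrite E1 eqxx ltn_eqF -?E1 // => S; rewrite E1 in ij; apply: N; by exists (Ordinal ij).
  by rewrite !ltn_eqF ?(ltn_trans ij) //; apply: Y2.
pose f1 (o : nat + nat + Jt) : nat + nat * Jt + Jt := match o with inl (inl v) => inl (inl v)
  | inl (inr v) => inl (inl v) | inr j => inr j end.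
pose f2 (i : nat) (o : Jt + Jt + nat) : nat + nat * Jt + Jt := match o with inl (inl j) => inl (inr (i, j))
  | inl (inr j) => inr j | inr v => inl (inl v) end.
have [t Ht] : defb (fun (N : structure Lr) (e : nat + nat * Jt -> univ N) => forall Y, holds (sume e Y) (ren f1 z) ->
    exists i, List.In i (enum 'I_m) /\ holds (sume e Y) (ren (f2 i) s)).
  apply: (@defb_all _ _ _ _ (fun N e => holds e (ren f1 z) -> exists i, List.In i (enum 'I_m) /\ holds e (ren (f2 i) s))).
  apply: defb_imp; first exact: defb_fm.
  by apply: (@defb_exseq _ _ _ _ (fun i N e => holds e (ren (f2 (nat_of_ord i)) s))) => i _; apply: defb_fm.
have f1E (u : nat * Jt -> univ M) (Y : Jt -> univ M) : sume (sume nu u) Y \o f1 =1 sume (sume nu nu) Y by do 2?case.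
have f2E i (u : nat * Jt -> univ M) (Y : Jt -> univ M) : sume (sume nu u) Y \o f2 i =1 sume (sume (fun j => u (i, j)) Y) nu by do 2?case.
have elr : elem (M := M) nu by exact: (elem_reduct el).
have [|g Hg] := elem_tuple elr (p := t) (w := fun o => Ys o.1 o.2).
  apply/(Ht M (0 : K)) => Y; rewrite holds_ren (holds_ext _ (f1E _ Y)) => /cover [i Hi].
  exists i; split; first by apply/In_mem; rewrite mem_enum.
  by rewrite holds_ren (holds_ext _ (f2E _ _ Y)); apply/Hs.
have [|i [_ Hi]] := iffLR (Ht M (0 : K) _) Hg (jet al).
  by rewrite holds_ren (holds_ext _ (f1E _ _)).
rewrite holds_ren (holds_ext _ (f2E _ _ _)) in Hi.
pose h j := g (nat_of_ord i, j).
have {}Hi : same_class eta nu (nu \o h) (jet al) by apply/Hs.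
pose f3 (o : Jt + Jt + nat) : nat + Jt := match o with inl (inl j) => inl (h j) | inl (inr j) => inr j | inr v => inl v end.
have f3E (x : J -> K) : holds (M := Kd d) (sume nu x) (jinst (ren f3 s)) <-> same_class eta nu (nu \o h) (jet x).
  rewrite (@holds_jinst K k d _ _ nu x) holds_ren -Hs; apply: holds_ext; by do 2?case.
pose f4 (o : Jt + Jt + nat) : nat + (J + J) * seq 'I_k := match o with inl (inl (j, w)) => inr (inl j, w)
  | inl (inr (j, w)) => inr (inr j, w) | inr v => inl v end.
have f4E (x : J + J -> K) : holds (M := Kd d) (sume nu x) (jinst (ren f4 s)) <->
    same_class eta nu (jet (x \o inl)) (jet (x \o inr)).
  rewrite (@holds_jinst K k d _ _ nu x) holds_ren -Hs; apply: holds_ext; by do 3?case.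
have dj (W : countType) (f : J -> W) : tdef (M := Kd d) nu (fun x : W -> univ (Kd d) => q (jet (x \o f))).
  have T1 := @tdef_jet K k d nat J nu _ (tdef_type (M := M) (e := nu) (a := jet al)).
  exact: (@tdef_ren _ _ (Kd d) _ nu J W f _ T1).
pose r := Imp (ren (@inr nat _) E) (Bot _) : Fm (Ld k) (nat + (J + J)).
have rE (x : J + J -> K) : holds (M := Kd d) (sume nu x) r <-> ~ E_rel (x \o inl) (x \o inr).
  suff X : holds (M := Kd d) (sume nu x) (ren inr E) <-> E_rel (x \o inl) (x \o inr) by split=> H /X /H.
  by rewrite holds_ren; apply: holds_ext; do 2?case.
(* That same class implies [E] is known for realizations of the type only; [t'] is a formula of the
   type which suffices for it when [al] is the other member. *)
have [|t' [t1 t2]] := separate (M := Kd d) (0 : K) satK (dj (J + void)%type inl)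
    (tdef_and (dj (J + J)%type inr) (tdef_and (tdef_fm (M := Kd d) (e := nu) (r := jinst (ren f4 s))) (tdef_fm (M := Kd d) (e := nu) (r := r)))).
  move=> x y1 y2 qx [qy [/f4E S /rE]]; apply.
  by apply/eta_jets.
have [p Hp] : defb (fun (N : structure (Ld k)) (e : nat + J -> univ N) => holds e t' /\ holds e (jinst (ren f3 s))).
  by apply: defb_and; apply: defb_fm.
have [|g' /(Hp (Kd d) (0 : K)) [H1 H2]] := elem_tuple el (p := p) (w := al).
  apply/(Hp (Kd d) (0 : K)); split; first by apply: (t1 al (fun v : void => match v with end)).
  exact/f3E.
apply: (notN g'); apply: contrapT => N; apply: (t2 (nu \o g') al) H1; split; first exact: eqv_refl.
split; last exact/rE.
apply/f4E; apply: same_class_trans (same_class_sym _) Hi; exact/f3E.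
Qed.

(** If the class of the jet were not algebraic over [nu] and the jet of [b] either, one could choose
    [m + 1] realizations of the type of [al] over [nu] and [b] that are pairwise not [E]-related,
    against the bound. *)
Lemma label_over_model (X : countType) (b : X -> K) (chi : Fm (Ld k) (nat + X + J)) m :
  holds (M := Kd d) (sume (sume nu b) al) chi ->
  (forall f : nat -> J -> K, (forall i, (i <= m)%N -> holds (M := Kd d) (sume (sume nu b) (f i)) chi) ->
     exists i j, [/\ (i < j)%N, (j <= m)%N & E_rel (f i) (f j)]) ->
  elem (M := Kd d) nu -> (forall g : J -> nat, ~ E_rel (nu \o g) al) ->
  exists chi' m', labelled nu (jet b) chi' eta m' (jet al) nu.
Proof.
move=> Hchi bound el notN; pose e0 : _ -> univ M := sume nu (jet b).
have je0 := jclosed_sume jn (jclosed_jet d b); rewrite -/e0 in je0.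
have [s Hs] := same_class_fm K eta.
suff [z [Hz [n Nn]]] : exists z, holds (M := M) (sume e0 (jet al)) z /\ exists n, ~ exists Ys : nat -> Jt -> univ M,
    (forall i, (i < n)%N -> holds (M := M) (sume e0 (Ys i)) z) /\
    forall i j, (i < j)%N -> (j < n)%N -> ~ same_class eta nu (Ys i) (Ys j).
  pose B := (X * seq 'I_k)%type.
  pose f1 (o : nat + B + Jt) : B + (Jt + nat) := match o with inl (inl v) => inr (inr v)
    | inl (inr x) => inl x | inr j => inr (inl j) end.
  pose g1 i (o : nat + B + Jt) : B + (Jt + nat) + nat * Jt := match o with inl (inl v) => inl (inr (inr v))
    | inl (inr x) => inl (inl x) | inr j => inr (i, j) end.
  pose g2 i i' (o : Jt + Jt + nat) : B + (Jt + nat) + nat * Jt := match o with inl (inl j) => inr (i, j)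
    | inl (inr j) => inr (i', j) | inr v => inl (inr (inr v)) end.
  have f1E (x : B -> univ M) (Y : Jt -> univ M) p : sume x (sume Y p) \o f1 =1 sume (sume p x) Y by do 2?case.
  have g1E i (x : B -> univ M) (Y : Jt -> univ M) p (u : nat * Jt -> univ M) :
    sume (sume x (sume Y p)) u \o g1 i =1 sume (sume p x) (fun j => u (i, j)) by do 2?case.
  have g2E i i' (x : B -> univ M) (Y : Jt -> univ M) p (u : nat * Jt -> univ M) :
    sume (sume x (sume Y p)) u \o g2 i i' =1 sume (sume (fun j => u (i, j)) (fun j => u (i', j))) p by do 2?case.
  (* [c] adds to [z] that [z] has no [n] pairwise inequivalent solutions; this makes [few_classes]
     true for all parameters. *)
  have [c Hc] : defb (fun (N : structure Lr) (e : B + (Jt + nat) -> univ N) => holds e (ren f1 z) /\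
      ~ exists u : nat * Jt -> univ N, (forall i : 'I_n, holds (sume e u) (ren (g1 i) z)) /\
        (forall ij : 'I_n * 'I_n, (ij.1 < ij.2)%N -> ~ holds (sume e u) (ren (g2 ij.1 ij.2) s))).
    apply: defb_and; first exact: defb_fm.
    apply: defb_not; apply: (@defb_ex _ _ _ _ (fun N e => (forall i : 'I_n, holds e (ren (g1 i) z)) /\
        (forall ij : 'I_n * 'I_n, (ij.1 < ij.2)%N -> ~ holds e (ren (g2 ij.1 ij.2) s)))).
    apply: defb_and.
      by apply: (@defb_allfin _ _ _ _ (fun (i : 'I_n) N e => holds e (ren (g1 i) z))) => i; apply: defb_fm.
    apply: (@defb_allfin _ _ _ _ (fun (ij : 'I_n * 'I_n) N e => (ij.1 < ij.2)%N -> ~ holds e (ren (g2 ij.1 ij.2) s))) => -[i i'] /=.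
    case: (ltnP i i') => _; last by apply: defb_ext (defb_true _ _) => N _ e; split.
    apply: defb_ext (defb_not (defb_fm (ren (g2 i i') s))) => N _ e; by split=> [|/(_ isT)].
  exists c, n; split.
  - apply/(Hc M (0 : K)); split; first by rewrite holds_ren (holds_ext _ (f1E _ _ _)).
    move=> [u [U1 U2]]; apply: Nn; exists (fun i j => u (i, j)); split=> [i Hi|i j ij Hj S].
      by have := U1 (Ordinal Hi); rewrite holds_ren (holds_ext _ (g1E _ _ _ _ _)).
    have := U2 (Ordinal (ltn_trans ij Hj), Ordinal Hj) ij.
    by rewrite holds_ren (holds_ext _ (g2E _ _ _ _ _ _)); apply; apply/Hs.
  - move=> x p Ys H; apply: contrapT => N.
    have /(Hc M (0 : K)) [_] := H 0%N isT; apply; exists (fun o => Ys o.1 o.2); split=> [i|[i i'] /= ii'].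
      rewrite holds_ren (holds_ext _ (g1E _ _ _ _ _)) /=.
      have /(Hc M (0 : K)) [+ _] := H i (ltnW (ltn_ord i)).
      by rewrite holds_ren (holds_ext _ (f1E _ _ _)).
    rewrite holds_ren (holds_ext _ (g2E _ _ _ _ _ _)) => /Hs S; apply: N; exists i, i'; split=> //.
    exact: ltnW.
  - exact: nonalgebraic_over_model.
apply: contrapT => star.
have {}star z : holds (M := M) (sume e0 (jet al)) z -> forall n, exists Ys : nat -> Jt -> univ M,
    (forall i, (i < n)%N -> holds (M := M) (sume e0 (Ys i)) z) /\
    forall i j, (i < j)%N -> (j < n)%N -> ~ same_class eta nu (Ys i) (Ys j).
  by move=> Hz n; apply: contrapT => N; apply: star; exists z; split=> //; exists n.
pose P (a : J -> univ M) := eqr K (sume e0 (jet al)) (sume e0 (jet a)).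
have qe (Y : Jt -> univ M) : eqr K (sume e0 (jet al)) (sume e0 Y) -> q Y.
  pose f (o : nat + Jt) : nat + X * seq 'I_k + Jt := match o with inl v => inl (inl v) | inr j => inr j end.
  by move=> H; apply: eqv_ext (eqv_ren f H); case.
have [|f [Pf rf]] := build_sequence al (P := P) (rel := fun a a' => ~ E_rel a a') _ m.+1.
  move=> n f Pf; pose A0 (o : nat * Jt) : univ M := jet (f o.1) o.2.
  have jA : jclosed d (fun i o => (o.1, jshift i o.2)) A0 by [].
  pose B := (X * seq 'I_k)%type.
  pose h1 i (o : nat + B + Jt) : nat + B + nat * Jt := match o with inl v => inl v | inr j => inr (i, j) end.
  pose h2 i i' (o : Jt + Jt + nat) : nat + B + nat * Jt := match o with inl (inl j) => inr (i, j)
    | inl (inr j) => inr (i', j) | inr v => inl (inl v) end.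
  have h1E i (u : nat * Jt -> univ M) : sume e0 u \o h1 i =1 sume e0 (fun j => u (i, j)) by do 2?case.
  have h2E i i' (u : nat * Jt -> univ M) : sume e0 u \o h2 i i' =1 sume (sume (fun j => u (i, j)) (fun j => u (i', j))) nu by do 2?case.
  pose G r := (exists i r0, (i <= n)%N /\ holds (M := M) (sume e0 (jet al)) r0 /\ r = ren (h1 i) r0) \/
     (exists i j, (i < j)%N /\ (j <= n)%N /\ r = Imp (ren (h2 i j) s) (Bot _)).
  have [|Z HZ] := @realize _ _ M (0 : K) satr _ (nat * Jt)%type e0 G.
    move=> l Gl.
    suff [z [Hz Hl]] : exists z, holds (M := M) (sume e0 (jet al)) z /\ forall u : nat * Jt -> univ M,
        (forall i, (i <= n)%N -> holds (M := M) (sume e0 (fun j => u (i, j))) z) ->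
        (forall i j, (i < j)%N -> (j <= n)%N -> ~ same_class eta nu (fun j' => u (i, j')) (fun j' => u (j, j'))) ->
        forall r, List.In r l -> holds (M := M) (sume e0 u) r.
      have [Ys [Y1 Y2]] := star z Hz n.+1.
      exists (fun o => Ys o.1 o.2) => r; exact: Hl.
    elim: l Gl => [|r l IH] Gl.
      by exists (@Equ Lr _ (fun _ => tt) tt (rzero _) (rzero _)).
    have [|z [Hz Hl]] := IH; first by move=> r' Hr'; apply: Gl; right.
    case: (Gl r (or_introl erefl)) => [[i [r0 [Hi [Hr0 ->]]]]|[i [j [ij [jn' ->]]]]].
      have [pr Epr] : defb (fun (M : structure Lr) (e : nat + B + Jt -> univ M) => holds e z /\ holds e r0).
        by apply: defb_and; apply: defb_fm.
      exists pr; split; first by apply/(Epr M (0 : K)).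
      move=> u U1 U2 r2 /= [<-|]; last by apply: Hl => // i' Hi'; have /(Epr M (0 : K)) [] := U1 i' Hi'.
      by rewrite holds_ren (holds_ext _ (h1E i u)); have /(Epr M (0 : K)) [] := U1 i Hi.
    exists z; split=> // u U1 U2 r2 /= [<-|]; last exact: Hl.
    suff : ~ holds (M := M) (sume e0 u) (ren (h2 i j) s) by [].
    by rewrite holds_ren (holds_ext _ (h2E i j u)) => /Hs; apply: U2.
  (* The [n + 1] inequivalent realizations are made independent from the earlier jets, so that one
     of them can be turned into a jet over these. *)
  have [Z' [EZ IZ]] := ext_indep char0 lK mcT KT satr A0 Z (@eqv_refl _ _ M _ e0).
  pose Yl l (j : Jt) : univ M := Z' (l, j).
  have EY l : (l <= n)%N -> eqr K (sume e0 (jet al)) (sume e0 (Yl l)).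
    move=> ln; have H r : holds (M := M) (sume e0 (jet al)) r -> holds (M := M) (sume e0 (Yl l)) r.
      move=> Hr; have Gr : G (ren (h1 l) r) by left; exists l, r.
      by have /EZ := HZ _ Gr; rewrite holds_ren (holds_ext _ (h1E l Z')).
    move=> r; split; first exact: H.
    by move=> Hr; apply: contrapT => N; exact: (H (Imp r (Bot _)) N Hr).
  have NS i j : (i < j)%N -> (j <= n)%N -> ~ same_class eta nu (Yl i) (Yl j).
    move=> ij jn'; have Gr : G (Imp (ren (h2 i j) s) (Bot _)) by right; exists i, j.
    have /EZ H := HZ _ Gr; move=> /Hs S; apply: H.
    by apply/holds_ren; apply: holds_eq S => o; rewrite h2E.
  (* [n + 1] distinct classes against [n] earlier jets. *)
  have [l [ln Nl]] : exists l, (l <= n)%N /\ forall i, (i < n)%N -> ~ same_class eta nu (Yl l) (jet (f i)).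
    apply: contrapT => N.
    have /choice [F HF] : forall l : 'I_n.+1, exists i : 'I_n, same_class eta nu (Yl l) (jet (f i)).
      move=> l; apply: contrapT => N'; apply: N; exists l; split; first by rewrite -ltnS.
      by move=> i Hi S; apply: N'; exists (Ordinal Hi).
    have F_inj : injective F.
      move=> l l' E1; apply/val_inj; case: (ltngtP l l') => // ll; [case: (NS _ _ ll _)|case: (NS _ _ ll _)];
        try by rewrite -ltnS.
      - apply: same_class_trans (HF l) _; rewrite E1; exact: same_class_sym (HF l').
      - apply: same_class_trans (HF l') _; rewrite -E1; exact: same_class_sym (HF l).
    by have := leq_card F F_inj; rewrite !card_ord ltnn.
  have IY : indep (range e0) (fun z => range e0 z \/ range A0 z) (Yl l : Jt -> K).
    exact: (indep_sub (fun j => (l, j)) IZ).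
  have [a Ea] := conjugate_jets je0 jA (EY l ln) IY.
  have Pa : P a.
    apply: eqv_trans (EY l ln) _.
    pose g (o : nat + B + Jt) : nat + B + nat * Jt + Jt := match o with inl v => inl (inl v) | inr j => inr j end.
    by apply: eqv_ext (eqv_ren g Ea); case.
  exists a; split=> // i Hi /(iffRL (eta_jets (qe _ (Pf i Hi)) (qe _ Pa))) S; apply: (Nl i Hi).
  apply/Hs; move/same_class_sym/Hs: S.
  pose g (o : Jt + Jt + nat) : nat + B + nat * Jt + Jt := match o with inl (inl j) => inr j
    | inl (inr j) => inl (inr (i, j)) | inr v => inl (inl (inl v)) end.
  have gE (Y : Jt -> univ M) : sume (sume e0 A0) Y \o g =1 sume (sume Y (jet (f i))) nu by do 2?case.
  have := Ea (ren g s); rewrite !holds_ren (holds_ext _ (gE (Yl l))) (holds_ext _ (gE (jet a))).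
  by case.
have [|i [j [ij jm]]] := bound f; last by apply: rf.
move=> i Hi; have H := jets_determine je0 (Pf i Hi).
pose g (o : nat + X + J) : nat + X * seq 'I_k + J := match o with inl (inl v) => inl (inl v)
  | inl (inr x) => inl (inr (x, [::])) | inr j => inr j end.
have /(_ chi) [H1 _] := eqv_ren g H.
have gE (a : J -> K) : sume e0 a \o g =1 sume (sume nu b) a by do 2?case.
apply: (@holds_eq _ _ (Kd d) _ _ _ _ (gE (f i))); apply: H1.
exact: (@holds_eq _ _ (Kd d) _ _ _ _ (fun o => esym (gE al o)) Hchi).
Qed.

End OverModel.

(** A coordinate of the jet that witnesses dependence is algebraic over [nu], the coordinates before
    it and the jet of [b], but not without the latter. Its classes are single elements, bounded by a
    polynomial on one side and infinitely many by largeness on the other. *)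
Lemma label_dependent (nu : nat -> univ M) (X J : countType) (b : X -> K) (al : J -> K) :
  ~ indep (range nu) (fun z => range nu z \/ range (jet b) z) (jet al) ->
  exists (JP : countType) chi (eta : Fm Lr (unit + unit + JP)) m Y p,
    [/\ labelled nu (jet b) chi eta m Y p, forall j : unit, range nu (Y j) \/ range (jet al) (Y j) &
      forall j, range nu (p j) \/ range (jet al) (p j)].
Proof.
have sub x : range nu x -> range nu x \/ range (jet b) x by left.
rewrite (indepP char0 _ sub) => /existsNP [j /not_implyP [C NC]].
pose I := {i : J * seq 'I_k | (pickle i < pickle j)%N}.
pose p : nat + I -> univ M := sume nu (fun i => jet al (val i)).
pose y : K := jet al j.
have pB z : range p z <-> range nu z \/ before (jet al) j z.
  rewrite range_sume; split=> -[|[i]]; try by left.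
    by move=> <-; right; exists (val i); split=> //; apply: (valP i).
  by move=> [Hi <-]; right; exists (exist _ i Hi).
have /(cl_alg_rel char0) [ts Hts] : cl (range (sume p (jet b))) y.
  by apply: cl_mono C => z [[Nz|bz]|bj]; apply/range_sume; [left; apply/pB; left|right|left; apply/pB; right].
have NC' : ~ cl (range (sume nu p)) y.
  by move=> C'; apply: NC; apply: cl_mono C' => z /range_sume [|/pB]; [left|].
have [t Ht] := alg_rel_defb ts.
pose eta : Fm Lr (unit + unit + (nat + I)) := @Equ Lr _ (fun _ => tt) tt (rvar (inl (inl tt))) (rvar (inl (inr tt))).
have sc q (Y Y' : unit -> univ M) : same_class eta q Y Y' <-> Y tt = Y' tt.
  rewrite /same_class /holds /=; split=> [H|-> //]; exact/esym/(H Y).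
pose f (o : option ((nat + I) + X * seq 'I_k)) : X * seq 'I_k + (unit + (nat + I)) := match o with
  | Some (inl i) => inr (inr i) | Some (inr x) => inl x | None => inr (inl tt) end.
have fE (x : X * seq 'I_k -> univ M) (Y : unit -> univ M) (q : nat + I -> univ M) :
  sume x (sume Y q) \o f =1 oext (sume q x) (Y tt) by do 2?case.
exists (nat + I)%type, (ren f t), eta, (size ts), (fun _ => y), p; split; last 2 first.
- by move=> _; right; exists j.
- by move=> [v|i]; [left; exists v|right; exists (val i)].
split.
- by rewrite holds_ren (holds_ext _ (fE _ _ _)); apply/(Ht M (0 : K)).
- move=> x q Ys H; have [l [sl Hl]] := alg_rel_finite ts (sume q x).
  have Yl i : (i <= size ts)%N -> (Ys i tt : K) \in l.
    move=> /H; rewrite holds_ren (holds_ext _ (fE _ _ _)) => /(Ht M (0 : K)); exact: Hl.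
  pose r := [seq (Ys i tt : K) | i <- iota 0 (size ts).+1].
  have : ~~ uniq r.
    apply/negP => ur; have /(uniq_leq_size ur) : {subset r <= l}.
      by move=> z /mapP [i + ->]; rewrite mem_iota add0n ltnS => /= /Yl.
    by rewrite size_map size_iota => le; move: (leq_trans le sl); rewrite ltnn.
  move=> /(uniqPn (0 : K)) [i [i' [ii' i's E]]]; exists i, i'.
  rewrite size_map size_iota in i's; split=> //; apply/sc.
  move: E; rewrite !(nth_map 0%N) ?size_iota ?(ltn_trans ii') // !nth_iota ?(ltn_trans ii') //.
- move=> z Hz n.
  pose g (o : nat + (nat + I) + unit) : option (nat + (nat + I)) := match o with inl v => Some v | inr _ => None end.
  have gE (Y : unit -> univ M) : oext (sume nu p) (Y tt) \o g =1 sume (sume nu p) Y by case=> [//|[]].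
  have Hz' : holds (M := M) (oext (sume nu p) y) (ren g z).
    by rewrite holds_ren (holds_ext _ (gE (fun _ => y))).
  have [|h [H1 H2]] := @build_sequence K 0 (fun a => holds (M := M) (oext (sume nu p) a) (ren g z)) (fun a a' => a <> a') _ n.
    move=> n' h _; have [a [al' Ha]] := infinitely_many_solutions char0 lK mcT KT satr NC' Hz' [seq h i | i <- iota 0 n'].
    exists a; split=> // i Hi E; move/negP: al'; apply; rewrite -E; apply: map_f; by rewrite mem_iota.
  exists (fun i _ => h i); split=> [i /H1|i i' ii' i'n /sc]; last exact: H2.
  by rewrite holds_ren (holds_ext _ (gE (fun _ => h i))).
Qed.

Lemma label_exists (nu : nat -> univ M) (X J : countType) (b : X -> K) (al : J -> K)
  (E : Fm (Ld k) (J + J)) (chi : Fm (Ld k) (nat + X + J)) m :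
  elem (M := Kd d) nu ->
  (forall a a', E_rel E a a' -> E_rel E a' a) ->
  (forall a a' a2, E_rel E a a' -> E_rel E a' a2 -> E_rel E a a2) ->
  holds (M := Kd d) (sume (sume nu b) al) chi ->
  (forall f : nat -> J -> K, (forall i, (i <= m)%N -> holds (M := Kd d) (sume (sume nu b) (f i)) chi) ->
     exists i j, [/\ (i < j)%N, (j <= m)%N & E_rel E (f i) (f j)]) ->
  (forall g : J -> nat, ~ E_rel E (nu \o g) al) ->
  exists (chi' : Fm Lr (X * seq 'I_k + (nat + nat))) (eta : Fm Lr (nat + nat + nat)) m' (Y p : nat -> univ M),
    [/\ forall j, range nu (Y j) \/ range (jet al) (Y j), forall j, range nu (p j) \/ range (jet al) (p j) &
        labelled nu (jet b) chi' eta m' Y p].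
Proof.
move=> el Es Et Hchi bound notN.
pose R z := range nu z \/ range (jet al) z; have Rn v : R (nu v) by left; exists v.
have [sn jn] := elem_jclosed el.
case: (pselect (indep (range nu) (fun z => range nu z \/ range (jet b) z) (jet al))) => [I|/label_dependent].
  have pr := independent_pair jn Hchi bound I.
  have [eta Heta] := linked_class jn Es Et pr.
  have [chi' [m' L]] := label_over_model jn Es Et pr Heta Hchi bound el notN.
  have [|chi2 [eta2 [Y [p [RY Rp L2]]]]] := @labelled_nat _ _ _ _ _ 0%N _ _ _ _ _ _ _ R Rn _ Rn L.
    by move=> j; right; exists j.
  by exists chi2, eta2, m', Y, p.
move=> [JP [c [eta [m' [Y [p [L RY Rp]]]]]]].
have [chi2 [eta2 [Y2 [p2 [RY2 Rp2 L2]]]]] := @labelled_nat _ _ _ _ _ 0%N _ _ _ _ _ _ _ R Rn RY Rp L.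
by exists chi2, eta2, m', Y2, p2.
Qed.

End Conjugates.

(** * Labels and thorn-ranks of the field *)

Section LabelledStates.

Variable K : fieldType.
Notation M := (Kr K).
Notation C := (struct_eq M).
Hypothesis satr : countably_saturated M.
Variables (B : countType) (chi : Fm Lr (B + (nat + nat))) (eta : Fm Lr (nat + nat + nat)) (m : nat).

Lemma support_bound V (c : V -> nat) (p : Fm Lr V) : exists b, forall e e' : V -> univ M,
  (forall v, (c v < b)%N -> e v = e' v) -> holds (M := M) e p <-> holds (M := M) e' p.
Proof.
have [l Hl] := formula_support p.
have [b Hb] : exists b, forall v, List.In v l -> (c v < b)%N.
  elim: l {Hl} => [|v l [b Hb]]; first by exists 0%N.
  exists (maxn (c v).+1 b) => w /= [<-|/Hb]; rewrite leq_max ?ltnSn // => ->; by rewrite orbT.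
by exists b => e e' H; apply: Hl => v /Hb /H.
Qed.

(** Non-algebraicity provides [n + 1] inequivalent solutions of each formula of the type, also at
    the conjugate parameters [d], [p0]; one of them avoids [n] given classes, and saturation handles
    all formulas together. *)
Lemma avoid_classes (e d : nat -> univ M) (Y p p0 : nat -> univ M) n (YL : nat -> nat -> univ M) :
  nonalgebraic e eta Y p -> eqr K (sume e p) (sume d p0) ->
  exists Y0, eqr K (sume (sume e p) Y) (sume (sume d p0) Y0) /\
    forall i, (i < n)%N -> ~ same_class eta p0 (YL i) Y0.
Proof.
move=> na E; have [s Hs] := same_class_fm K eta.
pose e1 : nat + nat + nat * nat -> univ M := sume (sume d p0) (fun o => YL o.1 o.2).
pose h1 (o : nat + nat + nat) : nat + nat + nat * nat + nat := match o with inl v => inl (inl v) | inr j => inr j end.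
pose h2 i (o : nat + nat + nat) : nat + nat + nat * nat + nat := match o with inl (inl j) => inl (inr (i, j))
    | inl (inr j) => inr j | inr v => inl (inl (inr v)) end.
have h1E (y : nat -> univ M) : sume e1 y \o h1 =1 sume (sume d p0) y by do 2?case.
have h2E i (y : nat -> univ M) : sume e1 y \o h2 i =1 sume (sume (YL i) y) p0 by do 2?case.
pose G r := (exists r0, holds (M := M) (sume (sume e p) Y) r0 /\ r = ren h1 r0) \/
     (exists i, (i < n)%N /\ r = Imp (ren (h2 i) s) (Bot _)).
have [|Y0 HY0] := @realize _ _ M (0 : K) satr _ nat e1 G.
  move=> l Gl.
  suff [z [Hz Hl]] : exists z, holds (M := M) (sume (sume e p) Y) z /\ forall y,
      holds (M := M) (sume (sume d p0) y) z -> (forall i, (i < n)%N -> ~ same_class eta p0 (YL i) y) ->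
      forall r, List.In r l -> holds (M := M) (sume e1 y) r.
    pose g1 i (o : nat + nat + nat) : nat + nat + nat * nat := match o with inl v => inl v | inr j => inr (i, j) end.
    pose g2 i i' (o : nat + nat + nat) : nat + nat + nat * nat := match o with inl (inl j) => inr (i, j)
      | inl (inr j) => inr (i', j) | inr v => inl (inr v) end.
    pose Fam (N : structure Lr) (e : nat + nat -> univ N) := exists u : nat * nat -> univ N,
        (forall i : 'I_n.+1, holds (sume e u) (ren (g1 i) z)) /\
        (forall ij : 'I_n.+1 * 'I_n.+1, (ij.1 < ij.2)%N -> ~ holds (sume e u) (ren (g2 ij.1 ij.2) s)).
    have dF : defb Fam.
      apply: (@defb_ex _ _ _ _ (fun N e => (forall i : 'I_n.+1, holds e (ren (g1 i) z)) /\
        (forall ij : 'I_n.+1 * 'I_n.+1, (ij.1 < ij.2)%N -> ~ holds e (ren (g2 ij.1 ij.2) s)))).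
      apply: defb_and.
        by apply: (@defb_allfin _ _ _ _ (fun (i : 'I_n.+1) N e => holds e (ren (g1 i) z))) => i; apply: defb_fm.
      apply: (@defb_allfin _ _ _ _ (fun (ij : 'I_n.+1 * 'I_n.+1) N e => (ij.1 < ij.2)%N -> ~ holds e (ren (g2 ij.1 ij.2) s))) => -[i i'] /=.
      case: (ltnP i i') => _; last by apply: defb_ext (defb_true _ _) => N _ e'; split.
      apply: defb_ext (defb_not (defb_fm (ren (g2 i i') s))) => N _ e'; by split=> [|/(_ isT)].
    have g1E i (x : nat + nat -> univ M) u : sume x u \o g1 i =1 sume x (fun j => u (i, j)) by do 2?case.
    have g2E i i' (x q : nat -> univ M) u : sume (sume x q) u \o g2 i i' =1 sume (sume (fun j => u (i, j)) (fun j => u (i', j))) q by do 2?case.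
    have Fe : Fam M (sume e p).
      have [Ys [Y1 Y2]] := na z Hz n.+1.
      exists (fun o => Ys o.1 o.2); split=> [i|[i i'] /= ii'].
        by rewrite holds_ren (holds_ext _ (g1E _ _ _)); apply: Y1.
      by rewrite holds_ren (holds_ext _ (g2E _ _ _ _ _)) => /Hs; apply: Y2.
    have [u [U1 U2]] := @eqv_defb _ _ M M (0 : K) (0 : K) _ _ _ Fam dF E Fe.
    have [i0 Ni0] : exists i0 : 'I_n.+1, forall i, (i < n)%N -> ~ same_class eta p0 (YL i) (fun j => u (nat_of_ord i0, j)).
      apply: contrapT => N.
      have /choice [F HF] : forall l : 'I_n.+1, exists i : 'I_n, same_class eta p0 (YL i) (fun j => u (nat_of_ord l, j)).
        move=> l'; apply: contrapT => N'; apply: N; exists l' => i Hi S; apply: N'; by exists (Ordinal Hi).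
      have NS (i i' : 'I_n.+1) : (i < i')%N -> ~ same_class eta p0 (fun j => u (nat_of_ord i, j)) (fun j => u (nat_of_ord i', j)).
        by move=> ii' /Hs S; apply: (U2 (i, i') ii'); rewrite holds_ren (holds_ext _ (g2E _ _ _ _ _)).
      have F_inj : injective F.
        move=> i i' E1; apply/val_inj; case: (ltngtP i i') => // ii'; [case: (NS _ _ ii')|case: (NS _ _ ii')].
        - apply: same_class_trans (same_class_sym (HF i)) _; rewrite E1; exact: HF.
        - apply: same_class_trans (same_class_sym (HF i')) _; rewrite -E1; exact: HF.
      by have := leq_card F F_inj; rewrite !card_ord ltnn.
    exists (fun j => u (nat_of_ord i0, j)) => r; apply: Hl => //.
    by have := U1 i0; rewrite holds_ren (holds_ext _ (g1E _ _ _)).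
  elim: l Gl => [|r l IH] Gl.
    by exists (@Equ Lr _ (fun _ => tt) tt (rzero _) (rzero _)).
  have [|z [Hz Hl]] := IH; first by move=> r' Hr'; apply: Gl; right.
  case: (Gl r (or_introl erefl)) => [[r0 [Hr0 ->]]|[i [Hi ->]]].
    have [pr Epr] : defb (fun (M : structure Lr) (e : nat + nat + nat -> univ M) => holds e z /\ holds e r0).
      by apply: defb_and; apply: defb_fm.
    exists pr; split; first by apply/(Epr M (0 : K)).
    move=> y /(Epr M (0 : K)) [Hy1 Hy2] N r2 /= [<-|]; last exact: Hl.
    by rewrite holds_ren (holds_ext _ (h1E _)).
  exists z; split=> // y Hy N r2 /= [<-|]; last exact: Hl.
  suff : ~ holds (M := M) (sume e1 y) (ren (h2 i) s) by [].
  by rewrite holds_ren (holds_ext _ (h2E i _)) => /Hs; apply: N.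
exists Y0; split.
  have H r : holds (M := M) (sume (sume e p) Y) r -> holds (M := M) (sume (sume d p0) Y0) r.
    move=> Hr; have := HY0 (ren h1 r) (or_introl (ex_intro _ r (conj Hr erefl))).
    by rewrite holds_ren (holds_ext _ (h1E _)).
  move=> r; split; first exact: H.
  by move=> Hr; apply: contrapT => N; exact: (H (Imp r (Bot _)) N Hr).
move=> i Hi /Hs S; apply: (HY0 (Imp (ren (h2 i) s) (Bot _)) (or_intror (ex_intro _ i (conj Hi erefl)))).
by apply/holds_ren; apply: holds_eq S => o; rewrite h2E.
Qed.

Variable b : nat.
Notation P := 'I_(b.+1).
Notation Q := 'I_(b.+1 + b.+1).

(** Thorn-ranks allow only finite tuples in [x] and [y], so tuples of length [b + 1] stand for
    infinite ones; [chi_bound] and [class_bound] say that nothing is lost. *)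
Definition hat (I : countType) (u : P -> univ M) (t : I) : univ M := u (inord (pickle t)).
Definition cut (I : countType) (u : I -> univ M) (i : P) : univ M := if @unpickle I i is Some t then u t else (0 : K).
Notation hatn := (@hat nat).
Notation cutn := (@cut nat).

Lemma hat_cut (I : countType) (u : I -> univ M) t : (pickle t < b.+1)%N -> hat (cut u) t = u t.
Proof. by move=> H; rewrite /hat /cut inordK // pickleK. Qed.

Lemma cut_hatn (u : P -> univ M) : cutn (hatn u) = u.
Proof. by apply: funext => i; rewrite /cut /hat /= inord_val. Qed.

Hypothesis chi_bound : forall (x x' : B -> univ M) (Y Y' p p' : nat -> univ M),
  (forall t, (pickle t < b.+1)%N -> x t = x' t) -> (forall i, (i < b.+1)%N -> Y i = Y' i) -> (forall i, (i < b.+1)%N -> p i = p' i) ->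
  holds (M := M) (sume x (sume Y p)) chi <-> holds (M := M) (sume x' (sume Y' p')) chi.
Hypothesis class_bound : forall (Y Y' Y2 Y2' p p' : nat -> univ M),
  (forall i, (i < b.+1)%N -> Y i = Y' i) -> (forall i, (i < b.+1)%N -> Y2 i = Y2' i) -> (forall i, (i < b.+1)%N -> p i = p' i) ->
  same_class eta p Y Y2 <-> same_class eta p' Y' Y2'.

Lemma chi_cut x Y p : holds (M := M) (sume x (sume Y p)) chi <-> holds (M := M) (sume (hat (cut x)) (sume (hatn (cutn Y)) (hatn (cutn p)))) chi.
Proof. by apply: chi_bound => t Ht; rewrite hat_cut. Qed.

Lemma class_cut Y Y' p : same_class eta p Y Y' <-> same_class eta (hatn (cutn p)) (hatn (cutn Y)) (hatn (cutn Y')).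
Proof. by apply: class_bound => t Ht; rewrite hat_cut. Qed.

Definition tup (a : Q -> univ M) : P -> univ M := a \o @lshift b.+1 b.+1.
Definition par (a : Q -> univ M) : P -> univ M := a \o @rshift b.+1 b.+1.
Definition pairt (u v : P -> univ M) (i : Q) : univ M := match split i with inl j => u j | inr j => v j end.

Lemma tup_pairt u v : tup (pairt u v) = u.
Proof. by apply: funext => i; rewrite /tup /pairt /= -[lshift _ i]/(unsplit (inl i)) unsplitK. Qed.
Lemma par_pairt u v : par (pairt u v) = v.
Proof. by apply: funext => i; rewrite /par /pairt /= -[rshift _ i]/(unsplit (inr i)) unsplitK. Qed.

(** The parameter is kept in the code of a class, so that [pi] can fix the parameter of an
    imaginary. *)
Definition code_eq (a a' : Q -> univ M) : Prop :=
  par a = par a' /\ same_class eta (hatn (par a)) (hatn (tup a)) (hatn (tup a')).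

Lemma code_eq_fm : exists p : Fm Lr (Q + Q), forall a a', holds (M := M) (sume a a') p <-> code_eq a a'.
Proof.
have [s Hs] := same_class_fm K eta.
pose f (o : nat + nat + nat) : Q + Q := match o with inl (inl n) => inl (lshift _ (inord n))
  | inl (inr n) => inr (lshift _ (inord n)) | inr n => inl (rshift _ (inord n)) end.
have [p Hp] : defb (fun (N : structure Lr) (e : Q + Q -> univ N) => (forall i : P, e (inl (rshift _ i)) = e (inr (rshift _ i))) /\ holds e (ren f s)).
  apply: defb_and; last exact: defb_fm.
  by apply: (@defb_allfin _ _ _ _ (fun (i : P) N e => e (inl (rshift _ i)) = e (inr (rshift _ i)))) => i; apply: defb_eqv.
exists p => a a'; rewrite (Hp M (0 : K)) holds_ren /code_eq -Hs.
have fE : sume a a' \o f =1 sume (sume (hatn (tup a)) (hatn (tup a'))) (hatn (par a)) by do 2?case.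
rewrite (holds_ext _ fE); split=> -[H1 H2]; split=> //; first by apply: funext.
by move=> i; have := congr1 (fun u => u i) H1.
Qed.

Let code_dom (i : Q) : sort Lr := tt.

Definition code_var (o : Q + Q) : @term Lr _ (juxt code_dom code_dom) tt :=
  match o return @term Lr _ (juxt code_dom code_dom) tt with
  | inl i => @Var Lr _ (juxt code_dom code_dom) (inl i)
  | inr i => @Var Lr _ (juxt code_dom code_dom) (inr i) end.

Definition code_form : formula (juxt code_dom code_dom) :=
  @fsub Lr _ _ (fun _ => tt) (juxt code_dom code_dom) code_var (sval (cid code_eq_fm)).

Lemma code_formE (a a' : assignment M code_dom) : sat (M := M) code_form (ajuxt a a') <-> code_eq a a'.
Proof.
rewrite /code_form; case: cid => p Hp /=; rewrite -Hp.
apply: iff_trans (sat_fsub _ _ _) _.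
by apply: (@holds_ext _ _ M); case.
Qed.

Lemma code_eq_refl a : code_eq a a. Proof. by split. Qed.
Lemma code_eq_sym a a' : code_eq a a' -> code_eq a' a.
Proof. by move=> [H1 H2]; split=> //; rewrite -H1; apply: same_class_sym. Qed.
Lemma code_eq_trans a a' a2 : code_eq a a' -> code_eq a' a2 -> code_eq a a2.
Proof. by move=> [H1 H2] [H3 H4]; split; [rewrite H1|apply: same_class_trans H2 _; rewrite H1]. Qed.

Definition code : eqdef M := @EqDef Lr M (b.+1 + b.+1) code_dom code_form
  (fun a => iffRL (code_formE a a) (code_eq_refl a))
  (fun a a' h => iffRL (code_formE a' a) (code_eq_sym (iffLR (code_formE a a') h)))
  (fun a a' a2 h h' => iffRL (code_formE a a2) (code_eq_trans (iffLR (code_formE a a') h) (iffLR (code_formE a' a2) h'))).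

Definition proj (a : Q -> univ M) : quotient code := exist _ (@eclass Lr M code a) (ex_intro _ a (erefl _)).

Lemma proj_eq a a' : proj a = proj a' <-> code_eq a a'.
Proof.
split=> [/(congr1 (@sval _ _)) /= H|H].
  have : @eclass Lr M code a a' by rewrite H; apply/code_formE; apply: code_eq_refl.
  by move/code_formE.
apply: quotient_eq => /=; apply: funext => c; apply/propext.
split=> /code_formE H'; apply/code_formE; [exact: code_eq_trans (code_eq_sym H) H'|exact: code_eq_trans H H'].
Qed.

Lemma proj_surj (q : quotient code) : exists a, q = proj a.
Proof. by case: q => X [a Xa]; exists a; apply: quotient_eq. Qed.

Notation home := (fun _ => inl tt : sort (sig_eq M)).
Definition ysort (i : 'I_1) : sort (sig_eq M) := inr code.
Definition yass (q : quotient code) : assignment C ysort := fun _ => q.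

Notation xsort := (fun _ : P => inl tt : sort (sig_eq M)).

Lemma yassE (a : assignment C ysort) : a = yass (a ord0).
Proof. by apply: functional_extensionality_dep => i; rewrite (ord1 i). Qed.

Lemma sat_and V (s : V -> sort (sig_eq M)) (p q : formula s) e :
  sat (M := C) (Neg (Imp p (Neg q))) e <-> sat (M := C) p e /\ sat (M := C) q e.
Proof.
split=> [H|[Hp Hq] H]; last exact: H Hp Hq.
by split; apply: contrapT => N; apply: H => Hp // Hq; apply: N.
Qed.

Lemma delta_fm : exists delta : @formula (sig_eq M) (P + 'I_1) (juxt xsort ysort), forall (x : P -> K) (q : quotient code),
  sat (M := C) delta (ajuxt (M := C) (s := xsort) x (yass q)) <->
  exists a, q = proj a /\ holds (M := M) (sume (hat x) (sume (hatn (tup a)) (hatn (par a)))) chi.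
Proof.
pose S : P + 'I_1 + Q -> sort (sig_eq M) := juxt (juxt xsort ysort) (fun _ : Q => inl tt).
pose p1 : formula S := @Equ (sig_eq M) _ S (inr code) (@Var (sig_eq M) _ S (inl (inr ord0)))
  (@App (sig_eq M) _ S (inr code) (fun i => @Var (sig_eq M) _ S (inr i))).
pose f (v : B + (nat + nat)) : @term (sig_eq M) _ S (inl tt) := match v with
  | inl t => @Var (sig_eq M) _ S (inl (inl (inord (pickle t))))
  | inr (inl n) => @Var (sig_eq M) _ S (inr (lshift _ (inord n)))
  | inr (inr n) => @Var (sig_eq M) _ S (inr (rshift _ (inord n))) end.
pose p2 : formula S := @iform Lr M _ (fun _ => tt) chi _ S f.
have [delta Hd] := exists_block (Neg (Imp p1 (Neg p2))).
exists delta => x q; rewrite Hd; split=> [[w /sat_and [H1 /sat_iform H2]]|[w [H1 H2]]]; exists w.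
  split; first exact: H1.
  by move: H2; apply: (@holds_eq _ _ M) => -[t|[n|n]].
apply/sat_and; split; first exact: H1.
by apply/sat_iform; move: H2; apply: (@holds_eq _ _ M) => -[t|[n|n]].
Qed.

Lemma pi_fm : exists pi : @formula (sig_eq M) ('I_1 + P) (juxt ysort xsort), forall (c : P -> K) (q : quotient code),
  sat (M := C) pi (ajuxt (M := C) (t := xsort) (yass q) c) <-> exists a, q = proj a /\ par a = c.
Proof.
pose S : 'I_1 + P + Q -> sort (sig_eq M) := juxt (juxt ysort xsort) (fun _ : Q => inl tt).
pose p1 : formula S := @Equ (sig_eq M) _ S (inr code) (@Var (sig_eq M) _ S (inl (inl ord0)))
  (@App (sig_eq M) _ S (inr code) (fun i => @Var (sig_eq M) _ S (inr i))).
have [r Hr] : defb (fun (N : structure Lr) (e : P + P -> univ N) => forall i, e (inl i) = e (inr i)).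
  by apply: (@defb_allfin _ _ _ _ (fun (i : P) N e => e (inl i) = e (inr i))) => i; apply: defb_eqv.
pose f (v : P + P) : @term (sig_eq M) _ S (inl tt) := match v with
  | inl i => @Var (sig_eq M) _ S (inr (rshift _ i))
  | inr i => @Var (sig_eq M) _ S (inl (inr i)) end.
pose p2 : formula S := @iform Lr M _ (fun _ => tt) r _ S f.
have [pi Hpi] := exists_block (Neg (Imp p1 (Neg p2))).
exists pi => c q; rewrite Hpi; split=> [[w /sat_and [H1 /sat_iform H2]]|[w [H1 H2]]]; exists w.
  split; first exact: H1.
  by apply: funext => i; exact: (iffLR (Hr M (0 : K) _) H2 i).
apply/sat_and; split; first exact: H1.
apply/sat_iform; apply/(Hr M (0 : K)) => i; exact: (congr1 (fun u => u i) H2).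
Qed.

Variable S : (nat -> univ M) -> (B -> univ M) -> Prop.
Hypothesis few : few_classes K chi eta m.
Hypothesis S_step : forall nu be, S nu be -> exists nu' be' r Y p, [/\ S nu' be', nu =1 nu' \o r,
  eqr K (sume nu be) (sume nu be'), (forall j, range nu' (Y j)) /\ (forall j, range nu' (p j)) &
  holds (M := M) (sume be' (sume Y p)) chi /\ nonalgebraic nu eta Y p].

(** Induction on [alpha], for all states, all formulas true of them and all conjugates [d] of [nu]
    at once: the infinitely many instances come from conjugates of [Y], and each carries the whole
    next model along to another [d']. The inconsistency is [m.+1] because [few] finds two equivalent
    tuples among any [m + 1]. *)
Lemma states_thorn delta pi :
  (forall (x : P -> K) (q : quotient code), sat (M := C) delta (ajuxt (M := C) (s := xsort) x (yass q)) <->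
    exists a, q = proj a /\ holds (M := M) (sume (hat x) (sume (hatn (tup a)) (hatn (par a)))) chi) ->
  (forall (c : P -> K) (q : quotient code),
    sat (M := C) pi (ajuxt (M := C) (t := xsort) (yass q) c) <-> exists a, q = proj a /\ par a = c) ->
  forall alpha nu be, S nu be -> forall phi : Fm Lr (nat + P), holds (M := M) (sume nu (cut be)) phi ->
  forall d : nat -> univ M, eqr K nu d ->
  @thorn_ge _ C _ _ _ xsort ysort xsort [:: delta] [:: pi] m.+1 alpha (fun x => holds (M := M) (sume d (x : P -> K)) phi).
Proof.
move=> deltaE piE; elim=> [|alpha IH|J j0 f IH] nu be Sn phi Hphi d Ed /=; last by move=> i; apply: IH Hphi _ Ed.
  have [x' Hx'] := @eqv_extend _ _ M (0 : K) satr _ _ _ _ (cut be : P -> univ M) Ed.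
  by exists x'; apply/Hx'.
have [nu' [be' [r [Y [p [Sn' nur Eb [RY Rp] [Hchi na]]]]]]] := S_step Sn.
(* The conjugate parameter is fixed before the classes to avoid are known: one parameter must serve
   infinitely many instances. *)
have [p0 Ep0] := @eqv_extend _ _ M (0 : K) satr _ _ _ _ p Ed.
exists delta, pi, (cutn p0); split; [by left|by left| |].
- move=> l.
  have /choice [F HF] : forall a : assignment C ysort, exists w, a ord0 = proj w by move=> a; apply: proj_surj.
  have [Y0 [EY0 NY0]] := avoid_classes (size l)
    (fun i => hatn (tup (nth (fun _ => (0 : K)) [seq F a | a <- l] i))) na Ep0.
  pose w0 := pairt (cutn Y0) (cutn p0).
  exists (yass (proj w0)); split; last first.
    move=> al; have [i [il ia]] : exists i, (i < size l)%N /\ nth (yass (proj w0)) l i = yass (proj w0).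
      elim: l al {NY0} => //= a l IHl [->|/IHl [i [Hi Ei]]]; first by exists 0%N.
      by exists i.+1.
    apply: (NY0 i il); rewrite (nth_map (yass (proj w0))) // ia.
    have /proj_eq [E1 E2] : proj (F (yass (proj w0))) = proj w0 by rewrite -HF.
    rewrite class_cut cut_hatn; move: E2; rewrite E1 par_pairt tup_pairt.
    by [].
  split; first by apply/piE; exists w0; rewrite par_pairt.
  have [d' Ed'] := @eqv_extend _ _ M (0 : K) satr _ _ _ _ nu' EY0.
  have coord (u : nat -> K) (f : nat -> nat + nat + nat) (u' : nat -> K) : (forall j, sume (sume nu p) Y (f j) = u j) ->
      (forall j, sume (sume d p0) Y0 (f j) = u' j) -> (forall j, range nu' (u j)) -> exists g, u =1 nu' \o g /\ u' =1 d' \o g.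
    move=> E1 E2 Ru; have [g Hg] := choice Ru; exists g; split=> j /=; first by rewrite Hg.
    have := Ed' (@Equ Lr _ (fun _ => tt) tt (rvar (inl (f j))) (rvar (inr (g j)))); rewrite /holds /= => -[H _].
    by rewrite -E2; apply: H; rewrite E1 Hg.
  have [gY [Y1 Y2]] := coord Y inr Y0 (fun _ => erefl) (fun _ => erefl) RY.
  have [gp [p1 p2]] := coord p (inl \o inr) p0 (fun _ => erefl) (fun _ => erefl) Rp.
  have [gn [n1 n2]] := coord nu (inl \o inl) d (fun _ => erefl) (fun _ => erefl) (fun j => ex_intro _ (r j) (esym (nur j))).
  pose h1 (o : nat + P) : nat + P := match o with inl v => inl (gn v) | inr i => inr i end.
  pose h2 (o : B + (nat + nat)) : nat + P := match o with inl t => inr (inord (pickle t))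
    | inr (inl n) => inl (gY (@inord b n)) | inr (inr n) => inl (gp (@inord b n)) end.
  (* [phi] together with the new instance of [chi], written over the next model, which contains
     [nu], [Y] and [p]. *)
  have [phi' Hphi'] : defb (fun (N : structure Lr) (e : nat + P -> univ N) => holds e (ren h1 phi) /\ holds e (ren h2 chi)).
    by apply: defb_and; apply: defb_fm.
  have h1E x : sume d' x \o h1 =1 sume d x by case=> //= v; rewrite -[RHS]n2.
  have h1E' x : sume nu' x \o h1 =1 sume nu x by case=> //= v; rewrite -[RHS]n1.
  have cutnE (u : nat -> K) n : cutn u (inord n) = u (@inord b n) by rewrite /cut /=.
  have h2E x : sume d' x \o h2 =1 sume (hat x) (sume (hatn (cutn Y0)) (hatn (cutn p0))).
    by do 2?case=> //; move=> n /=; rewrite /hat /= cutnE ?Y2 ?p2.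
  have h2E' x : sume nu' x \o h2 =1 sume (hat x) (sume (hatn (cutn Y)) (hatn (cutn p))).
    by do 2?case=> //; move=> n /=; rewrite /hat /= cutnE ?Y1 ?p1.
  have Hnu' : holds (M := M) (sume nu' (cut be')) phi'.
    apply/(Hphi' M (0 : K)); rewrite !holds_ren (holds_ext _ (h1E' _)) (holds_ext _ (h2E' _)); split; last exact: (iffLR (chi_cut be' Y p) Hchi).
    (* The entries of [cut] are given by terms, a variable or the padding zero, so [phi] passes from
       [be] to [be'] along [Eb]. *)
    pose g (o : nat + P) : Tm Lr (nat + B) := match o with inl v => rvar (inl v)
      | inr i => if @unpickle B i is Some t then rvar (inr t) else rzero _ end.
    have gE (x : B -> univ M) : (fun o => ev (M := M) (sume nu x) (g o)) =1 sume nu (cut x).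
      by case=> //= i; rewrite /cut; case: unpickle.
    have := Eb (inst g phi); rewrite !holds_inst (holds_ext _ (gE be)) (holds_ext _ (gE be')).
    by case=> H _; apply: H.
  have Tn := IH nu' be' Sn' phi' Hnu' d' (eqv_ren (@inr (nat + nat + nat) nat) Ed').
  apply: thorn_ge_mono Tn => x /(Hphi' M (0 : K)).
  rewrite !holds_ren (holds_ext _ (h1E _)) (holds_ext _ (h2E _)) => -[H1 H2]; split=> //.
  by apply/deltaE; exists w0; rewrite tup_pairt par_pairt.
- move=> a a_inj Ha [x Hx].
  have /choice [w Hw] : forall i : 'I_m.+1, exists w, a i ord0 = proj w /\
      holds (M := M) (sume (hat (x : P -> K)) (sume (hatn (tup w)) (hatn (par w)))) chi.
    by move=> i; have := Hx i; rewrite (yassE (a i)) => /deltaE.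
  have wp i : par (w i) = cutn p0.
    have := Ha i; rewrite (yassE (a i)) => /piE [w' [E1 <-]].
    by have [E2 _] := Hw i; move: E1; rewrite E2 => /proj_eq [].
  have [|i [j [ij jm Sij]]] := few (x := hat (x : P -> K)) (p := hatn (cutn p0)) (Ys := fun i => hatn (tup (w (inord i)))).
    by move=> i Hi; have [_] := Hw (inord i); rewrite wp.
  have : (inord i : 'I_m.+1) = inord j.
    apply: a_inj; rewrite (yassE (a _)) (yassE (a (inord j))); congr yass.
    have [-> _] := Hw (inord i); have [-> _] := Hw (inord j).
    by apply/proj_eq; split; rewrite !wp.
  move=> /(congr1 (@nat_of_ord _)); rewrite !inordK ?ltnS // ?(leq_trans (ltnW ij)) // => E.
  by rewrite E ltnn in ij.
Qed.

End LabelledStates.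

Lemma no_labelled_states (K : fieldType) (B : countType) (chi : Fm Lr (B + (nat + nat))) (eta : Fm Lr (nat + nat + nat)) (m : nat)
  (S : (nat -> univ (Kr K)) -> (B -> univ (Kr K)) -> Prop) :
  countably_saturated (Kr K) -> thorn_ranks_defined (struct_eq (Kr K)) ->
  (forall nu be, S nu be -> exists nu' be' r Y p, [/\ S nu' be', nu =1 nu' \o r,
    eqr K (sume nu be) (sume nu be'), (forall j, range nu' (Y j)) /\ (forall j, range nu' (p j)) &
    labelled nu be' chi eta m Y p]) ->
  forall nu be, ~ S nu be.
Proof.
move=> satr td step nu be Sn.
have few : few_classes K chi eta m by have [? [? [? [? [? [_ _ _ _ []]]]]]] := step nu be Sn.
have [s Hs] := same_class_fm K eta.
pose c1 (o : B + (nat + nat)) := match o with inl t => pickle t | inr (inl n) => n | inr (inr n) => n end.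
pose c2 (o : nat + nat + nat) := match o with inl (inl n) => n | inl (inr n) => n | inr n => n end.
have [b1 Hb1] := support_bound K c1 chi; have [b2 Hb2] := support_bound K c2 s.
pose b := maxn b1 b2.
have chi_b (x x' : B -> univ (Kr K)) (Y Y' p p' : nat -> univ (Kr K)) : (forall t, (pickle t < b.+1)%N -> x t = x' t) ->
  (forall i, (i < b.+1)%N -> Y i = Y' i) -> (forall i, (i < b.+1)%N -> p i = p' i) ->
  holds (M := Kr K) (sume x (sume Y p)) chi <-> holds (M := Kr K) (sume x' (sume Y' p')) chi.
  move=> H1 H2 H3; apply: Hb1 => o Ho; have : (c1 o < b.+1)%N by rewrite ltnS leq_max ltnW.
  by case: o {Ho} => [t|[n|n]] /=; auto.
have cl_b (Y Y' Y2 Y2' p p' : nat -> univ (Kr K)) : (forall i, (i < b.+1)%N -> Y i = Y' i) ->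
  (forall i, (i < b.+1)%N -> Y2 i = Y2' i) -> (forall i, (i < b.+1)%N -> p i = p' i) ->
  same_class eta p Y Y2 <-> same_class eta p' Y' Y2'.
  move=> H1 H2 H3; rewrite -!Hs; apply: Hb2 => o Ho; have : (c2 o < b.+1)%N by rewrite ltnS leq_max [X in _ || X]ltnW ?orbT.
  by case: o {Ho} => [[n|n]|n] /=; auto.
have [delta Hd] := delta_fm K chi eta b; have [pi Hpi] := pi_fm K eta b.
pose xs : 'I_b.+1 -> sort (sig_eq (Kr K)) := fun _ => inl tt.
pose tru := @Imp (sig_eq (Kr K)) ('I_b.+1 + void) (juxt xs (novar _)) (Bot _) (Bot _).
have [alpha] := td b.+1 1%N 'I_b.+1 xs (@ysort K eta b) xs [:: delta] [:: pi] m.+1 void (novar _) tru (anovar (struct_eq (Kr K))).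
apply; have step' nu0 be0 (H : S nu0 be0) : exists nu' be' r Y p, [/\ S nu' be', nu0 =1 nu' \o r,
    eqr K (sume nu0 be0) (sume nu0 be'), (forall j, range nu' (Y j)) /\ (forall j, range nu' (p j)) &
    holds (M := Kr K) (sume be' (sume Y p)) chi /\ nonalgebraic nu0 eta Y p].
  by have [nu' [be' [r [Y [p [? ? ? ? []]]]]]] := step nu0 be0 H; exists nu', be', r, Y, p.
have := states_thorn satr chi_b cl_b few step' Hd Hpi alpha Sn (phi := @Equ Lr _ (fun _ => tt) tt (rzero _) (rzero _)) erefl (@eqv_refl _ _ _ _ nu).
by apply: thorn_ge_mono => x _ /=.
Qed.

(** * The contradiction *)

Lemma nonalgebraic_mono (K : fieldType) (V V' JY JP : Type) (e : V -> univ (Kr K)) (e' : V' -> univ (Kr K)) (r : V' -> V)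
  (eta : Fm Lr (JY + JY + JP)) Y p : e' =1 e \o r -> nonalgebraic e eta Y p -> nonalgebraic e' eta Y p.
Proof.
move=> E na z Hz n.
pose f (o : V' + JP + JY) : V + JP + JY := match o with inl (inl v) => inl (inl (r v))
  | inl (inr i) => inl (inr i) | inr j => inr j end.
have fE y : sume (sume e p) y \o f =1 sume (sume e' p) y by case=> [[v|i]|j] //=; rewrite E.
have [|Ys [Y1 Y2]] := na (ren f z) _ n; first by rewrite holds_ren (holds_ext _ (fE Y)).
by exists Ys; split=> // i /Y1; rewrite holds_ren (holds_ext _ (fE (Ys i))).
Qed.

Section NoPattern.

Variables (K : fieldType) (k : nat).
Hypothesis char0 : forall n, n.+1%:R != 0 :> K.
Notation M := (Kr K).
Variable d : 'I_k -> K -> K.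
Hypotheses (dd : forall i, der (d i)) (dc : forall i j x, d i (d j x) = d j (d i x)).
Hypothesis lK : large K.
Variable T : theory Lr.
Hypotheses (mcT : model_complete T) (KT : model T (Kr K)).
Hypothesis satK : countably_saturated (Kd d).
Variable Ts : theory (Ld k).
Hypotheses (mcTs : model_complete Ts) (KTs : model Ts (Kd d)).
Hypothesis expand : forall D : 'I_k -> K -> K, (forall i, der (D i)) ->
  (forall i j x, D i (D j x) = D j (D i x)) ->
  exists (N : structure (Ld k)) (h : forall u, Kd D u -> N u), [/\ model Ts N, embedding h &
    forall (V : Type) (e : V -> K) (p : Fm Lr V),
      holds (M := Kr K) e p <-> holds (M := N) (fun v => h tt (e v)) (lift_fm k p)].
Hypothesis thorn_defined : thorn_ranks_defined (struct_eq (Kr K)).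

Variable en : nat -> Fm (Ld k) (option nat).
Hypothesis en_surj : forall p, exists n, en n = p.
Variables (X J : countType) (chi : Fm (Ld k) (X + J + nat)) (E : Fm (Ld k) (J + J)) (m : nat).
Notation Md := (Kd d).
Hypothesis E_sym : forall a a' : J -> univ Md, holds (sume a a') E -> holds (sume a' a) E.
Hypothesis E_trans : forall a a' a2 : J -> univ Md, holds (sume a a') E -> holds (sume a' a2) E -> holds (sume a a2) E.
Hypothesis few : forall b c (f : nat -> J -> univ Md), (forall i, (i <= m)%N -> holds (sume (sume b (f i)) c) chi) ->
  exists i j, [/\ (i < j)%N, (j <= m)%N & holds (sume (f i) (f j)) E].

Notation St nu b := (@state _ _ en Md X J chi E nu b).

Let satr : countably_saturated (Kr K) := saturated_reduct satK.

(** Only the type of [b] over the smaller model is kept, since limits produce conjugates of [b]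
    rather than [b] itself. *)
Definition extends (nu nu' : nat -> univ Md) (b b' : X -> univ Md) : Prop :=
  (exists r, nu =1 nu' \o r) /\ eqv (M := Md) (N := Md) (sume nu b) (sume nu b').

Lemma extends_refl nu b : extends nu nu b b.
Proof. by split; [exists id|apply: eqv_refl]. Qed.

Lemma extends_trans nu nu' nu2 b b' b2 : extends nu nu' b b' -> extends nu' nu2 b' b2 -> extends nu nu2 b b2.
Proof.
move=> [[r H] E1] [[r' H'] E2]; split; first by exists (r' \o r) => j; rewrite H /= H'.
apply: eqv_trans E1 _; pose f (o : nat + X) : nat + X := match o with inl v => inl (r v) | inr x => inr x end.
by apply: eqv_ext (eqv_ren f E2) => -[v|x] //=; rewrite H.
Qed.

Lemma extends_jet nu nu' b b' : extends nu nu' b b' -> eqr K (sume nu (jet d b)) (sume nu (jet d b')).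
Proof. by move=> [_ H] p; have := H (jinst p); rewrite !holds_jinst. Qed.

Notation label := (Fm Lr (X * seq 'I_k + (nat + nat)) * Fm Lr (nat + nat + nat) * nat)%type.

(** The class is non-algebraic over the present model, and its representative and parameters lie in
    the next one; so steps can be composed into a descent of thorn-rank. *)
Definition label_step (l : label) (nu nu' : nat -> univ Md) (b b' : X -> univ Md) : Prop :=
  [/\ St nu' b', extends nu nu' b b' & exists Y p : nat -> K,
    [/\ forall j, range nu' (Y j), forall j, range nu' (p j) & labelled (K := K) nu (jet d b') l.1.1 l.1.2 l.2 Y p]].

(** Otherwise the extensions of the state would be closed under steps labelled [l], and the field
    would have an undefined thorn-rank. *)
Lemma label_exhausted l nu b : St nu b -> exists nu' b', [/\ St nu' b', extends nu nu' b b' &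
  forall nu2 b2, ~ label_step l nu' nu2 b' b2].
Proof.
move=> Snb; apply: contrapT => N.
pose S (nu' : nat -> univ M) be := exists b', [/\ St nu' b', extends nu nu' b b' & be = jet d b'].
have SN : S nu (jet d b) by exists b; split=> //; apply: extends_refl.
apply: (@no_labelled_states K _ l.1.1 l.1.2 l.2 S satr thorn_defined _ _ _ SN) => nu1 _ [b1 [S1 e1 ->]].
have [nu2 [b2 [S2 e2 [Y [p [RY Rp L]]]]]] : exists nu2 b2, label_step l nu1 nu2 b1 b2.
  by apply: contrapT => N'; apply: N; exists nu1, b1; split=> // nu2 b2 H; apply: N'; exists nu2, b2.
have [[r Hr] _] := e2.
exists nu2, (jet d b2), r, Y, p; split=> //; last exact: extends_jet e2.
by exists b2; split=> //; apply: extends_trans e1 e2.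
Qed.

(** The label describes the first step of the pattern. The next model contains the new tuple and,
    being elementary, its whole jet, hence also the representative and the parameters of the
    label. *)
Lemma state_label nu b : St nu b -> exists nu' l, label_step l nu nu' b b.
Proof.
move=> [el [tau [h [Pt Hh]]]].
have [nu' [S' [r Hr] Ra]] := pattern_state en_surj Pt.
have [_ tp tc ta] := Pt.
pose al : J -> K := fun y => tau (GenTree.Leaf (aleaf 0 y)).
pose f (o : X + J + nat) : nat + X + J := match o with inl (inl x) => inl (inr x) | inl (inr j) => inr j
  | inr n => inl (inl (h n)) end.
have fE (a : J -> univ Md) : sume (sume nu b) a \o f =1 sume (sume b a) (nu \o h) by do 2?case.
have cE : (fun n => tau (GenTree.Leaf (cleaf J 0 n))) = nu \o h by apply: funext => n; rewrite Hh.
have [|||chi' [eta [m' [Y [p [RY Rp L]]]]]] := label_exists char0 dd dc lK mcT KT satK mcTs KTs expand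
    (b := b) (al := al) (E := E) (chi := ren f chi) (m := m) el E_sym E_trans.
- by rewrite holds_ren (holds_ext _ (fE al)) -cE; apply: (tc 0%N).
- move=> g Hg; apply: (few (b := b) (c := nu \o h)) => i /Hg.
  by rewrite holds_ren (holds_ext _ (fE (g i))).
- move=> g H; apply: (ta 0%N (fun y => GenTree.Leaf (pleaf J (g y)))); first by [].
  by apply: (@holds_eq _ _ Md) H; case=> //= y; rewrite tp.
have [el' _] := S'; have [s js] := elem_jclosed el'.
have Rj z : range nu z \/ range (jet d al) z -> range nu' z.
  move=> [[j <-]|[[y w] <-]]; first by exists (r j); rewrite Hr.
  elim: w => [|i w [j Hj]]; first exact: Ra.
  by exists (s i j); rewrite -js Hj.
exists nu', (chi', eta, m'); split=> //; first by split; [exists r|apply: eqv_refl].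
by exists Y, p; split=> [j|j|] //; apply: Rj.
Qed.

Lemma label_enum : exists lab : nat -> label, forall l, exists n, lab n = l.
Proof.
have [e1 H1] := @formula_enum _ ring_arity _ ring_code_inj (X * seq 'I_k + (nat + nat))%type.
have [e2 H2] := @formula_enum _ ring_arity _ ring_code_inj (nat + nat + nat)%type.
exists (fun n => let: (i, j, l) := odflt (0%N, 0%N, 0%N) (unpickle n) in (e1 i, e2 j, l)) => -[[p q] l].
have [i Hi] := H1 p; have [j Hj] := H2 q.
by exists (pickle (i, j, l)); rewrite pickleK /= Hi Hj.
Qed.

Lemma no_pattern nu b tau : ~ @pattern _ _ en Md X J chi E nu b tau.
Proof.
move=> /(pattern_state en_surj) [nu0 [S0 _ _]].
have [lab lab_surj] := label_enum.
pose state_pair := {s : (nat -> univ Md) * (X -> univ Md) | St s.1 s.2}.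
have /choice [F HF] : forall ns : nat * state_pair, exists s' : state_pair,
    extends (sval ns.2).1 (sval s').1 (sval ns.2).2 (sval s').2 /\
    forall nu2 b2, ~ label_step (lab ns.1) (sval s').1 nu2 (sval s').2 b2.
  move=> [n [[nu1 b1] S1]]; have [nu' [b' [S' e' N']]] := label_exhausted (lab n) S1.
  by exists (exist _ (nu', b') S').
pose ss := fix ss n : state_pair := if n is n'.+1 then F (n', ss n') else exist (fun s => St s.1 s.2) (nu0, b) S0.
have Sn n : St (sval (ss n)).1 (sval (ss n)).2 by exact: svalP (ss n).
have en' n := proj1 (HF (n, ss n)).
have /choice [rs Hrs] : forall n, exists r, (sval (ss n)).1 =1 (sval (ss n.+1)).1 \o r.
  by move=> n; have [] := en' n.
have [|nu1 [b1 [tau1 [P1 H1]]]] := pattern_limit (M := Md) (0 : K) satK Sn Hrs.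
  by move=> n; have [] := en' n.
have [nu2 [S2 [r2 Hr2] _]] := pattern_state en_surj P1.
have [nu3 [l [S3 e3 [Y [p [RY Rp [L1 L2 L3]]]]]]] := state_label S2.
have [n Hn] := lab_surj l.
(* Stage [n.+1] is the one beyond which the label [lab n] cannot occur. *)
have [[r1 Hr1] E1] := H1 n.+1.
have e2 : extends (sval (ss n.+1)).1 nu2 (sval (ss n.+1)).2 b1.
  by split=> //; exists (r2 \o r1) => j; rewrite Hr1 /= Hr2.
(* The step out of the limit is also a step out of stage [n.+1], since non-algebraicity over a model
   passes to smaller models. *)
apply: (proj2 (HF (n, ss n)) nu3 b1); split=> //; first exact: extends_trans e2 e3.
exists Y, p; split=> //; rewrite Hn; split=> //.
have [[r Hr] _] := e2; exact: nonalgebraic_mono Hr L3.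
Qed.

End NoPattern.

(** * Isomorphic copies, reducts and the axioms of differential fields *)

Lemma embedding_teval (L : signature) (M N : structure L) (h : forall u, M u -> N u) V (s : V -> sort L)
  u (t : term s u) (e : assignment M s) : embedding h -> teval (M := N) (fun v => h (s v) (e v)) t = h u (teval e t).
Proof.
move=> emb; elim: t => //= f args IH; rewrite (embedding_fun emb); congr finterp.
by apply: functional_extensionality_dep => i; apply: IH.
Qed.

Lemma iso_elementary (L : signature) (M N : structure L) (h : forall u, M u -> N u) :
  embedding h -> (forall u y, exists x, h u x = y) -> elementary h.
Proof.
move=> emb surj V s p; elim: p => {V s} [V s|V s u a b|V s r args|V s p IHp q IHq|V s u p IHp] e //=.
- by rewrite !(embedding_teval _ _ emb); split=> [->|/(embedding_inj emb)].
- rewrite (embedding_rel emb) (_ : (fun i => teval (M := N) _ (args i)) = (fun i => h _ (teval e (args i)))) //.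
  by apply: functional_extensionality_dep => i; rewrite (embedding_teval _ _ emb).
- by rewrite IHp IHq.
- have E a : (fun v => h (ext s u v) (aext e a v)) = aext (M := N) (fun v => h (s v) (e v)) (h u a).
    by apply: functional_extensionality_dep => -[].
  split=> [H y|H a]; last by apply/IHp; rewrite E.
  by have [a <-] := surj u y; rewrite -E; apply/IHp.
Qed.

Lemma elementary_model (L : signature) (M N : structure L) (h : forall u, M u -> N u) (T : theory L) :
  elementary h -> model T N -> model T M.
Proof.
move=> el TN p /TN; rewrite (el _ _ p (anovar M)); congr (sat p _).
by apply: functional_extensionality_dep => -[].
Qed.

Lemma iso_saturated (K : Type) (L : signature) (M N : structure L) (h : forall u, M u -> N u) :
  elementary h -> (forall u y, exists x, h u x = y) -> saturated K N -> saturated K M.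
Proof.
move=> el surj satN A s c u p cA fin.
have E (a : M u) q : sat q (aext c a) <-> sat q (aext (M := N) (fun v => h (s v) (c v)) (h u a)).
  rewrite el (_ : (fun v => _) = aext (M := N) (fun v => h (s v) (c v)) (h u a)) //.
  by apply: functional_extensionality_dep => -[].
have [|b Hb] := satN A s (fun v => h (s v) (c v)) u p cA.
  by move=> l /fin [b Hb]; exists (h u b) => q /Hb /E.
by have [a Ea] := surj u b; exists a => q /Hb; rewrite -Ea => /E.
Qed.

Section Reducts.

Variables (k : nat) (M : structure (Ld k)).

Lemma reduct_model (T : theory Lr) : model (lift_theory k T) M <-> model T (reduct M).
Proof.
have E (q : sentence Lring) : @sat (Ld k) M void (novar unit) (lift_formula k q) (anovar M) <-> sat (M := reduct M) q (anovar (reduct M)).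
  rewrite (@sat_lift k M void (novar unit) q); set a := (X in @sat _ _ _ _ _ X <-> _).
  suff -> : a = anovar (reduct M) by [].
  by apply: functional_extensionality_dep => -[].
split=> H p; first by move=> Tp; apply/E; apply: H; exists p.
by move=> [q [Tq ->]]; apply/E; apply: H.
Qed.

Lemma reduct_saturated (K : Type) : saturated K M -> saturated K (reduct M).
Proof.
move=> satM A s c u p cA fin.
have E (a : reduct M u) q : @sat (Ld k) M _ (ext s u) (@lift_formula k _ (ext s u) q) (@aext (Ld k) M A s c u a) <->
    @sat Lr (reduct M) _ (ext s u) q (@aext Lr (reduct M) A s c u a) by exact: sat_lift.
have [|b Hb] := satM A s c u (fun q' => exists q, p q /\ q' = @lift_formula k _ (ext s u) q) cA.
  move=> l Hl.
  have [l' [Hl' El]] : exists l', (forall q, List.In q l' -> p q) /\ l = map (@lift_formula k _ (ext s u)) l'.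
    elim: l Hl => [|q' l IH] H; first by exists [::].
    have [q [pq Eq]] := H q' (or_introl erefl).
    have [l' [pl El]] := IH (fun q Hq => H q (or_intror Hq)).
    by exists (q :: l'); rewrite Eq El; split=> // r /= [<-|/pl].
  have [b Hb] := fin l' Hl'; exists b => q; rewrite El => /List.in_map_iff [r [<- /Hb Hr]].
  exact/E.
by exists b => q pq; apply/E; apply: Hb; exists q.
Qed.

Lemma reduct_embedding (N : structure (Ld k)) (h : forall u, M u -> N u) :
  embedding h -> @embedding Lr (reduct M) (reduct N) h.
Proof.
move=> emb; split; first exact: (embedding_inj emb).
  by move=> f a; apply: (embedding_fun emb (f := inl f)).
by case.
Qed.

End Reducts.

Section DifferentialFieldAxioms.

Variables (K : fieldType) (k : nat) (d : 'I_k -> K -> K).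
Notation M := (Kd d).

Lemma teval_tnat V (s : V -> unit) (e : @assignment (Ld k) M V s) n :
  @teval (Ld k) M V s e tt (tnat k s n) = n%:R :> K.
Proof. by elim: n => //= n IH; rewrite IH mulrS. Qed.

Lemma Kd_diff_field : (forall n, n.+1%:R != 0 :> K) -> (forall i, der (d i)) ->
  (forall i j x, d i (d j x) = d j (d i x)) -> model (@diff_field0 k) M.
Proof.
move=> char0 dd dc p; case=> {p}.
- move=> z y x; exact: (addrA (x : K) y z).
- move=> y x; exact: (addrC (x : K) y).
- move=> x; exact: (add0r (x : K)).
- move=> x; exact: (addNr (x : K)).
- move=> z y x; exact: (mulrA (x : K) y z).
- move=> y x; exact: (mulrC (x : K) y).
- move=> x; exact: (mul1r (x : K)).
- move=> z y x; exact: (mulrDr (x : K) y z).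
- move=> H; have : (1 : K) == 0 by apply/eqP; exact: H.
  by rewrite oner_eq0.
- move=> x N H; apply: (H (x : K)^-1).
  have xn0 : (x : K) != 0 by apply/eqP => x0; apply: N; exact: x0.
  exact: (mulfV xn0).
- move=> n; rewrite /= -/(tnat k _ n) => H.
  by case/negP: (char0 n); rewrite mulrS -(teval_tnat (@anovar (Ld k) M) n); apply/eqP; exact: H.
- move=> i y x; case: (dd i) => dD _; exact: (dD (x : K) y I I).
- move=> i y x; case: (dd i) => _ dM; exact: (dM (x : K) y I I).
- move=> i j x; exact: (dc i j x).
Qed.

(** Only universal axioms are extracted, which pass from [N] to a substructure. *)
Lemma diff_field_sub (N : structure (Ld k)) (h : forall u, M u -> N u) :
  embedding h -> model (@diff_field0 k) N ->
  [/\ forall n, n.+1%:R != 0 :> K, forall i, der (d i) & forall i j x, d i (d j x) = d j (d i x)].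
Proof.
move=> emb HN; split.
- move=> n; apply/negP => /eqP H; have := HN _ (ax_char0 k n); apply.
  have E : anovar N = (fun v => h _ (anovar M v)) by apply: functional_extensionality_dep => -[].
  have := embedding_teval (tnat k (novar unit) n.+1 : @term (Ld k) _ _ tt) (anovar M) emb.
  have := embedding_teval (tzero k (novar unit) : @term (Ld k) _ _ tt) (anovar M) emb.
  rewrite -E => E0 E1; apply: etrans E1 (etrans _ (esym E0)); congr (h _).
  exact: etrans (teval_tnat _ _) H.
- have two (i : 'I_k) t u : diff_field0 (All (All (@Equ (Ld k) _ (ext (ext (novar unit) tt) tt) tt t u))) -> forall x y : K,
      teval (M := M) (aext (M := M) (aext (M := M) (u := tt) (anovar M) x) (u := tt) y) t =
      teval (M := M) (aext (M := M) (aext (M := M) (u := tt) (anovar M) x) (u := tt) y) u.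
    move=> /HN H x y; apply: (embedding_inj emb); rewrite -!(embedding_teval _ _ emb).
    have := H (h tt x) (h tt y); rewrite /=.
    rewrite (_ : aext _ _ = (fun v => h _ (aext (M := M) (aext (M := M) (u := tt) (anovar M) x) (u := tt) y v))) //.
    by apply: functional_extensionality_dep => -[[[]|]|].
  move=> i; split=> x y _ _.
    exact: (two i _ _ (ax_derD i) y x).
  exact: (two i _ _ (ax_derM i) y x).
- move=> i j x; apply: (embedding_inj emb (u := tt)).
  have H := HN _ (ax_der_comm i j) (h tt x).
  have E : aext (M := N) (u := tt) (anovar N) (h tt x) = (fun v => h _ (aext (M := M) (u := tt) (anovar M) x v)).
    by apply: functional_extensionality_dep => -[[]|].
  have T1 := embedding_teval (tder i (tder j (vx k (novar unit))) : @term (Ld k) _ _ tt) (aext (M := M) (u := tt) (anovar M) x) emb.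
  have T2 := embedding_teval (tder j (tder i (vx k (novar unit))) : @term (Ld k) _ _ tt) (aext (M := M) (u := tt) (anovar M) x) emb.
  rewrite -E in T1 T2; exact: etrans (esym T1) (etrans H T2).
Qed.

End DifferentialFieldAxioms.

Lemma pattern_iso (fs : Type) (ar : fs -> nat) en (M N : structure (sig1 ar)) (h : univ M -> univ N) (g : univ N -> univ M)
  (X J : countType) (chi : Fm (sig1 ar) (X + J + nat)) (E : Fm (sig1 ar) (J + J)) nu b tau :
  cancel g h -> (forall V (e : V -> univ M) p, holds e p <-> holds (h \o e) p) ->
  pattern en chi E nu b tau -> pattern en chi E (h \o nu) (h \o b) (h \o tau).
Proof.
move=> gK H [sk tp tc ta]; split.
- move=> n ts a Ha.
  have tE c : h \o oext (tenv (None : leaf J) tau ts) c =1 oext (tenv (None : leaf J) (h \o tau) ts) (h c) by case.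
  apply: holds_eq (tE _) _; apply/H; apply: (sk n ts (g a)); apply/H.
  by apply: holds_eq Ha => o; rewrite tE gK.
- by move=> j; rewrite /= tp.
- by move=> i; have /H := tc i; apply: holds_eq; do 2?case.
- by move=> i u Hu K; apply: (ta i u Hu); apply/H; apply: holds_eq K; case.
Qed.

Theorem theorem4p2p4 (k : nat) (T UC : theory (Ldiff k))
  (T_diff_field : forall p, diff_field0 p -> entails T p)
  (Tfield_mc : model_complete (field_part T))
  (Tfield_large : forall M : structure Lring, model (field_part T) M -> large_field M)
  (UC_companion : model_companion
     (theoryU (lift_theory k (field_part T)) UC)
     (theoryU (lift_theory k (field_part T)) (@diff_field0 k)))
  (Tfield_rosy : rosy (field_part T)) :
  rosy (theoryU (lift_theory k (field_part T)) UC).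
Proof.
move=> C0 CT0 mon0.
pose Tf : theory Lr := field_part T; pose Ts : theory (Ld k) := theoryU (lift_theory k Tf) UC.
pose C : structure (Ld k) := C0.
have CT : model Ts C by exact: CT0.
have mon : monster C by exact: mon0.
change (thorn_ranks_defined (struct_eq C)).
have red (N : structure (Ld k)) : model Ts N -> model Tf (reduct N).
  by move=> HN; apply/reduct_model => p Hp; apply: HN; left.
have [emb_star emb_df mcTs] := UC_companion.
have [K [h [h_bij [h0 h1 hN] hD hM lK]]] := Tfield_large (reduct C) (red C CT).
have [g hK gK] := h_bij.
(* The derivations of the given model are transported to the field type [K], so that the algebra
   library can be used on an isomorphic copy. *)
pose d (i : 'I_k) (x : K) : K := g (@finterp (Ld k) C (inr i) (fun _ => h x)).
pose hU (u : unit) : Kd d u -> C u := match u with tt => h end.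
have emb : @embedding (Ld k) (Kd d) C hU.
  split; last by case.
    by case; exact: can_inj hK.
  move=> f a; case: f a => [[]|i] a.
  - exact: esym (h0 (fun i => h (a i))).
  - exact: esym (h1 (fun i => h (a i))).
  - change (h (- a ord0)%R = @finterp Lring (reduct C) ROpp (fun i => h (a i))); rewrite -hN; congr finterp.
    by apply: functional_extensionality_dep => i; rewrite (ord1 i).
  - change (h (a ord0 + a ord_max)%R = @finterp Lring (reduct C) RAdd (fun i => h (a i))); rewrite -hD; congr finterp.
    by apply: functional_extensionality_dep => -[[|[|//]] Hi] /=; congr (h (a _)); exact: val_inj.
  - change (h (a ord0 * a ord_max)%R = @finterp Lring (reduct C) RMul (fun i => h (a i))); rewrite -hM; congr finterp.
    by apply: functional_extensionality_dep => -[[|[|//]] Hi] /=; congr (h (a _)); exact: val_inj.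
  - change (h (d i (a ord0)) = @finterp (Ld k) C (inr i) (fun j => h (a j))); rewrite /d gK; congr (@finterp (Ld k) C (inr i) _).
    by apply: functional_extensionality_dep => j; rewrite (ord1 j).
have surj u y : exists x, hU u x = y by case: u y => y; exists (g y); apply: gK.
have el : @elementary (Ld k) (Kd d) C hU by exact: iso_elementary.
have KTs : model Ts (Kd d) by exact: elementary_model el CT.
have KT : model Tf (Kr K) by exact: red KTs.
have [K' [cK satC]] := mon.
have satd : saturated K' (Kd d) by exact: iso_saturated el surj satC.
have satd' : countably_saturated (Kd d) := saturated_countably cK satd.
have satC' : countably_saturated C := saturated_countably cK satC.
(* The ring language is contained in the differential one, so the same cardinal witnesses that the
   reduct is sufficiently saturated. *)
have monr : monster (Kr K).
  exists K'; split; last exact: reduct_saturated satd.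
  move=> [f f_inj]; apply: cK; exists (fun x => match f x with
    | inl (inl (inl u)) => inl (inl (inl u)) | inl (inl (inr r)) => inl (inl (inr (inl r)))
    | inl (inr v) => inl (inr v) | inr n => inr n end) => x y E; apply: f_inj.
  by move: E; case: (f x) (f y) => [[[u|r]|v]|n] [[[u'|r']|v']|n'] //= [->].
(* A model of the companion embeds in a differential field, from which it inherits characteristic 0
   and commuting derivations. *)
have [N [h' [HN emb']]] := emb_df (Kd d) KTs.
have [char0 dd dc] : [/\ forall n, (n.+1%:R != 0 :> K)%R, forall i, der (d i) & forall i j x, d i (d j x) = d j (d i x)].
  by apply: (@diff_field_sub K k d N h' emb') => p Hp; apply: HN; right.
(* The field with the new derivations is a differential field whose reduct satisfies T^field, hence
   embeds in a model of the companion; on the reducts that embedding is elementary because T^field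
   is model complete. *)
have expand (D : 'I_k -> K -> K) : (forall i, der (D i)) -> (forall i j x, D i (D j x) = D j (D i x)) ->
    exists (N : structure (Ld k)) (h : forall u, Kd D u -> N u), [/\ model Ts N, @embedding (Ld k) (Kd D) N h &
      forall (V : Type) (e : V -> K) (p : Fm Lr V),
      holds (M := Kr K) e p <-> holds (M := N) (fun v => h tt (e v)) (lift_fm k p)].
  move=> dD Dc; have [|N' [e' [HN' Ee']]] := emb_star (Kd D).
    by move=> p [Hp|Hp]; [apply: (iffRL (@reduct_model k (Kd D) Tf)) Hp|exact: Kd_diff_field Hp].
  exists N', e'; split=> // V e p; rewrite holds_lift.
  exact: (Tfield_mc (Kr K) (reduct N') e' KT (red N' HN') (reduct_embedding Ee') V (fun _ => tt) p e).
have tdef_r : thorn_ranks_defined (struct_eq (Kr K)) by exact: Tfield_rosy KT monr.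
apply: contrapT => ND.
have [en en_surj] := @formula_enum _ (@diff_arity k) _ (@diff_code_inj k) (option nat).
have [X [J [chi [E [m [[nu [b [tau P]]] Es Et few]]]]]] := @thorn_pattern _ _ en C (h 0%R) satC' ND.
have iso V (e : V -> univ (Kd d)) (p : Fm (Ld k) V) : holds (M := Kd d) e p <-> holds (M := C) (h \o e) p.
  exact: (el V (fun _ => tt) p e).
have iso' V (e : V -> univ C) (p : Fm (Ld k) V) : holds (M := C) e p <-> holds (M := Kd d) (g \o e) p.
  by rewrite iso; apply: holds_ext => v /=; rewrite gK.
have isoE (a a' : J -> univ (Kd d)) : holds (M := Kd d) (sume a a') E <-> holds (M := C) (sume (h \o a) (h \o a')) E.
  by rewrite iso; apply: holds_ext; case.
have P' := @pattern_iso _ _ en C (Kd d) g h X J chi E nu b tau hK iso' P.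
refine (@no_pattern K k char0 d dd dc lK Tf Tfield_mc KT satd' Ts mcTs KTs expand tdef_r en en_surj X J chi E m _ _ _ _ _ _ P').
- by move=> a a' /isoE /Es /isoE.
- by move=> a a' a2 /isoE H /isoE H'; apply/isoE; exact: Et H H'.
- move=> b' c f H; have [|i [j [ij jm S]]] := few (h \o b') (h \o c) (fun i => h \o f i).
    by move=> i /H /iso; apply: holds_eq; do 2?case.
  by exists i, j; split=> //; apply/isoE.
Qed.
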